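(* Let $\gamma>2$. Then for any initial data $(u_0,\mu_0)\in\mathcal{D}$ such that $\int_{\mathbb{R}}(1+|x|^\gamma)\,d\mu_0<\infty$, the Hunter--Saxton equation has a unique global weak conservative solution $(u,\mu)$ (with $(u(t),\mu(t))\in\mathcal{D}$) in the sense defined below, with initial data $(u_0,\mu_0)$, and it satisfies $\int_{\mathbb{R}}(1+|x|^\gamma)\,d\mu(t)<\infty$ for all $t$.
   Context: The Hunter--Saxton equation is $u_t+uu_x=\tfrac14\big(\int_{-\infty}^x d\mu(t,z)-\int_x^{\infty}d\mu(t,z)\big)$, $\mu_t+(u\mu)_x=0$. Fix $\psi^+,\psi^-\in C^\infty(\mathbb{R})$ with $\psi^++\psi^-\equiv1$, $0\le\psi^\pm\le1$, $\operatorname{supp}\psi^-\subset(-\infty,1)$, $\operatorname{supp}\psi^+\subset(-1,\infty)$. Let $E_1=\{\bar f+a\psi^+:\bar f\in H^1(\mathbb{R}),a\in\mathbb{R}\}$, $E_2=\{\bar f+a\psi^++b\psi^-:\bar f\in H^1(\mathbb{R}),a,b\in\mathbb{R}\}$, and let $E_1^0,E_2^0$ be defined in the same way with $\bar f\in L^2(\mathbb{R})$, normed by $(\|\bar f\|_{L^2}^2+a^2)^{1/2}$ resp. $(\|\bar f\|_{L^2}^2+a^2+b^2)^{1/2}$. $\mathcal{D}$ is the set of pairs $(u,\mu)$ with $u\in E_2$, $\mu$ a positive finite Radon measure on $\mathbb{R}$, $x\mapsto\mu((-\infty,x))$ in $E_1^0$, and $d\mu_{\rm ac}=u_x^2dx$.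 A weak conservative solution with initial data $(u(0,\cdot),\mu(0))\in\mathcal{D}$ is a pair $(u,\mu)$ such that: (i) $u(t,\cdot)\in E_2$ for each $t$; (ii) $\mu(t,(-\infty,\cdot))\in E_1^0$ and $d\mu_{\rm ac}(t)=u_x^2(t,\cdot)dx$; (iii) for all $\phi\in C_c^\infty([0,\infty)\times\mathbb{R})$: $\int_0^\infty\!\int_{\mathbb{R}}\big[u\phi_t+\tfrac12u^2\phi_x+\tfrac14\big(\int_{-\infty}^xd\mu(t)-\int_x^\infty d\mu(t)\big)\phi\big]dxdt=-\int_{\mathbb{R}}u\phi|_{t=0}dx$ and $\int_0^\infty\!\int_{\mathbb{R}}(\phi_t+u\phi_x)d\mu(t)dt=-\int_{\mathbb{R}}\phi|_{t=0}d\mu(0)$; (iv) for every $T>0$, $u$ is Hölder continuous on $[0,T]\times\mathbb{R}$ and $t\mapsto u(t,\cdot)$ is Lipschitz from $[0,T]$ into $E_2^0$; (v) for $t$ outside a Lebesgue null set, $\mu(t)$ is absolutely continuous with density $u_x^2(t,\cdot)$; (vi) $t\mapsto\mu(t)$ is continuous for weak convergence of measures. *)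

(* Defs.v *)
From HB Require Import structures.
From mathcomp Require Import all_boot all_order all_algebra.
From mathcomp Require Import all_classical all_reals all_analysis.
Set Implicit Arguments. Unset Strict Implicit. Unset Printing Implicit Defensive.
Import Order.TTheory GRing.Theory Num.Theory.
Import numFieldNormedType.Exports.
Local Open Scope classical_set_scope.
Local Open Scope ring_scope.

Section HS.
Variable R : realType.
Notation leb := (@lebesgue_measure R).

Definition smooth1 (f : R -> R) : Prop :=
  forall (n : nat) (x : R), derivable (iter n (@derive1 R R) f) x 1.

Definition test1 (f : R -> R) : Prop :=
  smooth1 f /\ exists M : R, forall x, M < `|x| -> f x = 0.

Definition dpt (f : R -> R -> R) : R -> R -> R :=
  fun t x => derive1 (fun s => f s x) t.
Definition dpx (f : R -> R -> R) : R -> R -> R :=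
  fun t x => derive1 (f t) x.
Definition dpart (s : seq bool) (f : R -> R -> R) : R -> R -> R :=
  foldr (fun (b : bool) g => if b then dpt g else dpx g) f s.

Definition smooth2 (f : R -> R -> R) : Prop :=
  forall s : seq bool,
    (forall t x, derivable (fun r => dpart s f r x) t 1) /\
    (forall t x, derivable (dpart s f t) x 1) /\
    continuous (fun p : R * R => dpart s f p.1 p.2).

(* C_c^infinity(R^2); its restrictions to [0,oo) x R are C_c^infinity([0,oo) x R) *)
Definition test2 (f : R -> R -> R) : Prop :=
  smooth2 f /\ exists M : R, forall t x, M < `|t| \/ M < `|x| -> f t x = 0.

Definition L2 (f : R -> R) : Prop :=
  measurable_fun setT f /\ leb.-integrable setT (fun x => ((f x) ^+ 2)%:E).

Definition L2norm2 (f : R -> R) : R :=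
  fine (\int[leb]_(x in setT) ((f x) ^+ 2)%:E).

Definition loc_int (f : R -> R) : Prop :=
  measurable_fun setT f /\
  forall a b : R, leb.-integrable `[a, b] (fun x => (f x)%:E).

Definition weak_deriv (f g : R -> R) : Prop :=
  loc_int f /\ loc_int g /\
  forall phi, test1 phi ->
    (\int[leb]_(x in setT) (f x * derive1 phi x)%:E
     = - \int[leb]_(x in setT) (g x * phi x)%:E)%E.

Definition H1 (f : R -> R) : Prop :=
  L2 f /\ exists g, weak_deriv f g /\ L2 g.

Definition ae_eq (f g : R -> R) : Prop :=
  {ae leb, forall x, f x = g x}.

Definition inE1 (psip : R -> R) (f : R -> R) : Prop :=
  exists fb a, H1 fb /\ ae_eq f (fun x => fb x + a * psip x).
Definition inE2 (psip psim : R -> R) (f : R -> R) : Prop :=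
  exists fb a b, H1 fb /\ ae_eq f (fun x => fb x + a * psip x + b * psim x).
Definition inE1_0 (psip : R -> R) (f : R -> R) : Prop :=
  exists fb a, L2 fb /\ ae_eq f (fun x => fb x + a * psip x).

Definition E20_norm_le (psip psim : R -> R) (f : R -> R) (c : R) : Prop :=
  exists fb a b, L2 fb /\ ae_eq f (fun x => fb x + a * psip x + b * psim x) /\
    Num.sqrt (L2norm2 fb + a ^+ 2 + b ^+ 2) <= c.

Definition distrib (mu : {finite_measure set R -> \bar R}) : R -> R :=
  fun x => fine (mu [set y | y < x]).

(* d mu_ac = u_x^2 dx : mu = u_x^2 dx + (singular part carried by a
   Lebesgue-null set N) *)
Definition ac_part_ux2 (u : R -> R) (mu : {finite_measure set R -> \bar R}) : Prop :=
  exists g N, weak_deriv u g /\ measurable N /\ leb N = 0%E /\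
    forall A, measurable A ->
      mu (A `\` N) = (\int[leb]_(x in A) ((g x) ^+ 2)%:E)%E.

Definition ac_ux2 (u : R -> R) (mu : {finite_measure set R -> \bar R}) : Prop :=
  exists g, weak_deriv u g /\
    forall A, measurable A ->
      mu A = (\int[leb]_(x in A) ((g x) ^+ 2)%:E)%E.

Definition inD (psip psim : R -> R) (u : R -> R)
    (mu : {finite_measure set R -> \bar R}) : Prop :=
  inE2 psip psim u /\ inE1_0 psip (distrib mu) /\ ac_part_ux2 u mu.

Definition meas_eq (mu nu : {finite_measure set R -> \bar R}) : Prop :=
  forall A, measurable A -> mu A = nu A.

Definition weak_cons_sol (psip psim : R -> R) (u : R -> R -> R)
    (mu : R -> {finite_measure set R -> \bar R})
    (u0 : R -> R) (mu0 : {finite_measure set R -> \bar R}) : Prop :=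
  ae_eq (u 0) u0 /\ meas_eq (mu 0) mu0 /\
  (forall t, 0 <= t -> inE2 psip psim (u t)) /\
  (forall t, 0 <= t -> inE1_0 psip (distrib (mu t)) /\ ac_part_ux2 (u t) (mu t)) /\
  (forall phi, test2 phi ->
     (\int[leb]_(t in [set t : R | (0 <= t)%R]) \int[leb]_(x in setT)
        (u t x * dpt phi t x + 2^-1 * (u t x) ^+ 2 * dpx phi t x
         + 4^-1 * (fine (mu t [set y | (y < x)%R]) - fine (mu t [set y | (x < y)%R]))
           * phi t x)%:E
      = - \int[leb]_(x in setT) (u 0%R x * phi 0%R x)%:E)%E /\
     (\int[leb]_(t in [set t : R | (0 <= t)%R]) \int[mu t]_(x in setT)
        (dpt phi t x + u t x * dpx phi t x)%:E
      = - \int[mu 0%R]_(x in setT) (phi 0%R x)%:E)%E) /\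
  (forall T, 0 < T ->
     (exists alpha C, 0 < alpha /\ alpha <= 1 /\ 0 <= C /\
        forall t s x y, 0 <= t <= T -> 0 <= s <= T ->
          `|u t x - u s y| <= C * ((`|t - s| + `|x - y|) `^ alpha)) /\
     (exists L, 0 <= L /\ forall t s, 0 <= t <= T -> 0 <= s <= T ->
        E20_norm_le psip psim (fun x => u t x - u s x) (L * `|t - s|))) /\
  {ae leb, forall t, 0 <= t -> ac_ux2 (u t) (mu t)} /\
  (forall g : R -> R, continuous g -> (exists M, forall x, `|g x| <= M) ->
     {within [set t : R | 0 <= t],
        continuous (fun t => fine (\int[mu t]_(x in setT) (g x)%:E))}).

End HS.

(* Main.v *)
(* Uniqueness. Let C be the conserved total energy of a weak conservative solution
   (v, nu), and Y(t) the point below which the energy is eta. Testing the transport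
   equation with smooth steps that move slightly slower or faster than v shows
   Y' = v(t, Y). The momentum equation, integrated over a strip whose left end is
   Y(t) and divided by the width of the strip, shows that v(t, Y(t)) grows at the
   constant rate (eta - C / 2) / 2. Hence the quantiles of nu, thus nu itself, and
   the values of v at the quantiles are determined by the initial data; between
   quantiles v is determined because
   (v(q) - v(p))^2 <= (q - p) * nu([p, q[), so v is constant across energy gaps.

   Existence. Solve these equations explicitly in Lagrangian coordinates: the
   particle xi with energy H(xi) to its left has velocity
   U_t = U_0 + (t / 2) (H - C / 2) and position
   y_t = y_0 + t U_0 + (t^2 / 4) (H - C / 2). The densities a_t = dy_t, b_t = dU_t
   and c = dH satisfy a_t c = b_t^2 for every t, so y_t stays nondecreasing,
   dx is the image of a_t dxi, mu(t) is defined as the image of c dxi, and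
   u(t, y_t) = U_t. The weak equations become derivatives under an integral in xi. *)
Require Import Defs.
From HB Require Import structures.
From mathcomp Require Import all_boot all_order all_algebra.
From mathcomp Require Import all_classical all_reals all_analysis.
From mathcomp Require Import measurable_realfun ring lra.
Set Implicit Arguments. Unset Strict Implicit. Unset Printing Implicit Defensive.
Import Order.TTheory GRing.Theory Num.Theory.
Import numFieldNormedType.Exports.
Local Open Scope classical_set_scope.
Local Open Scope ring_scope.

(** * Telescoping estimates and test functions *)

(** The velocity is only Hölder continuous, so $Y'=v(t,Y)$ alone does not determine $Y$; the
    argument closes because $v(t,Y(t))$ turns out to be explicit and affine in $t$. The obstacle is
    that the energy may have atoms, across which the distribution function jumps over [eta]. Strips
    on both sides of the curve are therefore used: [eta] lies between the energies to the left of
    $Y$ without and with the atom, so right strips bound the growth of $v(t,Y(t))$ from below and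
    left strips bound it from above, by the same rate. A strip of width $h$ leaves the error
    $(v(Y\pm h)-v(Y))^2/(2h)$, at most half the energy of the open strip, which tends to 0 even if
    $Y$ carries an atom. For existence the labels are chosen so that $a_0+c=1$: an atom of the
    initial energy becomes an interval of labels with $a_0=0$, and all densities are bounded at each
    time. The moment hypothesis supplies a second moment of the energy, so the distribution function
    approaches its limits like $1/(1+x^2)$; membership in $E_1^0$ and the Lipschitz bound in $E_2^0$
    rest on this. *)

Section Telescope.
Variable R : realType.

(** Cutting $[a,b]$ into equal steps shorter than [d], the increments of [W] telescope, so the total
    loss is at most $e(W(b)-W(a))$ for every [e]. This replaces the mean value theorem for functions
    known only through estimates on short intervals; [W] will be the identity or an indefinite
    integral. *)
Lemma telescope_le (f W : R -> R) (a b : R) : a <= b ->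
  (forall e, 0 < e -> exists2 d, 0 < d & forall s t, a <= s -> s <= t -> t <= b ->
     t - s < d -> - (e * (W t - W s)) <= f t - f s) ->
  f a <= f b.
Proof.
move=> ab H.
have K e : 0 < e -> - (e * (W b - W a)) <= f b - f a.
  move=> /H[d d0 Hd].
  have [n Hn] : exists n : nat, (b - a) / n.+1%:R < d.
    exists (Num.truncn ((b - a) / d)).
    rewrite ltr_pdivrMr// mulrC -ltr_pdivrMr// truncnS_gt//.
  pose h := (b - a) / n.+1%:R.
  have h0 : 0 <= h by rewrite divr_ge0// subr_ge0.
  have S k : (k <= n.+1)%N -> - (e * (W (a + k%:R * h) - W a)) <= f (a + k%:R * h) - f a.
    elim: k => [_|k IH kn]; first by rewrite mul0r addr0 !subrr mulr0 oppr0.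
    have := IH (ltnW kn).
    have kb : a + k.+1%:R * h <= b.
      have -> : b = a + n.+1%:R * h by rewrite /h mulrCA divff ?pnatr_eq0// mulr1; ring.
      by rewrite lerD2l ler_wpM2r// ler_nat.
    have kk : a + k.+1%:R * h - (a + k%:R * h) = h by rewrite -natr1; ring.
    have := Hd (a + k%:R * h) (a + k.+1%:R * h).
    rewrite kk => /(_ _ _ kb Hn).
    have k1 : a <= a + k%:R * h by rewrite lerDl mulr_ge0.
    have k2 : a + k%:R * h <= a + k.+1%:R * h by rewrite lerD2l ler_wpM2r// ler_nat.
    move=> /(_ k1 k2); lra.
  have := S n.+1 (leqnn _).
  suff -> : a + n.+1%:R * h = b by [].
  by rewrite /h mulrCA divff ?pnatr_eq0// mulr1; ring.
rewrite leNgt; apply/negP => fba.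
have [W0|W0] := leP (W b - W a) 0.
  have := K 1 ltr01; lra.
have := K ((f a - f b) / 2 / (W b - W a)).
rewrite divfK ?gt_eqF// => /(_ _); apply: (fun P Q => Q) => //.
have : 0 < (f a - f b) / 2 / (W b - W a) by rewrite !divr_gt0// subr_gt0.
by move=> h1 /(_ h1); lra.
Qed.

Lemma telescope_eq (f W : R -> R) (a b : R) : a <= b ->
  (forall e, 0 < e -> exists2 d, 0 < d & forall s t, a <= s -> s <= t -> t <= b ->
     t - s < d -> `|f t - f s| <= e * (W t - W s)) ->
  f a = f b.
Proof.
move=> ab H; apply/eqP; rewrite eq_le; apply/andP; split.
  apply: (@telescope_le _ W _ _ ab) => e /H[d d0 Hd]; exists d => // s t sa st tb /Hd.
  by move=> /(_ sa st tb); rewrite ler_norml => /andP[].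
rewrite -lerN2.
apply: (@telescope_le (fun x => - f x) W _ _ ab) => e /H[d d0 Hd]; exists d => // s t sa st tb /Hd.
by move=> /(_ sa st tb); rewrite ler_norml => /andP[]; lra.
Qed.

End Telescope.

Section Smooth.
Variable R : realType.
Implicit Types (f g : R -> R).

Lemma smooth1_derivable f : smooth1 f -> forall x, derivable f x 1.
Proof. by move=> /(_ 0%N). Qed.

Lemma smooth1_derive1 f : smooth1 f -> smooth1 (derive1 f).
Proof. by move=> sf n x; have := sf n.+1 x; rewrite iterSr. Qed.

Lemma smooth1_continuous f : smooth1 f -> continuous f.
Proof.
move=> sf x; apply: differentiable_continuous.
by apply/derivable1_diffP; apply: smooth1_derivable.
Qed.

(** Coinduction for smoothness. Applied to classes such as sums or affine reparametrizations, it
    avoids formulas for iterated derivatives. *)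
Lemma smooth1_ind (P : (R -> R) -> Prop) :
  (forall f, P f -> (forall x, derivable f x 1) /\ P (derive1 f)) ->
  forall f, P f -> smooth1 f.
Proof.
move=> HP f Pf n.
suff: P (iter n (@derive1 R R) f) by move=> /HP[].
by elim: n => //= n /HP[].
Qed.

Lemma derive1_eq f (g : R -> R) : (forall x : R, is_derive x 1 f (g x)) -> derive1 f = g.
Proof. by move=> H; apply/funext => x; rewrite derive1E; apply: derive_val. Qed.

Lemma smooth1D f g : smooth1 f -> smooth1 g -> smooth1 (fun x => f x + g x).
Proof.
move=> sf sg; apply: (@smooth1_ind (fun h => exists f g, [/\ smooth1 f, smooth1 g & h = fun x => f x + g x])).
  move=> _ {f g sf sg} [f [g [sf sg ->]]]; split.
    by move=> x; apply: derivableD; exact: smooth1_derivable.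
  exists (derive1 f), (derive1 g); split; try exact: smooth1_derive1.
  apply: derive1_eq => x; rewrite !derive1E.
  by apply: is_deriveD; apply/derivableP; exact: smooth1_derivable.
by exists f, g.
Qed.

Lemma is_derive_affine (a b x : R) : is_derive x 1 (fun x : R => a * x + b) a.
Proof. by apply: is_derive_eq; rewrite /GRing.scale/= ?mul0r ?mulr1 ?addr0 ?mulr0. Qed.

Lemma smooth1_affine f (k a b : R) : smooth1 f -> smooth1 (fun x => k * f (a * x + b)).
Proof.
move=> sf; apply: (@smooth1_ind (fun h => exists f k, smooth1 f /\ h = fun x => k * f (a * x + b))); last by exists f, k.
move=> _ {f k sf} [f [k [sf ->]]].
have D (x : R) : is_derive x 1 (fun x : R => k * f (a * x + b)) (k * a * (derive1 f (a * x + b))).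
  have F : is_derive (a * x + b) 1 f (derive1 f (a * x + b)).
    by rewrite derive1E; apply/derivableP; exact: smooth1_derivable.
  have G := is_derive_affine a b x.
  have := @is_derive1_comp R f (fun x => a * x + b) x _ _ F G.
  move=> H.
  have -> : k * a * f^`()%classic (a * x + b) = k * (f^`()%classic (a * x + b) * a) by ring.
  by apply: is_derive_eq; rewrite /GRing.scale/= ?mulr0 ?addr0 ?mul0r ?add0r.
split; first by move=> x; case: (D x).
exists (derive1 f), (k * a); split; first exact: smooth1_derive1.
exact: derive1_eq.
Qed.

Lemma smooth1N f : smooth1 f -> smooth1 (fun x => - f x).
Proof.
move=> sf; have := @smooth1_affine f (-1) 1 0 sf.
by under eq_fun do rewrite mul1r addr0 mulN1r.
Qed.

End Smooth.

Section Moving.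
Variable R : realType.
Implicit Types (th ch : R -> R) (f g : R -> R -> R).

(** The time derivative of a product of this form is a sum of two such products; with addition built
    in, the class is stable under both partial derivatives, hence under every word of them. *)
Inductive moving (c : R) : (R -> R -> R) -> Prop :=
| moving_prod th ch : smooth1 th -> smooth1 ch -> moving c (fun t x => th t * ch (x - c * t))
| moving_add f g : moving c f -> moving c g -> moving c (fun t x => f t x + g t x).

Lemma is_derive_moving_x th ch c t x : smooth1 ch ->
  is_derive x (1:R) (fun x => th t * ch (x - c * t)) (th t * derive1 ch (x - c * t)).
Proof.
move=> sch.
have F : is_derive (x - c * t) 1 ch (derive1 ch (x - c * t)).
  by rewrite derive1E; apply/derivableP; exact: smooth1_derivable.
have G : is_derive x 1 (fun x => x - c * t) (1:R).
  by apply: is_derive_eq; rewrite subr0.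
have H := @is_derive1_comp R ch (fun x => x - c * t) x _ _ F G.
by apply: is_derive_eq; rewrite mulr1.
Qed.

Lemma is_derive_moving_t th ch c (t x : R) : smooth1 th -> smooth1 ch ->
  is_derive t (1:R) (fun t => th t * ch (x - c * t))
    (derive1 th t * ch (x - c * t) + (- c * th t) * derive1 ch (x - c * t)).
Proof.
move=> sth sch.
have F : is_derive (x - c * t) 1 ch (derive1 ch (x - c * t)).
  by rewrite derive1E; apply/derivableP; exact: smooth1_derivable.
have G : is_derive t 1 (fun t => x - c * t) (- c).
  by have := is_derive_affine (- c) x t; under eq_fun do rewrite addrC mulNr.
have H := @is_derive1_comp R ch (fun t => x - c * t) t _ _ F G.
have K : is_derive t 1 th (derive1 th t).
  by rewrite derive1E; apply/derivableP; exact: smooth1_derivable.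
by apply: is_derive_eq; rewrite /GRing.scale/=; ring.
Qed.

Lemma moving_dpx c f : moving c f -> (forall t x, derivable (f t) x 1) /\ moving c (dpx f).
Proof.
elim=> {f} [th ch sth sch|f g _ [df mf] _ [dg mg]].
  split=> [t x|]; first by case: (@is_derive_moving_x th ch c t x sch).
  have -> : dpx (fun t x => th t * ch (x - c * t)) = fun t x => th t * derive1 ch (x - c * t).
    by apply/funext => t; apply: derive1_eq => x; exact: is_derive_moving_x.
  by apply: (moving_prod c sth (smooth1_derive1 sch)).
split=> [t x|]; first exact: derivableD.
have -> : dpx (fun t x => f t x + g t x) = fun t x => dpx f t x + dpx g t x.
  apply/funext => t; apply: derive1_eq => x; rewrite /dpx !derive1E.
  by apply: is_deriveD; exact/derivableP.
exact: moving_add.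
Qed.

Lemma moving_dpt c f : moving c f ->
  (forall t x, derivable (fun r => f r x) t 1) /\ moving c (dpt f).
Proof.
elim=> {f} [th ch sth sch|f g _ [df mf] _ [dg mg]].
  split=> [t x|]; first by case: (@is_derive_moving_t th ch c t x sth sch).
  have -> : dpt (fun t x => th t * ch (x - c * t)) =
      fun t x => derive1 th t * ch (x - c * t) + (- c * th t) * derive1 ch (x - c * t).
    apply/funext => t; apply/funext => x.
    exact: (congr1 (@^~ t) (derive1_eq (fun t => @is_derive_moving_t th ch c t x sth sch))).
  apply: (@moving_add c (fun t x => derive1 th t * ch (x - c * t)) (fun t x => (- c * th t) * derive1 ch (x - c * t))).
    by apply: (moving_prod c (smooth1_derive1 sth) sch).
  apply: (@moving_prod c (fun t => - c * th t)); last exact: (smooth1_derive1 sch).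
  have := @smooth1_affine R th (- c) 1 0 sth.
  by under eq_fun do rewrite mul1r addr0.
split=> [t x|]; first exact: derivableD.
have -> : dpt (fun t x => f t x + g t x) = fun t x => dpt f t x + dpt g t x.
  apply/funext => t; apply/funext => x; rewrite /dpt !derive1E.
  by apply: derive_val; apply: is_deriveD; exact/derivableP.
exact: moving_add.
Qed.

Lemma moving_continuous c f : moving c f -> continuous (fun p : R * R => f p.1 p.2).
Proof.
elim=> {f} [th ch sth sch|f g _ cf _ cg] p; last by apply: continuousD; [exact: cf|exact: cg].
apply: (@continuousM R _ (fun p : R * R => th p.1) (fun p => ch (p.2 - c * p.1))).
  by apply: continuous_comp; [exact: cvg_fst|exact: smooth1_continuous].
apply: (@continuous_comp _ _ _ (fun p : R * R => p.2 - c * p.1) ch); last exact: smooth1_continuous.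
apply: (@continuousB _ _ _ (fun p : R * R => p.2) (fun p => c * p.1)); first exact: cvg_snd.
apply: (@continuousM _ _ (fun=> c) (fun p : R * R => p.1)); [exact: cst_continuous|exact: cvg_fst].
Qed.

Lemma moving_smooth2 c f : moving c f -> smooth2 f.
Proof.
move=> mf s.
have m : moving c (dpart s f).
  by elim: s => //= b s IH; case: b; [case: (moving_dpt IH)|case: (moving_dpx IH)].
by split; [case: (moving_dpt m)|split; [case: (moving_dpx m)|exact: moving_continuous m]].
Qed.

(** These are all the test functions that uniqueness needs: a cut-off in time multiplied by a
    profile carried at constant speed, which serves as a moving barrier, or with [c = 0] a separated
    test function. *)
Lemma test2_moving th ch c : test1 th -> test1 ch ->
  test2 (fun t x => th t * ch (x - c * t)).
Proof.
move=> [sth [A HA]] [sch [B HB]]; split.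
  by apply: (@moving_smooth2 c); exact: moving_prod.
exists (`|A| + `|B| + `|c| * `|A|) => t x Htx.
have [/HA->|tA] := ltP A `|t|; first by rewrite mul0r.
rewrite [X in _ * X]HB ?mulr0//.
have cA : 0 <= `|c| * `|A| by rewrite mulr_ge0.
have AA := ler_norm A; have BB := ler_norm B.
have A0 := normr_ge0 A; have B0 := normr_ge0 B.
case: Htx => H; first by exfalso; lra.
have h1 : `|x| <= `|x - c * t| + `|c * t|.
  by apply: le_trans (ler_normD _ _); rewrite subrK.
have h2 : `|c * t| <= `|c| * `|A| by rewrite normrM ler_wpM2l// (le_trans tA).
lra.
Qed.

End Moving.

(** * Real integrals and primitives *)

Section RealIntegral.
Context d (T : measurableType d) (R : realType) (mu : {measure set T -> \bar R}).
Implicit Types (f g : T -> R) (D : set T).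

Lemma integrable_le D f g : measurable D -> measurable_fun D f ->
  (forall x, D x -> `|f x| <= g x) -> mu.-integrable D (EFin \o g) -> mu.-integrable D (EFin \o f).
Proof.
move=> mD mf fg ig; apply: (le_integrable mD _ _ ig); first exact/measurable_EFinP.
move=> x Dx /=; rewrite lee_fin; apply: (le_trans (fg x Dx)); exact: ler_norm.
Qed.

Lemma integralE_fin D f : measurable D -> mu.-integrable D (EFin \o f) ->
  (\int[mu]_(x in D) (f x)%:E)%E = (\int[mu]_(x in D) f x)%:E.
Proof. by move=> mD i; rewrite /Rintegral fineK//; exact: integrable_fin_num. Qed.

Lemma Rintegral_dominated D (fn : nat -> T -> R) f g : measurable D ->
  (forall n, measurable_fun D (fn n)) -> mu.-integrable D (EFin \o g) ->
  (forall n x, D x -> `|fn n x| <= g x) ->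
  (forall x, D x -> fn n x @[n --> \oo] --> f x) ->
  mu.-integrable D (EFin \o f) /\
  \int[mu]_(x in D) fn n x @[n --> \oo] --> \int[mu]_(x in D) f x.
Proof.
move=> mD mfn ig fg cf.
have mf : measurable_fun D f by apply: measurable_fun_cvg mfn cf.
have cf' x : D x -> (EFin \o fn n) x @[n --> \oo] --> (EFin \o f) x.
  by move=> Dx; apply: cvg_EFin; [exact: nearW|exact: cf].
have [i1 i2 i3] := @dominated_convergence d T R mu D mD (fun n => EFin \o fn n) (EFin \o f) (EFin \o g)
  (fun n => (measurable_EFinP _ _).2 (mfn n)) ((measurable_EFinP _ _).2 mf)
  (aeW mu cf') ig (aeW mu (fun x n Dx => fg n x Dx)).
split => //.
apply: fine_cvg; rewrite fineK; last exact: integrable_fin_num.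
exact: i3.
Qed.

Lemma Rintegral_eq D f g : (forall x, D x -> f x = g x) ->
  \int[mu]_(x in D) f x = \int[mu]_(x in D) g x.
Proof. by move=> fg; apply: eq_Rintegral => x /set_mem /fg. Qed.

Lemma integrable_eq D f g : measurable D -> (forall x, D x -> f x = g x) ->
  mu.-integrable D (EFin \o f) -> mu.-integrable D (EFin \o g).
Proof. by move=> mD fg; apply: eq_integrable => // x /set_mem /fg/= ->. Qed.

Lemma RintegrableD D f g : measurable D -> mu.-integrable D (EFin \o f) ->
  mu.-integrable D (EFin \o g) -> mu.-integrable D (EFin \o (fun x => f x + g x)).
Proof. by move=> mD i j; have := integrableD mD i j; apply: eq_integrable. Qed.

Lemma RintegrableB D f g : measurable D -> mu.-integrable D (EFin \o f) ->
  mu.-integrable D (EFin \o g) -> mu.-integrable D (EFin \o (fun x => f x - g x)).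
Proof. by move=> mD i j; have := integrableB mD i j; apply: eq_integrable. Qed.

Lemma RintegrableZ D f k : measurable D -> mu.-integrable D (EFin \o f) ->
  mu.-integrable D (EFin \o (fun x => k * f x)).
Proof. by move=> mD i; have := integrableZl mD k i; apply: eq_integrable. Qed.

Lemma Rintegral_abs_le D f g : measurable D -> mu.-integrable D (EFin \o f) ->
  mu.-integrable D (EFin \o g) -> (forall x, D x -> `|f x| <= g x) ->
  `|\int[mu]_(x in D) f x| <= \int[mu]_(x in D) g x.
Proof.
move=> mD i j fg; apply: (le_trans (le_normr_Rintegral mD i)).
by apply: le_Rintegral => //; exact: integrable_norm.
Qed.

Lemma Rintegral_support D f : measurable D -> (forall x, ~ D x -> f x = 0) ->
  \int[mu]_(x in setT) f x = \int[mu]_(x in D) f x.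
Proof.
move=> mD fD; rewrite [RHS]Rintegral_mkcond; congr Rintegral; apply/funext => x.
by rewrite patchE; case: ifPn => // /negP xD; apply: fD => /mem_set.
Qed.

Lemma integrable_support D f : measurable D -> (forall x, ~ D x -> f x = 0) ->
  mu.-integrable D (EFin \o f) <-> mu.-integrable setT (EFin \o f).
Proof.
move=> mD fD; rewrite (@integrable_mkcond _ _ _ _ D)//.
suff -> : (EFin \o f) \_ D = EFin \o f by [].
apply/funext => x; rewrite patchE; case: ifPn => // /negP xD /=.
by rewrite fD// => /mem_set.
Qed.

Lemma Rintegral_negligible D N f : measurable N -> measurable D ->
  mu.-integrable D (EFin \o f) -> mu N = 0%E ->
  \int[mu]_(x in D) f x = \int[mu]_(x in D `\` N) f x.
Proof. by move=> mN mD i N0; rewrite /Rintegral (negligible_integral mN mD i N0). Qed.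

End RealIntegral.

Section Primitive.
Variable R : realType.
Notation leb := (@lebesgue_measure R).
Implicit Types (f g h : R -> R).

Lemma Rint_cat g (a b c : R) : loc_int g -> a <= b -> b <= c ->
  \int[leb]_(x in `[a, c]) g x = \int[leb]_(x in `[a, b]) g x + \int[leb]_(x in `[b, c]) g x.
Proof.
move=> [_ lg] ab bc.
have := @Rintegral_itvB R g (BLeft a) (BRight c) b (lg a c).
rewrite !bnd_simp ab bc => /(_ isT isT) H.
rewrite -[X in _ = _ + X]Rintegral_itv_obnd_cbnd; first by rewrite -H; ring.
apply: (integrableS _ _ _ (lg b c)) => //.
by apply: subset_itvr; rewrite bnd_simp.
Qed.

Lemma Rint_itv_cst (a b k : R) : a <= b -> \int[leb]_(x in `[a, b]) k = k * (b - a).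
Proof.
move=> ab; rewrite Rintegral_cst//; congr (_ * _).
rewrite /= lebesgue_measure_itv/= lte_fin; case: ltP => //= h.
by apply/esym/eqP; rewrite subr_eq0 eq_le h ab.
Qed.

Lemma integrable_itv_cst (a b k : R) : leb.-integrable `[a, b] (EFin \o cst k).
Proof.
apply: continuous_compact_integrable; first exact: segment_compact.
by apply: continuous_subspaceT; exact: cst_continuous.
Qed.

Lemma loc_int_cont f : continuous f -> loc_int f.
Proof.
move=> cf; split; first exact: continuous_measurable_fun.
move=> a b; apply: continuous_compact_integrable; first exact: segment_compact.
exact: continuous_subspaceT.
Qed.

Lemma loc_intD f g : loc_int f -> loc_int g -> loc_int (fun x => f x + g x).
Proof.
move=> [mf If] [mg Ig]; split; first exact: measurable_funD.
by move=> a b; apply: RintegrableD.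
Qed.

Lemma loc_intZ k f : loc_int f -> loc_int (fun x => k * f x).
Proof.
move=> [mf If]; split; first exact: measurable_funM.
by move=> a b; apply: RintegrableZ.
Qed.

Lemma loc_int_norm f : loc_int f -> loc_int (fun x => `|f x|).
Proof.
move=> [mf If]; split; first exact: measurableT_comp.
by move=> a b; exact: integrable_norm.
Qed.

Lemma continuous_itv_bounded f a b : continuous f ->
  exists2 M : R, 0 <= M & forall x, a <= x -> x <= b -> `|f x| <= M.
Proof.
move=> cf; have [ab|ba] := leP a b; last first.
  by exists 0 => // x h1 h2; exfalso; have := lt_le_trans ba (le_trans h1 h2); rewrite ltxx.
have [|c _ Hc] := @EVT_max R (fun x => `|f x|) a b ab.
  by apply: continuous_subspaceT => x; apply: continuous_comp; [exact: cf|exact: norm_continuous].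
by exists `|f c| => // x xa xb; apply: Hc; rewrite in_itv/= xa xb.
Qed.

Lemma loc_intM f h : loc_int f -> continuous h -> loc_int (fun x => f x * h x).
Proof.
move=> [mf If] ch.
have mh : measurable_fun setT h by exact: continuous_measurable_fun.
split; first exact: measurable_funM.
move=> a b; have [M M0 HM] := continuous_itv_bounded a b ch.
apply: (@integrable_le _ _ _ leb _ (fun x => f x * h x) (fun x => M * `|f x|)) => //.
- by apply/measurable_funTS/measurable_funM.
- move=> x; rewrite /= in_itv/= => /andP[xa xb]; rewrite normrM mulrC ler_wpM2r//; exact: HM.
- by apply: RintegrableZ => //; apply: integrable_norm.
Qed.

(** Local absolute continuity of [f] with density [g]. Stating it on increments means that [f] never
    has to be differentiated almost everywhere. *)
Definition prim f g := loc_int g /\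
  forall p q, p <= q -> f q - f p = \int[leb]_(x in `[p, q]) g x.

Lemma loc_int_abs_continuity g (a b e : R) : loc_int g -> 0 < e ->
  exists2 d : R, 0 < d & forall s t, a <= s -> s <= t -> t <= b -> t - s < d ->
    \int[leb]_(x in `[s, t]) `|g x| < e.
Proof.
move=> [mg ig] e0.
have i1 : leb.-integrable setT (EFin \o (g \_ `[a, b])).
  by rewrite -restrict_EFin; apply/integrable_restrict => //=; rewrite setIidr//; exact: ig.
have [d [d0 H]] := integral_normr_continuous i1 e0.
exists d => // s t sa st tb ts.
have := H `[s, t]%classic (measurable_itv _).
rewrite /= lebesgue_measure_itv/= lte_fin.
have -> : \int[leb]_(x in `[s, t]) `|(g \_ `[a, b]) x| = \int[leb]_(x in `[s, t]) `|g x|.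
  apply: Rintegral_eq => x; rewrite /= in_itv/= => /andP[h1 h2].
  rewrite patchE mem_set//= in_itv/= (le_trans sa h1)//=; exact: le_trans h2 tb.
by apply; case: ifP => // _; rewrite -EFinB lte_fin.
Qed.

Lemma prim_small f g (a b e : R) : prim f g -> 0 < e ->
  exists2 d : R, 0 < d & forall s t, a <= s -> s <= t -> t <= b -> t - s < d -> `|f t - f s| < e.
Proof.
move=> [lg fg] e0; have [d d0 H] := loc_int_abs_continuity a b lg e0.
exists d => // s t sa st tb ts; rewrite fg//.
by apply: (le_lt_trans (le_normr_Rintegral _ (lg.2 s t))) => //; exact: H.
Qed.

Lemma prim_continuous f g : prim f g -> continuous f.
Proof.
move=> pf x; apply/cvgrPdist_lt => e e0.
have [d d0 H] := prim_small (x - 1) (x + 1) pf e0.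
near=> y.
have xy : `|x - y| < Num.min d 1 by near: y; apply: cvgr_dist_lt; rewrite // lt_min d0 ltr01.
move: xy; rewrite lt_min => /andP[h1 h2].
move: h2; rewrite ltr_norml => /andP[h3 h4].
move: h1; rewrite ltr_norml => /andP[h5 h6].
have [xy|xy] := leP x y.
  rewrite distrC; apply: H; lra.
apply: H; lra.
Unshelve. all: by end_near. Qed.

(** Leibniz rule for absolutely continuous functions. On a short interval the defect is $\int_s^t
    (f(t)-f(x))h'(x)-(h(x)-h(s))f'(x)\,dx$, at most [e] times the increment of $\int(|f'|+|h'|)$,
    which is the weight [W] of the telescoping argument. *)
Lemma primM f f' h h' : prim f f' -> prim h h' ->
  prim (fun x => f x * h x) (fun x => h x * f' x + f x * h' x).
Proof.
move=> pf ph.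
have cf := prim_continuous pf; have ch := prim_continuous ph.
have [lf fE] := pf; have [lh hE] := ph.
have l1 : loc_int (fun x => h x * f' x).
  by under eq_fun do rewrite mulrC; exact: loc_intM.
have l2 : loc_int (fun x => f x * h' x).
  by under eq_fun do rewrite mulrC; exact: loc_intM.
have l := loc_intD l1 l2.
have lW := loc_intD (loc_int_norm lf) (loc_int_norm lh).
split=> // p q pq.
suff H : f p * h p - 0 = f q * h q - \int[leb]_(x in `[p, q]) (h x * f' x + f x * h' x).
  by move: H; rewrite subr0 => H; rewrite H; ring.
have -> : 0 = \int[leb]_(x in `[p, p]) (h x * f' x + f x * h' x).
  by rewrite set_itv1 Rintegral_set1.
apply: (@telescope_eq R (fun q => f q * h q - \int[leb]_(x in `[p, q]) (h x * f' x + f x * h' x))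
  (fun q => \int[leb]_(x in `[p, q]) (`|f' x| + `|h' x|)) p q pq) => e e0.
have [d1 d10 H1] := prim_small p q pf e0.
have [d2 d20 H2] := prim_small p q ph e0.
exists (Num.min d1 d2) => [|s t ps st tq]; first by rewrite lt_min d10 d20.
rewrite lt_min => /andP[ts1 ts2].
rewrite (Rint_cat l ps st) (Rint_cat lW ps st).
have -> : f t * h t - (\int[leb]_(x in `[p, s]) (h x * f' x + f x * h' x) +
   \int[leb]_(x in `[s, t]) (h x * f' x + f x * h' x)) -
   (f s * h s - \int[leb]_(x in `[p, s]) (h x * f' x + f x * h' x)) =
   h s * (f t - f s) + f t * (h t - h s) - \int[leb]_(x in `[s, t]) (h x * f' x + f x * h' x) by ring.
rewrite fE// hE// -!RintegralZl//; [|exact: lh.2|exact: lf.2].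
rewrite -RintegralD//; [|by apply: RintegrableZ => //; exact: lf.2|by apply: RintegrableZ => //; exact: lh.2].
rewrite -RintegralB//; [|by apply: RintegrableD => //; apply: RintegrableZ => //; [exact: lf.2|exact: lh.2]|exact: l.2].
rewrite [X in _ <= _ * X](_ : _ = \int[leb]_(x in `[s, t]) (`|f' x| + `|h' x|)); last by ring.
rewrite -RintegralZl//; last exact: lW.2.
apply: Rintegral_abs_le => //.
- apply: RintegrableB => //; last exact: l.2.
  by apply: RintegrableD => //; apply: RintegrableZ => //; [exact: lf.2|exact: lh.2].
- by apply: RintegrableZ => //; exact: lW.2.
move=> x; rewrite /= in_itv/= => /andP[sx xt].
have -> : h s * f' x + f t * h' x - (h x * f' x + f x * h' x) =
  (f t - f x) * h' x - (h x - h s) * f' x by ring.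
apply: (le_trans (ler_normB _ _)); rewrite !normrM mulrDr addrC.
apply: lerD; rewrite ler_wpM2r//; apply/ltW.
  apply: H2 => //; first by apply: le_trans xt tq.
  by apply: le_lt_trans ts2; rewrite lerB.
apply: H1 => //; first by apply: le_trans sx.
by apply: le_lt_trans ts1; rewrite lerB.
Qed.

Lemma prim_smooth1 f : smooth1 f -> prim f (derive1 f).
Proof.
move=> sf.
have cf := smooth1_continuous sf.
have cf' := smooth1_continuous (smooth1_derive1 sf).
split; first exact: loc_int_cont.
move=> p q; rewrite le_eqVlt => /predU1P[->|pq].
  by rewrite set_itv1 Rintegral_set1 subrr.
apply: EFin_inj; rewrite -integralE_fin//; last exact: (loc_int_cont cf').2.
rewrite (@continuous_FTC2 R (derive1 f) f p q pq).
- by rewrite EFinB.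
- exact: continuous_subspaceT.
- split; first by move=> x _; exact: smooth1_derivable.
  + by apply: cvg_at_right_filter; exact: cf.
  + by apply: cvg_at_left_filter; exact: cf.
- by [].
Qed.

Lemma primD f f' h h' : prim f f' -> prim h h' ->
  prim (fun x => f x + h x) (fun x => f' x + h' x).
Proof.
move=> [lf fE] [lh hE]; split; first exact: loc_intD.
move=> p q pq; rewrite RintegralD//; [|exact: lf.2|exact: lh.2].
by rewrite -fE// -hE//; ring.
Qed.

Lemma primZ k f f' : prim f f' -> prim (fun x => k * f x) (fun x => k * f' x).
Proof.
move=> [lf fE]; split; first exact: loc_intZ.
move=> p q pq; rewrite RintegralZl//; last exact: lf.2.
by rewrite -fE//; ring.
Qed.

Lemma prim_ge0_le f g (M : R) p q : prim f g -> (forall x, `|g x| <= M) -> p <= q ->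
  `|f q - f p| <= M * (q - p).
Proof.
move=> [lg fE] gM pq; rewrite fE// -(Rint_itv_cst _ pq).
by apply: Rintegral_abs_le => //; [exact: lg.2|exact: integrable_itv_cst].
Qed.

(* (int (g - m))^2 >= 0 with m the mean of g *)
Lemma prim_cauchy_schwarz f g p q : prim f g -> p <= q ->
  leb.-integrable `[p, q] (EFin \o (fun x => g x ^+ 2)) ->
  (f q - f p) ^+ 2 <= (q - p) * \int[leb]_(x in `[p, q]) (g x ^+ 2).
Proof.
move=> [lg fE]; rewrite le_eqVlt => /predU1P[->|pq] ig.
  by rewrite !subrr mul0r expr0n.
pose m := (f q - f p) / (q - p).
have qp : 0 < q - p by rewrite subr_gt0.
have I := lg.2 p q.
have H : 0 <= \int[leb]_(x in `[p, q]) (g x ^+ 2 + (- (2 * m) * g x + m ^+ 2)).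
  apply: Rintegral_ge0 => x _; have := sqr_ge0 (g x - m).
  by rewrite sqrrB; congr (_ <= _); rewrite -mulr_natl; ring.
have i1 : leb.-integrable `[p, q] (EFin \o (fun x => - (2 * m) * g x)) by exact: RintegrableZ.
have i2 : leb.-integrable `[p, q] (EFin \o (fun x => - (2 * m) * g x + m ^+ 2)).
  by apply: RintegrableD => //; exact: integrable_itv_cst.
move: H; rewrite RintegralD// RintegralD//; last exact: integrable_itv_cst.
rewrite RintegralZl// Rint_itv_cst; last exact: ltW.
rewrite -fE; last exact: ltW.
set S := \int[leb]_(_ in _) _ => H.
have : 0 <= (q - p) * (S + (- (2 * m) * (f q - f p) + m ^+ 2 * (q - p))) by rewrite mulr_ge0// ltW.
have -> : (q - p) * (S + (- (2 * m) * (f q - f p) + m ^+ 2 * (q - p))) = (q - p) * S - (f q - f p) ^+ 2.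
  by rewrite /m; field; rewrite gt_eqF.
by rewrite subr_ge0.
Qed.

End Primitive.

(** * Smooth steps *)

Section Step.
Variable R : realType.
Notation leb := (@lebesgue_measure R).

Definition Prim (g : R -> R) (x : R) : R :=
  if 0 <= x then \int[leb]_(y in `[0, x]) g y else - \int[leb]_(y in `[x, 0]) g y.

Lemma prim_Prim g : loc_int g -> prim (Prim g) g.
Proof.
move=> lg; split=> // p q pq; rewrite /Prim.
have [q0|q0] := leP 0 q; have [p0|p0] := leP 0 p.
- by rewrite (Rint_cat lg p0 pq); ring.
- by rewrite (Rint_cat lg (ltW p0) q0); ring.
- by exfalso; have := le_trans p0 (le_trans pq (ltW q0)); rewrite leNgt; lra.
- by rewrite (Rint_cat lg pq (ltW q0)); ring.
Qed.

Lemma near_lt (x a : R) : a < x -> \forall y \near x, a < y.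
Proof.
move=> ax; apply/nbhs_ballP; exists (x - a) => [|y]; first by rewrite /= subr_gt0.
by rewrite /ball/= ltr_norml => /andP[_]; rewrite ltrD2l ltrN2.
Qed.

Lemma near_gt (x a : R) : x < a -> \forall y \near x, y < a.
Proof. exact: lt_nbhsl. Qed.

Lemma is_derive_const (a x : R) : is_derive x 1 (fun _ : R => a) 0.
Proof. by apply: is_derive_eq. Qed.

Lemma is_derive_near (f g : R -> R) (x l : R) : is_derive x 1 f l ->
  (\forall y \near x, f y = g y) -> is_derive x 1 g l.
Proof. by move=> Df fg; exact: (near_eq_is_derive fg Df). Qed.

Lemma prim_is_derive (f g : R -> R) (x : R) : prim f g -> continuous g -> is_derive x 1 f (g x).
Proof.
move=> [lg fE] cg.
have x1 : x < x + 1 by lra.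
have x2 : x - 1 < x by lra.
have [D1 D2] := @continuous_FTC1_closed R g (x - 1) x (x + 1) x1 (lg.2 _ _) x2 (cg x).
pose F y := \int[leb]_(t in `[x - 1, y]) g t.
have D : is_derive x 1 F (g x) by apply: (DeriveDef D1); rewrite -[LHS](derive1E F x); exact: D2.
have H : is_derive x 1 (fun y => F y + f (x - 1)) (g x).
  by apply: is_derive_eq; rewrite addr0.
apply: (is_derive_near H).
near=> y; rewrite /F -fE ?subrK//.
suff : x - 1 < y by apply: ltW.
by near: y; exact: near_lt.
Unshelve. all: by end_near. Qed.

Lemma prim_monotone (f g : R -> R) p q : prim f g -> (forall x, 0 <= g x) -> p <= q -> f p <= f q.
Proof. by move=> [lg fE] g0 pq; rewrite -subr_ge0 fE//; apply: Rintegral_ge0. Qed.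

Lemma prim_const (f g : R -> R) p q : prim f g -> p <= q ->
  (forall x, p <= x -> x <= q -> g x = 0) -> f p = f q.
Proof.
move=> [lg fE] pq g0; apply/esym/eqP; rewrite -subr_eq0 fE//; apply/eqP.
rewrite (@Rintegral_eq _ _ _ leb _ g (cst 0)); first by rewrite Rint_itv_cst// mul0r.
by move=> x; rewrite /= in_itv/= => /andP[h1 h2]; exact: g0.
Qed.

Definition smooth_step (s : R -> R) (B : R) := [/\ smooth1 s,
  forall x, x <= -1 -> s x = 0, forall x, 1 <= x -> s x = 1 &
  forall x, 0 <= derive1 s x <= B].

(** The cut-off [psip] need not be monotone. The difference [g] of two shifted and dilated copies of
    it is nonnegative and vanishes outside $[-1,1]$; the step is its primitive, normalized to rise
    by 1. *)
Lemma smooth_step_exists (psip psim : R -> R) : smooth1 psip ->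
  (forall x, psip x + psim x = 1) -> (forall x, 0 <= psip x <= 1) ->
  closure [set x | psim x != 0] `<=` [set x | x < 1] ->
  closure [set x | psip x != 0] `<=` [set x | -1 < x] ->
  exists s B, smooth_step s B.
Proof.
move=> sp sum pb hm hp.
have p0 x : x <= -1 -> psip x = 0.
  move=> xle; apply/eqP; apply: contraT => xn.
  by have /= := hp x (@subset_closure R [set x | psip x != 0] x xn); rewrite ltNge xle.
have p1 x : 1 <= x -> psip x = 1.
  move=> xge; have : psim x = 0.
    apply/eqP; apply: contraT => xn.
    by have /= := hm x (@subset_closure R [set x | psim x != 0] x xn); rewrite ltNge xge.
  by move=> m0; rewrite -(sum x) m0 addr0.
pose g x := psip (2 * x + 1) - psip (2 * x - 1).
have sg : smooth1 g.
  have s1 := @smooth1_affine R psip 1 2 1 sp.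
  have s2 := @smooth1_affine R psip (-1) 2 (-1) sp.
  have := smooth1D s1 s2; congr smooth1; apply/funext => x; rewrite /g; ring.
(* one of the two values of psip is 0 or 1 *)
have g0 x : 0 <= g x.
  rewrite /g; have [x0|x0] := leP x 0.
    rewrite (p0 (2 * x - 1)); last lra.
    by rewrite subr0; case/andP: (pb (2 * x + 1)).
  rewrite (p1 (2 * x + 1)); last lra.
  by rewrite subr_ge0; case/andP: (pb (2 * x - 1)).
have gle x : g x <= 1.
  by rewrite /g; case/andP: (pb (2 * x + 1)); case/andP: (pb (2 * x - 1)); lra.
have cg := smooth1_continuous sg.
have lg := loc_int_cont cg.
have gout x : x <= -1 \/ 1 <= x -> g x = 0.
  by case=> h; rewrite /g; [rewrite !p0|rewrite !p1]; rewrite ?subrr//; lra.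
have pG := prim_Prim lg.
pose Z := Prim g 1 - Prim g (-1).
have mG p q : p <= q -> Prim g p <= Prim g q by exact: (prim_monotone pG).
(* If [Z] vanished, the monotone function [Prim g] would be constant on $[-1,1]$ and its derivative
   at 0 would be 0, whereas $g(0)=\psi^+(1)-\psi^+(-1)=1$. *)
have Z0 : 0 < Z.
  rewrite lt_neqAle subr_ge0 mG ?andbT; last lra.
  apply/eqP => Z0.
  have D := prim_is_derive 0 pG cg.
  have c x : -1 <= x -> x <= 1 -> Prim g x = Prim g (-1).
    move=> h1 h2; have := mG _ _ h2; have := mG _ _ h1; move: Z0; rewrite /Z; lra.
  have D0 : is_derive (0 : R) (1 : R) (Prim g) (0 : R).
    apply: (is_derive_near (is_derive_const (Prim g (-1)) _)).
    near=> y; rewrite /= c//; apply: ltW.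
      by near: y; apply: near_lt; lra.
    by near: y; apply: near_gt; lra.
  have : g 0 = 0 by rewrite -(@derive_val _ _ _ _ _ _ _ D) (@derive_val _ _ _ _ _ _ _ D0).
  by rewrite /g mulr0 add0r sub0r (p1 1)// (p0 (-1))// subr0 => /eqP; rewrite oner_eq0.
pose s x := Z^-1 * (Prim g x - Prim g (-1)).
have D x : is_derive x (1 : R) s (Z^-1 * g x).
  have D1 := prim_is_derive x pG cg.
  apply: is_derive_eq; rewrite /GRing.scale/= ?subr0 ?mulr0 ?addr0 ?mul0r ?add0r//.
have ds : derive1 s = fun x => Z^-1 * g x by exact: derive1_eq.
exists s, Z^-1; split.
- case=> [|n] x; first by case: (D x).
  rewrite iterSr ds.
  by have := @smooth1_affine R g Z^-1 1 0 sg; under eq_fun do rewrite mul1r addr0; exact.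
- move=> x x1; rewrite /s (prim_const pG x1) ?subrr ?mulr0// => y _ y1.
  by apply: gout; left.
- move=> x x1; rewrite /s -(prim_const pG x1); first by rewrite mulVf// gt_eqF.
  by move=> y y1 _; apply: gout; right.
- move=> x; rewrite ds mulr_ge0// ?invr_ge0 ?(ltW Z0)//=.
  by rewrite ler_piMr// invr_ge0 ltW.
Unshelve. all: by end_near. Qed.

Section StepTheory.
Variables (s : R -> R) (B : R).
Hypothesis (sB : smooth_step s B).

(** [stp d p] rises from 0 to 1 across $[p-d,p+d]$. Its derivative [stpd d p] is a nonnegative bump
    of mass 1 there and doubles as a mollifier. *)
Definition stp (d p x : R) := s (d^-1 * x + - (d^-1 * p)).
Definition stpd (d p x : R) := d^-1 * derive1 s (d^-1 * x + - (d^-1 * p)).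

Lemma step_ge0_bound : 0 <= B.
Proof. by case: sB => _ _ _ /(_ 0)/andP[h1 h2]; exact: le_trans h2. Qed.

Lemma smooth1_stp d p : smooth1 (stp d p).
Proof.
case: sB => ss _ _ _; have := @smooth1_affine R s 1 d^-1 (- (d^-1 * p)) ss.
by under eq_fun do rewrite mul1r.
Qed.

Lemma stp_derive d p : derive1 (stp d p) = stpd d p.
Proof.
apply: derive1_eq => x; rewrite /stp /stpd.
have G := is_derive_affine d^-1 (- (d^-1 * p)) x.
case: sB => ss _ _ _.
have F : is_derive (d^-1 * x + - (d^-1 * p)) 1 s (derive1 s (d^-1 * x + - (d^-1 * p))).
  by rewrite derive1E; apply/derivableP; exact: smooth1_derivable.
rewrite [X in is_derive _ _ _ X]mulrC; exact: (@is_derive1_comp R s (fun x => d^-1 * x + - (d^-1 * p)) x _ _ F G).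
Qed.

Lemma prim_stp d p : prim (stp d p) (stpd d p).
Proof. by have := prim_smooth1 (@smooth1_stp d p); rewrite stp_derive. Qed.

Lemma stpd_continuous d p : continuous (stpd d p).
Proof. by rewrite -stp_derive; apply: smooth1_continuous; apply/smooth1_derive1/smooth1_stp. Qed.

Lemma stp_left d p x : 0 < d -> x <= p - d -> stp d p x = 0.
Proof.
move=> d0 xp; case: sB => _ s0 _ _; apply: s0.
by rewrite -mulrBr mulrC ler_pdivrMr//; lra.
Qed.

Lemma stp_right d p x : 0 < d -> p + d <= x -> stp d p x = 1.
Proof.
move=> d0 xp; case: sB => _ _ s1 _; apply: s1.
by rewrite -mulrBr mulrC ler_pdivlMr//; lra.
Qed.

Lemma stpd_bound d p x : 0 < d -> 0 <= stpd d p x <= d^-1 * B.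
Proof.
move=> d0; case: sB => _ _ _ /(_ (d^-1 * x + - (d^-1 * p)))/andP[h1 h2].
by rewrite /stpd mulr_ge0 ?ler_wpM2l// invr_ge0 ltW.
Qed.

Lemma stp_bound d p x : 0 < d -> 0 <= stp d p x <= 1.
Proof.
move=> d0; have P := prim_stp d p.
have g0 y : 0 <= stpd d p y by case/andP: (stpd_bound p y d0).
apply/andP; split.
  have [xp|xp] := leP x (p - d); first by rewrite stp_left.
  by rewrite -(@stp_left d p (p - d))//; apply: (prim_monotone P) => //; exact: ltW.
have [xp|xp] := leP (p + d) x; first by rewrite stp_right.
by rewrite -(@stp_right d p (p + d))//; apply: (prim_monotone P) => //; exact: ltW.
Qed.

(** Beyond $\pm1$ the step is locally constant. At the two end points themselves the value follows
    from continuity of the derivative, by comparison with a nearby point [y] slightly further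
    out. *)
Lemma step_derive0 x : 1 <= `|x| -> derive1 s x = 0.
Proof.
case: sB => ss s0 s1 sd h.
have c : continuous (derive1 s) by apply: smooth1_continuous; exact: smooth1_derive1.
have out y : 1 < `|y| -> derive1 s y = 0.
  rewrite ltr_normr => hy; rewrite derive1E; case/orP: hy => hy.
    have D0 : is_derive y 1 s 0.
      apply: (is_derive_near (is_derive_const 1 _)).
      near=> z; rewrite /= s1//; apply: ltW.
      by near: z; exact: near_lt.
    exact: (@derive_val _ _ _ _ _ _ _ D0).
  have D0 : is_derive y 1 s 0.
    apply: (is_derive_near (is_derive_const 0 _)).
    near=> z; rewrite /= s0//; apply: ltW.
    by near: z; apply: near_gt; lra.
  exact: (@derive_val _ _ _ _ _ _ _ D0).
have [|/eqP h1] := boolP (1 < `|x|); first exact: out.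
apply/eqP/negPn/negP => n0.
have e0 : 0 < `|derive1 s x| by rewrite normr_gt0.
have /cvgrPdist_lt/(_ _ e0) := c x; move=> /nbhs_ballP[r /= r0 Hr].
pose y := if 0 <= x then x + r / 2 else x - r / 2.
have /Hr : ball x r y.
  rewrite /ball/= /y; case: ifP => _; rewrite ?opprD ?addrA ?subrr ?add0r ?opprK ?normrN gtr0_norm//; lra.
have y1 : 1 < `|y|.
  rewrite /y lter_normr; move: h; rewrite lter_normr; case: ifPn => x0 /orP[] h; apply/orP; try (left; lra); right; lra.
by rewrite (out y y1) subr0 ltxx.
Unshelve. all: by end_near. Qed.

Lemma stpd_out d p x : 0 < d -> d <= `|x - p| -> stpd d p x = 0.
Proof.
move=> d0 h; rewrite /stpd step_derive0 ?mulr0// -mulrBr normrM gtr0_norm ?invr_gt0//.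
by rewrite mulrC ler_pdivlMr// mul1r.
Qed.

Lemma Rint_stpd d p a b : 0 < d -> a <= p - d -> p + d <= b ->
  \int[leb]_(x in `[a, b]) stpd d p x = 1.
Proof.
move=> d0 ap pb; have [_ <-] := prim_stp d p; last by lra.
by rewrite stp_right// stp_left// subr0.
Qed.

Lemma test1_stp d p e q : 0 < d -> 0 < e -> test1 (fun x => stp d p x - stp e q x).
Proof.
move=> d0 e0; split; first by apply: smooth1D; [|apply: smooth1N]; exact: smooth1_stp.
exists (`|p| + `|q| + d + e) => x; rewrite lter_normr => /orP[] h;
  have h1 := ler_norm p; have h2 := ler_norm q; have h3 := normr_ge0 p; have h4 := normr_ge0 q;
  have h5 := ler_norm (- p); have h6 := ler_norm (- q); rewrite normrN in h5; rewrite normrN in h6.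
  by rewrite !stp_right ?subrr//; lra.
by rewrite !stp_left ?subrr//; lra.
Qed.

End StepTheory.
End Step.

(** * Weak derivatives *)

Section WeakDerivative.
Variable R : realType.
Notation leb := (@lebesgue_measure R).
Implicit Types (f g h : R -> R).

Lemma loc_int_compact_support h (M : R) : loc_int h -> (forall x, M < `|x| -> h x = 0) ->
  leb.-integrable setT (EFin \o h) /\
  \int[leb]_(x in setT) h x = \int[leb]_(x in `[- M, M]) h x.
Proof.
move=> [mh ih] h0.
have hS x : ~ `[- M, M]%classic x -> h x = 0.
  move=> H; apply: h0; rewrite ltNge; apply/negP => xM; apply: H.
  by rewrite /= in_itv/= -ler_norml.
split; last exact: Rintegral_support.
by apply/(integrable_support leb (measurable_itv `[- M, M]) hS); exact: ih.
Qed.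

Lemma loc_int_integrable f (D : set R) a b : loc_int f -> measurable D -> D `<=` `[a, b] ->
  leb.-integrable D (EFin \o f).
Proof. by move=> lf mD Dab; apply: (@integrableS _ _ _ leb `[a, b]%classic D (EFin \o f)) => //; exact: lf.2. Qed.

Lemma near_norm (M x : R) : M < `|x| -> \forall y \near x, M < `|y|.
Proof.
move=> Mx; apply/nbhs_ballP; exists (`|x| - M) => [|y]; first by rewrite /= subr_gt0.
by rewrite /ball/= => h; have := lerB_dist x y; lra.
Qed.

Lemma weak_derivE f g phi : weak_deriv f g -> test1 phi ->
  \int[leb]_(x in setT) (f x * derive1 phi x) = - \int[leb]_(x in setT) (g x * phi x).
Proof.
move=> [lf [lg H]] tp; have [sp [M HM]] := tp.
have HM' x : M < `|x| -> derive1 phi x = 0.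
  move=> Mx; rewrite derive1E.
  have D0 : is_derive x 1 phi 0.
    apply: (is_derive_near (is_derive_const 0 _)).
    have : \forall y \near x, M < `|y|.
      exact: near_norm.
    by apply: filterS => y /HM ->.
  exact: (@derive_val _ _ _ _ _ _ _ D0).
have [i1 _] := @loc_int_compact_support (fun x => f x * derive1 phi x) M
  (loc_intM lf (smooth1_continuous (smooth1_derive1 sp)))
  (fun x Mx => etrans (congr1 (fun z => f x * z) (HM' x Mx)) (mulr0 _)).
have [i2 _] := @loc_int_compact_support (fun x => g x * phi x) M
  (loc_intM lg (smooth1_continuous sp))
  (fun x Mx => etrans (congr1 (fun z => g x * z) (HM x Mx)) (mulr0 _)).
by apply: EFin_inj; rewrite -integralE_fin// EFinN -integralE_fin//; exact: H.
Qed.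

(** Integration by parts is the Leibniz rule [primM] on an interval that contains the support of the
    test function. *)
Lemma prim_weak_deriv f g : prim f g -> weak_deriv f g.
Proof.
move=> pf; have [lg fE] := pf; have cf := prim_continuous pf.
split; [exact: loc_int_cont|split=> // phi [sp [M HM]]].
(* [test1] gives [phi x = 0] only for $|x|>M$; the margin makes [phi] vanish at the end points $\pm
   N$ too, so the boundary terms disappear. *)
pose N := `|M| + 1.
have MN : M < N by rewrite /N; have := ler_norm M; lra.
have N0 : 0 < N by rewrite /N; have := normr_ge0 M; lra.
have HN x : N <= `|x| -> phi x = 0 by move=> h; apply: HM; exact: lt_le_trans h.
have HN' x : N < `|x| -> derive1 phi x = 0.
  move=> Mx; rewrite derive1E.
  have D0 : is_derive x 1 phi 0.
    apply: (is_derive_near (is_derive_const 0 _)).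
    have : \forall y \near x, N < `|y|.
      exact: near_norm.
    by apply: filterS => y /ltW/HN ->.
  exact: (@derive_val _ _ _ _ _ _ _ D0).
have l1 : loc_int (fun x => f x * derive1 phi x).
  exact: (loc_intM (loc_int_cont cf) (smooth1_continuous (smooth1_derive1 sp))).
have l2 : loc_int (fun x => g x * phi x) by exact: (loc_intM lg (smooth1_continuous sp)).
have [i1 E1] := loc_int_compact_support l1 (fun x Mx => etrans (congr1 (fun z => f x * z) (HN' x Mx)) (mulr0 _)).
have [i2 E2] := loc_int_compact_support l2 (fun x Mx => etrans (congr1 (fun z => g x * z) (HN x (ltW Mx))) (mulr0 _)).
rewrite !integralE_fin// -EFinN; congr EFin; rewrite E1 E2.
have [_ /(_ (- N) N)] := primM pf (prim_smooth1 sp).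
rewrite !HN ?normrN ?ger0_norm ?(ltW N0)// !mulr0 subrr => H.
have /H : - N <= N by lra.
under [X in 0 = X -> _]eq_Rintegral do rewrite mulrC.
by rewrite RintegralD//; [lra|exact: l2.2|exact: l1.2].
Qed.

Section Repr.
Variables (s : R -> R) (B : R).
Hypothesis (sB : smooth_step s B).
Notation stp := (stp s).
Notation stpd := (stpd s).

Let hn (n : nat) : R := n.+1%:R^-1.
Let hn0 n : 0 < hn n. Proof. by rewrite invr_gt0. Qed.
Let hn1 n : hn n <= 1. Proof. by rewrite invf_le1 ?ler1n. Qed.
Let hn_cvg : hn n @[n --> \oo] --> (0 : R).
Proof. exact: cvg_harmonic. Qed.
Let hn_cvgr : hn n @[n --> \oo] --> (0 : R)^'+.
Proof.
move=> A [e /= e0 He].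
have /cvgrPdist_lt/(_ _ e0) := hn_cvg.
by apply: filterS => n /= h; apply: He.
Qed.

Lemma stp_cvg p x : x != p -> stp (hn n) p x @[n --> \oo] --> (if p < x then 1 : R else 0).
Proof.
move=> xp.
have e0 : 0 < `|x - p| by rewrite normr_gt0 subr_eq0.
have /cvgrPdist_lt/(_ _ e0) H := hn_cvg.
apply: cvg_near_cst; apply: filterS H => n; rewrite sub0r normrN gtr0_norm// => h.
case: ifPn => px; first by apply: (stp_right sB) => //; move: h; rewrite gtr0_norm ?subr_gt0//; lra.
apply: (stp_left sB) => //; move: px; rewrite -leNgt => px; move: h.
by rewrite ler0_norm ?subr_le0//; lra.
Qed.

(** The kernel is at most $B/h$ on a ball of radius $h$, so the error is at most $2B$ times the
    average of $|f-f(p)|$ over that ball, which vanishes in the limit at a Lebesgue point. *)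
Lemma stpd_approx_identity f p : loc_int f -> lebesgue_pt f p ->
  \int[leb]_(x in setT) (f x * stpd (hn n) p x) @[n --> \oo] --> f p.
Proof.
move=> lf Lp.
have dc := cvg_comp _ _ hn_cvgr Lp.
pose b n := ball p (hn n).
have mb n : measurable (b n) by exact: measurable_ball.
have bsub n (x : R) : b n x -> `[p - 1, p + 1]%classic x.
  rewrite /b/ball/= ltr_norml in_itv/= => /andP[h1 h2].
  have h3 := hn1 n; apply/andP; split; lra.
have lfp : loc_int (fun x => `|f x - f p|).
  by apply: loc_int_norm; apply: loc_intD => //; apply: loc_int_cont; exact: cst_continuous.
have E n : `|f p - \int[leb]_(x in setT) (f x * stpd (hn n) p x)| <= 2 * B * fine (davg f p (hn n)).
  have out x : ~ b n x -> stpd (hn n) p x = 0.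
    move=> H; apply: (stpd_out sB) => //; rewrite leNgt; apply/negP => h; apply: H.
    by rewrite /b/ball/= distrC.
  have cs := @stpd_continuous R s B sB (hn n) p.
  have mbn : (measurable : set (set (measurableTypeR R))) (b n) := mb n.
  have i1 : leb.-integrable (b n) (EFin \o (fun x => f x * stpd (hn n) p x)).
    exact: (loc_int_integrable (loc_intM lf cs) _ (bsub n)).
  have i2 : leb.-integrable (b n) (EFin \o (fun x => f p * stpd (hn n) p x)).
    by apply: (loc_int_integrable (loc_intZ _ (loc_int_cont cs)) _ (bsub n)).
  have i3 : leb.-integrable (b n) (EFin \o stpd (hn n) p).
    exact: (loc_int_integrable (loc_int_cont cs) _ (bsub n)).
  rewrite (Rintegral_support leb (mb n)); last by move=> x /out ->; rewrite mulr0.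
  have -> : f p = \int[leb]_(x in b n) (f p * stpd (hn n) p x).
    rewrite RintegralZl//.
    have S1 := @Rintegral_support _ _ _ leb (b n) (stpd (hn n) p) (mb n) out.
    suff S2 : \int[leb]_(x in setT) stpd (hn n) p x = 1.
      by rewrite -[X in _ * X](etrans (esym S2) S1) mulr1.
    rewrite (@Rintegral_support _ _ _ leb `[p - hn n, p + hn n]%classic)//.
      by rewrite (Rint_stpd sB).
    move=> x H; apply: out => h; apply: H; move: h.
    by rewrite /b/ball/= in_itv/= ltr_norml => /andP[h1 h2]; apply/andP; split; lra.
  rewrite -RintegralB//.
  have -> : 2 * B * fine (davg f p (hn n)) = (hn n)^-1 * B * \int[leb]_(x in b n) `|f x - f p|.
    rewrite /davg /iavg lebesgue_measure_ball ?ltW// inver.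
    have -> : (hn n *+ 2 == 0) = false by rewrite mulrn_eq0 (gt_eqF (hn0 n)).
    rewrite (_ : (\int[_]_(y in _) _)%E = (\int[leb]_(x in b n) `|f x - f p|)%:E); last first.
      by rewrite -integralE_fin//; exact: (loc_int_integrable lfp _ (bsub n)).
    by rewrite -EFinM/= -mulr_natr; field; rewrite (gt_eqF (hn0 n)).
  rewrite -RintegralZl//; last exact: (loc_int_integrable lfp _ (bsub n)).
  apply: Rintegral_abs_le => //.
  - exact: RintegrableB.
  - by apply: RintegrableZ => //; exact: (loc_int_integrable lfp _ (bsub n)).
  move=> x _; rewrite -mulrBl normrM mulrC distrC ler_wpM2r//.
  by have /andP[h1 h2] := @stpd_bound R s B sB (hn n) p x (hn0 n); rewrite ger0_norm.
have F : (2 * B * fine (davg f p (hn n))) @[n --> \oo] --> (0 : R).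
  rewrite -[X in _ --> X](mulr0 (2 * B)); apply: cvgMr.
  exact: (fine_cvg dc).
apply/cvgrPdist_le => e e0.
have /cvgrPdist_le/(_ _ e0) := F.
apply: filterS => n; rewrite sub0r normrN => H; apply: (le_trans (E n)).
by apply: le_trans H; exact: ler_norm.
Qed.

Lemma stpB_out n p q x : p <= q -> ~ `[p - 1, q + 1]%classic x ->
  stp (hn n) p x - stp (hn n) q x = 0.
Proof.
move=> pq; have h3 := hn1 n; rewrite /= in_itv/= => /negP.
rewrite negb_and -!ltNge => /orP[] h.
  by rewrite !(stp_left sB) ?subrr//; lra.
by rewrite !(stp_right sB) ?subrr//; lra.
Qed.

Lemma stpB_continuous n p q : continuous (fun x => stp (hn n) p x - stp (hn n) q x).
Proof. exact/smooth1_continuous/(proj1 (test1_stp sB p q (hn0 n) (hn0 n))). Qed.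

Lemma stpB_cvg g p q : loc_int g -> p <= q ->
  \int[leb]_(x in setT) (g x * (stp (hn n) p x - stp (hn n) q x)) @[n --> \oo] -->
  \int[leb]_(x in `[p, q]) g x.
Proof.
move=> lg pq.
(* The end points are removed because there the steps need not converge to 0 or 1; they form a null
   set. *)
pose D := `[p - 1, q + 1]%classic `\` [set p; q].
have mpq : measurable [set p; q].
  by apply: measurableU; exact: measurable_set1.
have mD : measurable D by apply: measurableD.
have leb0 : leb [set p; q] = 0%E.
  have := countable_lebesgue_measure0 (@finite_set_countable _ _ (finite_set2 p q)).
  by [].
have rm k : loc_int k -> \int[leb]_(x in `[p - 1, q + 1]) k x = \int[leb]_(x in D) k x.
  by move=> lk; apply: Rintegral_negligible => //; exact: lk.2.
have ls n : loc_int (fun x => g x * (stp (hn n) p x - stp (hn n) q x)).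
  by apply: (loc_intM lg); exact: stpB_continuous.
have ilg : leb.-integrable D (EFin \o (fun x => `|g x|)).
  apply: (loc_int_integrable (loc_int_norm lg) mD); exact: subDsetl.
pose k x := g x * ((if p < x then 1 else 0) - (if q < x then 1 else 0)).
have [_ L2] : leb.-integrable D (EFin \o k) /\
   \int[leb]_(x in D) (g x * (stp (hn n) p x - stp (hn n) q x)) @[n --> \oo] --> \int[leb]_(x in D) k x.
  apply: (@Rintegral_dominated _ _ _ leb D _ _ (fun x => `|g x|) mD _ ilg).
  - by move=> n; apply: measurable_funTS; exact: (ls n).1.
  - move=> n x _; rewrite normrM ler_piMr//.
    have /andP[h1 h2] := stp_bound sB p x (hn0 n).
    have /andP[h3 h4] := stp_bound sB q x (hn0 n).
    by rewrite ler_norml; lra.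
  - move=> x [_ /= xpq]; apply: cvgMr; apply: cvgB; apply: stp_cvg; apply/eqP => xE; apply: xpq; auto.
have kE : \int[leb]_(x in D) k x = \int[leb]_(x in `[p, q]) g x.
  have -> : \int[leb]_(x in `[p, q]) g x = \int[leb]_(x in `[p, q]%classic `\` [set p; q]) g x.
    by apply: Rintegral_negligible => //; exact: lg.2.
  rewrite [LHS]Rintegral_mkcond [RHS]Rintegral_mkcond; congr Rintegral; apply/funext => x.
  rewrite !patchE /k.
  have [xpq|xpq] := pselect ([set p; q] x).
    by rewrite !memNset// => -[].
  have xp : x != p by apply/eqP => xE; apply: xpq; left.
  have xq : x != q by apply/eqP => xE; apply: xpq; right.
  have [xin|xin] := boolP (p <= x <= q).
    move: (xin) => /andP[h1 h2].
    rewrite !mem_set/=; first last.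
    - by split => //=; rewrite in_itv/=; apply/andP; split; lra.
    - by split => //=; rewrite in_itv/=.
    by rewrite lt_neqAle eq_sym xp h1/= ltNge h2/= subr0 mulr1.
  rewrite [in RHS]memNset; last by move=> [/= +]; rewrite in_itv/= (negbTE xin).
  case: ifP => // _; move: xin; rewrite negb_and -!ltNge => /orP[] h.
    by rewrite !ltNge (ltW h) (ltW (lt_le_trans h pq))/= subrr mulr0.
  by rewrite h (le_lt_trans pq h) subrr mulr0.
rewrite -kE; apply: cvg_trans L2; apply: near_eq_cvg; apply: nearW => n /=.
rewrite (@Rintegral_support _ _ _ leb `[p - 1, q + 1]%classic)//; first by rewrite rm.
by move=> x /(stpB_out n pq) ->; rewrite mulr0.
Qed.

(** The weak derivative is tested on a difference of two steps at [p] and [q]: one side mollifies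
    [f] at the two points, the other tends to $\int_p^q g$. *)
Lemma weak_deriv_lebesgue_pt f g p q : weak_deriv f g -> p <= q ->
  lebesgue_pt f p -> lebesgue_pt f q -> f q - f p = \int[leb]_(x in `[p, q]) g x.
Proof.
move=> w pq Lp Lq; have [lf [lg _]] := w.
have t n := @test1_stp R s B sB (hn n) p (hn n) q (hn0 n) (hn0 n).
have d n : derive1 (fun x => stp (hn n) p x - stp (hn n) q x) =
    fun x => stpd (hn n) p x - stpd (hn n) q x.
  apply: derive1_eq => x; rewrite -!(stp_derive sB) !derive1E.
  by apply: is_deriveB; apply/derivableP; apply: smooth1_derivable; exact: (smooth1_stp sB).
have E n : \int[leb]_(x in setT) (f x * stpd (hn n) p x) - \int[leb]_(x in setT) (f x * stpd (hn n) q x) =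
  - \int[leb]_(x in setT) (g x * (stp (hn n) p x - stp (hn n) q x)).
  have := weak_derivE w (t n); rewrite d.
  move=> <-; rewrite -RintegralB//.
  - by apply: Rintegral_eq => x _; rewrite mulrBr.
  - have /loc_int_compact_support : loc_int (fun x => f x * stpd (hn n) p x).
      by apply: (loc_intM lf); exact: (stpd_continuous sB).
    move=> /(_ (`|p| + hn n)) [|//] x hx; rewrite (stpd_out sB) ?mulr0//.
    by have := lerB_dist x p; lra.
  - have /loc_int_compact_support : loc_int (fun x => f x * stpd (hn n) q x).
      by apply: (loc_intM lf); exact: (stpd_continuous sB).
    move=> /(_ (`|q| + hn n)) [|//] x hx; rewrite (stpd_out sB) ?mulr0//.
    by have := lerB_dist x q; lra.
have L1 : \int[leb]_(x in setT) (f x * stpd (hn n) p x) -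
  \int[leb]_(x in setT) (f x * stpd (hn n) q x) @[n --> \oo] --> f p - f q.
  by apply: cvgB; exact: stpd_approx_identity.
have L3 : \int[leb]_(x in setT) (f x * stpd (hn n) p x) -
  \int[leb]_(x in setT) (f x * stpd (hn n) q x) @[n --> \oo] --> - \int[leb]_(x in `[p, q]) g x.
  by under eq_fun do rewrite E; apply: cvgN; exact: stpB_cvg.
have E1 := cvg_lim (@Rhausdorff R) L1.
have E2 := cvg_lim (@Rhausdorff R) L3.
by rewrite E1 in E2; rewrite -opprB E2 opprK.
Qed.

Lemma weak_deriv_prim f g : continuous f -> weak_deriv f g -> prim f g.
Proof.
move=> cf w; have [lf [lg _]] := w; split => // p q pq.
have lp x : lebesgue_pt f x.
  by apply: (@continuous_lebesgue_pt R f x setT _ _ lf.1 (cf x)) => //; split=> //; exact: openT.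
exact: weak_deriv_lebesgue_pt.
Qed.

Lemma loc_int_locally_integrable f : loc_int f -> locally_integrable setT f.
Proof.
move=> lf; split; [exact: lf.1|exact: openT|move=> K _ cK].
have [M [_ HM]] := compact_bounded cK.
have HK : K `<=` `[- (`|M| + 1), `|M| + 1]%classic.
  move=> x Kx; rewrite /= in_itv/= -ler_norml.
  by apply: (HM (`|M| + 1)) => //; have := ler_norm M; lra.
have /integrable_norm := loc_int_integrable lf (compact_measurable cK) HK.
by move=> H; have := @integrable_lty _ _ _ leb K _ _ H; apply; exact: compact_measurable.
Qed.

(** Lebesgue points have full measure, so one exists. The primitive of [g] anchored there agrees
    with [f] at every other Lebesgue point. *)
Lemma weak_deriv_repr f g : weak_deriv f g -> exists2 F, prim F g & Defs.ae_eq f F.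
Proof.
move=> w; have [lf [lg _]] := w.
have LD := lebesgue_differentiation (loc_int_locally_integrable lf).
have [p Lp] : exists p, lebesgue_pt f p.
  apply: contrapT => H; have : leb setT = 0%E.
    apply/negligibleP => //; apply: negligibleS LD => x _ /= Lx; apply: H; by exists x.
  by rewrite -(@set_itvNyy _ R) /= lebesgue_measure_itv/=.
have pP := prim_Prim lg; have [_ PE] := pP.
exists (fun x => Prim g x + (f p - Prim g p)).
  by split=> // a b ab; rewrite -PE//; ring.
apply: (negligibleS _ LD) => x /=; apply: contra_not => Lx.
have [px|xp] := leP p x.
  have := weak_deriv_lebesgue_pt w px Lp Lx; rewrite -PE//; lra.
have := weak_deriv_lebesgue_pt w (ltW xp) Lx Lp; rewrite -PE ?ltW//; lra.
Qed.

End Repr.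
End WeakDerivative.

(** * Images of measures *)

Section ImageMeasure.
Context d1 d2 (X : measurableType d1) (Y : measurableType d2) (R : realType)
  (mu : {measure set X -> \bar R}) (y : X -> Y) (w : X -> R).

(** The push-forward under [y] of the measure with density [w]. *)
Definition image_density (A : set Y) : \bar R := (\int[mu]_(x in y @^-1` A) (w x)%:E)%E.

(** The hypotheses are dummy arguments of this and the next definition, so that the instances can be
    declared: [image_sigma] is a measure, and integrability of [w] makes [image_meas] a finite
    one. *)
Definition image_sigma of measurable_fun setT y & measurable_fun setT w & (forall x, 0 <= w x) :=
  image_density.

Definition image_meas of measurable_fun setT y & measurable_fun setT w & (forall x, 0 <= w x) &
  mu.-integrable setT (EFin \o w) := image_density.

Section Measure.
Hypotheses (my : measurable_fun setT y) (mw : measurable_fun setT w) (w0 : forall x, 0 <= w x).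

Let mpre A : measurable A -> measurable (y @^-1` A).
Proof. by move=> mA; rewrite -[_ @^-1` _]setTI; exact: my. Qed.

Lemma image_density0 : image_density set0 = 0%E.
Proof. by rewrite /image_density preimage_set0 integral_set0. Qed.

Lemma image_density_ge0 A : (0 <= image_density A)%E.
Proof. by apply: integral_ge0 => x _; rewrite lee_fin. Qed.

Lemma image_density_sigma_additive : semi_sigma_additive image_density.
Proof.
move=> F mF tF mUF; rewrite /image_density preimage_bigcup ge0_integral_bigcup//=.
- apply: is_cvg_ereal_nneg_natsum_cond => n _ _.
  by apply: integral_ge0 => x _; rewrite lee_fin.
- by move=> k; exact: mpre.
- by apply/measurable_EFinP/measurable_funTS.
- by move=> x _; rewrite lee_fin.
- by apply/trivIsetP => i j _ _ ij; move/trivIsetP: tF => /(_ i j I I ij) H; rewrite -preimage_setI H preimage_set0.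
Qed.

End Measure.

HB.instance Definition _ my mw w0 := isMeasure.Build _ _ _ (@image_sigma my mw w0)
  image_density0 (image_density_ge0 w0) (image_density_sigma_additive my mw w0).

HB.instance Definition _ my mw w0 iw := isMeasure.Build _ _ _ (@image_meas my mw w0 iw)
  image_density0 (image_density_ge0 w0) (image_density_sigma_additive my mw w0).

Lemma image_meas_fin my mw w0 iw : fin_num_fun (@image_meas my mw w0 iw).
Proof.
move=> A mA; apply: integrable_fin_num; first by rewrite -[_ @^-1` _]setTI; exact: my.
by apply: integrableS iw => //; rewrite -[_ @^-1` _]setTI; exact: my.
Qed.

HB.instance Definition _ my mw w0 iw := Measure_isFinite.Build _ _ _ (@image_meas my mw w0 iw)
  (@image_meas_fin my mw w0 iw).

(** A predicate on arbitrary set functions, so that it also applies to a measure given beforehand,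
    such as Lebesgue measure or the initial energy. *)
Definition is_image (m : set Y -> \bar R) := forall A, measurable A -> m A = image_density A.

Import HBNNSimple.

Hypotheses (my : measurable_fun setT y) (mw : measurable_fun setT w) (w0 : forall x, 0 <= w x).

(** Change of variables: on simple functions it is the definition of the image, and monotone
    convergence extends it. *)
Lemma is_image_ge0_integral (m : {measure set Y -> \bar R}) (f : Y -> R) : is_image m ->
  measurable_fun setT f -> (forall z, 0 <= f z) ->
  (\int[m]_z (f z)%:E = \int[mu]_x (f (y x) * w x)%:E)%E.
Proof.
move=> im mf f0.
have mfE : measurable_fun setT (EFin \o f) by exact/measurable_EFinP.
have fE0 z : setT z -> (0 <= (EFin \o f) z)%E by rewrite /= lee_fin.
pose f_ := nnsfun_approx measurableT mfE.
have mwE : measurable_fun setT (EFin \o w) by exact/measurable_EFinP.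
transitivity (limn (fun n => \int[m]_x (f_ n x)%:E))%E.
  rewrite -monotone_convergence//.
  - apply: eq_integral => z _; apply/esym/cvg_lim => //.
    by apply: cvg_nnsfun_approx.
  - by move=> n; exact/measurable_EFinP/measurable_funP.
  - by move=> n z _; rewrite lee_fin.
  - by move=> z _ k n kn; rewrite lee_fin; exact/lefP/nd_nnsfun_approx.
rewrite [X in limn X](_ : _ = (fun n => \int[mu]_x ((f_ n (y x)) * w x)%:E)%E).
  rewrite -monotone_convergence//; last 3 first.
  - move=> n; apply/measurable_EFinP; apply: measurable_funM => //.
    exact: measurableT_comp.
  - by move=> n x _; rewrite lee_fin mulr_ge0.
  - by move=> x _ k n kn; rewrite lee_fin ler_wpM2r//; exact/lefP/nd_nnsfun_approx.
  apply: eq_integral => x _; apply/cvg_lim => //.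
  rewrite EFinM; under eq_fun do rewrite EFinM.
  apply: cvgeZr => //.
  by apply: cvg_nnsfun_approx.
apply/funext => n.
have mpre A : measurable A -> measurable (y @^-1` A).
  by move=> mA; rewrite -[_ @^-1` _]setTI; exact: my.
transitivity (\sum_(k \in range (f_ n))
    \int[mu]_x (k * (\1_(y @^-1` (f_ n @^-1` [set k])) x * w x))%:E)%E.
  under eq_integral do rewrite fimfunE -fsumEFin//.
  rewrite ge0_integral_fsum//; last 2 first.
  - by move=> r; exact/measurable_EFinP/measurable_funM.
  - by move=> r x _; rewrite nnfun_muleindic_ge0.
  apply: eq_fsbigr => r /set_mem[z _ rz]; rewrite integralZl_indic_nnsfun// integral_indic//= setIT.
  have r0 : 0 <= r by rewrite -rz.
  under [RHS]eq_integral do rewrite EFinM.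
  rewrite ge0_integralZl_EFin//.
  - congr (_ * _)%E; rewrite im// /image_density [LHS]integral_mkcond.
    by apply: eq_integral => x _; rewrite patchE indicE; case: (_ \in _); rewrite ?mul1r ?mul0r.
  - by move=> x _; rewrite lee_fin mulr_ge0// indicE.
  - by apply/measurable_EFinP; apply: measurable_funM => //; apply: measurable_indic; exact: mpre.
rewrite -ge0_integral_fsum//.
- apply: eq_integral => x _; rewrite fsumEFin//; congr EFin.
  rewrite [in RHS]fimfunE.
  rewrite mulr_fsuml//.
  by apply: eq_fsbigr => r _; rewrite mulrA.
- move=> r; apply/measurable_EFinP; apply: measurable_funM => //.
  by apply: measurable_funM => //; apply: measurable_indic; exact: mpre.
- move=> r x _; rewrite lee_fin mulrA mulr_ge0//.
  by have := nnfun_muleindic_ge0 (f_ n) r (y x); rewrite lee_fin.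
Qed.

Lemma is_image_integral (m : {measure set Y -> \bar R}) (f : Y -> R) : is_image m ->
  measurable_fun setT f -> (\int[m]_z (f z)%:E = \int[mu]_x (f (y x) * w x)%:E)%E.
Proof.
move=> im mf; rewrite integralE [RHS]integralE; congr (_ - _)%E.
  have -> : (fun z => (f z)%:E)^\+%E = (fun z => (Num.max (f z) 0)%:E).
    by apply/funext => z; rewrite funeposE EFin_max.
  rewrite is_image_ge0_integral//.
  - apply: eq_integral => x _; rewrite funeposE -EFin_max; congr EFin.
    by rewrite maxr_pMl// mul0r.
  - exact: measurable_funrpos.
  - by move=> z; rewrite le_max lexx orbT.
have -> : (fun z => (f z)%:E)^\-%E = (fun z => (Num.max (- f z) 0)%:E).
  by apply/funext => z; rewrite funenegE EFin_max.
rewrite is_image_ge0_integral//.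
- apply: eq_integral => x _; rewrite funenegE -EFinN -EFin_max; congr EFin.
  by rewrite maxr_pMl// mul0r mulNr.
- exact: measurable_funrneg.
- by move=> z; rewrite le_max lexx orbT.
Qed.

Lemma is_image_integrable (m : {measure set Y -> \bar R}) (f : Y -> R) : is_image m ->
  measurable_fun setT f ->
  m.-integrable setT (EFin \o f) <-> mu.-integrable setT (EFin \o (fun x => f (y x) * w x)).
Proof.
move=> im mf.
have mg : measurable_fun setT (fun x => f (y x) * w x).
  by apply: measurable_funM => //; exact: measurableT_comp.
have E : (\int[m]_z `|(EFin \o f) z| = \int[mu]_x `|(EFin \o (fun x => (f (y x) * w x)%R)) x|)%E.
  rewrite -[LHS]/(\int[m]_z (`|f z|)%:E)%E.
  rewrite (is_image_integral im (measurableT_comp (@normr_measurable R setT) mf)).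
  by apply: eq_integral => x _ /=; rewrite normrM (ger0_norm (w0 x)).
split=> /integrableP[_ h]; apply/integrableP; split; try exact/measurable_EFinP.
  by rewrite -E.
by rewrite E.
Qed.

End ImageMeasure.

(** * Borel measures on the line determined by half-open intervals *)

Section MeasureUnique.
Variable R : realType.

(** Half-open intervals are stable under intersection, generate the Borel sets and contain an
    exhausting sequence of finite measure, so the uniqueness theorem for measures applies. *)
Lemma measure_eq_itvco (m1 m2 : {measure set R -> \bar R}) :
  (forall p q : R, p < q -> m1 `[p, q[%classic = m2 `[p, q[%classic) ->
  (forall p q : R, p < q -> (m1 `[p, q[%classic < +oo)%E) ->
  forall A, measurable A -> m1 A = m2 A.
Proof.
move=> m12 fin.
pose G : set (set R) := [set A | exists p q : R, A = `[p, q[%classic].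
apply: (@measure_unique _ _ _ G (fun n => `[- n%:R, n%:R[%classic)).
- transitivity ((@RGenCInfty.G R).-sigma.-measurable); first exact: RGenCInfty.measurableE.
  apply/seteqP; split.
    apply: smallest_sub; first exact: smallest_sigma_algebra.
    move=> _ [x ->].
    have -> : `[x, +oo[%classic = \bigcup_(n : nat) `[x, x + n%:R[%classic :> set R.
      apply/seteqP; split => z /=.
        rewrite in_itv/= andbT => xz; exists (Num.truncn (z - x)).+1 => //=.
        by rewrite in_itv/= xz/= -ltrBlDl truncnS_gt.
      by move=> [n _ /=]; rewrite !in_itv/= => /andP[->].
    apply: sigma_algebra_bigcup => n; apply: sub_sigma_algebra.
    by exists x, (x + n%:R).
  apply: smallest_sub; first exact: smallest_sigma_algebra.
  move=> _ [p [q ->]]; exact: RGenCInfty.measurable_itv_bounded.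
- move=> _ _ [p [q ->]] [p' [q' ->]].
  exists (Num.max p p'), (Num.min q q'); apply/seteqP; split => z /=; rewrite !in_itv/= lt_min ge_max.
    by move=> [/andP[-> ->] /andP[-> ->]].
  by move=> /andP[/andP[-> ->] /andP[-> ->]].
- by move=> n; exists (- n%:R), n%:R.
- apply/seteqP; split => // z _; exists (Num.truncn `|z|).+1 => //=.
  have := truncnS_gt `|z|; rewrite ltr_norml in_itv/= => /andP[h1 h2].
  by rewrite (ltW h1) h2.
- move=> _ [p [q ->]]; have [pq|qp] := ltP p q; first exact: m12.
  by rewrite set_itv_ge ?measure0// bnd_simp -leNgt.
- move=> n; have [pq|qp] := ltP (- n%:R : R) n%:R; first exact: fin.
  by rewrite set_itv_ge ?measure0 ?ltry// bnd_simp -leNgt.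
Qed.

(* lebesgue_measure on the measurable space R, whose display differs from
   that of measurableTypeR R *)
Definition lebR : set R -> \bar R := @lebesgue_measure R.

Let lebR0 : lebR set0 = 0%E. Proof. exact: (measure0 (@lebesgue_measure R)). Qed.
Let lebR_ge0 A : (0 <= lebR A)%E. Proof. exact: (measure_ge0 (@lebesgue_measure R)). Qed.
Let lebR_sigma_additive : semi_sigma_additive lebR.
Proof. exact: (@measure_semi_sigma_additive _ _ _ (@lebesgue_measure R)). Qed.

HB.instance Definition _ := isMeasure.Build _ _ _ lebR lebR0 lebR_ge0 lebR_sigma_additive.

Notation leb := (@lebesgue_measure R).

Lemma lebesgue_is_image (y : R -> R) (w : R -> R) :
  measurable_fun setT y -> measurable_fun setT w -> (forall x, 0 <= w x) ->
  (forall p q, p < q -> (\int[leb]_(x in y @^-1` `[p, q[%classic) (w x)%:E = (q - p)%:E)%E) ->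
  @is_image _ _ (measurableTypeR R) (measurableTypeR R) R leb y w leb.
Proof.
move=> my mw w0 H A mA.
have lE (p q : R) : p < q -> lebR `[p, q[%classic = (q - p)%:E.
  by move=> pq; rewrite /lebR lebesgue_measure_itv/= lte_fin pq.
refine (@measure_eq_itvco lebR (@image_sigma _ _ (measurableTypeR R) R R leb y w my mw w0) _ _ A mA) => p q pq.
  by rewrite /= lE// /image_sigma /image_density H.
by rewrite /= lE// ltry.
Qed.

End MeasureUnique.

(** * Distribution functions and quantiles *)

Section Distribution.
Variable R : realType.
Implicit Types (m : {finite_measure set R -> \bar R}) (A B : set R).

Definition rmeas m A : R := fine (m A).

Lemma rmeasE m A : measurable A -> m A = (rmeas m A)%:E.
Proof. by move=> mA; rewrite /rmeas fineK//; exact: fin_num_measure. Qed.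

Lemma rmeas_ge0 m A : 0 <= rmeas m A.
Proof. exact/fine_ge0/measure_ge0. Qed.

Lemma le_rmeas m A B : measurable A -> measurable B -> A `<=` B -> rmeas m A <= rmeas m B.
Proof.
by move=> mA mB AB; rewrite -lee_fin -!rmeasE//; apply: le_measure; rewrite ?inE.
Qed.

Lemma rmeasU m A B : measurable A -> measurable B -> A `&` B = set0 ->
  rmeas m (A `|` B) = rmeas m A + rmeas m B.
Proof.
move=> mA mB AB; apply: EFin_inj.
by rewrite EFinD -!rmeasE//; [exact: measureU|exact: measurableU].
Qed.

Lemma rmeas_cvg_nonincreasing m (F : nat -> set R) : (forall n, measurable (F n)) ->
  (forall n, F n.+1 `<=` F n) -> rmeas m (F n) @[n --> \oo] --> rmeas m (\bigcap_n F n).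
Proof.
move=> mF dF; apply: fine_cvg; rewrite -rmeasE; last exact: bigcapT_measurable.
apply: nonincreasing_cvg_mu => //.
- by rewrite -ge0_fin_numE// fin_num_measure.
- exact: bigcapT_measurable.
- by apply/nonincreasing_seqP => n; apply/subsetPset.
Qed.

Lemma rmeas_cvg_nondecreasing m (F : nat -> set R) : (forall n, measurable (F n)) ->
  (forall n, F n `<=` F n.+1) -> rmeas m (F n) @[n --> \oo] --> rmeas m (\bigcup_n F n).
Proof.
move=> mF dF; apply: fine_cvg; rewrite -rmeasE; last exact: bigcupT_measurable.
apply: nondecreasing_cvg_mu => //.
- exact: bigcupT_measurable.
- by apply/nondecreasing_seqP => n; apply/subsetPset.
Qed.

(** Both one-sided distribution functions are kept because the energy may have atoms: [Nl] is left
    continuous, [Nr] right continuous, and they differ exactly at the atoms. *)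
Definition Nl m (x : R) := rmeas m [set z | z < x].
Definition Nr m (x : R) := rmeas m [set z | z <= x].
Definition mass m := rmeas m setT.

Lemma measurable_lt (x : R) : measurable [set z | z < x].
Proof. by rewrite -set_itvNyo. Qed.
Lemma measurable_le (x : R) : measurable [set z | z <= x].
Proof. by rewrite -set_itvNyc. Qed.
Lemma measurable_gt (x : R) : measurable [set z | x < z].
Proof. by rewrite -set_itvoy. Qed.
Lemma measurable_ge (x : R) : measurable [set z | x <= z].
Proof. by rewrite -set_itvcy. Qed.
Hint Resolve measurable_lt measurable_le measurable_gt measurable_ge : core.

Lemma Nl_ge0 m x : 0 <= Nl m x. Proof. exact: rmeas_ge0. Qed.

Lemma mass_ge0 m : 0 <= mass m. Proof. exact: rmeas_ge0. Qed.

Lemma Nl_le_Nr m x : Nl m x <= Nr m x.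
Proof. by apply: le_rmeas => // z /= /ltW. Qed.

Lemma Nr_le_mass m x : Nr m x <= mass m.
Proof. exact: le_rmeas. Qed.

Lemma Nl_le_mass m x : Nl m x <= mass m.
Proof. exact: le_rmeas. Qed.

Lemma Nl_mono m x y : x <= y -> Nl m x <= Nl m y.
Proof. by move=> xy; apply: le_rmeas => // z /= /lt_le_trans; apply. Qed.

Lemma rmeas_gt m x : rmeas m [set z | x < z] = mass m - Nr m x.
Proof.
rewrite /mass (_ : setT = [set z | z <= x] `|` [set z | x < z]) ?rmeasU//; first by rewrite /Nr; ring.
  by apply/seteqP; split => z //= []; rewrite leNgt => /negP.
by apply/seteqP; split => z //= _; have [] := leP z x; auto.
Qed.

Lemma rmeas_ge m x : rmeas m [set z | x <= z] = mass m - Nl m x.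
Proof.
rewrite /mass (_ : setT = [set z | z < x] `|` [set z | x <= z]) ?rmeasU//; first by rewrite /Nl; ring.
  by apply/seteqP; split => z //= []; rewrite ltNge => /negP.
by apply/seteqP; split => z //= _; have [] := ltP z x; auto.
Qed.

Lemma rmeas_itvco m p q : p <= q -> rmeas m `[p, q[%classic = Nl m q - Nl m p.
Proof.
move=> pq; rewrite /Nl (_ : [set z | z < q] = [set z | z < p] `|` `[p, q[%classic) ?rmeasU//; first by ring.
  by apply/seteqP; split => z //= []; rewrite in_itv/= => zp /andP[]; rewrite leNgt zp.
apply/seteqP; split => z /=; rewrite in_itv/=.
  by move=> ->; have [] := ltP z p; auto.
by case=> [/lt_le_trans -> //|/andP[]].
Qed.

Lemma rmeas_itvoo m p q : p < q -> rmeas m `]p, q[%classic = Nl m q - Nr m p.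
Proof.
move=> pq; rewrite /Nl /Nr (_ : [set z | z < q] = [set z | z <= p] `|` `]p, q[%classic) ?rmeasU//; first by ring.
  by apply/seteqP; split => z //= []; rewrite in_itv/= => zp /andP[]; rewrite ltNge zp.
apply/seteqP; split => z /=; rewrite in_itv/=.
  by move=> ->; have [] := leP z p; auto.
by case=> [/le_lt_trans -> //|/andP[]].
Qed.

Let hn (n : nat) : R := n.+1%:R^-1.
Let hn0 n : 0 < hn n. Proof. by rewrite invr_gt0. Qed.
Let hnS n : hn n.+1 <= hn n.
Proof. by rewrite lef_pV2 ?posrE// ler_nat. Qed.
Let hn_small (e : R) : 0 < e -> exists n, hn n < e.
Proof.
move=> e0; have /cvgrPdist_lt/(_ _ e0)[n _ /(_ n (leqnn n))] : hn k @[k --> \oo] --> (0 : R) by exact: cvg_harmonic.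
by rewrite /= sub0r normrN gtr0_norm//; exists n.
Qed.

Lemma cvgn_small (u : nat -> R) (l e : R) : u n @[n --> \oo] --> l -> 0 < e ->
  exists n, `|l - u n| < e.
Proof. by move=> /cvgrPdist_lt H /H[n _ /(_ n (leqnn n))]; exists n. Qed.

Lemma Nl_left_continuous m x e : 0 < e -> exists2 d : R, 0 < d & Nl m x - e < Nl m (x - d).
Proof.
move=> e0.
have H := @rmeas_cvg_nondecreasing m (fun n => [set z | z < x - hn n]) (fun n => measurable_lt _) _.
have [|n] := cvgn_small (H _) e0.
  by move=> n z /= h; apply: (lt_le_trans h); rewrite lerD2l lerN2.
rewrite (_ : \bigcup_n _ = [set z | z < x]).
  by rewrite -/(Nl m x) -/(Nl m _) ltr_norml => /andP[_ h]; exists (hn n) => //; lra.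
apply/seteqP; split => z /= => [[k _ /= h]|zx]; first by have := hn0 k; lra.
have : 0 < x - z by rewrite subr_gt0.
by move=> /hn_small[k hk]; exists k => //=; lra.
Qed.

Lemma Nr_right_continuous m x e : 0 < e -> exists2 d : R, 0 < d & Nl m (x + d) < Nr m x + e.
Proof.
move=> e0.
have H := @rmeas_cvg_nonincreasing m (fun n => [set z | z < x + hn n]) (fun n => measurable_lt _) _.
have [|n] := cvgn_small (H _) e0.
  by move=> n z /= h; apply: (lt_le_trans h); rewrite lerD2l.
rewrite (_ : \bigcap_n _ = [set z | z <= x]).
  by rewrite -/(Nr m x) -/(Nl m _) ltr_norml => /andP[h _]; exists (hn n) => //; lra.
apply/seteqP; split => z /= => [h|zx k _ /=]; last by have := hn0 k; lra.
rewrite leNgt; apply/negP; rewrite -subr_gt0 => /hn_small[k hk].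
by have := h k I; rewrite /=; lra.
Qed.

Lemma Nl_cvgNy m e : 0 < e -> exists x, Nl m x < e.
Proof.
move=> e0.
have H := @rmeas_cvg_nonincreasing m (fun n => [set z | z < - n%:R]) (fun n => measurable_lt _) _.
have [|n] := cvgn_small (H _) e0.
  by move=> n z /= h; apply: (lt_le_trans h); rewrite lerN2 ler_nat.
rewrite (_ : \bigcap_n _ = set0).
  have -> : rmeas m set0 = 0 by rewrite /rmeas measure0.
  by rewrite sub0r normrN -/(Nl m _) ger0_norm ?Nl_ge0// => h; exists (- n%:R).
apply/seteqP; split => z //= h.
have := h (Num.truncn `|z|).+1 I; rewrite /= => h1.
by have := truncnS_gt `|z|; have := ler_norm (- z); rewrite normrN; lra.
Qed.

Lemma Nl_cvgy m e : 0 < e -> exists x, mass m - e < Nl m x.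
Proof.
move=> e0.
have H := @rmeas_cvg_nondecreasing m (fun n => [set z | z < n%:R]) (fun n => measurable_lt _) _.
have [|n] := cvgn_small (H _) e0.
  by move=> n z /= h; apply: (lt_le_trans h); rewrite ler_nat.
rewrite (_ : \bigcup_n _ = setT).
  by rewrite -/(mass m) -/(Nl m _) ltr_norml => /andP[_ h]; exists (n%:R); lra.
apply/seteqP; split => z //= _; exists (Num.truncn `|z|).+1 => //=.
by have := truncnS_gt `|z|; have := ler_norm z; lra.
Qed.

Lemma Nl_meas_eq m1 m2 : (forall x, Nl m1 x = Nl m2 x) -> meas_eq m1 m2.
Proof.
move=> H A mA; apply: (@measure_eq_itvco R m1 m2) => // p q pq.
  have E (m : {finite_measure set R -> \bar R}) : m `[p, q[%classic = (Nl m q - Nl m p)%:E.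
    by rewrite rmeasE// rmeas_itvco ?ltW.
  by refine (etrans (E m1) (etrans _ (esym (E m2)))); rewrite !H.
by rewrite -ge0_fin_numE// fin_num_measure.
Qed.

Lemma measurable_Nl m : measurable_fun setT (Nl m).
Proof. by apply: nondecreasing_measurable => // x y; exact: Nl_mono. Qed.

Lemma measurable_Nr m : measurable_fun setT (Nr m).
Proof.
apply: nondecreasing_measurable => // x y xy.
by apply: le_rmeas => // z /= zx; exact: le_trans xy.
Qed.

Lemma Rint_indic m A : measurable A -> \int[m]_(x in setT) \1_A x = rmeas m A.
Proof. by move=> mA; rewrite /Rintegral integral_indic// setIT. Qed.

Lemma finite_integrable m (f : R -> R) (M : R) : measurable_fun setT f ->
  (forall x, `|f x| <= M) -> m.-integrable setT (EFin \o f).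
Proof.
move=> mf fM; apply: (@integrable_le _ _ _ m setT f (cst M)) => //.
exact: finite_measure_integrable_cst.
Qed.

End Distribution.
#[export] Hint Resolve measurable_lt measurable_le measurable_gt measurable_ge : core.

(** * Continuity in time of integrals against weakly continuous measures *)

Section UniformlyContinuousInTime.
Variable R : realType.
Notation leb := (@lebesgue_measure R).
Implicit Types (g : R -> R -> R).

(** The solution is known for nonnegative times only. Composition with the positive part extends
    each function of time to one that is continuous on the whole line. *)
Definition pos (t : R) : R := Num.max t 0.

Lemma pos_ge0 t : 0 <= pos t. Proof. by rewrite le_max lexx orbT. Qed.

Lemma posE t : 0 <= t -> pos t = t. Proof. by move=> t0; rewrite /pos max_l. Qed.

Lemma pos_dist s t : `|pos s - pos t| <= `|s - t|.
Proof.
rewrite /pos; case: (leP s 0) => s0; case: (leP t 0) => t0; rewrite ?subrr ?normr0//.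
- by rewrite sub0r normrN (gtr0_norm t0) (_ : `|s - t| = t - s); [lra|rewrite ler0_norm; lra].
- by rewrite subr0 (gtr0_norm s0) ler_normr; apply/orP; left; lra.
Qed.

(** Bounded on bounded time intervals, continuous in space, and continuous in time uniformly in
    space. The last clause is what allows the integrand to vary together with a weakly continuous
    measure. *)
Definition ucb g := [/\ forall t, 0 <= t -> continuous (g t),
  forall T, exists M : R, forall t z, 0 <= t -> t <= T -> `|g t z| <= M &
  forall t e, 0 <= t -> 0 < e -> exists2 d : R, 0 < d &
    forall s z, 0 <= s -> `|s - t| < d -> `|g s z - g t z| <= e].

Lemma ucb_const (f : R -> R) (M : R) : continuous f -> (forall z, `|f z| <= M) -> ucb (fun _ => f).
Proof.
move=> cf fM; split=> //; first by move=> T; exists M.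
by move=> t e _ e0; exists 1 => // s z _ _; rewrite subrr normr0 ltW.
Qed.

Lemma ucbD g h : ucb g -> ucb h -> ucb (fun t z => g t z + h t z).
Proof.
move=> [g1 g2 g3] [h1 h2 h3]; split.
- by move=> t t0 z; apply: continuousD; [exact: g1|exact: h1].
- move=> T; have [M HM] := g2 T; have [N HN] := h2 T; exists (M + N) => t z t0 tT.
  by apply: (le_trans (ler_normD _ _)); apply: lerD; [exact: HM|exact: HN].
- move=> t e t0 e0; have e2 : 0 < e / 2 by rewrite divr_gt0.
  have [d d0 Hd] := g3 t _ t0 e2; have [b b0 Hb] := h3 t _ t0 e2.
  exists (Num.min d b) => [|s z s0]; first by rewrite lt_min d0.
  rewrite lt_min => /andP[sd sb].
  have := Hd s z s0 sd; have := Hb s z s0 sb.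
  have := ler_normD (g s z - g t z) (h s z - h t z).
  have -> : g s z - g t z + (h s z - h t z) = g s z + h s z - (g t z + h t z) by ring.
  by lra.
Qed.

Lemma ucbM g h : ucb g -> ucb h -> ucb (fun t z => g t z * h t z).
Proof.
move=> [g1 g2 g3] [h1 h2 h3]; split.
- by move=> t t0 z; apply: continuousM; [exact: g1|exact: h1].
- move=> T; have [M HM] := g2 T; have [N HN] := h2 T; exists (M * N) => t z t0 tT.
  by rewrite normrM ler_pM//; [exact: HM|exact: HN].
- move=> t e t0 e0; have [M HM] := g2 (t + 1); have [N HN] := h2 (t + 1).
  pose K := `|M| + `|N| + 1.
  have M0 := normr_ge0 M; have N0 := normr_ge0 N; have MM := ler_norm M; have NN := ler_norm N.
  have K0 : 0 < K by rewrite /K; lra.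
  have e2 : 0 < e / (2 * K) by rewrite divr_gt0// mulr_gt0.
  have [d d0 Hd] := g3 t _ t0 e2; have [b b0 Hb] := h3 t _ t0 e2.
  exists (Num.min (Num.min d b) 1) => [|s z s0]; first by rewrite !lt_min d0 b0 ltr01.
  rewrite !lt_min => /andP[/andP[sd sb] s1].
  have h4 : `|h s z| <= K.
    have s2 : s <= t + 1 by move: s1; rewrite ltr_norml => /andP[_]; lra.
    by have := HN s z s0 s2; rewrite /K; lra.
  have h5 : `|g t z| <= K.
    have t2 : t <= t + 1 by lra.
    by have := HM t z t0 t2; rewrite /K; lra.
  have -> : g s z * h s z - g t z * h t z = (g s z - g t z) * h s z + g t z * (h s z - h t z) by ring.
  apply: (le_trans (ler_normD _ _)); rewrite !normrM.
  have h6 : `|g s z - g t z| * `|h s z| <= e / (2 * K) * K by rewrite ler_pM//; exact: Hd.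
  have h7 : `|g t z| * `|h s z - h t z| <= K * (e / (2 * K)) by rewrite ler_pM//; exact: Hb.
  have -> : e = e / (2 * K) * K + K * (e / (2 * K)) by field; rewrite gt_eqF.
  exact: lerD.
Qed.

Lemma ucbZ k g : ucb g -> ucb (fun t z => k * g t z).
Proof.
move=> ug; apply: ucbM => //; apply: (@ucb_const _ `|k|) => //; exact: cst_continuous.
Qed.

Lemma lipschitz_continuous (f : R -> R) (L : R) :
  (forall x y, `|f x - f y| <= L * `|x - y|) -> continuous f.
Proof.
move=> fL x; apply/cvgrPdist_lt => e e0.
have L0 : 0 < `|L| + 1 by have := normr_ge0 L; lra.
near=> y; apply: (le_lt_trans (fL x y)).
apply: (@le_lt_trans _ _ ((`|L| + 1) * `|x - y|)).
  by rewrite ler_wpM2r//; have := ler_norm L; lra.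
rewrite mulrC -ltr_pdivlMr//; near: y; apply: cvgr_dist_lt => //; exact: divr_gt0.
Unshelve. all: by end_near. Qed.

Lemma ucb_shift (f y : R -> R) (L M : R) : (forall x y, `|f x - f y| <= L * `|x - y|) ->
  (forall x, `|f x| <= M) -> continuous y -> ucb (fun t z => f (z - y t)).
Proof.
move=> fL fM cy; split.
- move=> t t0; apply: (@lipschitz_continuous _ L) => a b.
  by apply: le_trans (fL _ _) _; rewrite (_ : a - y t - (b - y t) = a - b)//; ring.
- by move=> T; exists M.
- move=> t e t0 e0.
  have L0 : 0 < `|L| + 1 by have := normr_ge0 L; lra.
  have /cvgrPdist_lt/(_ _ (divr_gt0 e0 L0))/nbhs_ballP[d /= d0 Hd] := cy t.
  exists d => // s z s0 st; apply: (le_trans (fL _ _)).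
  apply: (@le_trans _ _ ((`|L| + 1) * `|y t - y s|)).
    rewrite (_ : z - y s - (z - y t) = y t - y s); last by ring.
    by rewrite ler_wpM2r//; have := ler_norm L; lra.
  rewrite mulrC -ler_pdivlMr//; apply: ltW; apply: Hd.
  by rewrite /ball/= distrC.
Qed.

Section WeakContinuity.
Variable nu : R -> {finite_measure set R -> \bar R}.
Hypothesis nu_weak : forall g : R -> R, continuous g -> (exists M, forall x, `|g x| <= M) ->
  {within [set t : R | 0 <= t], continuous (fun t => fine (\int[nu t]_(x in setT) (g x)%:E))}.

Lemma weak_continuity_eps (g : R -> R) (M t e : R) : continuous g -> (forall x, `|g x| <= M) ->
  0 <= t -> 0 < e -> exists2 d : R, 0 < d & forall s, 0 <= s -> `|s - t| < d ->
    `|\int[nu s]_(x in setT) g x - \int[nu t]_(x in setT) g x| < e.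
Proof.
move=> cg gM t0 e0; have := nu_weak cg (ex_intro _ M gM).
move=> /subspace_continuousP /(_ t t0) /cvgrPdist_lt /(_ _ e0).
rewrite /within/= => /nbhs_ballP[d /= d0 Hd]; exists d => // s s0 st.
rewrite distrC; apply: Hd => //; by rewrite /ball/= distrC.
Qed.

Lemma mass_Rint m : mass m = \int[m]_(x in setT) (1 : R).
Proof. by rewrite Rintegral_cst// mul1r. Qed.

Lemma mass_near t e : 0 <= t -> 0 < e -> exists2 d : R, 0 < d & forall s, 0 <= s -> `|s - t| < d ->
  `|mass (nu s) - mass (nu t)| < e.
Proof.
move=> t0 e0; have c1 : continuous (cst 1 : R -> R) by exact: cst_continuous.
have b1 (x : R) : `|(cst 1 : R -> R) x| <= 1 by rewrite normr1.
have [d d0 H] := weak_continuity_eps c1 b1 t0 e0.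
by exists d => // s s0 st; rewrite !mass_Rint; exact: H.
Qed.

(** Replacing [g (pos s)] by [g (pos t)] costs the uniform distance times the mass, which is bounded
    near [t]; weak continuity takes care of the integrand thus frozen. *)
Lemma ucb_weak_continuous g : ucb g ->
  continuous (fun t => \int[nu (pos t)]_(z in setT) g (pos t) z).
Proof.
move=> [g1 g2 g3] t; apply/cvgrPdist_lt => e e0.
have t0 := pos_ge0 t.
have [M HM] := g2 (pos t); have {}HM z := HM _ z t0 (lexx _).
pose C := mass (nu (pos t)) + 1.
have C0 : 0 < C by have := mass_ge0 (nu (pos t)); rewrite /C; lra.
have e3 : 0 < e / (3 * C) by rewrite divr_gt0// mulr_gt0.
have e2 : 0 < e / 2 by rewrite divr_gt0.
have [d1 d10 H1] := mass_near t0 ltr01.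
have [d2 d20 H2] := g3 _ _ t0 e3.
have [d3 d30 H3] := weak_continuity_eps (g1 _ t0) HM t0 e2.
apply/nbhs_ballP; exists (Num.min (Num.min d1 d2) d3); first by rewrite /= !lt_min d10 d20 d30.
move=> s; rewrite /ball/= distrC => st.
have : `|pos s - pos t| < Num.min (Num.min d1 d2) d3 by apply: le_lt_trans st; exact: pos_dist.
rewrite !lt_min => /andP[/andP[s1 s2] s3].
have s0 := pos_ge0 s.
have b z : `|g (pos s) z| <= M + e / (3 * C).
  have := H2 _ z s0 s2; have := HM z.
  by have := ler_normD (g (pos s) z - g (pos t) z) (g (pos t) z); rewrite subrK; lra.
have i1 : (nu (pos s)).-integrable setT (EFin \o g (pos s)).
  by apply: finite_integrable b; apply: continuous_measurable_fun; exact: g1.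
have i2 : (nu (pos s)).-integrable setT (EFin \o g (pos t)).
  by apply: finite_integrable HM; apply: continuous_measurable_fun; exact: g1.
have A : `|\int[nu (pos s)]_(z in setT) g (pos s) z - \int[nu (pos s)]_(z in setT) g (pos t) z| <= e / 3.
  rewrite -RintegralB//.
  apply: (@le_trans _ _ (\int[nu (pos s)]_(z in setT) (e / (3 * C)))).
    apply: Rintegral_abs_le => //.
    - exact: RintegrableB.
    - exact: finite_measure_integrable_cst.
    - by move=> z _; exact: H2.
  rewrite Rintegral_cst// -/(mass _).
  have : mass (nu (pos s)) <= C.
    by have := H1 _ s0 s1; rewrite ltr_norml /C => /andP[_]; lra.
  move=> h; apply: (@le_trans _ _ (e / (3 * C) * C)); first by rewrite ler_wpM2l// ltW.
  by rewrite (_ : e / (3 * C) * C = e / 3)//; field; rewrite gt_eqF.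
have B := H3 _ s0 s3.
rewrite distrC.
have := ler_normD (\int[nu (pos s)]_(z in setT) g (pos s) z - \int[nu (pos s)]_(z in setT) g (pos t) z)
  (\int[nu (pos s)]_(z in setT) g (pos t) z - \int[nu (pos t)]_(z in setT) g (pos t) z).
rewrite addrA subrK; lra.
Qed.

End WeakContinuity.

Lemma ucb_lebesgue_continuous g : ucb g ->
  (forall T, exists M : R, forall t z, 0 <= t -> t <= T -> M < `|z| -> g t z = 0) ->
  continuous (fun t => \int[leb]_(z in setT) g (pos t) z).
Proof.
move=> [g1 g2 g3] gs t; apply/cvgrPdist_lt => e e0.
have t0 := pos_ge0 t.
have [M HM] := gs (pos t + 1).
pose N := `|M| + 1.
have N0 : 0 < N by rewrite /N; have := normr_ge0 M; lra.
have MN : M < N by rewrite /N; have := ler_norm M; lra.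
have e2 : 0 < e / (4 * N) by rewrite divr_gt0// mulr_gt0.
have [d d0 Hd] := g3 _ _ t0 e2.
apply/nbhs_ballP; exists (Num.min d 1); first by rewrite /= lt_min d0 ltr01.
move=> s; rewrite /ball/= distrC => st.
have : `|pos s - pos t| < Num.min d 1 by apply: le_lt_trans st; exact: pos_dist.
rewrite lt_min => /andP[s1 s2].
have s0 := pos_ge0 s.
have E r : 0 <= r -> r <= pos t + 1 ->
    \int[leb]_(z in setT) g r z = \int[leb]_(z in `[- N, N]) g r z.
  move=> r0 rt; have [_ E] := @loc_int_compact_support R (g r) N (loc_int_cont (g1 r r0))
    (fun x Nx => HM r x r0 rt (lt_trans MN Nx)).
  exact: E.
rewrite !E//; last 2 first.
- by move: s2; rewrite ltr_norml => /andP[_]; lra.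
- by lra.
rewrite distrC -RintegralB//; [|exact: (loc_int_cont (g1 _ _)).2|exact: (loc_int_cont (g1 _ _)).2].
apply: (@le_lt_trans _ _ (\int[leb]_(z in `[- N, N]) (e / (4 * N)))).
  apply: Rintegral_abs_le => //.
  - by apply: RintegrableB => //; exact: (loc_int_cont (g1 _ _)).2.
  - exact: integrable_itv_cst.
  - by move=> z _; exact: Hd.
rewrite Rint_itv_cst; last by lra.
have -> : e / (4 * N) * (N - - N) = e / 2 by field; rewrite gt_eqF.
lra.
Qed.

End UniformlyContinuousInTime.

Section ContinuousAlgebra.
Variable R : realType.

Lemma cont_add (f g : R -> R) : continuous f -> continuous g -> continuous (fun x => f x + g x).
Proof. by move=> cf cg x; apply: continuousD; [exact: cf|exact: cg]. Qed.

Lemma cont_mul (f g : R -> R) : continuous f -> continuous g -> continuous (fun x => f x * g x).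
Proof. by move=> cf cg x; apply: continuousM; [exact: cf|exact: cg]. Qed.

End ContinuousAlgebra.

(** * From equations tested in time to equations integrated in time *)

Section TimeIntegral.
Variables (R : realType) (s : R -> R) (B : R).
Hypothesis (sB : smooth_step s B).
Notation leb := (@lebesgue_measure R).
Notation stp := (stp s).
Notation stpd := (stpd s).

Lemma prim_lipschitz (f g : R -> R) (M : R) : prim f g -> (forall x, `|g x| <= M) ->
  forall x y, `|f x - f y| <= M * `|x - y|.
Proof.
move=> pf gM x y; have [xy|yx] := leP x y.
  rewrite distrC (distrC x y) (ger0_norm (x := y - x)) ?subr_ge0//.
  exact: (prim_ge0_le pf gM xy).
rewrite (ger0_norm (x := x - y)) ?subr_ge0 ?(ltW yx)//.
exact: (prim_ge0_le pf gM (ltW yx)).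
Qed.

Lemma step_derive_lipschitz : exists L : R, forall x y, `|derive1 s x - derive1 s y| <= L * `|x - y|.
Proof.
have [ss _ _ _] := sB.
have s1 := smooth1_derive1 ss; have s2 := smooth1_derive1 s1.
have [M M0 HM] := continuous_itv_bounded (-1) 1 (smooth1_continuous s2).
exists M; apply: (prim_lipschitz (prim_smooth1 s1)) => x.
have [x1|x1] := leP `|x| 1; first by move: x1; rewrite ler_norml => /andP[h1 h2]; exact: HM.
rewrite (_ : derive1 (derive1 s) x = 0) ?normr0// derive1E.
have D0 : is_derive x 1 (derive1 s) 0.
  apply: (is_derive_near (is_derive_const 0 _)).
  have := near_norm x1; apply: filterS => y /ltW/(step_derive0 sB) ->//.
exact: (@derive_val _ _ _ _ _ _ _ D0).
Qed.

Lemma stp_lipschitz d p : 0 < d -> forall x y, `|stp d p x - stp d p y| <= d^-1 * B * `|x - y|.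
Proof.
move=> d0; apply: (prim_lipschitz (prim_stp sB d p)) => x.
by have /andP[h1 h2] := stpd_bound sB p x d0; rewrite ger0_norm.
Qed.

Lemma stpd_lipschitz d p : exists L : R, forall x y, `|stpd d p x - stpd d p y| <= L * `|x - y|.
Proof.
have [L HL] := step_derive_lipschitz.
exists (`|d^-1| * (L * `|d^-1|)) => x y; rewrite /stpd -mulrBr normrM -mulrA ler_wpM2l//.
apply: (le_trans (HL _ _)).
rewrite (_ : d^-1 * x + - (d^-1 * p) - (d^-1 * y + - (d^-1 * p)) = d^-1 * (x - y)); last by ring.
by rewrite normrM mulrA.
Qed.

Let hn (n : nat) : R := n.+1%:R^-1.
Let hn0 n : 0 < hn n. Proof. by rewrite invr_gt0. Qed.
Let hn1 n : hn n <= 1. Proof. by rewrite invf_le1 ?ler1n. Qed.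
Let hn_cvg : hn n @[n --> \oo] --> (0 : R).
Proof. exact: cvg_harmonic. Qed.

Lemma derive1_stpB d p e q : derive1 (fun x => stp d p x - stp e q x) = fun x => stpd d p x - stpd e q x.
Proof.
apply: derive1_eq => x; rewrite -!(stp_derive sB) !derive1E.
by apply: is_deriveB; apply/derivableP; apply: smooth1_derivable; exact: (smooth1_stp sB).
Qed.

(* the cut-off at time t is th_n(r) = stp 1 (-2) r - stp (1/n) t r, which equals
   1 - stp (1/n) t r for r >= 0 *)
Lemma time_integral (I J : R -> R) : continuous I -> continuous J ->
  (forall th, test1 th -> \int[leb]_(r in [set r | 0 <= r]) (derive1 th r * I r + th r * J r) =
     - (th 0 * I 0)) ->
  forall t, 0 <= t -> I t - I 0 = \int[leb]_(r in `[0, t]) J r.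
Proof.
move=> cI cJ H t; rewrite le_eqVlt => /predU1P[<-|t0].
  by rewrite set_itv1 Rintegral_set1 subrr.
pose th n r := stp 1 (- 2) r - stp (hn n) t r.
have tth n : test1 (th n).
  split; first by apply: smooth1D; [|apply: smooth1N]; exact: (smooth1_stp sB).
  exists (t + 3) => x; rewrite lter_normr /th => /orP[] h.
    by have h1 := hn1 n; rewrite !(stp_right sB) ?subrr//; lra.
  by have h1 := hn1 n; rewrite !(stp_left sB) ?subrr//; lra.
have th1 n r : 0 <= r -> th n r = 1 - stp (hn n) t r.
  by move=> r0; rewrite /th (stp_right sB)//; lra.
have dth n r : 0 <= r -> derive1 (th n) r = - stpd (hn n) t r.
  move=> r0; rewrite derive1_stpB (stpd_out sB (d := 1)) ?sub0r//.
  by rewrite ger0_norm; lra.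
pose K := `[0, t + 1]%classic.
have mK : (measurable : set (set (measurableTypeR R))) K by exact: measurable_itv.
pose f n r := - (I r * stpd (hn n) t r) + J r * (1 - stp (hn n) t r).
have l1 n : loc_int (fun r => I r * stpd (hn n) t r).
  by apply: (loc_intM (loc_int_cont cI)); exact: (stpd_continuous sB).
have c2 n : continuous (fun r => 1 - stp (hn n) t r).
  move=> r; apply: continuousB; first exact: cst_continuous.
  by apply: smooth1_continuous; exact: (smooth1_stp sB).
have l2 n : loc_int (fun r => J r * (1 - stp (hn n) t r)).
  exact: (loc_intM (loc_int_cont cJ)).
have E1 n : \int[leb]_(r in [set r | 0 <= r]) (derive1 (th n) r * I r + th n r * J r) =
    (- \int[leb]_(r in K) (I r * stpd (hn n) t r)) + \int[leb]_(r in K) (J r * (1 - stp (hn n) t r)).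
  transitivity (\int[leb]_(r in K) f n r).
    rewrite [LHS]Rintegral_mkcond [RHS]Rintegral_mkcond; congr Rintegral; apply/funext => r.
    rewrite !patchE; have [r0|r0] := leP 0 r; last first.
      have n1 : ~ K r by rewrite /K/= in_itv/= => /andP[]; rewrite leNgt r0.
      have n2 : ~ [set r | 0 <= r] r by rewrite /= leNgt r0.
      by rewrite (memNset n1) (memNset n2).
    rewrite mem_set//=; case: ifPn => [_|/negP rK].
      by rewrite dth// th1// /f; ring.
    have rt : t + 1 < r.
      by rewrite ltNge; apply/negP => h; apply: rK; rewrite inE /K/= in_itv/= r0.
    have h1 := hn1 n.
    rewrite dth// th1// (stp_right sB)//; last by lra.
    rewrite (stpd_out sB)//; last by rewrite ger0_norm; lra.
    by rewrite oppr0 mul0r subrr mul0r addr0.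
  rewrite /f RintegralD//; last exact: (l2 n).2.
    congr (_ + _); rewrite -mulN1r -RintegralZl//; last exact: (l1 n).2.
    by apply: Rintegral_eq => x _; rewrite mulN1r.
  apply: (@integrable_eq _ _ _ leb K (fun x => -1 * (I x * stpd (hn n) t x))) => //.
    by move=> x _; rewrite mulN1r.
  by apply: RintegrableZ => //; exact: (l1 n).2.
have lI : lebesgue_pt I t.
  by apply: (@continuous_lebesgue_pt R I t setT _ _ (loc_int_cont cI).1 (cI t)) => //; split=> //; exact: openT.
have small : \forall n \near \oo, hn n < Num.min t 1.
  have m0 : 0 < Num.min t 1 by rewrite lt_min t0 ltr01.
  have /cvgrPdist_lt/(_ _ m0) := hn_cvg.
  by apply: filterS => n; rewrite sub0r normrN gtr0_norm.
have L1 : \int[leb]_(r in K) (I r * stpd (hn n) t r) @[n --> \oo] --> I t.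
  apply: cvg_trans (stpd_approx_identity sB (loc_int_cont cI) lI).
  apply: near_eq_cvg; apply: filterS small => n; rewrite lt_min => /andP[h1 h2].
  have aux (x : R) : `|x - t| < hn n -> 0 <= x <= t + 1.
    move: h1 h2; move: (hn n) => e h1 h2; rewrite ltr_norml => /andP[h3 h4].
    by apply/andP; split; lra.
  rewrite (@Rintegral_support _ _ _ leb K)// => x xK; rewrite (stpd_out sB) ?mulr0//.
  by rewrite leNgt; apply/negP => /aux h; apply: xK; rewrite /K/= in_itv.
have L2 : \int[leb]_(r in K) (J r * (1 - stp (hn n) t r)) @[n --> \oo] --> \int[leb]_(r in `[0, t]) J r.
  pose D := K `\` [set t].
  have mD : measurable D by apply: measurableD; [exact: measurable_itv|exact: measurable_set1].
  have rm k : loc_int k -> \int[leb]_(x in K) k x = \int[leb]_(x in D) k x.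
    move=> lk; apply: Rintegral_negligible => //; [exact: lk.2|exact: lebesgue_measure_set1].
  have ilg : leb.-integrable D (EFin \o (fun x => `|J x|)).
    apply: (loc_int_integrable (loc_int_norm (loc_int_cont cJ)) mD); exact: subDsetl.
  rewrite (_ : (fun n => _) = fun n => \int[leb]_(r in D) (J r * (1 - stp (hn n) t r))); last first.
    by apply/funext => n; exact: rm.
  have -> : \int[leb]_(r in `[0, t]) J r = \int[leb]_(r in D) (J r * (1 - (if t < r then 1 else 0))).
    have -> : \int[leb]_(x in `[0, t]) J x = \int[leb]_(x in `[0, t]%classic `\` [set t]) J x.
      apply: Rintegral_negligible => //; [exact: (loc_int_cont cJ).2|exact: lebesgue_measure_set1].
    rewrite [LHS]Rintegral_mkcond [RHS]Rintegral_mkcond; congr Rintegral; apply/funext => x.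
    rewrite !patchE; have [->|/eqP xt] := eqVneq x t; first by rewrite !memNset// => -[_]; apply.
    have [xin|xin] := boolP (0 <= x <= t).
      move: (xin) => /andP[h1 h2].
      have d1 : D x.
        by split => //; rewrite /K/= in_itv/= h1/= (le_trans h2)// lerDl.
      have d2 : (`[0, t]%classic `\ t) x by split => //=; rewrite in_itv.
      rewrite (mem_set d1) (mem_set d2).
      by rewrite ltNge h2/= subr0 mulr1.
    rewrite [in LHS]memNset; last by move=> [/= +]; rewrite in_itv/= (negbTE xin).
    case: ifPn => // /set_mem[+ _]; rewrite /K/= in_itv/= => /andP[h1 _].
    by move: xin; rewrite h1/= -ltNge => ->; rewrite subrr mulr0.
  suff [] : leb.-integrable D (EFin \o (fun r => J r * (1 - (if t < r then 1 else 0)))) /\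
     \int[leb]_(r in D) (J r * (1 - stp (hn n) t r)) @[n --> \oo] -->
     \int[leb]_(r in D) (J r * (1 - (if t < r then 1 else 0))) by [].
  apply: (@Rintegral_dominated _ _ _ leb D _ _ (fun x => `|J x|) mD _ ilg).
  - by move=> n; apply: measurable_funTS; exact: (l2 n).1.
  - move=> n x _; rewrite normrM ler_piMr//.
    have /andP[h1 h2] := stp_bound sB t x (hn0 n).
    by rewrite ler_norml; lra.
  - move=> x [_ /= xt]; apply: cvgMr; apply: cvgB; first exact: cvg_cst.
    by apply: (stp_cvg sB); apply/eqP.
have L3 : (- \int[leb]_(r in K) (I r * stpd (hn n) t r)) + \int[leb]_(r in K) (J r * (1 - stp (hn n) t r))
    @[n --> \oo] --> - I t + \int[leb]_(r in `[0, t]) J r.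
  by apply: cvgD => //; exact: cvgN.
(* By the tested equation the same sequence is eventually constant: once $1/(n+1)<t$ the cut-off
   equals 1 at time 0. *)
have L4 : (- \int[leb]_(r in K) (I r * stpd (hn n) t r)) + \int[leb]_(r in K) (J r * (1 - stp (hn n) t r))
    @[n --> \oo] --> - I 0.
  apply: cvg_near_cst; apply: filterS small => n; rewrite lt_min => /andP[h1 h2].
  rewrite -E1 (H _ (tth n)) th1// (stp_left sB)//; last by lra.
  by rewrite subr0 mul1r.
have : - I t + \int[leb]_(r in `[0, t]) J r = - I 0.
  exact: etrans (esym (cvg_lim (@Rhausdorff R) L3)) (cvg_lim (@Rhausdorff R) L4).
lra.
Qed.

End TimeIntegral.

(** * Quantiles of a finite measure *)

Section Quantile.
Variable R : realType.
Implicit Types (m : {finite_measure set R -> \bar R}).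

(** The largest quantile of level [eta]: if the distribution function is constant and equal to [eta]
    on an interval, its right end is taken. *)
Definition quantile m (eta : R) : R := sup [set x | Nl m x <= eta].

(** A Galois connection between positions and levels. It holds because [Nl] is left continuous, so
    the supremum belongs to the set; comparisons with the quantile are read off from it. *)
Lemma quantileP m eta x : 0 < eta -> eta < mass m -> (x <= quantile m eta) = (Nl m x <= eta).
Proof.
move=> e0 em.
have S : has_sup [set x | Nl m x <= eta].
  split; first by have [y /ltW] := Nl_cvgNy m e0; exists y.
  have [|y Hy] := @Nl_cvgy R m (mass m - eta); first by rewrite subr_gt0.
  exists y => z /= zeta; rewrite leNgt; apply/negP => yz.
  by have := Nl_mono m (ltW yz); lra.
apply/idP/idP => [|h]; last exact: (sup_upper_bound S).
move=> /(Nl_mono m)/le_trans; apply.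
apply/ler_addgt0Pr => e epos.
have [d d0 Hd] := Nl_left_continuous m (quantile m eta) epos.
have [y /= Hy yq] := sup_adherent d0 S.
have : Nl m (quantile m eta - d) <= Nl m y by apply: Nl_mono; rewrite ltW.
by lra.
Qed.

Lemma quantile_Nl m eta : 0 < eta -> eta < mass m -> Nl m (quantile m eta) <= eta.
Proof. by move=> e0 em; rewrite -quantileP. Qed.

Lemma quantile_lt m eta x : 0 < eta -> eta < mass m -> quantile m eta < x -> eta < Nl m x.
Proof. by move=> e0 em; rewrite !ltNge quantileP. Qed.

Lemma quantile_Nr m eta : 0 < eta -> eta < mass m -> eta <= Nr m (quantile m eta).
Proof.
move=> e0 em; apply/ler_addgt0Pr => e epos.
have [d d0 Hd] := Nr_right_continuous m (quantile m eta) epos.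
have := @quantile_lt m eta (quantile m eta + d) e0 em; lra.
Qed.

(** If the distribution functions differed at [x], the level halfway between their values would have
    its two quantiles on different sides of [x]. *)
Lemma quantile_eq_Nl m1 m2 : mass m1 = mass m2 ->
  (forall eta, 0 < eta -> eta < mass m1 -> quantile m1 eta = quantile m2 eta) ->
  forall x, Nl m1 x = Nl m2 x.
Proof.
move=> mm.
suff K m m' : mass m = mass m' -> (forall eta, 0 < eta -> eta < mass m -> quantile m eta = quantile m' eta) ->
    forall x, Nl m x <= Nl m' x.
  move=> H x; apply/eqP; rewrite eq_le !K// => eta e0; rewrite -mm => em; exact/esym/H.
move=> {}mm H x; rewrite leNgt; apply/negP => lt.
pose eta := (Nl m x + Nl m' x) / 2.
have h1 := Nl_ge0 m' x; have h2 := Nl_le_mass m x.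
have e0 : 0 < eta by rewrite /eta; lra.
have em : eta < mass m by rewrite /eta; lra.
have em' : eta < mass m' by rewrite -mm.
have : x <= quantile m' eta by rewrite quantileP// /eta; lra.
by rewrite -H// quantileP// /eta; lra.
Qed.

(** The interval is open, so an atom at the quantile does not count, and [eta] lies between [Nl] and
    [Nr] there. *)
Lemma rmeas_quantile_gap m eta x : 0 < eta -> eta < mass m ->
  rmeas m `]Num.min x (quantile m eta), Num.max x (quantile m eta)[%classic <= `|Nl m x - eta|.
Proof.
move=> e0 em; have q1 := quantile_Nl e0 em; have q2 := quantile_Nr e0 em.
have [xq|qx|->] := ltgtP x (quantile m eta).
- rewrite rmeas_itvoo//; have := Nl_le_Nr m x; have := Nl_mono m (ltW xq).
  by rewrite distrC => h1 h2; apply: le_trans (ler_norm _); lra.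
- by rewrite rmeas_itvoo//; apply: le_trans (ler_norm _); lra.
- rewrite (_ : `]_, _[%classic = set0) ?set_itv_ge ?bnd_simp ?ltxx//.
  by rewrite /rmeas measure0/=; exact: normr_ge0.
Qed.

End Quantile.

(** * The energy quantiles move with the velocity *)

Lemma cvg_seqB (R : realType) (f g : nat -> R) (a b : R) :
  f n @[n --> \oo] --> a -> g n @[n --> \oo] --> b -> f n - g n @[n --> \oo] --> a - b.
Proof. by move=> fa gb; exact: cvgB. Qed.

Lemma cvg_seq_eq (R : realType) (f g : nat -> R) (a b : R) :
  f n @[n --> \oo] --> a -> g n @[n --> \oo] --> b -> (forall n, f n = g n) -> a = b.
Proof.
move=> fa gb /funext fg; move: gb; rewrite -fg => gb.
exact: etrans (esym (cvg_lim (@Rhausdorff R) fa)) (cvg_lim (@Rhausdorff R) gb).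
Qed.

Section Transport.
Variables (R : realType) (s : R -> R) (B : R).
Hypothesis (sB : smooth_step s B).
Notation leb := (@lebesgue_measure R).
Notation stp := (stp s).
Notation stpd := (stpd s).
Implicit Types (d e p q c t r : R).
Variables (v : R -> R -> R) (nu : R -> {finite_measure set R -> \bar R}).
Hypothesis nu_weak : forall g : R -> R, continuous g -> (exists M, forall x, `|g x| <= M) ->
  {within [set t : R | 0 <= t], continuous (fun t => fine (\int[nu t]_(x in setT) (g x)%:E))}.
Hypothesis uv : ucb v.
Hypothesis transport : forall phi, test2 phi ->
  (\int[leb]_(t in [set t : R | (0 <= t)%R]) \int[nu t]_(x in setT)
        (dpt phi t x + v t x * dpx phi t x)%:E
      = - \int[nu 0%R]_(x in setT) (phi 0%R x)%:E)%E.

Lemma ucb_moving (f : R -> R) (L M c : R) : (forall x y, `|f x - f y| <= L * `|x - y|) ->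
  (forall x, `|f x| <= M) -> ucb (fun t z => f (z - c * t)).
Proof.
move=> fL fM; apply: ucb_shift fL fM _ => x.
by apply: continuousM; [exact: cst_continuous|exact: cvg_id].
Qed.

Lemma ucb_nu_integrable g t : ucb g -> 0 <= t -> (nu t).-integrable setT (EFin \o g t).
Proof.
move=> [g1 g2 _] t0; have [M HM] := g2 t.
apply: (@finite_integrable _ _ _ M) => [|x]; last exact: HM.
by apply: continuous_measurable_fun; exact: g1.
Qed.

Lemma test_integrable_half (h : R -> R) (M : R) : continuous h -> (forall x, M < `|x| -> h x = 0) ->
  leb.-integrable [set r : R | 0 <= r] (EFin \o h).
Proof.
move=> ch h0; have [i _] := loc_int_compact_support (loc_int_cont ch) h0.
by apply: (@integrableS _ _ _ leb setT) => //; rewrite -set_itvcy; exact: measurable_itv.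
Qed.

Lemma dpt_moving th ch c (t x : R) : smooth1 th -> smooth1 ch ->
  dpt (fun t x => th t * ch (x - c * t)) t x =
  derive1 th t * ch (x - c * t) + (- c * th t) * derive1 ch (x - c * t).
Proof.
move=> sth sch; rewrite /dpt derive1E.
exact: (@derive_val _ _ _ _ _ _ _ (is_derive_moving_t c t x sth sch)).
Qed.

Lemma dpx_moving th ch c (t x : R) : smooth1 ch ->
  dpx (fun t x => th t * ch (x - c * t)) t x = th t * derive1 ch (x - c * t).
Proof.
move=> sch; rewrite /dpx derive1E.
exact: (@derive_val _ _ _ _ _ _ _ (is_derive_moving_x th c t x sch)).
Qed.

Lemma derive1_compact_support (th : R -> R) (M : R) : (forall x, M < `|x| -> th x = 0) ->
  forall x, M < `|x| -> derive1 th x = 0.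
Proof.
move=> H x Mx; rewrite derive1E.
have D0 : is_derive x 1 th 0.
  apply: (is_derive_near (is_derive_const 0 _)).
  by have := near_norm Mx; apply: filterS => y /H ->.
exact: (@derive_val _ _ _ _ _ _ _ D0).
Qed.

(** In the frame moving at speed [c] the energy has relative velocity $v-c$, whence the flux
    $\chi'(z-cr)(v-c)$; the cut-off in time is removed by [time_integral]. *)
Lemma transport_test (chi : R -> R) (L1 L2 M1 M2 c : R) : test1 chi ->
  (forall x y, `|chi x - chi y| <= L1 * `|x - y|) -> (forall x, `|chi x| <= M1) ->
  (forall x y, `|derive1 chi x - derive1 chi y| <= L2 * `|x - y|) -> (forall x, `|derive1 chi x| <= M2) ->
  forall t, 0 <= t ->
  \int[nu t]_(z in setT) chi (z - c * t) - \int[nu 0]_(z in setT) chi z =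
  \int[leb]_(r in `[0, t]) \int[nu (pos r)]_(z in setT) (derive1 chi (z - c * pos r) * (v (pos r) z - c)).
Proof.
move=> tc l1 m1 l2 m2 t t0; have [sc _] := tc.
have u1 := ucb_moving c l1 m1; have u2 := ucb_moving c l2 m2.
have uc : ucb (fun _ _ => - c).
  by apply: (@ucb_const _ _ `|c|) => [|z]; [exact: cst_continuous|rewrite normrN].
have u3 : ucb (fun t z => derive1 chi (z - c * t) * (v t z - c)) by apply: ucbM => //; exact: ucbD.
pose I r := \int[nu (pos r)]_(z in setT) chi (z - c * pos r).
pose J r := \int[nu (pos r)]_(z in setT) (derive1 chi (z - c * pos r) * (v (pos r) z - c)).
have cI : continuous I by exact: (ucb_weak_continuous nu_weak u1).
have cJ : continuous J by exact: (ucb_weak_continuous nu_weak u3).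
have I0 : I 0 = \int[nu 0]_(z in setT) chi z.
  by rewrite /I posE//; apply: Rintegral_eq => z _; rewrite mulr0 subr0.
rewrite -I0 -[X in X - _](_ : I t = _); last by rewrite /I posE.
apply: (time_integral sB cI cJ) => // th tth; have [sth [M HM]] := tth.
have := transport (test2_moving c tth tc).
rewrite (_ : (\int[leb]_(t in _) _)%E =
   (\int[leb]_(r in [set r | (0 <= r)%R]) (derive1 th r * I r + th r * J r)%:E)%E); last first.
  apply: eq_integral => r /set_mem /= r0.
  rewrite /I /J posE//.
  transitivity (\int[nu r]_x (derive1 th r * chi (x - c * r) + th r * (derive1 chi (x - c * r) * (v r x - c)))%:E)%E.
    apply: eq_integral => x _; rewrite dpt_moving// dpx_moving//; congr EFin; ring.
  have i1 := ucb_nu_integrable u1 r0; have i3 := ucb_nu_integrable u3 r0.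
  have j1 := RintegrableZ (derive1 th r) measurableT i1.
  have j3 := RintegrableZ (th r) measurableT i3.
  rewrite integralE_fin//; last exact: RintegrableD.
  by congr EFin; rewrite RintegralD// RintegralZl// RintegralZl.
have i : leb.-integrable [set r : R | 0 <= r] (EFin \o (fun r => derive1 th r * I r + th r * J r)).
  apply: (@test_integrable_half _ M).
    apply: cont_add; apply: cont_mul => //.
      exact: (smooth1_continuous (smooth1_derive1 sth)).
    exact: (smooth1_continuous sth).
  by move=> x Mx; rewrite HM// (derive1_compact_support HM Mx) !mul0r addr0.
rewrite integralE_fin//; last by rewrite -set_itvcy; exact: measurable_itv.
rewrite integralE_fin//; last first.
  apply: RintegrableZ => //.
  by have := ucb_nu_integrable u1 (lexx 0); apply: integrable_eq => // x _; rewrite mulr0 subr0.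
rewrite -EFinN => E; apply: (etrans (EFin_inj E)); congr (- _).
rewrite I0 -RintegralZl//.
  by apply: Rintegral_eq => x _; rewrite mulr0 subr0.
by have := ucb_nu_integrable u1 (lexx 0); apply: integrable_eq => // x _; rewrite mulr0 subr0.
Qed.

Lemma ucb_stp d p c : 0 < d -> ucb (fun t z => stp d p (z - c * t)).
Proof.
move=> d0; apply: (ucb_moving c (stp_lipschitz sB p d0) (M := 1)) => x.
by have /andP[h1 h2] := stp_bound sB p x d0; rewrite ger0_norm.
Qed.

Lemma ucb_stpd d p c : 0 < d -> ucb (fun t z => stpd d p (z - c * t)).
Proof.
move=> d0; have [L HL] := stpd_lipschitz sB d p.
apply: (ucb_moving c HL (M := d^-1 * B)) => x.
by have /andP[h1 h2] := stpd_bound sB p x d0; rewrite ger0_norm.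
Qed.

Lemma ucb_flux d p c : 0 < d -> ucb (fun t z => stpd d p (z - c * t) * (v t z - c)).
Proof.
move=> d0; apply: ucbM; first exact: ucb_stpd.
apply: ucbD => //; apply: (@ucb_const _ _ `|c|) => [|z]; last by rewrite normrN.
exact: cst_continuous.
Qed.

(** The rate at which energy crosses, from left to right, a smoothed point that moves at speed
    [c]. *)
Definition flux d p c r := \int[nu (pos r)]_(z in setT) (stpd d p (z - c * pos r) * (v (pos r) z - c)).

Lemma flux_continuous d p c : 0 < d -> continuous (flux d p c).
Proof. by move=> d0; apply: (ucb_weak_continuous nu_weak (ucb_flux p c d0)). Qed.

Lemma flux_integrable d p c t : 0 < d -> leb.-integrable `[0, t] (EFin \o flux d p c).
Proof. by move=> d0; have [_] := loc_int_cont (@flux_continuous d p c d0); exact. Qed.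

Lemma transport_stpB d p e q c t : 0 < d -> 0 < e -> 0 <= t ->
  (\int[nu t]_(z in setT) stp d p (z - c * t) - \int[nu t]_(z in setT) stp e q (z - c * t)) -
  (\int[nu 0]_(z in setT) stp d p z - \int[nu 0]_(z in setT) stp e q z) =
  \int[leb]_(r in `[0, t]) flux d p c r - \int[leb]_(r in `[0, t]) flux e q c r.
Proof.
move=> d0 e0 t0.
have i r d' p' : 0 < d' -> 0 <= r -> (nu r).-integrable setT (EFin \o (fun z => stp d' p' (z - c * r))).
  by move=> d'0 r0; exact: (ucb_nu_integrable (ucb_stp p' c d'0) r0).
have i0 d' p' : 0 < d' -> (nu 0).-integrable setT (EFin \o (fun z => stp d' p' z)).
  move=> d'0; have := i 0 d' p' d'0 (lexx 0).
  by apply: integrable_eq => // x _; rewrite mulr0 subr0.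
have [L1 HL1] := stpd_lipschitz sB d p; have [L2 HL2] := stpd_lipschitz sB e q.
rewrite -!RintegralB//; try exact: i; try exact: i0; first last.
- exact: flux_integrable.
- exact: flux_integrable.
rewrite (@transport_test (fun x => stp d p x - stp e q x) (d^-1 * B + e^-1 * B) (L1 + L2) 2 (d^-1 * B + e^-1 * B) c)//.
- apply: Rintegral_eq => r _; rewrite /flux.
  have j d' p' : 0 < d' -> (nu (pos r)).-integrable setT
      (EFin \o (fun z => stpd d' p' (z - c * pos r) * (v (pos r) z - c))).
    by move=> d'0; exact: (ucb_nu_integrable (ucb_flux p' c d'0) (pos_ge0 r)).
  rewrite -RintegralB//; [|exact: j|exact: j].
  by apply: Rintegral_eq => z _; rewrite (derive1_stpB sB)// mulrBl.
- exact: (test1_stp sB).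
- move=> x y; have h1 := stp_lipschitz sB p d0 x y; have h2 := stp_lipschitz sB q e0 x y.
  have := ler_normB (stp d p x - stp d p y) (stp e q x - stp e q y).
  have -> : stp d p x - stp d p y - (stp e q x - stp e q y) = stp d p x - stp e q x - (stp d p y - stp e q y) by ring.
  rewrite mulrDl; lra.
- move=> x; have := stp_bound sB p x d0; have := stp_bound sB q x e0.
  by move=> /andP[h1 h2] /andP[h3 h4]; rewrite ler_norml; lra.
- move=> x y; rewrite (derive1_stpB sB)//; have h1 := HL1 x y; have h2 := HL2 x y.
  have := ler_normB (stpd d p x - stpd d p y) (stpd e q x - stpd e q y).
  have -> : stpd d p x - stpd d p y - (stpd e q x - stpd e q y) = stpd d p x - stpd e q x - (stpd d p y - stpd e q y) by ring.
  rewrite mulrDl; lra.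
- move=> x; rewrite (derive1_stpB sB)//; have := stpd_bound sB p x d0; have := stpd_bound sB q x e0.
  by move=> /andP[h1 h2] /andP[h3 h4]; rewrite ler_norml; lra.
Qed.

Lemma flux_bound d p c r (K : R) : 0 < d -> 0 <= r -> (forall z, `|v r z| <= K) ->
  `|flux d p c r| <= d^-1 * B * (K + `|c|) * mass (nu r).
Proof.
move=> d0 r0 vK; rewrite /flux posE//.
rewrite -[X in _ <= _ * X]/(fine _) -[X in _ <= X](@Rintegral_cst _ _ _ (nu r) setT)//.
apply: Rintegral_abs_le => //.
- exact: (ucb_nu_integrable (ucb_flux p c d0) r0).
- exact: finite_measure_integrable_cst.
move=> z _; rewrite normrM ler_pM//.
  by have /andP[h1 h2] := stpd_bound sB p (z - c * r) d0; rewrite ger0_norm.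
by apply: (le_trans (ler_normB _ _)); rewrite lerD2r.
Qed.

Lemma mass_bounded t : exists2 M : R, 0 <= M & forall r, 0 <= r -> r <= t -> mass (nu r) <= M.
Proof.
have c : continuous (fun r => mass (nu (pos r))).
  have u1 : ucb (fun _ _ => (1 : R)).
    by apply: (@ucb_const _ _ 1) => [|z]; [exact: cst_continuous|rewrite normr1].
  have := ucb_weak_continuous nu_weak u1.
  by under eq_fun do rewrite -mass_Rint.
have [M M0 HM] := continuous_itv_bounded 0 t c.
exists M => // r r0 rt; have := HM r r0 rt; rewrite posE//.
by apply: le_trans; exact: ler_norm.
Qed.

(** A step of half-width [n.+1] has slope of order $1/n$, while velocity and mass stay bounded on
    $[0,t]$; the estimate does not depend on where the step is centred. *)
Lemma flux_integral_vanish (p : nat -> R) c t : 0 <= t ->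
  \int[leb]_(r in `[0, t]) flux n.+1%:R (p n) c r @[n --> \oo] --> (0 : R).
Proof.
move=> t0; have [_ /(_ t)[K HK] _] := uv.
have [M M0 HM] := mass_bounded t.
have B0 := step_ge0_bound sB.
pose A := B * (`|K| + `|c|) * M * t.
have A0 : 0 <= A by rewrite !mulr_ge0// addr_ge0.
have H n : `|\int[leb]_(r in `[0, t]) flux n.+1%:R (p n) c r| <= n.+1%:R^-1 * A.
  have -> : n.+1%:R^-1 * A = n.+1%:R^-1 * B * (`|K| + `|c|) * M * (t - 0) by rewrite /A; ring.
  rewrite -Rint_itv_cst//; apply: Rintegral_abs_le => //.
  - exact: flux_integrable.
  - exact: integrable_itv_cst.
  move=> r; rewrite /= in_itv/= => /andP[r0 rt].
  apply: (le_trans (flux_bound (p n) c _ r0 (K := `|K|) _)) => //.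
    by move=> z; apply: le_trans (HK r z r0 rt) (ler_norm _).
  by rewrite ler_wpM2l ?HM// !mulr_ge0// addr_ge0.
apply/cvgrPdist_le => e e0.
have hA : n.+1%:R^-1 * A @[n --> \oo] --> (0 : R).
  by rewrite -[X in _ --> X](mul0r A); apply: cvgMl; exact: cvg_harmonic.
have /cvgrPdist_le/(_ _ e0) := hA; apply: filterS => n; rewrite !sub0r !normrN => h.
by apply: (le_trans (H n)); apply: le_trans h; exact: ler_norm.
Qed.

(** Centred at $2(n+1)$ with half-width $n+1$, the step still vanishes to the left of $n+1$: it
    recedes to infinity while it flattens. *)
Lemma stp_far_cvg x : stp n.+1%:R (2 * n.+1%:R) x @[n --> \oo] --> (0 : R).
Proof.
apply: cvg_near_cst; exists (Num.truncn `|x|).+1 => // n /= xn.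
apply: (stp_left sB) => //; have := truncnS_gt `|x|; have := ler_norm x.
have : ((Num.truncn `|x|).+1%:R : R) <= n.+1%:R by rewrite ler_nat ltnW// ltnS.
lra.
Qed.

Lemma stp_farN_cvg x : stp n.+1%:R (- (2 * n.+1%:R)) x @[n --> \oo] --> (1 : R).
Proof.
apply: cvg_near_cst; exists (Num.truncn `|x|).+1 => // n /= xn.
apply: (stp_right sB) => //; have := truncnS_gt `|x|; have := ler_norm (- x); rewrite normrN.
have : ((Num.truncn `|x|).+1%:R : R) <= n.+1%:R by rewrite ler_nat ltnW// ltnS.
lra.
Qed.

Lemma stp_measure_cvg (m : {finite_measure set R -> \bar R}) (p : nat -> R) (l c : R) :
  (forall x, stp n.+1%:R (p n) x @[n --> \oo] --> l) ->
  \int[m]_(z in setT) stp n.+1%:R (p n) (z - c) @[n --> \oo] --> l * mass m.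
Proof.
move=> H; rewrite mass_Rint -RintegralZl//; last exact: finite_measure_integrable_cst.
have [] := @Rintegral_dominated _ _ _ m setT (fun n z => stp n.+1%:R (p n) (z - c)) (fun _ => l * 1) (cst 1).
- by [].
- move=> n; apply: continuous_measurable_fun => z.
  apply: (@continuous_comp _ _ _ (fun z => z - c)).
    by apply: continuousB; [exact: cvg_id|exact: cst_continuous].
  exact: (smooth1_continuous (@smooth1_stp _ _ _ sB _ _)).
- exact: finite_measure_integrable_cst.
- move=> n x _; have /andP[h1 h2] := stp_bound sB (p n) (x - c) (ltr0Sn R n).
  by rewrite ger0_norm.
- by move=> x _; rewrite mulr1; exact: H.
by [].
Qed.

Lemma stp_measure_cvg0 (m : {finite_measure set R -> \bar R}) (p : nat -> R) (l : R) :
  (forall x, stp n.+1%:R (p n) x @[n --> \oo] --> l) ->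
  \int[m]_(z in setT) stp n.+1%:R (p n) z @[n --> \oo] --> l * mass m.
Proof.
move=> H; have := @stp_measure_cvg m p l 0 H; apply: cvg_trans; apply: near_eq_cvg.
by apply: nearW => n; apply: Rintegral_eq => z _; rewrite subr0.
Qed.

(** The difference of two flattening steps that recede to $-\infty$ and to $+\infty$ tends to 1,
    while both fluxes vanish: no energy escapes to infinity. *)
Lemma mass_const t : 0 <= t -> mass (nu t) = mass (nu 0).
Proof.
move=> t0.
have E n := @transport_stpB n.+1%:R (- (2 * n.+1%:R)) n.+1%:R (2 * n.+1%:R) 0 t (ltr0Sn R n) (ltr0Sn R n) t0.
have L1 := cvg_seqB (flux_integral_vanish (fun n => - (2 * n.+1%:R)) 0 t0) (flux_integral_vanish (fun n => 2 * n.+1%:R) 0 t0).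
have a1 := @stp_measure_cvg (nu t) (fun n => - (2 * n.+1%:R)) 1 (0 * t) stp_farN_cvg.
have a2 := @stp_measure_cvg (nu t) (fun n => 2 * n.+1%:R) 0 (0 * t) stp_far_cvg.
have a3 := @stp_measure_cvg0 (nu 0) (fun n => - (2 * n.+1%:R)) 1 stp_farN_cvg.
have a4 := @stp_measure_cvg0 (nu 0) (fun n => 2 * n.+1%:R) 0 stp_far_cvg.
have := cvg_seq_eq (cvg_seqB (cvg_seqB a1 a2) (cvg_seqB a3 a4)) L1 E.
lra.
Qed.

(** A single step is not compactly supported, so it is completed by a second, flattening step that
    is sent to $+\infty$. *)
Lemma transport_stp d p c t : 0 < d -> 0 <= t ->
  \int[nu t]_(z in setT) stp d p (z - c * t) - \int[nu 0]_(z in setT) stp d p z =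
  \int[leb]_(r in `[0, t]) flux d p c r.
Proof.
move=> d0 t0.
have E n := @transport_stpB d p n.+1%:R (2 * n.+1%:R) c t d0 (ltr0Sn R n) t0.
have L1 := flux_integral_vanish (fun n => 2 * n.+1%:R) c t0.
have a2 := @stp_measure_cvg (nu t) (fun n => 2 * n.+1%:R) 0 (c * t) stp_far_cvg.
have a4 := @stp_measure_cvg0 (nu 0) (fun n => 2 * n.+1%:R) 0 stp_far_cvg.
have L3 := cvg_seqB (cvg_seqB a2 a4) L1.
suff : \int[nu t]_(z in setT) stp d p (z - c * t) - \int[nu 0]_(z in setT) stp d p z -
  \int[leb]_(r in `[0, t]) flux d p c r = 0 * mass (nu t) - 0 * mass (nu 0) - 0.
  by move/eqP; rewrite !mul0r !subr0 subr_eq0 => /eqP.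
apply: cvg_seq_eq L3 _; first exact: cvg_cst.
have aux (x y z w f g : R) : x - y - (z - w) = f - g -> x - z - f = y - w - g by lra.
by move=> n; exact: (aux _ _ _ _ _ _ (E n)).
Qed.

End Transport.

(** * Moving barriers and the speed of a quantile *)

Section QuantileSpeed.
Variables (R : realType) (s : R -> R) (B : R).
Hypothesis (sB : smooth_step s B).
Notation leb := (@lebesgue_measure R).
Notation stp := (stp s).
Notation stpd := (stpd s).
Implicit Types (d e p q c t r k : R).

Lemma stp_integrable (m : {finite_measure set R -> \bar R}) d p k : 0 < d ->
  m.-integrable setT (EFin \o (fun z => stp d p (z - k))).
Proof.
move=> d0; apply: (@finite_integrable _ _ _ 1).
  apply: continuous_measurable_fun; apply: (@lipschitz_continuous _ _ (d^-1 * B)) => x y.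
  apply: le_trans (stp_lipschitz sB p d0 _ _) _.
  by rewrite (_ : x - k - (y - k) = x - y)//; ring.
by move=> x; have /andP[h1 h2] := stp_bound sB p (x - k) d0; rewrite ger0_norm.
Qed.

Lemma Rint_stp_le (m : {finite_measure set R -> \bar R}) d p k y : 0 < d -> y <= p + k - d ->
  \int[m]_(z in setT) stp d p (z - k) <= mass m - Nl m y.
Proof.
move=> d0 yp; rewrite -rmeas_ge -Rint_indic//.
apply: (le_trans (ler_norm _)); apply: Rintegral_abs_le => //; first exact: stp_integrable.
  apply: (@finite_integrable _ _ _ 1); first by apply: measurable_indic; exact: measurable_ge.
  by move=> x; rewrite indicE; case: (_ \in _); rewrite ?normr0 ?normr1.
move=> z _; have /andP[h1 h2] := stp_bound sB p (z - k) d0; rewrite ger0_norm// indicE.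
have [yz|zy] := leP y z; first by rewrite mem_set.
by rewrite (stp_left sB)//; lra.
Qed.

Lemma Rint_stp_ge (m : {finite_measure set R -> \bar R}) d p k y : 0 < d -> p + k + d <= y ->
  mass m - Nl m y <= \int[m]_(z in setT) stp d p (z - k).
Proof.
move=> d0 yp; rewrite -rmeas_ge -Rint_indic//.
apply: (le_trans (ler_norm _)); apply: Rintegral_abs_le => //.
- apply: (@finite_integrable _ _ _ 1); first by apply: measurable_indic; exact: measurable_ge.
  by move=> x; rewrite indicE; case: (_ \in _); rewrite ?normr0 ?normr1.
- exact: stp_integrable.
move=> z _; have /andP[h1 h2] := stp_bound sB p (z - k) d0; rewrite indicE.
have [yz|zy] := leP y z; last by rewrite memNset ?normr0//= leNgt zy.
by rewrite mem_set// normr1 (stp_right sB)//; lra.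
Qed.

Variables (v : R -> R -> R) (nu : R -> {finite_measure set R -> \bar R}).
Hypothesis nu_weak : forall g : R -> R, continuous g -> (exists M, forall x, `|g x| <= M) ->
  {within [set t : R | 0 <= t], continuous (fun t => fine (\int[nu t]_(x in setT) (g x)%:E))}.
Hypothesis uv : ucb v.
Hypothesis transport : forall phi, test2 phi ->
  (\int[leb]_(t in [set t : R | (0 <= t)%R]) \int[nu t]_(x in setT)
        (dpt phi t x + v t x * dpx phi t x)%:E
      = - \int[nu 0%R]_(x in setT) (phi 0%R x)%:E)%E.

Lemma transport_flux d p c r t : 0 < d -> 0 <= r -> r <= t ->
  \int[nu t]_(z in setT) stp d p (z - c * t) - \int[nu r]_(z in setT) stp d p (z - c * r) =
  \int[leb]_(q in `[r, t]) flux s v nu d p c q.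
Proof.
move=> d0 r0 rt; have t0 := le_trans r0 rt.
have lf := loc_int_cont (@flux_continuous _ _ _ sB _ _ nu_weak uv d p c d0).
have := transport_stp sB nu_weak uv transport p c d0 t0.
have := transport_stp sB nu_weak uv transport p c d0 r0.
rewrite (Rint_cat lf r0 rt); lra.
Qed.

(** In the layer where the step varies the energy moves no faster than the barrier, so none crosses
    it to the right. *)
Lemma barrier_le d p c r t : 0 < d -> 0 <= r -> r <= t ->
  (forall q z, r <= q -> q <= t -> `|z - c * q - p| <= d -> v q z <= c) ->
  \int[nu t]_(z in setT) stp d p (z - c * t) <= \int[nu r]_(z in setT) stp d p (z - c * r).
Proof.
move=> d0 r0 rt H; rewrite -subr_le0 transport_flux// -oppr_ge0 -mulN1r -RintegralZl//; last first.
  exact: (loc_int_cont (@flux_continuous _ _ _ sB _ _ nu_weak uv d p c d0)).2.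
apply: Rintegral_ge0 => q; rewrite /= in_itv/= => /andP[rq qt].
rewrite mulN1r oppr_ge0 /flux posE; last exact: le_trans rq.
rewrite -oppr_ge0 -mulN1r -RintegralZl//; last first.
  exact: (ucb_nu_integrable nu (ucb_flux sB uv p c d0) (le_trans r0 rq)).
apply: Rintegral_ge0 => z _; rewrite mulN1r oppr_ge0.
have [h|h] := leP d `|z - c * q - p|; first by rewrite (stpd_out sB)// mul0r.
by rewrite mulr_ge0_le0 ?subr_le0 ?H ?(ltW h)//; case/andP: (stpd_bound sB p (z - c * q) d0).
Qed.

Lemma barrier_ge d p c r t : 0 < d -> 0 <= r -> r <= t ->
  (forall q z, r <= q -> q <= t -> `|z - c * q - p| <= d -> c <= v q z) ->
  \int[nu r]_(z in setT) stp d p (z - c * r) <= \int[nu t]_(z in setT) stp d p (z - c * t).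
Proof.
move=> d0 r0 rt H; rewrite -subr_ge0 transport_flux//.
apply: Rintegral_ge0 => q; rewrite /= in_itv/= => /andP[rq qt].
rewrite /flux posE; last exact: le_trans rq.
apply: Rintegral_ge0 => z _.
have [h|h] := leP d `|z - c * q - p|; first by rewrite (stpd_out sB)// mul0r.
by rewrite mulr_ge0 ?subr_ge0 ?H ?(ltW h)//; case/andP: (stpd_bound sB p (z - c * q) d0).
Qed.

Variables (T K C al : R).
Hypothesis C0 : 0 <= C.
Hypothesis al0 : 0 <= al.
Hypothesis vK : forall t z, 0 <= t -> t <= T -> `|v t z| <= K.
Hypothesis hold : forall t s x y, 0 <= t <= T -> 0 <= s <= T ->
  `|v t x - v s y| <= C * ((`|t - s| + `|x - y|) `^ al).

(* The barriers move with the constant speeds min (v + E) K and max (v - E) (- K),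
   which keeps them inside the region where v differs from v r (Y r) by at most E. *)
Lemma quantile_speed eta r t : 0 < eta -> eta < mass (nu 0) -> 0 <= r -> r <= t -> t <= T ->
  `|quantile (nu t) eta - quantile (nu r) eta - (t - r) * v r (quantile (nu r) eta)| <= (t - r) * (C * (((K + 2) * (t - r)) `^ al)).
Proof.
move=> e0 em r0 rt tT; pose Y t := quantile (nu t) eta; rewrite -/(Y t) -/(Y r); set h := t - r; set E := C * _.
have t0 : 0 <= t by exact: le_trans rt.
have rT : r <= T by exact: le_trans tT.
have mt : mass (nu t) = mass (nu 0) by exact: (mass_const sB nu_weak uv transport).
have mr : mass (nu r) = mass (nu 0) by exact: (mass_const sB nu_weak uv transport).
have emt : eta < mass (nu t) by rewrite mt.
have emr : eta < mass (nu r) by rewrite mr.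
have K0 : 0 <= K by apply: le_trans (vK 0 r0 rT).
move: rt; rewrite le_eqVlt => /predU1P[tr|rt].
  by rewrite /h /Y tr !subrr !mul0r subrr normr0.
have h0 : 0 < h by rewrite subr_gt0.
have E0 : 0 <= E by rewrite mulr_ge0// powR_ge0.
(* A point within [3 * d <= h] of a path of speed at most [K] that starts at [Y r] is, time and
   space together, within [(K + 2) * h] of the starting point; this is the origin of the constant in
   [E]. *)
have near_v q z c d : `|c| <= K -> 0 < d -> 3 * d <= h -> r <= q -> q <= t ->
    `|z - Y r - c * (q - r)| <= 3 * d -> `|v q z - v r (Y r)| <= E.
  move=> cK d0 dh rq qt zd.
  have qr : 0 <= q - r by rewrite subr_ge0.
  have q0 : 0 <= q by exact: le_trans rq.
  have qT : q <= T by exact: le_trans tT.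
  apply: (le_trans (hold _ _ _ _)); rewrite ?q0 ?r0//.
  apply: ler_wpM2l => //; apply: ge0_ler_powR; rewrite ?nnegrE ?addr_ge0 ?mulr_ge0 ?(ltW h0)//.
    lra.
  have h1 : `|q - r| <= h by rewrite ger0_norm// /h; lra.
  have h2 : `|c * (q - r)| <= K * h.
    by rewrite normrM ler_pM.
  have := ler_normD (z - Y r - c * (q - r)) (c * (q - r)); rewrite subrK.
  by rewrite mulrDl; lra.
have vr : `|v r (Y r)| <= K by exact: vK.
move: (vr); rewrite ler_norml => /andP[vr1 vr2].
have up : Y t <= Y r + h * (v r (Y r) + E).
  pose c := Num.min (v r (Y r) + E) K.
  have cK : `|c| <= K.
    by rewrite ler_norml /c ge_min lexx orbT andbT le_min; apply/andP; split; lra.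
  have cv : c <= v r (Y r) + E by rewrite /c ge_min lexx.
  suff : Y t <= Y r + h * c.
    by move=> H; apply: (le_trans H); rewrite lerD2l ler_wpM2l// ltW.
  apply/ler_addgt0Pr => e epos.
  pose d := Num.min h e / 3.
  have d0 : 0 < d by rewrite divr_gt0// lt_min h0.
  have d3 : 3 * d <= h by rewrite /d mulrC divfK// ge_min lexx.
  have d3e : 3 * d <= e by rewrite /d mulrC divfK// ge_min lexx orbT.
  (* At time [r] the layer of this step is $[Y(r)+d,\,Y(r)+3d]$. It lies strictly to the right of
     the quantile, so the energy beyond it is less than the total minus [eta]; at time [t] it has
     moved by $ch$. *)
  have b := @barrier_le d (Y r + 2 * d - c * r) c r t d0 r0 (ltW rt).
  have {}b : \int[nu t]_(z in setT) stp d (Y r + 2 * d - c * r) (z - c * t) <=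
      \int[nu r]_(z in setT) stp d (Y r + 2 * d - c * r) (z - c * r).
    apply: b => q z rq qt zd.
    have q0 : 0 <= q by exact: le_trans rq.
    have zY : `|z - Y r - c * (q - r)| <= 3 * d.
      have := ler_normD (z - c * q - (Y r + 2 * d - c * r)) (2 * d).
      rewrite (_ : z - c * q - (Y r + 2 * d - c * r) + 2 * d = z - Y r - c * (q - r)); last by ring.
      by rewrite (ger0_norm (x := 2 * d)); lra.
    have := near_v q z c d cK d0 d3 rq qt zY; rewrite ler_norml => /andP[_ h1].
    rewrite /c le_min; apply/andP; split; first lra.
    by apply: le_trans (ler_norm _) _; apply: vK => //; exact: le_trans tT.
  have b1 : \int[nu r]_(z in setT) stp d (Y r + 2 * d - c * r) (z - c * r) <= mass (nu r) - Nl (nu r) (Y r + d).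
    by apply: Rint_stp_le => //; lra.
  have b2 : mass (nu t) - Nl (nu t) (Y r + c * h + 3 * d) <= \int[nu t]_(z in setT) stp d (Y r + 2 * d - c * r) (z - c * t).
    by apply: Rint_stp_ge => //; rewrite /h; lra.
  have b3 : eta < Nl (nu r) (Y r + d) by apply: quantile_lt => //; rewrite /Y; lra.
  suff : Y t < Y r + c * h + 3 * d by lra.
  by rewrite ltNge quantileP// -ltNge; lra.
have low : Y r + h * (v r (Y r) - E) <= Y t.
  pose c := Num.max (v r (Y r) - E) (- K).
  have cK : `|c| <= K.
    rewrite ler_norml /c le_max lexx orbT/= ge_max; apply/andP; split; lra.
  have cv : v r (Y r) - E <= c by rewrite /c le_max lexx.
  suff : Y r + h * c <= Y t.
    by move=> H; apply: le_trans H; rewrite lerD2l ler_wpM2l// ltW.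
  apply/ler_addgt0Pr => e epos.
  pose d := Num.min h e / 3.
  have d0 : 0 < d by rewrite divr_gt0// lt_min h0.
  have d3 : 3 * d <= h by rewrite /d mulrC divfK// ge_min lexx.
  have d3e : 3 * d <= e by rewrite /d mulrC divfK// ge_min lexx orbT.
  (* Here the layer is $[Y(r)-2d,\,Y(r)]$ and may touch the quantile: the step is 1 from [Y r] on,
     and the energy strictly to the left of [Y r] is at most [eta]. *)
  have b : \int[nu r]_(z in setT) stp d (Y r - d - c * r) (z - c * r) <=
      \int[nu t]_(z in setT) stp d (Y r - d - c * r) (z - c * t).
    apply: barrier_ge => // [|q z rq qt zd]; first exact: ltW.
    have q0 : 0 <= q by exact: le_trans rq.
    have zY : `|z - Y r - c * (q - r)| <= 3 * d.
      have := ler_normD (z - c * q - (Y r - d - c * r)) (- d).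
      rewrite (_ : z - c * q - (Y r - d - c * r) + - d = z - Y r - c * (q - r)); last by ring.
      by rewrite normrN (ger0_norm (x := d)); lra.
    have := near_v q z c d cK d0 d3 rq qt zY; rewrite ler_norml => /andP[h1 _].
    rewrite /c ge_max; apply/andP; split; first lra.
    have : `|v q z| <= K by apply: vK => //; exact: le_trans tT.
    by rewrite ler_norml => /andP[].
  have b1 : mass (nu r) - Nl (nu r) (Y r) <= \int[nu r]_(z in setT) stp d (Y r - d - c * r) (z - c * r).
    by apply: Rint_stp_ge => //; lra.
  have b2 : \int[nu t]_(z in setT) stp d (Y r - d - c * r) (z - c * t) <= mass (nu t) - Nl (nu t) (Y r + c * h - 2 * d).
    by apply: Rint_stp_le => //; rewrite /h; lra.
  have b3 : Nl (nu r) (Y r) <= eta by apply: quantile_Nl.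
  suff : Y r + c * h - 2 * d <= Y t by lra.
  by rewrite quantileP//; lra.
by rewrite ler_norml; apply/andP; split; lra.
Qed.

End QuantileSpeed.

(** * The velocity along a quantile *)

Lemma Rfubini d1 d2 (X : measurableType d1) (Y : measurableType d2) (R : realType)
    (m1 : {sigma_finite_measure set X -> \bar R}) (m2 : {sigma_finite_measure set Y -> \bar R})
    (f : X -> Y -> R) : measurable_fun setT (fun p : X * Y => f p.1 p.2) ->
  (\int[m1]_x \int[m2]_y (`|f x y|)%:E < +oo)%E ->
  (\int[m1]_x \int[m2]_y (f x y)%:E = \int[m2]_y \int[m1]_x (f x y)%:E)%E.
Proof.
move=> mf fin; apply: (@Fubini _ _ _ _ _ m1 m2 (fun p => (f p.1 p.2)%:E)).
by apply/integrable12ltyP => //; exact/measurable_EFinP.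
Qed.

Section SignKernel.
Variable R : realType.
Notation leb := (@lebesgue_measure R).
Implicit Types (m : {finite_measure set R -> \bar R}) (x z p q : R) (f : R -> R).

(** The sign of $x-z$. Integrated in [z] it gives the source of the momentum equation; after Fubini,
    the source against a test function is the integral of the Lipschitz function [kern_int] against
    the measure, to which weak continuity applies. *)
Definition kern x z : R := if z < x then 1 else if x < z then -1 else 0.

Lemma kern_bound x z : `|kern x z| <= 1.
Proof. by rewrite /kern; do 2?case: ifP => _; rewrite ?normrN ?normr1 ?normr0. Qed.

Lemma measurable_kern d (X : measurableType d) (f g : X -> R) : measurable_fun setT f ->
  measurable_fun setT g -> measurable_fun setT (fun w => kern (f w) (g w)).
Proof.
move=> mf mg; apply: measurable_fun_ifT; [exact: measurable_fun_ltr|exact: measurable_cst|].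
by apply: measurable_fun_ifT; [exact: measurable_fun_ltr|exact: measurable_cst|exact: measurable_cst].
Qed.

Lemma Rint_kern m x : \int[m]_z kern x z = Nl m x - rmeas m [set z | x < z].
Proof.
have i A : measurable A -> m.-integrable setT (EFin \o (\1_A : R -> R)).
  move=> mA; apply: (@finite_integrable _ _ _ 1); first exact: measurable_indic.
  by move=> w; rewrite indicE; case: (_ \in _); rewrite ?normr0 ?normr1.
rewrite /Nl -(Rint_indic m (measurable_lt x)) -(Rint_indic m (measurable_gt x)) -RintegralB//; try exact: i.
apply: Rintegral_eq => z _; rewrite !indicE /kern.
have [zx|xz] := ltP z x; first by rewrite mem_set// memNset ?subr0//=; apply/negP; rewrite -leNgt ltW.
rewrite memNset; last by apply/negP; rewrite -leNgt.
by case: ifP => h; [rewrite mem_set ?sub0r|rewrite memNset ?subrr//= h].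
Qed.

Lemma fubini_kern m f : measurable_fun setT f -> leb.-integrable setT (EFin \o f) ->
  \int[leb]_x (f x * (Nl m x - rmeas m [set z | x < z])) = \int[m]_z \int[leb]_x (f x * kern x z).
Proof.
move=> mf fi.
have mk : measurable_fun setT (fun w : measurableTypeR R * R => kern w.1 w.2).
  by apply: measurable_kern; [exact: measurable_fst|exact: measurable_snd].
have mfk : measurable_fun setT (fun w : measurableTypeR R * R => f w.1 * kern w.1 w.2).
  apply: measurable_funM => //.
  by apply: (@measurableT_comp _ _ _ _ _ _ f); [exact: mf|exact: measurable_fst].
have ik x : m.-integrable setT (EFin \o kern x).
  by apply: (@finite_integrable _ _ _ 1) => [|z]; [apply: measurable_kern|exact: kern_bound].
have ikf z : leb.-integrable setT (EFin \o (fun x => f x * kern x z)).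
  apply: (@integrable_le _ _ _ leb setT _ (fun x => `|f x|)) => //.
  - apply: measurable_funM; first exact: mf.
    by apply: measurable_kern; [exact: measurable_id|exact: measurable_cst].
  - by move=> x _; rewrite normrM ler_piMr// kern_bound.
  - exact: integrable_norm.
have := @Rfubini _ _ _ _ R leb m (fun x z => f x * kern x z) mfk.
move=> HF; have /HF E : (\int[leb]_x \int[m]_z (`|f x * kern x z|)%:E < +oo)%E.
  apply: (@le_lt_trans _ _ (\int[leb]_x ((`|f x| * mass m)%:E))%E).
    apply: ge0_le_integral => //.
    - by move=> x _; exact: integral_ge0.
    - apply: (@measurable_fun_fubini_tonelli_F _ _ _ _ R m (fun w : measurableTypeR R * R => (`|f w.1 * kern w.1 w.2|)%:E)) => //.
      by apply/measurable_EFinP; exact: measurableT_comp.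
    - apply/measurable_EFinP; apply: measurable_funM => //.
      by apply: measurableT_comp => //; exact: mf.
    - move=> x _.
      have -> : (`|f x| * mass m)%:E = (\int[m]_z (`|f x|)%:E)%E.
        by rewrite integral_cst// EFinM /mass -rmeasE.
      apply: ge0_le_integral => //.
      + by apply/measurable_EFinP; apply: measurableT_comp => //; apply: measurable_funM => //; exact: measurable_kern.
      + by move=> z _; rewrite lee_fin normrM ler_piMr// kern_bound.
  rewrite (_ : (fun x => _) = (EFin \o (fun x => mass m * `|f x|))); last first.
    by apply/funext => x /=; rewrite mulrC.
  have : leb.-integrable setT (EFin \o (fun x => mass m * `|f x|)).
    by apply: RintegrableZ => //; exact: integrable_norm.
  move=> /integrableP[_]; apply: le_lt_trans.
  by under eq_integral => x _ do rewrite -[X in X%:E]ger0_norm ?mulr_ge0 ?mass_ge0//.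
rewrite /Rintegral; congr fine; apply: etrans (etrans E _).
  apply: eq_integral => x _; rewrite -Rint_kern -RintegralZl// integralE_fin//.
  exact: RintegrableZ.
by apply: eq_integral => z _; rewrite integralE_fin.
Qed.

Definition kern_int f z := \int[leb]_x (f x * kern x z).

Lemma kern_int_integrable f z : measurable_fun setT f -> leb.-integrable setT (EFin \o f) ->
  leb.-integrable setT (EFin \o (fun x => f x * kern x z)).
Proof.
move=> mf fi; apply: (@integrable_le _ _ _ leb setT _ (fun x => `|f x|)) => //.
- apply: measurable_funM; first exact: mf.
  by apply: measurable_kern; [exact: measurable_id|exact: measurable_cst].
- by move=> x _; rewrite normrM ler_piMr// kern_bound.
- exact: integrable_norm.
Qed.

Lemma kern_int_bound f z : measurable_fun setT f -> leb.-integrable setT (EFin \o f) ->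
  `|kern_int f z| <= \int[leb]_x `|f x|.
Proof.
move=> mf fi; apply: Rintegral_abs_le => //; first exact: kern_int_integrable.
  exact: integrable_norm.
by move=> x _; rewrite normrM ler_piMr// kern_bound.
Qed.

(** The kernels of [z] and [z'] differ only between these two points, and there by at most 2. *)
Lemma kern_int_lipschitz f : measurable_fun setT f -> leb.-integrable setT (EFin \o f) ->
  (forall x, `|f x| <= 1) -> forall z z', `|kern_int f z - kern_int f z'| <= 2 * `|z - z'|.
Proof.
move=> mf fi f1.
suff H z z' : z <= z' -> `|kern_int f z - kern_int f z'| <= 2 * (z' - z).
  move=> z z'; have [zz|zz] := leP z z'.
    by rewrite (ler0_norm (x := z - z')) ?subr_le0// opprB; exact: H.
  by rewrite distrC (gtr0_norm (x := z - z')) ?subr_gt0//; apply: H; exact: ltW.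
move=> zz; rewrite /kern_int -RintegralB//; try exact: kern_int_integrable.
rewrite (@Rintegral_support _ _ _ leb `[z, z']%classic)//; last first.
  move=> x; rewrite /= in_itv/= => /negP; rewrite negb_and -!ltNge => /orP[] h.
    by rewrite /kern h (lt_le_trans h zz) !ltNge (ltW h) (ltW (lt_le_trans h zz))/= subrr.
  by rewrite /kern h (le_lt_trans zz h) subrr.
rewrite -(Rint_itv_cst _ zz); apply: Rintegral_abs_le => //.
- apply: (@integrableS _ _ _ leb setT) => //.
  by apply: RintegrableB => //; exact: kern_int_integrable.
- exact: integrable_itv_cst.
move=> x _; have h := f1 x; have h1 := kern_bound x z; have h2 := kern_bound x z'.
rewrite -mulrBr normrM; have := ler_normB (kern x z) (kern x z').
move=> h3; rewrite -[X in _ <= X]mul1r ler_pM//; lra.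
Qed.

Lemma Rint_kern_right z p q : z <= p -> p <= q -> \int[leb]_(x in `[p, q]) kern x z = q - p.
Proof.
move=> zp pq.
have ik : leb.-integrable `[p, q] (EFin \o kern ^~ z).
  apply: (@integrable_le _ _ _ leb `[p, q] _ (cst 1)) => //; last exact: integrable_itv_cst.
    by apply: measurable_funTS; apply: measurable_kern; [exact: measurable_id|exact: measurable_cst].
  by move=> x _; exact: kern_bound.
rewrite (@Rintegral_negligible _ _ _ leb _ [set z])//; last exact: lebesgue_measure_set1.
rewrite -[RHS]mul1r -(Rint_itv_cst 1 pq) (@Rintegral_negligible _ _ _ leb `[p, q]%classic [set z])//.
- apply: Rintegral_eq => x [/=]; rewrite in_itv/= => /andP[px _] /eqP xz.
  by rewrite /kern lt_neqAle eq_sym xz (le_trans zp px).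
- exact: integrable_itv_cst.
- exact: lebesgue_measure_set1.
Qed.

Lemma Rint_kern_left z p q : q <= z -> p <= q -> \int[leb]_(x in `[p, q]) kern x z = - (q - p).
Proof.
move=> qz pq.
have ik : leb.-integrable `[p, q] (EFin \o kern ^~ z).
  apply: (@integrable_le _ _ _ leb `[p, q] _ (cst 1)) => //; last exact: integrable_itv_cst.
    by apply: measurable_funTS; apply: measurable_kern; [exact: measurable_id|exact: measurable_cst].
  by move=> x _; exact: kern_bound.
rewrite (@Rintegral_negligible _ _ _ leb _ [set z])//; last exact: lebesgue_measure_set1.
rewrite -mulN1r -(Rint_itv_cst (-1) pq) (@Rintegral_negligible _ _ _ leb `[p, q]%classic [set z] (cst (-1)))//.
- apply: Rintegral_eq => x [/=]; rewrite in_itv/= => /andP[_ xq] /eqP xz.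
  by rewrite /kern ltNge (le_trans xq qz)/= lt_neqAle xz (le_trans xq qz).
- exact: integrable_itv_cst.
- exact: lebesgue_measure_set1.
Qed.

Lemma loc_int_kern z : loc_int (kern ^~ z).
Proof.
have mk : measurable_fun setT (kern ^~ z) by apply: measurable_kern; [exact: measurable_id|exact: measurable_cst].
split => // a b; apply: (@integrable_le _ _ _ leb `[a, b] _ (cst 1)) => //; last exact: integrable_itv_cst.
  exact: measurable_funTS.
by move=> x _; exact: kern_bound.
Qed.

Lemma Rint_kern_itv z p q : p <= q -> \int[leb]_(x in `[p, q]) kern x z = `|q - z| - `|p - z|.
Proof.
move=> pq; have [zp|pz] := leP z p.
  rewrite Rint_kern_right// !ger0_norm ?subr_ge0//; [ring|exact: le_trans pq].
have [qz|zq] := leP q z.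
  rewrite Rint_kern_left// !ler0_norm ?subr_le0//; [ring|exact: ltW].
rewrite (Rint_cat (loc_int_kern z) (ltW pz) (ltW zq)) Rint_kern_left ?(ltW pz)// Rint_kern_right ?(ltW zq)//.
by rewrite (gtr0_norm (x := q - z)) ?subr_gt0// ltr0_norm ?subr_lt0//; ring.
Qed.

End SignKernel.

(** * Momentum balance of a fixed strip *)

Section Momentum.
Variables (R : realType) (s : R -> R) (B : R).
Hypothesis (sB : smooth_step s B).
Notation leb := (@lebesgue_measure R).
Notation stp := (stp s).
Notation stpd := (stpd s).
Implicit Types (d e p q c t r k : R).
Variables (v : R -> R -> R) (nu : R -> {finite_measure set R -> \bar R}).
Hypothesis nu_weak : forall g : R -> R, continuous g -> (exists M, forall x, `|g x| <= M) ->
  {within [set t : R | 0 <= t], continuous (fun t => fine (\int[nu t]_(x in setT) (g x)%:E))}.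
Hypothesis uv : ucb v.
Hypothesis momentum : forall phi, test2 phi ->
  (\int[leb]_(t in [set t : R | (0 <= t)%R]) \int[leb]_(x in setT)
        (v t x * dpt phi t x + 2^-1 * (v t x) ^+ 2 * dpx phi t x
         + 4^-1 * (fine (nu t [set y | (y < x)%R]) - fine (nu t [set y | (x < y)%R]))
           * phi t x)%:E
      = - \int[leb]_(x in setT) (v 0%R x * phi 0%R x)%:E)%E.

Lemma test1_bounded (chi : R -> R) : test1 chi -> exists M, forall x, `|chi x| <= M.
Proof.
move=> [sc [M HM]]; have [K K0 HK] := continuous_itv_bounded (- M) M (smooth1_continuous sc).
exists K => x; have [xM|/HM ->] := leP `|x| M; last by rewrite normr0.
by apply: HK; move: xM; rewrite ler_norml => /andP[].
Qed.

Lemma ucb_test (chi : R -> R) : test1 chi -> ucb (fun _ => chi).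
Proof.
move=> tc; have [M HM] := test1_bounded tc.
exact: ucb_const (smooth1_continuous tc.1) HM.
Qed.

Lemma test1_derive1 (chi : R -> R) : test1 chi -> test1 (derive1 chi).
Proof.
by move=> [sc [M HM]]; split; [exact: smooth1_derive1|exists M; exact: derive1_compact_support].
Qed.

Lemma ucb_supported_continuous (g : R -> R -> R) (chi : R -> R) : ucb g -> test1 chi ->
  continuous (fun r => \int[leb]_x (g (pos r) x * chi x)).
Proof.
move=> ug tc; have [_ [M HM]] := tc.
apply: (@ucb_lebesgue_continuous R (fun r x => g r x * chi x)).
  by apply: ucbM => //; exact: ucb_test.
by move=> T; exists M => t z _ _ /HM ->; rewrite mulr0.
Qed.

Lemma supported_integrable (f chi : R -> R) : continuous f -> test1 chi ->
  leb.-integrable setT (EFin \o (fun x => f x * chi x)).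
Proof.
move=> cf [sc [M HM]].
have l : loc_int (fun x => f x * chi x).
  by apply: loc_int_cont; apply: cont_mul => //; exact: smooth1_continuous.
by have [] := loc_int_compact_support l (fun x Mx => etrans (congr1 _ (HM x Mx)) (mulr0 _)).
Qed.

Lemma test1_integrable (chi : R -> R) : test1 chi -> leb.-integrable setT (EFin \o chi).
Proof.
move=> [sc [M HM]].
by have [] := loc_int_compact_support (loc_int_cont (smooth1_continuous sc)) HM.
Qed.

(** The rate of change of $\int v\chi\,dx$. The source has been moved onto [chi] by Fubini, which
    makes the rate continuous in time. *)
Definition momentum_rate (chi : R -> R) r := \int[leb]_x (2^-1 * v (pos r) x ^+ 2 * derive1 chi x)
  + 4^-1 * \int[nu (pos r)]_z kern_int chi z.

Lemma ucb_half_square : ucb (fun t x => 2^-1 * v t x ^+ 2).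
Proof. by apply: ucbZ; exact: ucbM. Qed.

Lemma momentum_rate_continuous chi : test1 chi -> (forall x, `|chi x| <= 1) ->
  continuous (momentum_rate chi).
Proof.
move=> tc c1; apply: cont_add.
  exact: (ucb_supported_continuous ucb_half_square (test1_derive1 tc)).
apply: cont_mul; first exact: cst_continuous.
have mc : measurable_fun setT chi by exact: (continuous_measurable_fun (smooth1_continuous tc.1)).
have ic := test1_integrable tc.
apply: (@ucb_weak_continuous R nu nu_weak (fun _ => kern_int chi)).
apply: ucb_const => [|z]; last exact: kern_int_bound.
exact: lipschitz_continuous (kern_int_lipschitz mc ic c1).
Qed.

Lemma momentum_test chi : test1 chi -> (forall x, `|chi x| <= 1) -> forall t, 0 <= t ->
  \int[leb]_x (v t x * chi x) - \int[leb]_x (v 0 x * chi x) =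
  \int[leb]_(r in `[0, t]) momentum_rate chi r.
Proof.
move=> tc c1 t t0; have [sc [N HN]] := tc.
pose I r := \int[leb]_x (v (pos r) x * chi x).
have cI : continuous I by exact: ucb_supported_continuous.
have cJ := momentum_rate_continuous tc c1.
have mc : measurable_fun setT chi by exact: (continuous_measurable_fun (smooth1_continuous sc)).
have ic := test1_integrable tc.
have [v1 _ _] := uv.
have IE r : 0 <= r -> I r = \int[leb]_x (v r x * chi x) by move=> r0; rewrite /I posE.
rewrite -!IE//; apply: (time_integral sB cI cJ) => // th tth; have [sth [M HM]] := tth.
have := momentum (test2_moving 0 tth tc).
rewrite (_ : (\int[leb]_(t in _) _)%E =
   (\int[leb]_(r in [set r | (0 <= r)%R]) (derive1 th r * I r + th r * momentum_rate chi r)%:E)%E); last first.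
  apply: eq_integral => r /set_mem /= r0.
  rewrite /momentum_rate IE// posE// -fubini_kern//.
  pose k x := fine (nu r [set y | (y < x)%R]) - fine (nu r [set y | (x < y)%R]).
  transitivity (\int[leb]_x (derive1 th r * (v r x * chi x) + th r * (2^-1 * v r x ^+ 2 * derive1 chi x + 4^-1 * (chi x * k x)))%:E)%E.
    apply: eq_integral => x _; rewrite dpt_moving// dpx_moving// mul0r subr0 -/(k x); congr EFin.
    by rewrite oppr0 mul0r mul0r addr0; ring.
  have i1 := supported_integrable (v1 r r0) tc.
  have i2 : leb.-integrable setT (EFin \o (fun x => 2^-1 * v r x ^+ 2 * derive1 chi x)).
    apply: supported_integrable (test1_derive1 tc).
    apply: cont_mul; first exact: cst_continuous.
    by apply: cont_mul; exact: v1.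
  have i3 : leb.-integrable setT (EFin \o (fun x => chi x * k x)).
    have mk : measurable_fun setT k.
      have -> : k = fun x => \int[nu r]_z kern x z by apply/funext => x; rewrite Rint_kern.
      rewrite (_ : (fun x => _) = fun x => Nl (nu r) x - (mass (nu r) - Nr (nu r) x)); last first.
        by apply/funext => x; rewrite Rint_kern rmeas_gt.
      apply: measurable_funB; first exact: measurable_Nl.
      by apply: measurable_funB; [exact: measurable_cst|exact: measurable_Nr].
    apply: (@integrable_le _ _ _ leb setT _ (fun x => 2 * mass (nu r) * `|chi x|)) => //.
    - by apply: measurable_funM; [exact: mc|exact: mk].
    - move=> x _; rewrite normrM mulrC ler_wpM2r//.
      have -> : k x = Nl (nu r) x - (mass (nu r) - Nr (nu r) x) by rewrite -rmeas_gt.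
      have := Nl_ge0 (nu r) x; have := Nl_le_mass (nu r) x.
      have := Nr_le_mass (nu r) x; have := Nl_le_Nr (nu r) x => h1 h2 h3 h4.
      by rewrite ler_norml; apply/andP; split; lra.
    - by apply: RintegrableZ => //; exact: integrable_norm.
  have j3 := RintegrableZ (4^-1) measurableT i3.
  have j23 := RintegrableD measurableT i2 j3.
  have j1 := RintegrableZ (derive1 th r) measurableT i1.
  have j4 := RintegrableZ (th r) measurableT j23.
  rewrite integralE_fin//; last exact: RintegrableD.
  by congr EFin; rewrite RintegralD// RintegralZl// RintegralZl// RintegralD// RintegralZl.
have i : leb.-integrable [set r : R | 0 <= r] (EFin \o (fun r => derive1 th r * I r + th r * momentum_rate chi r)).
  apply: (@test_integrable_half _ _ M).
    apply: cont_add; apply: cont_mul => //.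
      exact: (smooth1_continuous (smooth1_derive1 sth)).
    exact: (smooth1_continuous sth).
  by move=> x Mx; rewrite HM// (derive1_compact_support HM Mx) !mul0r addr0.
have ci := supported_integrable (v1 0 (lexx 0)) tc.
rewrite integralE_fin//; last by rewrite -set_itvcy; exact: measurable_itv.
rewrite (_ : (\int[leb]_x (v 0 x * _)%:E)%E = (\int[leb]_x (th 0 * (v 0 x * chi x))%:E)%E); last first.
  by apply: eq_integral => x _; rewrite mulr0 subr0; congr EFin; ring.
rewrite integralE_fin//; last exact: RintegrableZ.
by rewrite -EFinN => E; apply: (etrans (EFin_inj E)); rewrite RintegralZl// IE.
Qed.

Let hn (n : nat) : R := n.+1%:R^-1.
Let hn0 n : 0 < hn n. Proof. by rewrite invr_gt0. Qed.
Let hn1 n : hn n <= 1. Proof. by rewrite invf_le1 ?ler1n. Qed.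

Lemma stpd_average_bound (f : R -> R) (M : R) n p : continuous f -> (forall x, `|f x| <= M) ->
  `|\int[leb]_x (f x * stpd (hn n) p x)| <= M.
Proof.
move=> cf fM.
have out x : ~ `[p - hn n, p + hn n]%classic x -> f x * stpd (hn n) p x = 0.
  move=> H; rewrite (stpd_out sB) ?mulr0// leNgt; apply/negP => h; apply: H.
  rewrite /= in_itv/=; move: h; rewrite ltr_norml => /andP[h1 h2].
  by move: (hn n) h1 h2 => e h1 h2; apply/andP; split; lra.
have c1 : continuous (fun x => f x * stpd (hn n) p x).
  by apply: cont_mul => //; exact: (stpd_continuous sB).
rewrite (@Rintegral_support _ _ _ leb `[p - hn n, p + hn n]%classic)//.
rewrite -[X in _ <= X]mulr1 -(Rint_stpd sB (hn0 n) (lexx (p - hn n)) (lexx (p + hn n))) -RintegralZl//; last first.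
  exact: (loc_int_cont (@stpd_continuous _ _ _ sB _ _)).2.
apply: Rintegral_abs_le => //; first exact: (loc_int_cont c1).2.
  apply: RintegrableZ => //; exact: (loc_int_cont (@stpd_continuous _ _ _ sB _ _)).2.
move=> x _; have /andP[h1 h2] := stpd_bound sB p x (hn0 n).
by rewrite normrM (ger0_norm h1) ler_wpM2r.
Qed.

Lemma stpdB_average (f : R -> R) n p q : continuous f ->
  \int[leb]_x (f x * derive1 (fun x => stp (hn n) p x - stp (hn n) q x) x) =
  \int[leb]_x (f x * stpd (hn n) p x) - \int[leb]_x (f x * stpd (hn n) q x).
Proof.
move=> cf.
have i a : leb.-integrable setT (EFin \o (fun x => f x * stpd (hn n) a x)).
  have l : loc_int (fun x => f x * stpd (hn n) a x).
    by apply: loc_int_cont; apply: cont_mul => //; exact: (stpd_continuous sB).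
  have [x hx|//] := @loc_int_compact_support _ _ (`|a| + hn n) l.
  rewrite (stpd_out sB) ?mulr0// ltW// (lt_le_trans _ (lerB_dist x a))//.
  by rewrite ltrBrDl.
rewrite -RintegralB//.
by apply: Rintegral_eq => x _; rewrite (derive1_stpB sB) mulrBr.
Qed.

(** The limit of [momentum_rate] as the test function tends to the indicator of $[p,q]$: the fluxes
    through the two ends and the source, where $|q-z|-|p-z|=\int_p^q\mathrm{sign}(x-z)\,dx$. *)
Definition strip_rate p q r := 2^-1 * v (pos r) p ^+ 2 - 2^-1 * v (pos r) q ^+ 2
  + 4^-1 * \int[nu (pos r)]_z (`|q - z| - `|p - z|).

Lemma kern_int_stpB_cvg p q z : p <= q ->
  kern_int (fun x => stp (hn n) p x - stp (hn n) q x) z @[n --> \oo] --> `|q - z| - `|p - z|.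
Proof.
move=> pq; rewrite -Rint_kern_itv//.
have := stpB_cvg sB (loc_int_kern z) pq; apply: cvg_trans; apply: near_eq_cvg.
by apply: nearW => n; apply: Rintegral_eq => x _; rewrite mulrC.
Qed.

Lemma stpB_norm_integral n p q : p <= q -> \int[leb]_x `|stp (hn n) p x - stp (hn n) q x| <= q - p + 2.
Proof.
move=> pq; rewrite (@Rintegral_support _ _ _ leb `[p - 1, q + 1]%classic)//; last first.
  by move=> x H; rewrite (stpB_out sB n pq H) normr0.
have -> : q - p + 2 = 1 * ((q + 1) - (p - 1)) by ring.
rewrite -Rint_itv_cst; last by lra.
apply: (le_trans (ler_norm _)); apply: Rintegral_abs_le => //; last 2 first.
- exact: integrable_itv_cst.
- move=> x _; rewrite normr_id.
  have /andP[h1 h2] := stp_bound sB p x (hn0 n); have /andP[h3 h4] := stp_bound sB q x (hn0 n).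
  by rewrite ler_norml; lra.
by have [_] := loc_int_norm (loc_int_cont (@stpB_continuous _ _ _ sB n p q)); exact.
Qed.

(** The test functions are differences of sharpening steps. Continuity of [v] identifies the fluxes
    at the ends, and the convergence is dominated in time: each mollified flux is at most $K^2/2$
    and the integral of [kern_int] at most $(q-p+2)M$. *)
Lemma momentum_strip p q t : p <= q -> 0 <= t ->
  \int[leb]_(x in `[p, q]) v t x - \int[leb]_(x in `[p, q]) v 0 x =
  \int[leb]_(r in `[0, t]) strip_rate p q r.
Proof.
move=> pq t0; have [v1 v2 _] := uv.
have half (x : R) : 2^-1 * x + 2^-1 * x <= x by lra.
pose chi n x := stp (hn n) p x - stp (hn n) q x.
have tc n : test1 (chi n) by exact: (test1_stp sB).
have c1 n x : `|chi n x| <= 1.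
  have /andP[h1 h2] := stp_bound sB p x (hn0 n); have /andP[h3 h4] := stp_bound sB q x (hn0 n).
  by rewrite /chi ler_norml; lra.
have E n := momentum_test (tc n) (c1 n) t0.
have L1 r : 0 <= r -> \int[leb]_x (v r x * chi n x) @[n --> \oo] --> \int[leb]_(x in `[p, q]) v r x.
  by move=> r0; exact: (stpB_cvg sB (loc_int_cont (v1 r r0)) pq).
have [K HK] := v2 t; have [M M0 HM] := mass_bounded nu_weak t.
apply: (cvg_seq_eq (cvg_seqB (L1 t t0) (L1 0 (lexx 0))) _ E).
apply: (proj2 (@Rintegral_dominated _ _ _ leb `[0, t]%classic (fun n => momentum_rate (chi n))
  (strip_rate p q) (cst (`|K| * `|K| + (q - p + 2) * M)) _ _ _ _ _)) => //.
- by move=> n; apply: measurable_funTS; apply: continuous_measurable_fun; exact: momentum_rate_continuous.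
- exact: integrable_itv_cst.
- move=> n r; rewrite /= in_itv/= => /andP[r0 rt]; rewrite /momentum_rate posE//.
  apply: (le_trans (ler_normD _ _)); apply: lerD.
    have cg : continuous (fun x => 2^-1 * v r x ^+ 2).
      apply: cont_mul; first exact: cst_continuous.
      by apply: cont_mul; exact: v1.
    have gb x : `|2^-1 * v r x ^+ 2| <= 2^-1 * (`|K| * `|K|).
      rewrite normrM ger0_norm ?invr_ge0// ler_wpM2l ?invr_ge0// expr2 normrM.
      by rewrite ler_pM//; apply: le_trans (HK r x r0 rt) (ler_norm _).
    have h1 := stpd_average_bound n p cg gb; have h2 := stpd_average_bound n q cg gb.
    rewrite stpdB_average//.
    exact: le_trans (ler_normB _ _) (le_trans (lerD h1 h2) (half _)).
  have mc : measurable_fun setT (chi n) by exact: (continuous_measurable_fun (smooth1_continuous (tc n).1)).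
  have ic := test1_integrable (tc n).
  have kb z : `|kern_int (chi n) z| <= q - p + 2.
    by apply: le_trans (kern_int_bound z mc ic) _; exact: stpB_norm_integral.
  rewrite normrM ger0_norm ?invr_ge0//.
  have h : `|\int[nu r]_z kern_int (chi n) z| <= (q - p + 2) * M.
    apply: (@le_trans _ _ ((q - p + 2) * mass (nu r))); last by rewrite ler_wpM2l ?HM//; lra.
    rewrite -[X in _ <= X](@Rintegral_cst _ _ _ (nu r) setT)//.
    apply: Rintegral_abs_le => //; last exact: finite_measure_integrable_cst.
    apply: (@finite_integrable _ _ _ (q - p + 2)) => //; apply: continuous_measurable_fun.
    exact: lipschitz_continuous (kern_int_lipschitz mc ic (c1 n)).
  by have := normr_ge0 (\int[nu r]_z kern_int (chi n) z); lra.
move=> r; rewrite /= in_itv/= => /andP[r0 rt]; rewrite /momentum_rate /strip_rate posE//.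
have cg : continuous (fun x => 2^-1 * v r x ^+ 2).
  apply: cont_mul; first exact: cst_continuous.
  by apply: cont_mul; exact: v1.
apply: cvgD.
  have Lg a : lebesgue_pt (fun x => 2^-1 * v r x ^+ 2) a.
    by apply: (@continuous_lebesgue_pt R _ a setT _ _ (loc_int_cont cg).1 (cg a)) => //; split=> //; exact: openT.
  have := cvg_seqB (stpd_approx_identity sB (loc_int_cont cg) (Lg p)) (stpd_approx_identity sB (loc_int_cont cg) (Lg q)).
  apply: cvg_trans; apply: near_eq_cvg; apply: nearW => n /=.
  by rewrite stpdB_average.
apply: cvgMr.
apply: (proj2 (@Rintegral_dominated _ _ _ (nu r) setT (fun n => kern_int (chi n))
  (fun z => `|q - z| - `|p - z|) (cst (q - p + 2)) _ _ _ _ _)) => //.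
- move=> n; have mc : measurable_fun setT (chi n) by exact: (continuous_measurable_fun (smooth1_continuous (tc n).1)).
  apply: continuous_measurable_fun.
  exact: lipschitz_continuous (kern_int_lipschitz mc (test1_integrable (tc n)) (c1 n)).
- exact: finite_measure_integrable_cst.
- move=> n z _; have mc : measurable_fun setT (chi n) by exact: (continuous_measurable_fun (smooth1_continuous (tc n).1)).
  by apply: le_trans (kern_int_bound z mc (test1_integrable (tc n))) _; exact: stpB_norm_integral.
- by move=> z _; exact: kern_int_stpB_cvg.
Qed.

End Momentum.

Lemma cont_sub (R : realType) (f g : R -> R) : continuous f -> continuous g -> continuous (fun x => f x - g x).
Proof. by move=> cf cg x; apply: continuousB; [exact: cf|exact: cg]. Qed.

Lemma powR_small (R : realType) (A al e : R) : 0 < al -> 0 < e ->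
  exists2 d : R, 0 < d & forall h, 0 <= h -> h < d -> A * (h `^ al) <= e.
Proof.
move=> al0 e0.
have A0 : 0 < `|A| + 1 by have := normr_ge0 A; lra.
exists ((e / (`|A| + 1)) `^ al^-1); first by rewrite powR_gt0// divr_gt0.
move=> h h0 hd.
have : h `^ al <= e / (`|A| + 1).
  have -> : e / (`|A| + 1) = ((e / (`|A| + 1)) `^ al^-1) `^ al.
    by rewrite -powRrM mulVf ?gt_eqF// powRr1// divr_ge0// ltW.
  by apply: ge0_ler_powR; rewrite ?nnegrE ?powR_ge0// ltW.
rewrite ler_pdivlMr// mulrC; apply: le_trans; rewrite ler_wpM2r ?powR_ge0//.
by have := ler_norm A; lra.
Qed.

Lemma prim_linear_approx (R : realType) (f g : R -> R) (x y k e : R) : prim f g ->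
  (forall w, `|w - y| <= `|y - x| -> `|g w - k| <= e) ->
  `|f y - f x - (y - x) * k| <= `|y - x| * e.
Proof.
move=> pf.
suff H a b : a <= b -> (forall w, a <= w -> w <= b -> `|g w - k| <= e) ->
    `|f b - f a - (b - a) * k| <= (b - a) * e.
  move=> Hw; have [xy|yx] := leP x y.
    rewrite (ger0_norm (x := y - x)) ?subr_ge0//; apply: H => // w xw wy; apply: Hw.
    by rewrite (ger0_norm (x := y - x)) ?subr_ge0// ler0_norm ?subr_le0//; lra.
  rewrite (ltr0_norm (x := y - x)) ?subr_lt0// -normrN.
  have := H y x (ltW yx); rewrite (_ : f x - f y - (x - y) * k = - (f y - f x - (y - x) * k)); last by ring.
  move=> H1; rewrite (_ : - (y - x) * e = (x - y) * e); last by ring.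
  apply: H1 => w yw wx; apply: Hw.
  by rewrite (ltr0_norm (x := y - x)) ?subr_lt0// ger0_norm ?subr_ge0//; lra.
move=> ab Hw; have [lg fE] := pf; have ik := @integrable_itv_cst R a b k.
rewrite fE// [(b - a) * k]mulrC -(Rint_itv_cst _ ab) -RintegralB//; last exact: lg.2.
rewrite [(b - a) * e]mulrC -(Rint_itv_cst _ ab); apply: Rintegral_abs_le => //.
- by apply: RintegrableB => //; exact: lg.2.
- exact: integrable_itv_cst.
- by move=> w; rewrite /= in_itv/= => /andP[]; exact: Hw.
Qed.

Lemma ler_norm4 (R : realType) (x y z u X Y Z U : R) : `|x| <= X -> `|y| <= Y -> `|z| <= Z ->
  `|u| <= U -> `|x + y - z + u| <= X + Y + Z + U.
Proof. by rewrite !ler_norml => /andP[? ?] /andP[? ?] /andP[? ?] /andP[? ?]; apply/andP; split; lra. Qed.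

(** * Variation of the velocity and energy of a strip *)

Section EnergyStrip.
Variables (R : realType) (s : R -> R) (B : R).
Hypothesis (sB : smooth_step s B).
Notation leb := (@lebesgue_measure R).

(** Cauchy--Schwarz for the density [g], the energy of $g^2dx$ being at most the full energy. Since
    $g^2dx$ does not charge the end points, the open strip suffices, and atoms at its ends do not
    enter. *)
Lemma ac_part_strip (u : R -> R) (m : {finite_measure set R -> \bar R}) p q : continuous u ->
  ac_part_ux2 u m -> p <= q -> (u q - u p) ^+ 2 <= (q - p) * rmeas m `]p, q[%classic.
Proof.
move=> cu [g [N [w [mN [N0 H]]]]] pq.
have pu := weak_deriv_prim sB cu w.
have mg2 : measurable_fun setT (fun x => g x ^+ 2).
  by apply: measurable_funX; exact: pu.1.1.
have ig : leb.-integrable `[p, q] (EFin \o (fun x => g x ^+ 2)).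
  apply/integrableP; split; first by apply/measurable_EFinP; exact: measurable_funTS.
  have -> : (\int[leb]_(x in `[p, q]) `|(EFin \o (fun x => (g x ^+ 2)%R)) x| = m (`[p, q] `\` N))%E.
    rewrite H; last exact: measurable_itv.
    by apply: eq_integral => x _ /=; rewrite ger0_norm// sqr_ge0.
  by rewrite -ge0_fin_numE// fin_num_measure//; apply: measurableD => //; exact: measurable_itv.
apply: (le_trans (prim_cauchy_schwarz pu pq ig)).
rewrite ler_wpM2l ?subr_ge0// /Rintegral integral_itv_bndoo; last first.
  by apply/measurable_EFinP; exact: measurable_funTS.
rewrite /rmeas -H; last exact: measurable_itv.
by apply: le_rmeas; [apply: measurableD => //; exact: measurable_itv|exact: measurable_itv|exact: subDsetl].
Qed.

Lemma rmeas_vanish (m : {finite_measure set R -> \bar R}) (F : nat -> set R) :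
  (forall n, measurable (F n)) -> (forall n, F n.+1 `<=` F n) -> (forall z, exists n, ~ F n z) ->
  rmeas m (F n) @[n --> \oo] --> (0 : R).
Proof.
move=> mF dF H; have := @rmeas_cvg_nonincreasing R m F mF dF.
have -> : \bigcap_n F n = set0.
  by apply/seteqP; split => z //= Fz; have [n] := H z; apply; exact: Fz.
by rewrite {2}/rmeas measure0.
Qed.

Lemma harmonic_lt (e : R) : 0 < e -> exists n, (n.+1%:R^-1 : R) < e.
Proof.
move=> e0; exists (Num.truncn e^-1).
by rewrite -[X in _ < X]invrK ltf_pV2 ?posrE ?invr_gt0// truncnS_gt.
Qed.

Lemma rmeas_right_strip (m : {finite_measure set R -> \bar R}) (x : R) :
  rmeas m `]x, (x + n.+1%:R^-1)[%classic @[n --> \oo] --> (0 : R).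
Proof.
apply: rmeas_vanish => [n|n z /=|z]; first exact: measurable_itv.
  rewrite !in_itv/= => /andP[-> h]/=; apply: (lt_le_trans h).
  by rewrite lerD2l lef_pV2 ?posrE// ler_nat.
have [xz|zx] := ltP x z; last by exists 0%N; rewrite /= in_itv/= ltNge zx.
have [|n hn] := @harmonic_lt (z - x); first by rewrite subr_gt0.
by exists n; move: hn; move: (n.+1%:R^-1) => e he /=; rewrite in_itv/= => /andP[_] h; lra.
Qed.

Lemma rmeas_left_strip (m : {finite_measure set R -> \bar R}) (x : R) :
  rmeas m `](x - n.+1%:R^-1), x[%classic @[n --> \oo] --> (0 : R).
Proof.
apply: rmeas_vanish => [n|n z /=|z]; first exact: measurable_itv.
  rewrite !in_itv/= => /andP[h ->]; rewrite andbT; apply: le_lt_trans h.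
  by rewrite lerD2l lerN2 lef_pV2 ?posrE// ler_nat.
have [zx|xz] := ltP z x; last by exists 0%N; rewrite /= in_itv/= => /andP[_]; rewrite ltNge xz.
have [|n hn] := @harmonic_lt (x - z); first by rewrite subr_gt0.
by exists n; move: hn; move: (n.+1%:R^-1) => e he /=; rewrite in_itv/= => /andP[h _]; lra.
Qed.

End EnergyStrip.

(** * The primitive of the velocity along a quantile curve *)

Section QuantileCurve.
Variables (R : realType) (s : R -> R) (B : R).
Hypothesis (sB : smooth_step s B).
Notation leb := (@lebesgue_measure R).
Implicit Types (d e p q c t r k x y z T L : R).
Variables (v : R -> R -> R) (nu : R -> {finite_measure set R -> \bar R}).
Hypothesis nu_weak : forall g : R -> R, continuous g -> (exists M, forall x, `|g x| <= M) ->
  {within [set t : R | 0 <= t], continuous (fun t => fine (\int[nu t]_(x in setT) (g x)%:E))}.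
Hypothesis uv : ucb v.
Hypothesis hold : forall T, 0 < T -> exists alpha C, 0 < alpha /\ alpha <= 1 /\ 0 <= C /\
  forall t s x y, 0 <= t <= T -> 0 <= s <= T ->
    `|v t x - v s y| <= C * ((`|t - s| + `|x - y|) `^ alpha).
Hypothesis transport : forall phi, test2 phi ->
  (\int[leb]_(t in [set t : R | (0 <= t)%R]) \int[nu t]_(x in setT)
        (dpt phi t x + v t x * dpx phi t x)%:E
      = - \int[nu 0%R]_(x in setT) (phi 0%R x)%:E)%E.
Hypothesis momentum : forall phi, test2 phi ->
  (\int[leb]_(t in [set t : R | (0 <= t)%R]) \int[leb]_(x in setT)
        (v t x * dpt phi t x + 2^-1 * (v t x) ^+ 2 * dpx phi t x
         + 4^-1 * (fine (nu t [set y | (y < x)%R]) - fine (nu t [set y | (x < y)%R]))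
           * phi t x)%:E
      = - \int[leb]_(x in setT) (v 0%R x * phi 0%R x)%:E)%E.
Hypothesis ac : forall t, 0 <= t -> ac_part_ux2 (v t) (nu t).

Lemma oscillation T L e : 0 < T -> 0 <= L -> 0 < e -> exists2 d, 0 < d & forall a b r r' x y,
  0 <= a -> b <= T -> b - a < d -> a <= r <= b -> a <= r' <= b -> `|x - y| <= L * (b - a) ->
  `|v r x - v r' y| <= e.
Proof.
move=> T0 L0 e0; have [al [C [al0 [_ [C0 H]]]]] := hold T0.
have [d d0 Hd] := powR_small C al0 e0.
have L1 : 0 < 1 + L by lra.
exists (d / (1 + L)) => [|a b r r' x y a0 bT]; first exact: divr_gt0.
rewrite ltr_pdivlMr// mulrC => bad /andP[h1 h2] /andP[h3 h4] xy.
have ab : 0 <= b - a by lra.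
apply: (le_trans (H r r' x y _ _)); try by apply/andP; split; lra.
apply: le_trans (Hd _ _ bad); last by rewrite mulr_ge0// ltW.
apply: ler_wpM2l => //; apply: ge0_ler_powR; rewrite ?nnegrE ?addr_ge0 ?mulr_ge0 ?(ltW al0) ?(ltW L1)//.
rewrite mulrDl mul1r; apply: lerD => //.
by rewrite ler_norml; apply/andP; split; lra.
Qed.

Variable eta : R.
Hypotheses (eta0 : 0 < eta) (etaM : eta < mass (nu 0)).
Let Y t := quantile (nu t) eta.

Lemma quantile_speed_eps T e : 0 < T -> 0 < e -> exists2 d, 0 < d & forall a b,
  0 <= a -> a <= b -> b <= T -> b - a < d -> `|Y b - Y a - (b - a) * v a (Y a)| <= (b - a) * e.
Proof.
move=> T0 e0; have [al [C [al0 [_ [C0 H]]]]] := hold T0.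
have [_ v2 _] := uv; have [K HK] := v2 T.
have K0 : 0 <= K by apply: le_trans (HK 0 0 (lexx 0) (ltW T0)).
have K2 : 0 < K + 2 by lra.
have [d d0 Hd] := powR_small C al0 e0.
exists (d / (K + 2)) => [|a b a0 ab bT]; first exact: divr_gt0.
rewrite ltr_pdivlMr// mulrC => bad.
have Q := quantile_speed sB nu_weak uv transport C0 (ltW al0) (fun t z => HK t z) H eta0 etaM a0 ab bT.
apply: (le_trans Q); apply: ler_wpM2l; first by rewrite subr_ge0.
by apply: Hd => //; rewrite mulr_ge0 ?subr_ge0// ltW.
Qed.

Lemma quantile_lipschitz T : 0 < T -> exists2 L, 0 <= L & forall a b,
  0 <= a -> a <= b -> b <= T -> `|Y b - Y a| <= L * (b - a).
Proof.
move=> T0; have [al [C [al0 [_ [C0 H]]]]] := hold T0.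
have [_ v2 _] := uv; have [K HK] := v2 T.
have K0 : 0 <= K by apply: le_trans (HK 0 0 (lexx 0) (ltW T0)).
pose E := C * ((K + 2) * T) `^ al.
have E0 : 0 <= E by rewrite mulr_ge0// powR_ge0.
exists (K + E) => [|a b a0 ab bT]; first by rewrite addr_ge0.
have ba : 0 <= b - a by rewrite subr_ge0.
have Q := quantile_speed sB nu_weak uv transport C0 (ltW al0) (fun t z => HK t z) H eta0 etaM a0 ab bT.
have := ler_normD (Y b - Y a - (b - a) * v a (Y a)) ((b - a) * v a (Y a)); rewrite subrK.
rewrite normrM (ger0_norm ba) => h; apply: (le_trans h).
rewrite addrC (_ : (K + E) * (b - a) = (b - a) * K + (b - a) * E); last by ring.
apply: lerD; first by apply: ler_wpM2l => //; apply: HK => //; exact: le_trans bT.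
apply: (le_trans Q); apply: ler_wpM2l => //; apply: ler_wpM2l => //.
apply: ge0_ler_powR; rewrite ?nnegrE ?mulr_ge0 ?(ltW al0) ?(ltW T0)//; try by lra.
by apply: ler_wpM2l; lra.
Qed.

Lemma quantile_continuous : continuous (fun r => Y (pos r)).
Proof.
move=> t; have T0 : 0 < pos t + 1 by have := pos_ge0 t; lra.
have [L L0 HL] := quantile_lipschitz T0.
apply/cvgrPdist_lt => e e0.
have d0 : 0 < Num.min 1 (e / (L + 1)) by rewrite lt_min ltr01 divr_gt0//; lra.
apply/nbhs_ballP; exists (Num.min 1 (e / (L + 1))) => //= r; rewrite /ball/= => tr.
have := le_lt_trans (pos_dist t r) tr; rewrite lt_min => /andP[h1].
have r0 := pos_ge0 r; have t0 := pos_ge0 t.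
rewrite ltr_pdivlMr; last by lra.
move=> h2; apply: le_lt_trans h2.
apply: (@le_trans _ _ (L * `|pos t - pos r|)); last by rewrite mulrC ler_wpM2l//; lra.
have [tr1|rt1] := leP (pos t) (pos r).
  rewrite distrC (ler0_norm (x := pos t - pos r)) ?subr_le0// opprB; apply: HL => //.
  by move: h1; rewrite ltr_norml => /andP[]; lra.
rewrite (gtr0_norm (x := pos t - pos r)) ?subr_gt0//; apply: HL => //; first exact: ltW.
lra.
Qed.

Lemma trace_continuous (x : R -> R) : continuous x -> continuous (fun r => v (pos r) (x r)).
Proof.
move=> cx t; have [v1 _ v3] := uv; have t0 := pos_ge0 t.
apply/cvgrPdist_lt => e e0.
have e2 : 0 < e / 2 by rewrite divr_gt0.
have [d d0 Hd] := v3 _ _ t0 e2.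
have cvx : {for t, continuous (fun r => v (pos t) (x r))}.
  by apply: (@continuous_comp _ _ _ x (v (pos t))); [exact: cx|exact: v1].
have /cvgrPdist_lt/(_ _ e2)/nbhs_ballP[d1 /= d10 Hd1] := cvx.
apply/nbhs_ballP; exists (Num.min d d1) => [|r]; first by rewrite /= lt_min d0.
rewrite /ball/= lt_min => /andP[h1 h2].
have h3 := Hd1 r h2; rewrite /= in h3.
have h4 := Hd (pos r) (x r) (pos_ge0 r).
have {}h4 : `|v (pos r) (x r) - v (pos t) (x r)| <= e / 2.
  by apply: h4; apply: (le_lt_trans (pos_dist r t)); rewrite distrC.
have := ler_normB (v (pos t) (x t) - v (pos t) (x r)) (v (pos r) (x r) - v (pos t) (x r)).
rewrite (_ : _ - _ - _ = v (pos t) (x t) - v (pos r) (x r)); [lra|ring].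
Qed.

Lemma ucb_dist (x : R -> R) : continuous x -> ucb (fun t z => `|x t - z| - `|z|).
Proof.
move=> cx; have lip (a b c : R) : `| `|a - c| - `|b - c| | <= `|a - b|.
  by apply: (le_trans (ler_dist_dist _ _)); rewrite (_ : a - c - (b - c) = a - b)//; ring.
split.
- move=> t t0; apply: cont_sub; last exact: norm_continuous.
  move=> z; apply: (@continuous_comp _ _ _ (fun z => x t - z) (fun z : R => `|z|)); last exact: norm_continuous.
  by apply: cont_sub => [|w]; [exact: cst_continuous|exact: cvg_id].
- move=> T; have [M M0 HM] := continuous_itv_bounded 0 T cx.
  exists M => t z t0 tT; apply: le_trans (HM t t0 tT).
  by have := lip (x t) 0 z; rewrite sub0r normrN subr0.
- move=> t e t0 e0; have /cvgrPdist_lt/(_ _ e0)/nbhs_ballP[d /= d0 Hd] := cx t.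
  exists d => // r z r0 rt.
  rewrite (_ : _ - _ - _ = `|x r - z| - `|x t - z|); last by ring.
  apply: (le_trans (lip _ _ _)); apply: ltW; rewrite distrC; apply: Hd.
  by rewrite /ball/= distrC.
Qed.

(* formal time derivative of the primitive of v r that vanishes at 0 *)
Definition prim_rate x r := 2^-1 * v (pos r) 0 ^+ 2 - 2^-1 * v (pos r) x ^+ 2
  + 4^-1 * \int[nu (pos r)]_z (`|x - z| - `|z|).

Lemma prim_rate_curve_continuous (x : R -> R) : continuous x -> continuous (fun r => prim_rate (x (pos r)) r).
Proof.
move=> cx.
have cxp : continuous (fun r => x (pos r)).
  move=> r; apply/cvgrPdist_lt => e e0.
  have /cvgrPdist_lt/(_ _ e0)/nbhs_ballP[d /= d0 Hd] := cx (pos r).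
  apply/nbhs_ballP; exists d => // r'; rewrite /ball/= => h; apply: Hd.
  by apply: le_lt_trans h; exact: pos_dist.
apply: cont_add; last first.
  apply: cont_mul; first exact: cst_continuous.
  exact: (@ucb_weak_continuous R nu nu_weak _ (ucb_dist cx)).
have c0 : continuous (fun r => v (pos r) 0) by apply: trace_continuous; exact: cst_continuous.
have c1 := trace_continuous cxp.
apply: cont_sub; apply: cont_mul; try exact: cst_continuous.
  by apply: cont_mul; exact: c0.
by apply: cont_mul; exact: c1.
Qed.

Lemma prim_rateB a b r : 0 <= r -> prim_rate b r - prim_rate a r = strip_rate v nu a b r.
Proof.
move=> r0; rewrite /prim_rate /strip_rate posE//.
have i c : (nu r).-integrable setT (EFin \o (fun z => `|c - z| - `|z|)).
  exact: (ucb_nu_integrable nu (@ucb_dist (fun _ => c) (@cst_continuous _ _ c)) r0).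
have -> : \int[nu r]_z (`|b - z| - `|a - z|) = \int[nu r]_z (`|b - z| - `|z|) - \int[nu r]_z (`|a - z| - `|z|).
  by rewrite -RintegralB//; apply: Rintegral_eq => z _; ring.
by ring.
Qed.

(** Both sides vanish at $x=0$, where $\int(|0-z|-|z|)=0$; their increments in [x] are the strip
    balance. *)
Lemma prim_momentum x t : 0 <= t ->
  Prim (v t) x - Prim (v 0) x = \int[leb]_(r in `[0, t]) prim_rate x r.
Proof.
move=> t0; have [v1 _ _] := uv.
have P r : 0 <= r -> prim (Prim (v r)) (v r) by move=> r0; apply: prim_Prim; exact: (loc_int_cont (v1 r r0)).
have P0 f : loc_int f -> Prim f 0 = 0.
  by move=> lf; rewrite /Prim lexx set_itv1 Rintegral_set1.
have Z r : 0 <= r -> Prim (v r) 0 = 0 by move=> r0; apply: P0; exact: (loc_int_cont (v1 r r0)).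
have ci y : leb.-integrable `[0, t] (EFin \o prim_rate y).
  have [_] := loc_int_cont (@prim_rate_curve_continuous (fun _ => y) (@cst_continuous _ _ y)); exact.
have E a b : a <= b -> (Prim (v t) b - Prim (v 0) b) - (Prim (v t) a - Prim (v 0) a) =
    \int[leb]_(r in `[0, t]) prim_rate b r - \int[leb]_(r in `[0, t]) prim_rate a r.
  move=> ab; rewrite -RintegralB//.
  have := momentum_strip sB nu_weak uv momentum ab t0.
  rewrite -(P t t0).2// -(P 0 (lexx 0)).2// => H.
  rewrite (_ : _ - _ = Prim (v t) b - Prim (v t) a - (Prim (v 0) b - Prim (v 0) a)); last by ring.
  rewrite H; apply: Rintegral_eq => r; rewrite /= in_itv/= => /andP[r0 _].
  by rewrite -prim_rateB.
have R0 : \int[leb]_(r in `[0, t]) prim_rate 0 r = 0.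
  transitivity (\int[leb]_(r in `[0, t]) (0 : R)); last by rewrite Rint_itv_cst ?mul0r.
  apply: Rintegral_eq => r _; rewrite /prim_rate subrr add0r.
  have -> : \int[nu (pos r)]_z (`|0 - z| - `|z|) = \int[nu (pos r)]_z (0 : R); last by rewrite Rintegral_cst// mul0r mulr0.
  by apply: Rintegral_eq => z _; rewrite sub0r normrN subrr.
have [x0|x0] := leP 0 x.
  by have := E 0 x x0; rewrite R0 !Z// !subr0.
by have := E x 0 (ltW x0); rewrite R0 !Z// subrr !sub0r => /oppr_inj.
Qed.

(** A chain rule along the shifted curve $Y+x_0$, for which only the short-time speed estimate is
    available. On a short interval the increment splits into a move in space, with the displacement
    of $Y$ replaced by its speed, and a change in time at a frozen point; each error is small
    relative to the length of the interval, and telescoping removes them. *)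
Lemma prim_curve x0 t : 0 <= t ->
  Prim (v t) (Y t + x0) - Prim (v 0) (Y 0 + x0) =
  \int[leb]_(r in `[0, t]) (v (pos r) (Y (pos r)) * v (pos r) (Y (pos r) + x0) + prim_rate (Y (pos r) + x0) r).
Proof.
move=> t0; have T0 : 0 < t + 1 by lra.
have [v1 v2 _] := uv; have [K HK] := v2 (t + 1).
have K0 : 0 <= K by apply: le_trans (HK 0 0 (lexx 0) (ltW T0)).
have [L L0 HL] := quantile_lipschitz T0.
have [M M0 HM] := mass_bounded nu_weak (t + 1).
pose Z r := Y r + x0.
pose rho r := v (pos r) (Y (pos r)) * v (pos r) (Y (pos r) + x0) + prim_rate (Y (pos r) + x0) r.
have pp r : pos (pos r) = pos r by apply: posE; exact: pos_ge0.
have cY := quantile_continuous.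
have cZ : continuous (fun r => Y (pos r) + x0).
  by apply: cont_add cY _; exact: cst_continuous.
have crho : continuous rho.
  apply: cont_add.
    by apply: cont_mul; [exact: trace_continuous cY|exact: trace_continuous cZ].
  have := prim_rate_curve_continuous cZ.
  by under eq_fun do rewrite pp.
have lrho := loc_int_cont crho.
pose I r := \int[leb]_(q in `[0, r]) rho q.
suff : Prim (v 0) (Z 0) - I 0 = Prim (v t) (Z t) - I t.
  rewrite {1}/I set_itv1 Rintegral_set1 subr0 => h.
  rewrite -/(I t) -/(Z t) -/(Z 0); lra.
apply: (@telescope_eq _ (fun r => Prim (v r) (Z r) - I r) id) => // e e0.
pose A := L + K + 2 * K + K + 1.
have A0 : 0 < A by rewrite /A; lra.
have eA : 0 < e / A by rewrite divr_gt0.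
have [d1 d10 H1] := oscillation T0 L0 eA.
have [d2 d20 H2] := quantile_speed_eps T0 eA.
have d30 : 0 < e / A / (4^-1 * (L * M) + 1).
  by rewrite divr_gt0// ltr_wpDl// !mulr_ge0.
exists (Num.min (Num.min d1 d2) (e / A / (4^-1 * (L * M) + 1))); first by rewrite !lt_min d10 d20 d30.
move=> a b a0 ab bt; rewrite !lt_min => /andP[/andP[h1 h2] h3].
have b0 : 0 <= b by exact: le_trans ab.
have bT : b <= t + 1 by lra.
have aT : a <= t + 1 by lra.
have ba : 0 <= b - a by rewrite subr_ge0.
have Pb : prim (Prim (v b)) (v b) by apply: prim_Prim; exact: (loc_int_cont (v1 b b0)).
have mom : Prim (v b) (Z a) - Prim (v a) (Z a) = \int[leb]_(r in `[a, b]) prim_rate (Z a) r.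
  have ci : loc_int (prim_rate (Z a)).
    exact: (loc_int_cont (@prim_rate_curve_continuous (fun _ => Z a) (@cst_continuous _ _ _))).
  have := prim_momentum (Z a) b0; have := prim_momentum (Z a) a0.
  by rewrite (Rint_cat ci a0 ab); lra.
have Iab : I b - I a = \int[leb]_(r in `[a, b]) rho r by rewrite /I (Rint_cat lrho a0 ab); ring.
have osc r r' x y : a <= r <= b -> a <= r' <= b -> `|x - y| <= L * (b - a) -> `|v r x - v r' y| <= e / A.
  by move=> ra rb xy; apply: (H1 a b).
have Yl r r' : a <= r -> r <= r' -> r' <= b -> `|Y r' - Y r| <= L * (b - a).
  move=> ar rr rb; apply: (le_trans (HL r r' _ rr _)); [exact: le_trans ar|exact: le_trans rb bT|].
  by apply: ler_wpM2l => //; exact: lerB.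
have aab : a <= a <= b by rewrite lexx ab.
have bab : a <= b <= b by rewrite lexx ab.
have P1 : `|Prim (v b) (Z b) - Prim (v b) (Z a) - (Z b - Z a) * v b (Z b)| <= (b - a) * (L * (e / A)).
  have W := Yl a b (lexx a) ab (lexx b).
  have Zab : Z b - Z a = Y b - Y a by rewrite /Z; ring.
  apply: (le_trans (prim_linear_approx (k := v b (Z b)) (e := e / A) Pb _)).
    by move=> w; rewrite Zab => h; apply: osc => //; exact: le_trans W.
  rewrite Zab (_ : (b - a) * (L * (e / A)) = L * (b - a) * (e / A)); last by ring.
  by apply: ler_wpM2r => //; exact: ltW.
have P2 : `|(Z b - Z a) * v b (Z b) - (b - a) * (v a (Y a) * v b (Z b))| <= (b - a) * (K * (e / A)).
  rewrite (_ : _ - _ = (Y b - Y a - (b - a) * v a (Y a)) * v b (Z b)); last by rewrite /Z; ring.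
  rewrite normrM (mulrC K) mulrA; apply: ler_pM => //; first exact: H2.
  exact: HK.
have P3 : `|(b - a) * (v a (Y a) * v b (Z b)) + \int[leb]_(r in `[a, b]) prim_rate (Z a) r
    - \int[leb]_(r in `[a, b]) rho r| <= (b - a) * ((2 * K + K + 1) * (e / A)).
  rewrite [(b - a) * _]mulrC -(Rint_itv_cst _ ab).
  have i1 : leb.-integrable `[a, b] (EFin \o prim_rate (Z a)).
    have [_] := loc_int_cont (@prim_rate_curve_continuous (fun _ => Z a) (@cst_continuous _ _ (Z a))); exact.
  have i2 : leb.-integrable `[a, b] (EFin \o rho) by exact: lrho.2.
  have i0 k : leb.-integrable `[a, b] (EFin \o cst k) by exact: integrable_itv_cst.
  have i3 : leb.-integrable `[a, b] (EFin \o (fun r => v a (Y a) * v b (Z b) + prim_rate (Z a) r)).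
    by apply: RintegrableD => //; exact: i0.
  rewrite -RintegralD//; last exact: i0.
  rewrite -(RintegralB _ i3 i2)// [(b - a) * _]mulrC -(Rint_itv_cst _ ab).
  apply: Rintegral_abs_le; [exact: measurable_itv|exact: (RintegrableB _ i3 i2)|exact: i0|].
  move=> r; rewrite /= in_itv/= => /andP[ar rb].
  have r0 : 0 <= r by exact: le_trans ar.
  have rT : r <= t + 1 by exact: le_trans rb bT.
  have rab : a <= r <= b by rewrite ar.
  rewrite /rho /prim_rate posE//.
  have ZL : `|Z a - Z r| <= L * (b - a).
    by rewrite (_ : Z a - Z r = - (Y r - Y a)) ?normrN; [exact: Yl|rewrite /Z; ring].
  have o1 : `|v a (Y a) - v r (Y r)| <= e / A.
    by apply: osc => //; rewrite -normrN opprB; exact: Yl.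
  have o2 : `|v b (Z b) - v r (Z r)| <= e / A.
    apply: osc => //; rewrite (_ : Z b - Z r = Y b - Y r); last by rewrite /Z; ring.
    exact: Yl.
  have o3 : `|v r (Z a) - v r (Z r)| <= e / A by exact: osc.
  have kk : `|\int[nu r]_z (`|Z a - z| - `|z|) - \int[nu r]_z (`|Z r - z| - `|z|)| <= L * (b - a) * M.
    have i c : (nu r).-integrable setT (EFin \o (fun z => `|c - z| - `|z|)).
      exact: (ucb_nu_integrable nu (@ucb_dist (fun _ => c) (@cst_continuous _ _ c)) r0).
    rewrite -RintegralB//; apply: (@le_trans _ _ (L * (b - a) * mass (nu r))); last first.
      by apply: ler_wpM2l; [rewrite mulr_ge0|exact: HM].
    rewrite -[X in _ <= X](@Rintegral_cst _ _ _ (nu r) setT)//.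
    apply: Rintegral_abs_le => //; [exact: RintegrableB|exact: finite_measure_integrable_cst|].
    move=> z _; rewrite (_ : _ - _ = `|Z a - z| - `|Z r - z|); last by ring.
    apply: le_trans ZL; apply: (le_trans (ler_dist_dist _ _)).
    by rewrite (_ : Z a - z - (Z r - z) = Z a - Z r)//; ring.
  have kk2 : 4^-1 * (L * (b - a) * M) <= e / A.
    have : (b - a) * (4^-1 * (L * M) + 1) < e / A by rewrite -ltr_pdivlMr// ltr_wpDl// !mulr_ge0.
    rewrite mulrDr mulr1 (_ : (b - a) * _ = 4^-1 * (L * (b - a) * M)); last by ring.
    by move/ltW; apply: le_trans; rewrite lerDl.
  have bb x : `|v r x| <= K by exact: HK.
  have q1 : `|(v a (Y a) - v r (Y r)) * v b (Z b)| <= e / A * K.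
    by rewrite normrM; apply: ler_pM => //; exact: HK.
  have q2 : `|v r (Y r) * (v b (Z b) - v r (Z r))| <= K * (e / A).
    by rewrite normrM; apply: ler_pM.
  have q3 : `|2^-1 * ((v r (Z a) - v r (Z r)) * (v r (Z a) + v r (Z r)))| <= 2^-1 * (e / A * (K + K)).
    rewrite normrM (ger0_norm (x := 2^-1)) ?invr_ge0// ler_wpM2l ?invr_ge0// normrM; apply: ler_pM => //.
    by apply: (le_trans (ler_normD _ _)); apply: lerD.
  rewrite -/(Z r).
  move: kk q1 q2 q3 kk2; set i1' := \int[_]_z _; set i2' := \int[_]_z _.
  set w := e / A; move=> kk q1 q2 q3 kk2.
  rewrite (_ : _ - _ = (v a (Y a) - v r (Y r)) * v b (Z b) + v r (Y r) * (v b (Z b) - v r (Z r))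
     - 2^-1 * ((v r (Z a) - v r (Z r)) * (v r (Z a) + v r (Z r))) + 4^-1 * (i1' - i2')); last by ring.
  have q4 : `|4^-1 * (i1' - i2')| <= 4^-1 * (L * (b - a) * M).
    by rewrite normrM (ger0_norm (x := 4^-1)) ?invr_ge0// ler_wpM2l ?invr_ge0.
  apply: (le_trans (ler_norm4 q1 q2 q3 q4)).
  have -> : (2 * K + K + 1) * w = w * K + K * w + 2^-1 * (w * (K + K)) + w by field.
  by rewrite lerD2l.
move: P1 P2 P3; rewrite -mom -Iab.
move: (Prim (v b) (Z b)) (Prim (v b) (Z a)) (Prim (v a) (Z a)) (I b) (I a) ((Z b - Z a) * _) ((b - a) * (_ * _)).
move=> x1 x2 x3 x4 x5 x6 x7 P1 P2 P3.
have -> : x1 - x4 - (x3 - x5) = x1 - x2 - x6 + (x6 - x7) + (x7 + (x2 - x3) - (x4 - x5)) by ring.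
apply: (le_trans (ler_normD _ _)); apply: (le_trans (lerD (ler_normD _ _) P3)).
apply: (le_trans (lerD (lerD P1 P2) (lexx _))).
rewrite -!mulrDr -!mulrDl (_ : L + K + (2 * K + K + 1) = A); last by rewrite /A; ring.
by rewrite [A * _]mulrC divfK ?gt_eqF// mulrC.
Qed.

End QuantileCurve.

(** * Law of motion of a quantile *)

Section QuantileMotion.
Variables (R : realType) (s : R -> R) (B : R).
Hypothesis (sB : smooth_step s B).
Notation leb := (@lebesgue_measure R).
Implicit Types (d e p q c t r k x y z T L : R).
Variables (v : R -> R -> R) (nu : R -> {finite_measure set R -> \bar R}).
Hypothesis nu_weak : forall g : R -> R, continuous g -> (exists M, forall x, `|g x| <= M) ->
  {within [set t : R | 0 <= t], continuous (fun t => fine (\int[nu t]_(x in setT) (g x)%:E))}.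
Hypothesis uv : ucb v.
Hypothesis hold : forall T, 0 < T -> exists alpha C, 0 < alpha /\ alpha <= 1 /\ 0 <= C /\
  forall t s x y, 0 <= t <= T -> 0 <= s <= T ->
    `|v t x - v s y| <= C * ((`|t - s| + `|x - y|) `^ alpha).
Hypothesis transport : forall phi, test2 phi ->
  (\int[leb]_(t in [set t : R | (0 <= t)%R]) \int[nu t]_(x in setT)
        (dpt phi t x + v t x * dpx phi t x)%:E
      = - \int[nu 0%R]_(x in setT) (phi 0%R x)%:E)%E.
Hypothesis momentum : forall phi, test2 phi ->
  (\int[leb]_(t in [set t : R | (0 <= t)%R]) \int[leb]_(x in setT)
        (v t x * dpt phi t x + 2^-1 * (v t x) ^+ 2 * dpx phi t x
         + 4^-1 * (fine (nu t [set y | (y < x)%R]) - fine (nu t [set y | (x < y)%R]))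
           * phi t x)%:E
      = - \int[leb]_(x in setT) (v 0%R x * phi 0%R x)%:E)%E.
Hypothesis ac : forall t, 0 <= t -> ac_part_ux2 (v t) (nu t).

Variable eta : R.
Hypotheses (eta0 : 0 < eta) (etaM : eta < mass (nu 0)).
Let Y t := quantile (nu t) eta.

Lemma prim_quotient_cvg (f g : R -> R) x (sg : R) : prim f g -> continuous g -> `|sg| = 1 ->
  n.+1%:R * (f (x + sg * n.+1%:R^-1) - f x) @[n --> \oo] --> sg * g x.
Proof.
move=> pf cg sg1; apply/cvgrPdist_le => e e0.
have /cvgrPdist_le/(_ _ e0)/nbhs_ballP[d /= d0 Hd] := cg x.
have /cvgrPdist_lt/(_ (d / 2) (divr_gt0 d0 (ltr0Sn R 1))) := @cvg_harmonic R.
apply: filterS => n; rewrite sub0r normrN /harmonic/=; set h := n.+1%:R^-1.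
have h0 : 0 < h by rewrite invr_gt0.
rewrite gtr0_norm// => hd; pose y := x + sg * h.
have yx : `|y - x| = h by rewrite /y addrC addKr normrM sg1 mul1r gtr0_norm.
have := @prim_linear_approx _ f g x y (g x) e pf.
rewrite yx => H.
have {}H : `|f y - f x - (y - x) * g x| <= h * e.
  apply: H => w wy; rewrite distrC; apply: Hd; rewrite /ball/= distrC.
  have := ler_normD (w - y) (y - x); rewrite yx (_ : w - y + (y - x) = w - x); last by ring.
  by lra.
have hE : n.+1%:R * h = 1 by rewrite mulfV.
rewrite distrC (_ : _ - _ = n.+1%:R * (f y - f x - (y - x) * g x)); last first.
  rewrite -/y [RHS]mulrBr mulrA (_ : n.+1%:R * (y - x) = sg)//.
  have -> : n.+1%:R * (y - x) = sg * (n.+1%:R * h) by rewrite /y; ring.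
  by rewrite hE mulr1.
rewrite normrM ger0_norm// -(ler_pM2l h0) mulrA [h * _]mulrC hE mul1r.
exact: H.
Qed.

Lemma Rint_step (m : {finite_measure set R -> \bar R}) (A : set R) k : measurable A ->
  m.-integrable setT (EFin \o (fun z => k * (2 * \1_A z - 1))) /\
  \int[m]_z (k * (2 * \1_A z - 1)) = k * (2 * rmeas m A - mass m).
Proof.
move=> mA.
have i1 : m.-integrable setT (EFin \o (\1_A : R -> R)).
  apply: (@finite_integrable _ _ _ 1); first by apply: measurable_indic.
  by move=> x; rewrite indicE; case: (_ \in _); rewrite ?normr0 ?normr1.
have i2 : m.-integrable setT (EFin \o (fun z => 2 * \1_A z - 1)).
  apply: (@RintegrableB _ _ _ m setT (fun z => 2 * \1_A z) (cst 1)) => //.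
    exact: RintegrableZ.
  exact: finite_measure_integrable_cst.
split; first exact: RintegrableZ.
rewrite RintegralZl// RintegralB//; last 2 first.
- exact: RintegrableZ.
- exact: finite_measure_integrable_cst.
by rewrite RintegralZl// Rint_indic// Rintegral_cst// mul1r.
Qed.

Lemma dist_integrable (m : {finite_measure set R -> \bar R}) a b :
  m.-integrable setT (EFin \o (fun z => `|a - z| - `|b - z|)).
Proof.
apply: (@finite_integrable _ _ _ `|a - b|).
  apply: measurable_funB; apply: measurableT_comp => //; apply: measurable_funB => //.
move=> z; apply: (le_trans (ler_dist_dist _ _)).
by rewrite (_ : a - z - (b - z) = a - b)//; ring.
Qed.

(** A subgradient inequality for the convex function $y\mapsto\int|y-z|\,dm(z)$ at the quantile. Its
    one-sided derivatives there are $2$[Nl]$-$[mass] and $2$[Nr]$-$[mass], and [eta] lies between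
    [Nl] and [Nr]. *)
Lemma dist_shift_lower (m : {finite_measure set R -> \bar R}) y h (sg : R) : 0 < eta -> eta < mass m ->
  y = quantile m eta -> 0 < h -> sg = 1 \/ sg = -1 ->
  h * (sg * (2 * eta - mass m)) <= \int[m]_z (`|y + sg * h - z| - `|y - z|).
Proof.
move=> e0 em yq h0 [->|->].
  have [i E] := @Rint_step m [set z | z <= y] h (measurable_le y).
  apply: (@le_trans _ _ (\int[m]_z (h * (2 * \1_[set z | z <= y] z - 1)))).
    rewrite E ler_pM2l// mul1r; have := quantile_Nr e0 em.
    by rewrite -yq /Nr; lra.
  apply: le_Rintegral => //; first exact: dist_integrable.
  move=> z _; rewrite mul1r indicE; have [zy|yz] := leP z y.
    rewrite mem_set//= !ger0_norm; lra.
  rewrite memNset/=; last by apply/negP; rewrite -ltNge.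
  rewrite (ltr0_norm (x := y - z)); last by lra.
  by have := ler_norm (- (y + h - z)); rewrite normrN; lra.
have [i E] := @Rint_step m [set z | z < y] (- h) (measurable_lt y).
apply: (@le_trans _ _ (\int[m]_z (- h * (2 * \1_[set z | z < y] z - 1)))).
  rewrite E; have := quantile_Nl e0 em; rewrite -yq -/(Nl m y) => H.
  rewrite (_ : - h * _ = h * (mass m - 2 * Nl m y)); last by ring.
  by rewrite ler_pM2l//; lra.
apply: le_Rintegral => //; first exact: dist_integrable.
move=> z _; rewrite mulN1r indicE; have [zy|yz] := ltP z y.
  rewrite mem_set//= (gtr0_norm (x := y - z)); last by lra.
  by have := ler_norm (y - h - z); lra.
rewrite memNset/=; last by apply/negP; rewrite -leNgt.
rewrite (ler0_norm (x := y - z)); last by lra.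
by have := ler_norm (- (y - h - z)); rewrite normrN; lra.
Qed.

(** The strips are open at [y], so they shrink to the empty set and their energy tends to 0; the
    total mass is the dominating constant for the later integral in time. *)
Lemma strip_energy r y (sg : R) : 0 <= r -> sg = 1 \/ sg = -1 ->
  (forall n, n.+1%:R * (v r (y + sg * n.+1%:R^-1) - v r y) ^+ 2 <= mass (nu r)) /\
  n.+1%:R * (v r (y + sg * n.+1%:R^-1) - v r y) ^+ 2 @[n --> \oo] --> (0 : R).
Proof.
move=> r0 sg1; have [v1 _ _] := uv; have cv := v1 r r0.
suff [F [F1 F2 F3]] : exists F : nat -> set R, [/\ forall n, measurable (F n),
    rmeas (nu r) (F n) @[n --> \oo] --> (0 : R) &
    forall n, n.+1%:R * (v r (y + sg * n.+1%:R^-1) - v r y) ^+ 2 <= rmeas (nu r) (F n)].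
  split=> [n|]; first by apply: le_trans (F3 n) _; apply: le_rmeas.
  apply: (@squeeze_cvgr _ _ _ _ (cst 0) (fun n => rmeas (nu r) (F n))) => //; last exact: cvg_cst.
  by apply: nearW => n; rewrite F3 mulr_ge0// sqr_ge0.
case: sg1 => ->.
  exists (fun n => `]y, (y + n.+1%:R^-1)[%classic); split=> [n||n]; [exact: measurable_itv|exact: rmeas_right_strip|].
  have h0 : (0 : R) < n.+1%:R^-1 by rewrite invr_gt0.
  rewrite mul1r -ler_pdivlMl// -[X in X <= _]/(_).
  have := ac_part_strip sB (p := y) (q := y + n.+1%:R^-1) cv (ac r0).
  rewrite (_ : y + n.+1%:R^-1 - y = n.+1%:R^-1); last by ring.
  apply.
  by rewrite lerDl ltW.
exists (fun n => `](y - n.+1%:R^-1), y[%classic); split=> [n||n]; [exact: measurable_itv|exact: rmeas_left_strip|].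
have h0 : (0 : R) < n.+1%:R^-1 by rewrite invr_gt0.
rewrite mulN1r -ler_pdivlMl// -sqrrN opprB.
have := ac_part_strip sB (p := y - n.+1%:R^-1) (q := y) cv (ac r0).
rewrite (_ : y - (y - n.+1%:R^-1) = n.+1%:R^-1); last by ring.
apply.
by rewrite gerBl ltW.
Qed.

(** [prim_curve] with shift [sg * h] minus [prim_curve] with shift 0, divided by [h]. The source is
    bounded below by the subgradient inequality, the error vanishes by [strip_energy], and the two
    signs of [sg] give opposite inequalities. *)
Lemma quantile_value_lower t (sg : R) : 0 <= t -> sg = 1 \/ sg = -1 ->
  4^-1 * (sg * (2 * eta - mass (nu 0))) * t <= sg * (v t (Y t) - v 0 (Y 0)).
Proof.
move=> t0 sg1; have [v1 _ _] := uv.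
have sgn : `|sg| = 1 by case: sg1 => ->; rewrite ?normrN normr1.
have P r : 0 <= r -> prim (Prim (v r)) (v r) by move=> r0; apply: prim_Prim; exact: (loc_int_cont (v1 r r0)).
have mc := mass_const sB nu_weak uv transport.
have cY := quantile_continuous sB nu_weak uv hold transport eta0 etaM.
pose D n r := v (pos r) (Y (pos r) + sg * n.+1%:R^-1) - v (pos r) (Y (pos r)).
have DE n (q : R) : 0 <= q -> D n q = v q (Y q + sg * n.+1%:R^-1) - v q (Y q).
  by move=> q0; rewrite /D posE.
have cD n : continuous (D n).
  apply: cont_sub; apply: trace_continuous => //.
  by apply: (cont_add cY); exact: cst_continuous.
pose E n := \int[leb]_(r in `[0, t]) (n.+1%:R * D n r ^+ 2).
have cE : E n @[n --> \oo] --> (0 : R).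
  have -> : (0 : R) = \int[leb]_(r in `[0, t]) (0 : R) by rewrite Rint_itv_cst// mul0r.
  apply: (proj2 (@Rintegral_dominated _ _ _ leb `[0, t]%classic (fun n r => n.+1%:R * D n r ^+ 2)
     (cst 0) (cst (mass (nu 0))) _ _ _ _ _)) => //.
  - move=> n; apply: measurable_funTS; apply: continuous_measurable_fun.
    by apply: cont_mul; [exact: cst_continuous|apply: cont_mul; exact: cD].
  - exact: integrable_itv_cst.
  - move=> n r; rewrite /= in_itv/= => /andP[r0 _].
    have := proj1 (strip_energy (Y r) r0 sg1) n; rewrite mc//.
    by rewrite -DE// ger0_norm// mulr_ge0// sqr_ge0.
  - move=> r; rewrite /= in_itv/= => /andP[r0 _]; under eq_fun do rewrite (DE _ _ r0).
    exact: (proj2 (strip_energy (Y r) r0 sg1)).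
have key n : 4^-1 * (sg * (2 * eta - mass (nu 0))) * t - 2^-1 * E n <=
   n.+1%:R * (Prim (v t) (Y t + sg * n.+1%:R^-1) - Prim (v t) (Y t)) -
   n.+1%:R * (Prim (v 0) (Y 0 + sg * n.+1%:R^-1) - Prim (v 0) (Y 0)).
  set h := n.+1%:R^-1; have h0 : 0 < h by rewrite invr_gt0.
  have hE : n.+1%:R * h = 1 by rewrite mulfV.
  have C1 := prim_curve sB nu_weak uv hold transport momentum eta0 etaM (sg * h) t0.
  have C0 := prim_curve sB nu_weak uv hold transport momentum eta0 etaM 0 t0.
  rewrite !addr0 in C0.
  rewrite -mulrBr (_ : _ - _ - _ = Prim (v t) (Y t + sg * h) - Prim (v 0) (Y 0 + sg * h) -
    (Prim (v t) (Y t) - Prim (v 0) (Y 0))); last by ring.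
  rewrite C1 C0.
  have ci x0 : leb.-integrable `[0, t] (EFin \o (fun r =>
      v (pos r) (quantile (nu (pos r)) eta) * v (pos r) (quantile (nu (pos r)) eta + x0) + prim_rate v nu (quantile (nu (pos r)) eta + x0) r)).
    have cY0 : continuous (fun r => Y (pos r) + x0) by apply: (cont_add cY); exact: cst_continuous.
    have pp r : pos (pos r) = pos r by apply: posE; exact: pos_ge0.
    have c : continuous (fun r => v (pos r) (Y (pos r)) * v (pos r) (Y (pos r) + x0) + prim_rate v nu (Y (pos r) + x0) r).
      apply: cont_add; first by apply: cont_mul; apply: trace_continuous.
      have := prim_rate_curve_continuous nu_weak uv cY0.
      by under eq_fun do rewrite pp.
    by have [_] := loc_int_cont c; exact.
  rewrite -RintegralB//.
  have iD : leb.-integrable `[0, t] (EFin \o (fun r => n.+1%:R * D n r ^+ 2)).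
    have c : continuous (fun r => n.+1%:R * D n r ^+ 2).
      by apply: cont_mul; [exact: cst_continuous|apply: cont_mul; exact: cD].
    by have [_] := loc_int_cont c; exact.
  have -> : 4^-1 * (sg * (2 * eta - mass (nu 0))) * t = 4^-1 * (sg * (2 * eta - mass (nu 0))) * (t - 0) by rewrite subr0.
  rewrite -Rint_itv_cst// -RintegralZl// -RintegralZl//; last first.
    exact: RintegrableB.
  rewrite -RintegralB//; last 2 first.
  - exact: integrable_itv_cst.
  - exact: RintegrableZ.
  apply: le_Rintegral => //.
  - by apply: RintegrableB => //; [exact: integrable_itv_cst|exact: RintegrableZ].
  - by apply: RintegrableZ => //; exact: RintegrableB.
  move=> r; rewrite /= in_itv/= => /andP[r0 _].
  rewrite DE// posE// -/(Y r) -/h addr0.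
  have em : eta < mass (nu r) by rewrite mc.
  have low := dist_shift_lower eta0 em (erefl (Y r)) h0 sg1.
  have RB := @prim_rateB _ v nu (Y r) (Y r + sg * h) r r0.
  rewrite (_ : v r (Y r) * v r (Y r + sg * h) + prim_rate v nu (Y r + sg * h) r - _ =
     v r (Y r) * v r (Y r + sg * h) - v r (Y r) * v r (Y r) + (prim_rate v nu (Y r + sg * h) r - prim_rate v nu (Y r) r)); last by ring.
  rewrite RB /strip_rate posE//.
  move: low; set I := \int[_]_z _; set a := v r (Y r); set b := v r _; rewrite mc// => low.
  (* Because the strip moves with its end point, the transport terms and the difference of the
     fluxes combine into a square of the variation across the strip. *)
  have -> : a * b - a * a + (2^-1 * a ^+ 2 - 2^-1 * b ^+ 2 + 4^-1 * I) = - (2^-1 * (b - a) ^+ 2) + 4^-1 * I by field.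
  have -> : n.+1%:R * (- (2^-1 * (b - a) ^+ 2) + 4^-1 * I) = 4^-1 * (n.+1%:R * I) - 2^-1 * (n.+1%:R * (b - a) ^+ 2) by ring.
  rewrite lerD2r ler_wpM2l ?invr_ge0//.
  by have := ler_wpM2l (ler0n R n.+1) low; rewrite mulrA hE mul1r.
have L1 : 4^-1 * (sg * (2 * eta - mass (nu 0))) * t - 2^-1 * E n @[n --> \oo] -->
    4^-1 * (sg * (2 * eta - mass (nu 0))) * t - 2^-1 * 0.
  by apply: cvg_seqB; [exact: cvg_cst|apply: cvgMr].
rewrite mulr0 subr0 in L1; rewrite [X in _ <= X]mulrBr.
apply: (ler_cvg_to L1); last by apply: nearW => n; exact: key.
by apply: cvg_seqB; apply: prim_quotient_cvg => //; [exact: P|exact: v1|exact: P|exact: v1].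
Qed.

Theorem quantile_value t : 0 <= t -> v t (Y t) = v 0 (Y 0) + (eta - mass (nu 0) / 2) / 2 * t.
Proof.
move=> t0; have h1 := @quantile_value_lower t 1 t0 (or_introl erefl).
have h2 := @quantile_value_lower t (-1) t0 (or_intror erefl).
apply/eqP; rewrite eq_le; apply/andP; split; lra.
Qed.

(** The speed along the curve is now affine in time. On a short interval the candidate formula
    differs from the speed estimate by $k(b-a)^2$, which telescoping removes. *)
Theorem quantile_curve t : 0 <= t ->
  Y t = Y 0 + t * v 0 (Y 0) + (eta - mass (nu 0) / 2) / 4 * t ^+ 2.
Proof.
move=> t0; have T0 : 0 < t + 1 by lra.
pose k := (eta - mass (nu 0) / 2) / 4.
suff : Y 0 - (Y 0 + 0 * v 0 (Y 0) + k * 0 ^+ 2) = Y t - (Y t + 0) + (Y t - (Y 0 + t * v 0 (Y 0) + k * t ^+ 2)).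
  by rewrite -/k; lra.
have -> : Y t - (Y t + 0) + (Y t - (Y 0 + t * v 0 (Y 0) + k * t ^+ 2)) = Y t - (Y 0 + t * v 0 (Y 0) + k * t ^+ 2) by ring.
apply: (@telescope_eq _ (fun r => Y r - (Y 0 + r * v 0 (Y 0) + k * r ^+ 2)) id) => // e e0.
have e2 : 0 < e / 2 by rewrite divr_gt0.
have [d d0 Hd] := quantile_speed_eps sB nu_weak uv hold transport eta0 etaM T0 e2.
have k0 : 0 < 2 * `|k| + 1 by have := normr_ge0 k; lra.
exists (Num.min d (e / (2 * `|k| + 1))); first by rewrite lt_min d0 divr_gt0.
move=> a b a0 ab bt; rewrite lt_min => /andP[bd]; rewrite ltr_pdivlMr// => be.
have bT : b <= t + 1 by lra.
have := Hd a b a0 ab bT bd; rewrite -/(Y a) -/(Y b) quantile_value// => H.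
have -> : Y b - (Y 0 + b * v 0 (Y 0) + k * b ^+ 2) - (Y a - (Y 0 + a * v 0 (Y 0) + k * a ^+ 2)) =
  (Y b - Y a - (b - a) * (v 0 (Y 0) + (eta - mass (nu 0) / 2) / 2 * a)) - (b - a) * (k * (b - a)).
  by rewrite /k; field.
apply: (le_trans (ler_normB _ _)); have ba : 0 <= b - a by rewrite subr_ge0.
have H2 : `|(b - a) * (k * (b - a))| <= (b - a) * (e / 2).
  rewrite normrM (ger0_norm ba) ler_wpM2l// normrM (ger0_norm ba).
  by have := normr_ge0 k; lra.
by apply: (le_trans (lerD H H2)); lra.
Qed.

End QuantileMotion.

(** * Uniqueness *)

Section Uniqueness.
Variables (R : realType) (s : R -> R) (B : R).
Hypothesis (sB : smooth_step s B).
Notation leb := (@lebesgue_measure R).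
Implicit Types (v w : R -> R -> R) (nu mu : R -> {finite_measure set R -> \bar R}).

(** A weak conservative solution in the form used for uniqueness: the bounds in [ucb] stand in for
    the far-field spaces. *)
Record conservative v nu : Prop := Conservative {
  weakly_continuous : forall g : R -> R, continuous g -> (exists M, forall x, `|g x| <= M) ->
    {within [set t : R | 0 <= t], continuous (fun t => fine (\int[nu t]_(x in setT) (g x)%:E))};
  bounded_velocity : ucb v;
  holder_velocity : forall T, 0 < T -> exists alpha C, 0 < alpha /\ alpha <= 1 /\ 0 <= C /\
    forall t s x y, 0 <= t <= T -> 0 <= s <= T ->
      `|v t x - v s y| <= C * ((`|t - s| + `|x - y|) `^ alpha);
  transport_eq : forall phi, test2 phi ->
    (\int[leb]_(t in [set t : R | (0 <= t)%R]) \int[nu t]_(x in setT)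
        (dpt phi t x + v t x * dpx phi t x)%:E
      = - \int[nu 0%R]_(x in setT) (phi 0%R x)%:E)%E;
  momentum_eq : forall phi, test2 phi ->
    (\int[leb]_(t in [set t : R | (0 <= t)%R]) \int[leb]_(x in setT)
        (v t x * dpt phi t x + 2^-1 * (v t x) ^+ 2 * dpx phi t x
         + 4^-1 * (fine (nu t [set y | (y < x)%R]) - fine (nu t [set y | (x < y)%R]))
           * phi t x)%:E
      = - \int[leb]_(x in setT) (v 0%R x * phi 0%R x)%:E)%E;
  energy_density : forall t, 0 <= t -> ac_part_ux2 (v t) (nu t) }.

Lemma quantile_mono (m : {finite_measure set R -> \bar R}) e1 e2 : 0 < e1 -> e1 <= e2 -> e2 < mass m ->
  quantile m e1 <= quantile m e2.
Proof.
move=> e0 e12 em; rewrite quantileP//; last exact: lt_le_trans e12.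
exact: le_trans (quantile_Nl e0 (le_lt_trans e12 em)) e12.
Qed.

Lemma strip_quantile (f : R -> R) m (x eta : R) : continuous f -> ac_part_ux2 f m -> 0 < eta -> eta < mass m ->
  (f x - f (quantile m eta)) ^+ 2 <= `|x - quantile m eta| * `|Nl m x - eta|.
Proof.
move=> cv av e0 em; have := rmeas_quantile_gap x e0 em.
set q := quantile m eta; have [xq|qx] := leP x q.
  move=> H; rewrite -sqrrN opprB (ler0_norm (x := x - q)) ?subr_le0// opprB.
  apply: (le_trans (ac_part_strip sB cv av xq)); rewrite ler_wpM2l ?subr_ge0//.
move=> H; rewrite (gtr0_norm (x := x - q)) ?subr_gt0//.
by apply: (le_trans (ac_part_strip sB cv av (ltW qx))); rewrite ler_wpM2l// subr_ge0 ltW.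
Qed.

(** Without energy there are no quantiles. Then [v] is constant in space by the strip estimate, and
    the momentum balance of $[0,1]$ has neither flux difference nor source, so [v] is constant in
    time as well. *)
Lemma zero_mass_constant v nu t x : conservative v nu -> mass (nu 0) = 0 -> 0 <= t -> v t x = v 0 0.
Proof.
move=> cs m0 t0; have [v1 _ _] := bounded_velocity cs.
have mt r : 0 <= r -> mass (nu r) = 0.
  by move=> r0; rewrite (mass_const sB (weakly_continuous cs) (bounded_velocity cs) (transport_eq cs) r0).
have c r p q : 0 <= r -> v r p = v r q.
  move=> r0; wlog pq : p q / p <= q.
    by move=> H; have [/H//|/ltW/H] := leP p q.
  have := ac_part_strip sB (v1 r r0) (energy_density cs r0) pq.
  have : rmeas (nu r) `]p, q[%classic <= 0 by rewrite -(mt r r0); apply: le_rmeas => //; exact: measurable_itv.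
  have := rmeas_ge0 (nu r) `]p, q[%classic => h1 h2.
  have -> : rmeas (nu r) `]p, q[%classic = 0 by apply/eqP; rewrite eq_le h1 h2.
  rewrite mulr0 => h; apply/esym/eqP; rewrite -subr_eq0 -sqrf_eq0 eq_le h/=; exact: sqr_ge0.
have := momentum_strip sB (weakly_continuous cs) (bounded_velocity cs) (momentum_eq cs) (@ler01 R) t0.
rewrite (_ : \int[leb]_(y in `[0, 1]) v t y = v t x); last first.
  transitivity (\int[leb]_(y in `[0, 1]) v t x); first by apply: Rintegral_eq => y _; exact: c.
  by rewrite Rint_itv_cst// subr0 mulr1.
rewrite (_ : \int[leb]_(y in `[0, 1]) v 0 y = v 0 0); last first.
  transitivity (\int[leb]_(y in `[0, 1]) v 0 0); first by apply: Rintegral_eq => y _; exact: c.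
  by rewrite Rint_itv_cst// subr0 mulr1.
rewrite (_ : \int[leb]_(r in `[0, t]) strip_rate v nu 0 1 r = 0); first by move/eqP; rewrite subr_eq0 => /eqP.
transitivity (\int[leb]_(r in `[0, t]) (0 : R)); last by rewrite Rint_itv_cst// mul0r.
apply: Rintegral_eq => r; rewrite /= in_itv/= => /andP[r0 _].
rewrite /strip_rate posE// (c r 0 1 r0) subrr add0r.
have -> : \int[nu r]_z (`|1 - z| - `|0 - z|) = 0; last by rewrite mulr0.
suff : `|\int[nu r]_z (`|1 - z| - `|0 - z|)| <= 1 * mass (nu r) by rewrite mt// mulr0 normr_le0 => /eqP.
rewrite -[X in _ <= X](@Rintegral_cst _ _ _ (nu r) setT)//; apply: Rintegral_abs_le => //.
- exact: dist_integrable.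
- exact: finite_measure_integrable_cst.
- move=> z _; apply: (le_trans (ler_dist_dist _ _)).
  by rewrite (_ : 1 - z - (0 - z) = 1) ?normr1//; ring.
Qed.

Lemma interpolate_level (n M e : R) : 0 < M -> 0 <= n -> n <= M -> 0 < e -> exists eta,
  [/\ 0 < eta, eta < M, `|n - eta| <= e & (n <= eta /\ eta <= M / 2) \/ (M / 2 <= eta /\ eta < n)].
Proof.
move=> M0 n0 nM e0; have [h|h] := leP n (M / 2).
  exists (n + Num.min e (M / 2 - n)); have [h1|h1] := leP e (M / 2 - n).
    split; [lra|lra| |left; lra].
    by rewrite opprD addrA subrr sub0r normrN gtr0_norm.
  split; [lra|lra| |left; lra].
  by rewrite opprD addrA subrr sub0r normrN ger0_norm; lra.
exists (n - Num.min e (n - M / 2)); have [h1|h1] := leP e (n - M / 2).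
  split; [lra|lra| |right; lra].
  by rewrite opprB addrC subrK gtr0_norm.
split; [lra|lra| |right; lra].
by rewrite opprB addrC subrK ger0_norm; lra.
Qed.

Theorem conservative_unique v nu w mu : conservative v nu -> conservative w mu ->
  (forall x, v 0 x = w 0 x) -> meas_eq (nu 0) (mu 0) ->
  forall t, 0 <= t -> (forall x, v t x = w t x) /\ meas_eq (nu t) (mu t).
Proof.
move=> cv cw vw0 nm0 t t0.
have mv := mass_const sB (weakly_continuous cv) (bounded_velocity cv) (transport_eq cv) t0.
have mw := mass_const sB (weakly_continuous cw) (bounded_velocity cw) (transport_eq cw) t0.
have N0 x : Nl (nu 0) x = Nl (mu 0) x by rewrite /Nl /rmeas (nm0 _ (measurable_lt x)).
have m0 : mass (nu 0) = mass (mu 0) by rewrite /mass /rmeas (nm0 _ measurableT).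
have q0 eta : 0 < eta -> eta < mass (nu 0) -> quantile (nu 0) eta = quantile (mu 0) eta.
  move=> e0 em; rewrite /quantile; congr sup; apply/seteqP; split => x /=; by rewrite N0.
have C1 eta (e0 : 0 < eta) (em : eta < mass (nu 0)) := quantile_curve sB (weakly_continuous cv)
  (bounded_velocity cv) (holder_velocity cv) (transport_eq cv) (momentum_eq cv) (energy_density cv) e0 em t0.
have C2 eta (e0 : 0 < eta) (em : eta < mass (mu 0)) := quantile_curve sB (weakly_continuous cw)
  (bounded_velocity cw) (holder_velocity cw) (transport_eq cw) (momentum_eq cw) (energy_density cw) e0 em t0.
have V1 eta (e0 : 0 < eta) (em : eta < mass (nu 0)) := quantile_value sB (weakly_continuous cv)
  (bounded_velocity cv) (holder_velocity cv) (transport_eq cv) (momentum_eq cv) (energy_density cv) e0 em t0.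
have V2 eta (e0 : 0 < eta) (em : eta < mass (mu 0)) := quantile_value sB (weakly_continuous cw)
  (bounded_velocity cw) (holder_velocity cw) (transport_eq cw) (momentum_eq cw) (energy_density cw) e0 em t0.
have qt eta : 0 < eta -> eta < mass (nu t) -> quantile (nu t) eta = quantile (mu t) eta.
  move=> e0; rewrite mv => em; have em' : eta < mass (mu 0) by rewrite -m0.
  by rewrite C1// C2// q0// vw0 m0.
have vt eta : 0 < eta -> eta < mass (nu t) -> v t (quantile (nu t) eta) = w t (quantile (nu t) eta).
  move=> e0 em; rewrite {2}(qt _ e0 em); move: em; rewrite mv => em.
  have em' : eta < mass (mu 0) by rewrite -m0.
  by rewrite V1// V2// q0// vw0 m0.
have Nt x : Nl (nu t) x = Nl (mu t) x by apply: quantile_eq_Nl qt x; rewrite mv mw.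
split; last exact: Nl_meas_eq.
move=> x; have := mass_ge0 (nu 0); rewrite le_eqVlt => /predU1P[z|M0].
  by rewrite (zero_mass_constant _ cv)// (zero_mass_constant _ cw) -?m0.
rewrite -mv in M0; pose M := mass (nu t).
have [v1 _ _] := bounded_velocity cv; have [w1 _ _] := bounded_velocity cw.
pose D := `|x - quantile (nu t) (M / 2)|.
have M20 : 0 < M / 2 by rewrite divr_gt0.
have M2M : M / 2 < M by rewrite ltr_pdivrMr// ltr_pMr// ltr1n.
(* The two velocities agree at the quantile of a level [eta] that is [e]-close to the value of [Nl]
   at [x], and each varies from there to [x] by at most $\sqrt{De}$; [D], the distance from [x] to
   the median, does not depend on [e]. *)
have key e : 0 < e -> (v t x - w t x) ^+ 2 <= 4 * (D * e).
  move=> e0; have [eta [e1 e2 e3 e4]] := interpolate_level M0 (Nl_ge0 (nu t) x) (Nl_le_mass (nu t) x) e0.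
  have e2' : eta < mass (mu t) by rewrite mw -m0 -mv.
  have s1 := strip_quantile x (v1 t t0) (energy_density cv t0) e1 e2.
  have s2 := strip_quantile x (w1 t t0) (energy_density cw t0) e1 e2'.
  rewrite -Nt -qt// -vt// in s2.
  have qD : `|x - quantile (nu t) eta| <= D.
    rewrite /D; case: e4 => -[h1 h2].
      have xq : x <= quantile (nu t) eta by rewrite quantileP.
      have := quantile_mono e1 h2 M2M => qq.
      by rewrite !ler0_norm ?subr_le0//; [lra|exact: le_trans qq].
    have xq : quantile (nu t) eta < x by rewrite ltNge quantileP// -ltNge.
    have qq := quantile_mono M20 h1 e2.
    by rewrite !ger0_norm ?subr_ge0//; [lra|exact: le_trans (ltW xq)|exact: ltW].
  have b : `|x - quantile (nu t) eta| * `|Nl (nu t) x - eta| <= D * e by exact: ler_pM.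
  move: s1 s2 b; set X := v t x; set W := w t x; set Q := v t _; set P := _ * _; set DE := D * e.
  move=> s1 s2 b.
  have : 0 <= ((X - Q) + (W - Q)) ^+ 2 by exact: sqr_ge0.
  by move: s1 s2; rewrite !expr2; lra.
have D0 : 0 <= D by exact: normr_ge0.
have z : (v t x - w t x) ^+ 2 <= 0.
  apply/ler_addgt0Pr => e e0; rewrite add0r.
  have D4 : 0 < 4 * D + 1 by lra.
  apply: (le_trans (key (e / (4 * D + 1)) (divr_gt0 e0 D4))).
  rewrite (_ : 4 * (D * (e / (4 * D + 1))) = (4 * D) * (e / (4 * D + 1))); last by ring.
  by rewrite mulrCA ler_piMr ?(ltW e0)// ler_pdivrMr//; lra.
by apply/eqP; rewrite -subr_eq0 -sqrf_eq0 eq_le z sqr_ge0.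
Qed.

End Uniqueness.

(** * From Lagrangian to Eulerian coordinates *)

Lemma measurable_fun_inv (R : realType) : measurable_fun setT (@GRing.inv R).
Proof.
have m0 : measurable [set (0 : R)] by exact: measurable_set1.
rewrite (_ : setT = [set (0 : R)] `|` ~` [set 0]); last by rewrite setUv.
apply/measurable_funU => //; first exact: measurableC.
split; first exact: measurable_fun_set1.
apply: subspace_continuous_measurable_fun; first exact: measurableC.
by apply: continuous_in_subspaceT => x; rewrite inE => /eqP x0; exact: inv_continuous.
Qed.

Lemma lebesgue_null_setU (R : realType) (A B : set (measurableTypeR R)) : measurable A -> measurable B ->
  @lebesgue_measure R A = 0%E -> @lebesgue_measure R B = 0%E -> @lebesgue_measure R (A `|` B) = 0%E.
Proof.
move=> mA mB A0 B0; apply/eqP; rewrite eq_le measure_ge0 andbT.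
apply: (le_trans (measureU2 _ mA mB)); rewrite -[X in (_ <= X)%E]adde0.
by apply: leeD; rewrite le_eqVlt; apply/orP; left; apply/eqP; [exact: A0|exact: B0].
Qed.

Lemma is_image_integral_on d1 d2 (X : measurableType d1) (Y : measurableType d2) (R : realType)
    (mu : {measure set X -> \bar R}) (y : X -> Y) (w : X -> R)
    (m : {measure set Y -> \bar R}) (f : Y -> R) (A : set Y) :
  is_image mu y w m -> measurable_fun setT y -> measurable_fun setT w -> (forall x, 0 <= w x) ->
  measurable A -> measurable_fun setT f ->
  (\int[m]_(z in A) (f z)%:E = \int[mu]_(x in y @^-1` A) (f (y x) * w x)%:E)%E.
Proof.
move=> im my mw w0 mA mf; rewrite [LHS]integral_mkcond [RHS]integral_mkcond.
rewrite (_ : ((fun z => (f z)%:E) \_ A) = fun z => (f z * \1_A z)%:E); last first.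
  by apply/funext => z; rewrite patchE indicE; case: ifP => _; rewrite ?mulr1 ?mulr0.
rewrite (is_image_integral my mw w0 im); last first.
  by apply: measurable_funM => //; exact: measurable_indic.
apply: eq_integral => x _; rewrite patchE indicE.
rewrite (_ : (x \in y @^-1` A) = (y x \in A)); last by apply/idP/idP; rewrite !inE.
by case: ifP => _; rewrite ?mulr1 ?mulr0 ?mul0r.
Qed.

(* A Lagrangian state: [y] is the position, [U] the velocity and [c] the energy
   density of the particles; [a] and [b] are the derivatives of [y] and [U]. *)
Section Eulerian.
Variable R : realType.
Notation leb := (@lebesgue_measure R).
Variables (y U a b c : R -> R) (K : R).
Implicit Types (x z p q xi k : R).
Hypothesis py : prim y a.
Hypothesis pU : prim U b.
Hypothesis a0 : forall xi, 0 <= a xi.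
Hypothesis c0 : forall xi, 0 <= c xi.
Hypothesis acb : forall xi, a xi * c xi = b xi ^+ 2.
Hypothesis mc : measurable_fun setT c.
Hypothesis ic : leb.-integrable setT (EFin \o c).
Hypothesis yK : forall xi, `|y xi - xi| <= K.

Let ma : measurable_fun setT a. Proof. exact: py.1.1. Qed.
Let mb : measurable_fun setT b. Proof. exact: pU.1.1. Qed.
Let cy : continuous y. Proof. exact: prim_continuous py. Qed.
Let my : measurable_fun setT y. Proof. exact: continuous_measurable_fun. Qed.

Definition energy_before xi := \int[leb]_(z in [set z | z < xi]) c z.
Notation H := energy_before.

Lemma lagrangian_mono p q : p <= q -> y p <= y q.
Proof. exact: prim_monotone py a0. Qed.

(** The leftmost label at [x]. Since [y] may be flat it has no inverse, only this generalized one,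
    which satisfies a Galois connection with [y]. *)
Definition label x := inf [set xi | x <= y xi].
Notation Xi := label.

Lemma labelP x xi : (Xi x <= xi) = (x <= y xi).
Proof.
have yb z : z - K <= y z /\ y z <= z + K by have := yK z; rewrite ler_norml => /andP[]; lra.
have S : has_inf [set xi | x <= y xi].
  split; first by exists (x + K) => /=; have [] := yb (x + K); lra.
  by exists (x - K) => z /=; have [_] := yb z; lra.
apply/idP/idP => [h|h]; last exact: (inf_lbound S.2).
apply: le_trans (lagrangian_mono h); apply/ler_addgt0Pr => e e0.
have /cvgrPdist_lt/(_ _ e0)/nbhs_ballP[d /= d0 Hd] := @cy (Xi x).
have [z /= xz zd] := inf_adherent d0 S.
have zX : Xi x <= z by exact: (inf_lbound S.2).
have := Hd z; rewrite /ball/= distrC ger0_norm ?subr_ge0// => /(_ _).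
rewrite ltrBlDl => /(_ zd); rewrite ltr_norml => /andP[]; lra.
Qed.

Lemma label_lagrangian x : y (Xi x) = x.
Proof.
apply/eqP; rewrite eq_le -[X in _ && X]labelP lexx andbT leNgt; apply/negP => h.
have e0 : 0 < y (Xi x) - x by rewrite subr_gt0.
have /cvgrPdist_lt/(_ _ e0)/nbhs_ballP[d /= d0 Hd] := @cy (Xi x).
have := Hd (Xi x - d / 2); rewrite /ball/= opprB addrC subrK gtr0_norm ?divr_gt0// => /(_ _).
have dd : d / 2 < d by rewrite ltr_pdivrMr// ltr_pMr// ltr1n.
move=> /(_ dd); rewrite ltr_norml => /andP[_ h1].
have : Xi x <= Xi x - d / 2 by rewrite labelP; lra.
by rewrite lerBrDr gerDl leNgt divr_gt0.
Qed.

Lemma label_mono x z : x <= z -> Xi x <= Xi z.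
Proof. by move=> xz; rewrite labelP label_lagrangian. Qed.

Lemma lagrangian_labelE xi : y (Xi (y xi)) = y xi. Proof. exact: label_lagrangian. Qed.

Lemma label_le xi : Xi (y xi) <= xi. Proof. by rewrite labelP. Qed.

Lemma measurable_label : measurable_fun setT Xi.
Proof. by apply: nondecreasing_measurable => // p q; exact: label_mono. Qed.

Lemma preimage_lt x : y @^-1` [set z | z < x] = [set xi | xi < Xi x].
Proof. by apply/seteqP; split => xi /=; rewrite !ltNge labelP. Qed.

Lemma preimage_itvco p q : y @^-1` `[p, q[%classic = `[Xi p, Xi q[%classic.
Proof. by apply/seteqP; split => xi /=; rewrite !in_itv/= labelP ltNge [X in _ -> _ && X]ltNge labelP. Qed.

Lemma loc_int_integrable_co (f : R -> R) p q : loc_int f -> leb.-integrable `[p, q[ (EFin \o f).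
Proof.
move=> lf; apply: (@loc_int_integrable _ f _ p q lf); first exact: measurable_itv.
by move=> z /=; rewrite !in_itv/= => /andP[-> /ltW].
Qed.

Lemma Rint_co (f : R -> R) p q : loc_int f -> \int[leb]_(x in `[p, q[) f x = \int[leb]_(x in `[p, q]) f x.
Proof.
move=> lf; apply: Rintegral_itv_bndo_bndc.
exact: loc_int_integrable_co.
Qed.

(** The preimage of $[p,q[$ under [y] is the half-open interval between the labels of [p] and [q],
    over which [a] integrates to $q-p$. *)
Lemma lebesgue_lagrangian : @is_image _ _ (measurableTypeR R) (measurableTypeR R) R leb y a leb.
Proof.
apply: lebesgue_is_image => // p q pq; rewrite preimage_itvco.
have pqX := label_mono (ltW pq).
have i := @loc_int_integrable_co a (Xi p) (Xi q) py.1.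
rewrite (@integralE_fin _ _ _ leb)//.
by rewrite Rint_co; [rewrite -py.2// !label_lagrangian|exact: py.1].
Qed.

Definition energy : {finite_measure set R -> \bar R} :=
  @image_meas _ _ (measurableTypeR R) R R leb y c my mc c0 ic.

Lemma energyE : @is_image _ _ (measurableTypeR R) R R leb y c energy.
Proof. by []. Qed.

Lemma energy_distrib x : Nl energy x = H (Xi x).
Proof. by rewrite /Nl /rmeas /= /image_meas /image_density preimage_lt. Qed.

Lemma energy_mass : mass energy = \int[leb]_xi c xi.
Proof. by rewrite /mass /rmeas /= /image_meas /image_density preimage_setT. Qed.

Lemma energy_beforeB p q : p <= q -> H q - H p = \int[leb]_(xi in `[p, q]) c xi.
Proof.
move=> pq; have lc : loc_int c.
  by split => // u v; apply: (@integrableS _ _ _ leb setT) => //; exact: measurable_itv.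
rewrite -Rint_co// /H (_ : [set z | z < q] = [set z | z < p] `|` `[p, q[%classic).
  rewrite Rintegral_setU//; first by rewrite addrC addKr.
  - by rewrite -set_itvNyo; exact: measurable_itv.
  - apply: (@integrableS _ _ _ leb setT) => //; apply: measurableU; last exact: measurable_itv.
    by rewrite -set_itvNyo; exact: measurable_itv.
  - apply/disj_setPLR => z /= zp; rewrite in_itv/= => /negP; apply => /andP[].
    by rewrite leNgt zp.
apply/seteqP; split => z /=; rewrite in_itv/=.
  by have [zp|pz] := ltP z p; [left|right].
by case=> [zp|/andP[]//]; exact: lt_le_trans pq.
Qed.

Lemma energy_before_bound xi : 0 <= H xi <= \int[leb]_xi c xi.
Proof.
have mlt : (measurable : set (set (measurableTypeR R))) [set z | z < xi].
  by rewrite -set_itvNyo; exact: measurable_itv.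
rewrite Rintegral_ge0//= /H /Rintegral fine_le//.
- apply: integrable_fin_num => //; exact: (@integrableS _ _ _ leb setT).
- exact: integrable_fin_num.
- apply: ge0_subset_integral => //; first exact/measurable_EFinP.
  by move=> z _; rewrite lee_fin.
Qed.

(* [a s^2 + 2 b s + c >= 0] for every [s], because [a c = b^2]; integrate and take the discriminant *)
Lemma velocity_energy p q : p <= q -> (U q - U p) ^+ 2 <= (y q - y p) * (H q - H p).
Proof.
move=> pq; rewrite (energy_beforeB pq) (py.2 _ _ pq) (pU.2 _ _ pq).
have lc : loc_int c.
  by split => // u v; apply: (@integrableS _ _ _ leb setT) => //; exact: measurable_itv.
set A := \int[leb]_(x in _) a x; set D := \int[leb]_(x in _) b x; set G := \int[leb]_(x in _) c x.
have A0 : 0 <= A by apply: Rintegral_ge0.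
have Q s : 0 <= s ^+ 2 * A + 2 * s * D + G.
  have i1 := @RintegrableZ _ _ _ leb `[p, q]%classic a (s ^+ 2) (measurable_itv _) (py.1.2 p q).
  have i2 := @RintegrableZ _ _ _ leb `[p, q]%classic b (2 * s) (measurable_itv _) (pU.1.2 p q).
  have i12 := @RintegrableD _ _ _ leb `[p, q]%classic _ _ (measurable_itv _) i1 i2.
  rewrite /A /D /G -RintegralZl//; last exact: py.1.2.
  rewrite -RintegralZl//; last exact: pU.1.2.
  rewrite -RintegralD// -RintegralD//; last exact: lc.2.
  apply: Rintegral_ge0 => x _.
  have := a0 x; rewrite le_eqVlt => /predU1P[ax|ax].
    have bx : b x = 0 by apply/eqP; rewrite -sqrf_eq0 -acb -ax mul0r.
    by rewrite -ax bx !mulr0 !add0r.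
  rewrite -(pmulr_rge0 _ ax) (_ : a x * _ = (s * a x + b x) ^+ 2); first exact: sqr_ge0.
  rewrite mulrDr acb; ring.
move: A0; rewrite le_eqVlt => /predU1P[A0|A0].
  rewrite -A0 mul0r; have := Q (- (G + 1) / (2 * D)); rewrite -A0 mulr0 add0r.
  have [->|D0] := eqVneq D 0; first by rewrite expr0n.
  rewrite (_ : 2 * (- (G + 1) / (2 * D)) * D = - (G + 1)); last by field.
  by lra.
have := Q (- D / A); rewrite -(pmulr_rge0 _ A0).
rewrite (_ : A * _ = A * G - D ^+ 2); last by field; rewrite gt_eqF.
by rewrite subr_ge0.
Qed.

Definition velocity x := U (Xi x).
Notation u := velocity.

(** Along a flat piece of [y] the bound of [velocity_energy] is 0, so [U] is constant there and the
    choice of the leftmost label is harmless. *)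
Lemma velocity_lagrangian xi : u (y xi) = U xi.
Proof.
have := velocity_energy (label_le xi); rewrite lagrangian_labelE subrr mul0r => h.
by apply/eqP; rewrite eq_sym -subr_eq0 -sqrf_eq0 eq_le h sqr_ge0.
Qed.

Lemma velocity_strip p q : p <= q -> (u q - u p) ^+ 2 <= (q - p) * (Nl energy q - Nl energy p).
Proof.
by move=> pq; have := velocity_energy (label_mono pq); rewrite !label_lagrangian -!energy_distrib.
Qed.

(** Two distinct labels at the same position enclose a rational label at that position too. This
    countable set therefore contains every position shared by several labels. *)
Let Q0 : set R := [set y (ratr r) | r in [set: rat]].

Let leb_Q0 : leb Q0 = 0%E.
Proof.
apply: countable_lebesgue_measure0; apply: (card_le_trans (card_image_le _ _)).
exact: countableP.
Qed.

Let mQ0 : measurable Q0.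
Proof.
apply: countable_measurable; first by move=> t; exact: measurable_set1.
by apply: (card_le_trans (card_image_le _ _)); exact: countableP.
Qed.

Let label_inverse p q : p < q -> y p = y q -> Q0 (y p).
Proof.
move=> pq ypq; have [r] := rat_in_itvoo pq; rewrite in_itv/= => /andP[pr rq].
exists r => //; apply/eqP; rewrite eq_le (lagrangian_mono (ltW pr)) andbT ypq.
exact/lagrangian_mono/ltW.
Qed.

(** A null set carrying the singular part of the energy: off it, each position has a single label
    and [a] is positive there. *)
Definition flat_set : set R := Q0 `|` [set x | a (Xi x) == 0].
Notation N := flat_set.

Let mA0 : measurable [set x | a (Xi x) == 0].
Proof.
have -> : [set x | a (Xi x) == 0] = (a \o Xi) @^-1` [set 0].
  by apply/seteqP; split => x /= /eqP.
rewrite -[X in measurable X]setTI.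
by apply: (measurableT_comp ma measurable_label) => //; exact: measurable_set1.
Qed.

Lemma measurable_flat_set : measurable N.
Proof. by apply: measurableU. Qed.

Lemma label_flat xi : ~ N (y xi) -> Xi (y xi) = xi /\ 0 < a xi.
Proof.
move=> nN; have E : Xi (y xi) = xi.
  apply/eqP; rewrite eq_le label_le/= leNgt; apply/negP => h; apply: nN; left.
  by rewrite -lagrangian_labelE; apply: label_inverse h _; exact: lagrangian_labelE.
split=> //; rewrite lt_neqAle a0 andbT eq_sym; apply/negP => az; apply: nN; right.
by rewrite /= E.
Qed.

Lemma leb_flat_set : leb N = 0%E.
Proof.
have -> : N = Q0 `|` ([set x | a (Xi x) == 0] `\` Q0) by rewrite setUDr setDv setD0.
have mD : measurable ([set x | a (Xi x) == 0] `\` Q0) by exact: measurableD.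
apply: (lebesgue_null_setU mQ0 mD leb_Q0).
apply: etrans (lebesgue_lagrangian mD) _; rewrite /image_density.
rewrite integral0_eq// => xi [/= /eqP az nQ]; congr EFin.
suff E : Xi (y xi) = xi by rewrite -E.
apply/eqP; rewrite eq_le label_le/= leNgt; apply/negP => h; apply: nQ.
by rewrite -lagrangian_labelE; apply: label_inverse h _; exact: lagrangian_labelE.
Qed.

(** The preimage of [flat_set] is null for the measure of density [a], so [a] vanishes almost
    everywhere on it, and with it $b^2=ac$. *)
Lemma flat_null : exists Z : set R, [/\ measurable Z, leb Z = 0%E &
  forall xi, ~ Z xi -> (Xi (y xi) = xi /\ 0 < a xi /\ ~ N (y xi)) \/ (a xi = 0 /\ b xi = 0 /\ N (y xi))].
Proof.
have mN := measurable_flat_set.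
have mZ : measurable (y @^-1` N) by rewrite -[X in measurable X]setTI; exact: my.
have : (\int[leb]_(xi in y @^-1` N) (a xi)%:E = 0)%E.
  by have := lebesgue_lagrangian mN; rewrite leb_flat_set /image_density => <-.
move=> h.
have [Z [mZ0 Z0 HZ]] : {ae leb, forall xi, (y @^-1` N) xi -> (a xi)%:E = 0%E}.
  have/(ae_eq_integral_abs leb mZ) : measurable_fun (y @^-1` N) (EFin \o a).
    by apply/measurable_EFinP; exact: measurable_funTS.
  move=> [+ _]; apply; rewrite -[RHS]h; apply: eq_integral => xi _.
  by rewrite /= ger0_norm.
exists Z; split => // xi nZ.
have [nN|nN] := pselect (N (y xi)); last by left; have [? ?] := label_flat nN.
right; have ax : a xi = 0.
  by apply: contrapT => ax; apply: nZ; apply: HZ => /= /(_ nN) [].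
by split=> //; split=> //; apply/eqP; rewrite -sqrf_eq0 -acb ax mul0r.
Qed.

(** The derivative $u_x=U_\xi/y_\xi$. Where [a] vanishes the division returns 0; these positions
    belong to [flat_set]. *)
Definition slope x := b (Xi x) / a (Xi x).
Notation g := slope.

Lemma measurable_slope : measurable_fun setT g.
Proof.
apply: measurable_funM; first exact: (measurableT_comp mb measurable_label).
apply: (measurableT_comp (@measurable_fun_inv R)).
exact: (measurableT_comp ma measurable_label).
Qed.

(** Where [a] is positive, $c=b^2/a=(b/a)^2a$, so the image of $c\,d\xi$ is the square of the slope
    times the image of $a\,d\xi$, that is times $dx$. *)
Lemma energy_off_flat A : measurable A -> energy (A `\` N) = (\int[leb]_(x in A) (g x ^+ 2)%:E)%E.
Proof.
move=> mA; have mN := measurable_flat_set; have mAN : measurable (A `\` N) by exact: measurableD.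
have mg2 : measurable_fun setT (fun x => g x ^+ 2) by apply: measurable_funX; exact: measurable_slope.
transitivity (\int[leb]_(x in A `\` N) (g x ^+ 2)%:E)%E; last first.
  apply/esym; apply: ge0_negligible_integral => //; first by apply/measurable_EFinP; exact: measurable_funTS.
    by move=> x _; rewrite lee_fin sqr_ge0.
  exact: leb_flat_set.
rewrite (is_image_integral_on lebesgue_lagrangian my ma a0 mAN mg2).
rewrite (energyE mAN) /image_density; apply: eq_integral => xi /set_mem[_ nN].
have [E ax] := label_flat nN; congr EFin; rewrite /g E.
have -> : c xi = b xi ^+ 2 / a xi by rewrite -acb mulrC mulKf// gt_eqF.
by field; rewrite gt_eqF.
Qed.

Lemma slope_square_integrable : leb.-integrable setT (EFin \o (fun x => g x ^+ 2)).
Proof.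
apply/integrableP; split.
  by apply/measurable_EFinP/measurable_funX; exact: measurable_slope.
have -> : (\int[leb]_x `|(EFin \o (fun x => (g x ^+ 2)%R)) x| = energy (setT `\` N))%E.
  rewrite energy_off_flat//; apply: eq_integral => x _ /=.
  by rewrite ger0_norm ?sqr_ge0.
by rewrite -ge0_fin_numE// fin_num_measure//; apply: measurableD => //; exact: measurable_flat_set.
Qed.

Lemma loc_int_slope : loc_int g.
Proof.
split; first exact: measurable_slope.
move=> p q; apply: (@integrable_le _ _ _ leb `[p, q] g (fun x => 1 + g x ^+ 2)) => //.
- by apply: measurable_funTS; exact: measurable_slope.
- by move=> x _; have := sqr_ge0 (`|g x| - 1); rewrite -[g x ^+ 2]real_normK ?num_real// sqrrB1; have := normr_ge0 (g x); lra.
- apply: RintegrableD => //; first exact: integrable_itv_cst.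
  by apply: (@integrableS _ _ _ leb setT) => //; exact: slope_square_integrable.
Qed.

Lemma slope_lagrangian : exists Z : set R, [/\ measurable Z, leb Z = 0%E &
  forall xi, ~ Z xi -> g (y xi) * a xi = b xi].
Proof.
have [Z [mZ Z0 HZ]] := flat_null; exists Z; split => // xi /HZ[[E [ax _]]|[ax [bx _]]].
  by rewrite /g E divfK// gt_eqF.
by rewrite ax bx mulr0.
Qed.

Lemma prim_velocity : prim u g.
Proof.
split; first exact: loc_int_slope.
move=> p q pq; rewrite /u (pU.2 _ _ (label_mono pq)).
have lg := loc_int_slope.
rewrite -(Rint_co _ _ lg) -Rint_co; last exact: pU.1.
rewrite /Rintegral (is_image_integral_on lebesgue_lagrangian my ma a0 (measurable_itv _) measurable_slope).
rewrite preimage_itvco; congr fine.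
have [Z [mZ Z0 HZ]] := slope_lagrangian.
have mI : (measurable : set (set (measurableTypeR R))) `[Xi p, Xi q[%classic by exact: measurable_itv.
have mga : measurable_fun setT (fun xi => g (y xi) * a xi).
  by apply: measurable_funM => //; exact: (measurableT_comp measurable_slope my).
apply/esym; apply: ae_eq_integral => //.
- by apply/measurable_EFinP; exact: measurable_funTS.
- by apply/measurable_EFinP; exact: measurable_funTS.
exists Z; split => // xi /=; apply: contra_notP => nZ _.
by rewrite HZ.
Qed.

Lemma velocity_ac_part : ac_part_ux2 u energy.
Proof.
exists g, N; split; first exact: prim_weak_deriv prim_velocity.
by split; [exact: measurable_flat_set|split; [exact: leb_flat_set|exact: energy_off_flat]].
Qed.

(** The singular part is the energy of the labels with $a=0$ and $c\ne0$; if these are null, nothing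
    is left on [flat_set]. *)
Lemma velocity_ac : leb [set xi | a xi = 0 /\ c xi != 0] = 0%E -> ac_ux2 u energy.
Proof.
move=> h; exists g; split; first exact: prim_weak_deriv prim_velocity.
move=> A mA; rewrite -energy_off_flat//.
have mN := measurable_flat_set; have mAN : measurable (A `&` N) by exact: measurableI.
have -> : energy A = energy (A `\` N `|` A `&` N).
  congr (_ _); apply/seteqP; split => x /=; last by case=> -[].
  by move=> Ax; have [Nx|Nx] := pselect (N x); [right|left].
rewrite measureU//; [|exact: measurableD|]; last first.
  by apply/seteqP; split => // x [[_ nN] [_ /nN]].
rewrite [X in (_ + X)%E](_ : _ = 0%E) ?adde0//.
apply: etrans (energyE mAN) _; rewrite /image_density.
have [Z [mZ Z0 HZ]] := flat_null.
have mpre : (measurable : set (set (measurableTypeR R))) (y @^-1` (A `&` N)).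
  by rewrite -[X in measurable X]setTI; exact: my.
rewrite -[RHS](integral0 leb (y @^-1` (A `&` N))); apply: ae_eq_integral => //.
  by apply/measurable_EFinP; exact: measurable_funTS.
have m0 : (measurable : set (set (measurableTypeR R))) [set xi | a xi = 0 /\ c xi != 0].
  have -> : [set xi | a xi = 0 /\ c xi != 0] = (a @^-1` [set 0]) `&` (c @^-1` [set~ 0]).
    by apply/seteqP; split => xi /=; [move=> [-> /eqP]|move=> [-> /eqP]].
  apply: measurableI; rewrite -[X in measurable X]setTI; [apply: ma|apply: mc] => //.
  by apply: measurableC; exact: measurable_set1.
exists (Z `|` [set xi | a xi = 0 /\ c xi != 0]); split; first exact: measurableU.
  exact: lebesgue_null_setU.
move=> xi /=; apply: contra_notP => /not_orP[nZ nac] [_ NY].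
case: (HZ xi nZ) => [[_ [_ /(_ NY)]]//|[ax _]].
congr EFin; apply/eqP; apply: contrapT => /negP cx; exact: nac.
Qed.

End Eulerian.

(** * Uniform derivatives in time *)

Section TestCalculus.
Variable R : realType.
Notation leb := (@lebesgue_measure R).
Implicit Types (phi : R -> R -> R) (t x z r : R).

Lemma derivable_continuous (f : R -> R) : (forall x, derivable f x 1) -> continuous f.
Proof. by move=> df x; apply: differentiable_continuous; apply/derivable1_diffP; exact: df. Qed.

Lemma prim_C1 (f : R -> R) : (forall x, derivable f x 1) -> continuous (derive1 f) -> prim f (derive1 f).
Proof.
move=> df cf'.
have cf := derivable_continuous df.
split; first exact: loc_int_cont.
move=> p q; rewrite le_eqVlt => /predU1P[->|pq].
  by rewrite set_itv1 Rintegral_set1 subrr.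
apply: EFin_inj; rewrite -integralE_fin//; last exact: (loc_int_cont cf').2.
rewrite (@continuous_FTC2 R (derive1 f) f p q pq).
- by rewrite EFinB.
- exact: continuous_subspaceT.
- split; first by move=> x _; exact: df.
  + by apply: cvg_at_right_filter; exact: cf.
  + by apply: cvg_at_left_filter; exact: cf.
- by [].
Qed.

Lemma box_bounded (f : R -> R -> R) (N : R) : continuous (fun p : R * R => f p.1 p.2) ->
  (forall t x, N < `|t| \/ N < `|x| -> f t x = 0) -> exists2 M : R, 0 <= M & forall t x, `|f t x| <= M.
Proof.
move=> cf f0.
have : compact ((fun p : R * R => f p.1 p.2) @` (`[- N, N]%classic `*` `[- N, N]%classic)).
  apply: continuous_compact; first exact: continuous_subspaceT.
  by apply: compact_setX; exact: segment_compact.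
move=> /compact_bounded[M [_ HM]]; exists (`|M| + 1) => [|t x]; first by rewrite addr_ge0.
have [tN|tN] := leP `|t| N; last by rewrite f0 ?normr0 ?addr_ge0//; left.
have [xN|xN] := leP `|x| N; last by rewrite f0 ?normr0 ?addr_ge0//; right.
apply: (HM (`|M| + 1)); first by have := ler_norm M; lra.
by exists (t, x) => //; split; rewrite /= in_itv/= -ler_norml.
Qed.

Lemma dpart_support phi (N : R) s : (forall t x, N < `|t| \/ N < `|x| -> phi t x = 0) ->
  forall t x, N < `|t| \/ N < `|x| -> dpart s phi t x = 0.
Proof.
move=> f0; elim: s => //= b s IH t x H; case: b; rewrite /dpt /dpx derive1E.
  have D0 : is_derive t 1 (fun r => dpart s phi r x) 0.
    case: H => [tN|xN].
      apply: (is_derive_near (is_derive_const 0 _)).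
      by have := near_norm tN; apply: filterS => r rN; rewrite IH//; left.
    have -> : (fun r => dpart s phi r x) = fun=> 0 by apply/funext => r; rewrite IH//; right.
    exact: is_derive_const.
  exact: (@derive_val _ _ _ _ _ _ _ D0).
have D0 : is_derive x 1 (dpart s phi t) 0.
  case: H => [tN|xN]; last first.
    apply: (is_derive_near (is_derive_const 0 _)).
    by have := near_norm xN; apply: filterS => r rN; rewrite IH//; right.
  have -> : dpart s phi t = fun=> 0 by apply/funext => r; rewrite IH//; left.
  exact: is_derive_const.
exact: (@derive_val _ _ _ _ _ _ _ D0).
Qed.

Lemma test2_support phi : test2 phi -> exists2 N : R, 0 <= N & forall s t x, N < `|t| \/ N < `|x| -> dpart s phi t x = 0.
Proof.
move=> [_ [N HN]]; exists `|N| => // s; apply: dpart_support => t x H; apply: HN.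
by case: H => h; [left|right]; exact: le_lt_trans (ler_norm _) h.
Qed.

Lemma test2_bounded phi s : test2 phi -> exists2 M : R, 0 <= M & forall t x, `|dpart s phi t x| <= M.
Proof.
move=> tp; have [N _ HN] := test2_support tp.
by apply: box_bounded (HN s); have [_ []] := tp.1 s.
Qed.

Lemma test2_prim phi s : test2 phi ->
  (forall t, prim (dpart s phi t) (dpart (false :: s) phi t)) /\
  (forall x, prim (fun t => dpart s phi t x) (fun t => dpart (true :: s) phi t x)).
Proof.
move=> tp; have [d1 [d2 _]] := tp.1 s.
have [_ [c1 _]] := tp.1 (false :: s); have [c2 _] := tp.1 (true :: s).
by split=> [t|x]; apply: prim_C1 => //; apply: derivable_continuous => r; [exact: c1|exact: c2].
Qed.

Lemma test2_lipschitz phi s : test2 phi -> exists2 L : R, 0 <= L & forall t x r z,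
  `|dpart s phi t x - dpart s phi r z| <= L * (`|t - r| + `|x - z|).
Proof.
move=> tp; have [M1 M10 H1] := test2_bounded (false :: s) tp.
have [M2 M20 H2] := test2_bounded (true :: s) tp.
have [p1 p2] := test2_prim s tp.
exists (M1 + M2) => [|t x r z]; first exact: addr_ge0.
have h1 := prim_lipschitz (p1 t) (H1 t) x z.
have h2 := prim_lipschitz (p2 z) (fun w => H2 w z) t r.
have := ler_normD (dpart s phi t x - dpart s phi t z) (dpart s phi t z - dpart s phi r z).
rewrite addrA subrK => /le_trans; apply; apply: (le_trans (lerD h1 h2)).
have h3 : 0 <= M1 * `|t - r| by rewrite mulr_ge0.
have h4 : 0 <= M2 * `|x - z| by rewrite mulr_ge0.
by rewrite mulrDl !mulrDr; lra.
Qed.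

Lemma test2_taylor phi : test2 phi -> exists2 L : R, 0 <= L & forall t x r z,
  `|phi t z - phi r x - (t - r) * dpt phi r x - (z - x) * dpx phi r x| <= L * (`|t - r| + `|z - x|) ^+ 2.
Proof.
move=> tp; have [L1 L10 H1] := test2_lipschitz [:: true] tp; have [L2 L20 H2] := test2_lipschitz [:: false] tp.
have [p1 p2] := test2_prim [::] tp.
exists (2 * (L1 + L2)) => [|t x r z]; first by rewrite mulr_ge0// addr_ge0.
set h := `|t - r| + `|z - x|.
have ht : `|t - r| <= h by rewrite lerDl.
have hz : `|z - x| <= h by rewrite lerDr.
have h0 : 0 <= h by rewrite addr_ge0.
have T1 : `|phi t z - phi r z - (t - r) * dpt phi r x| <= `|t - r| * (L1 * (2 * h)).
  apply: (prim_linear_approx (p2 z)) => w wt; apply: (le_trans (H1 _ _ _ _)); rewrite ler_wpM2l//.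
  have := ler_normD (w - t) (t - r); rewrite addrA subrK; have := normr_ge0 (z - x); rewrite /h; lra.
have T2 : `|phi r z - phi r x - (z - x) * dpx phi r x| <= `|z - x| * (L2 * (2 * h)).
  apply: (prim_linear_approx (p1 r)) => w wt; apply: (le_trans (H2 _ _ _ _)); rewrite ler_wpM2l//.
  by have := ler_normD (w - z) (z - x); rewrite addrA subrK subrr normr0 add0r; lra.
have := ler_normD (phi t z - phi r z - (t - r) * dpt phi r x) (phi r z - phi r x - (z - x) * dpx phi r x).
rewrite (_ : phi t z - phi r z - (t - r) * dpt phi r x + (phi r z - phi r x - (z - x) * dpx phi r x) =
  phi t z - phi r x - (t - r) * dpt phi r x - (z - x) * dpx phi r x); last by ring.
move=> /le_trans; apply; apply: (le_trans (lerD T1 T2)).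
have -> : 2 * (L1 + L2) * h ^+ 2 = h * (L1 * (2 * h)) + h * (L2 * (2 * h)) by ring.
by apply: lerD; rewrite ler_wpM2r// !mulr_ge0.
Qed.

End TestCalculus.

Section UniformDerivative.
Variables (R : realType) (X : Type).
Implicit Types (f g : R -> X -> R).

(** Differentiability in time, uniform in the label, with a Lipschitz derivative and a quadratic
    remainder on bounded time intervals. It is stable under products and allows differentiation
    under the integral against any integrable weight. *)
Definition unif_deriv f f' := forall T : R, exists2 L : R, 0 <= L & forall s t x, `|s| <= T -> `|t| <= T ->
  [/\ `|f t x| <= L, `|f' t x| <= L, `|f t x - f s x| <= L * `|t - s|, `|f' t x - f' s x| <= L * `|t - s| &
    `|f t x - f s x - (t - s) * f' s x| <= L * (t - s) ^+ 2].

Let sum4_le (p a b c d : R) : a <= p -> b <= p -> c <= p -> d <= p -> a + b + (c + d) <= 4 * p.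
Proof. by lra. Qed.

Let sum2_le (p a b : R) : 0 <= p -> a <= p -> b <= p -> a + b <= 4 * p.
Proof. by lra. Qed.

Lemma unif_derivM f f' g g' : unif_deriv f f' -> unif_deriv g g' ->
  unif_deriv (fun t x => f t x * g t x) (fun t x => f' t x * g t x + f t x * g' t x).
Proof.
move=> Hf Hg T; have [L L0 HL] := Hf T; have [M M0 HM] := Hg T.
exists (4 * (L * M)) => [|s t x sT tT]; first by rewrite !mulr_ge0.
have [f1 f2 f3 f4 f5] := HL s t x sT tT; have [g1 g2 g3 g4 g5] := HM s t x sT tT.
have [f1' f2' _ _ _] := HL t s x tT sT; have [g1' g2' _ _ _] := HM t s x tT sT.
have LM : 0 <= L * M by rewrite mulr_ge0.
have lm (u w P Q : R) : `|u| <= P -> `|w| <= Q -> `|u * w| <= P * Q by move=> hu hw; rewrite normrM ler_pM.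
have e1 (u w : R) : u * `|t - s| * w = u * w * `|t - s| by ring.
have e2 (u w : R) : u * (w * `|t - s|) = u * w * `|t - s| by ring.
have D0 : 0 <= L * M * `|t - s| by rewrite mulr_ge0.
have D1 : 0 <= L * M * (t - s) ^+ 2 by rewrite mulr_ge0// sqr_ge0.
split.
- by apply: (le_trans (lm _ _ _ _ f1 g1)); rewrite ler_peMl// ler1n.
- apply: (le_trans (ler_normD _ _)).
  by apply: sum2_le LM _ _; [exact: lm f2 g1|exact: lm f1 g2].
- rewrite (_ : _ - _ = (f t x - f s x) * g t x + f s x * (g t x - g s x)); last by ring.
  apply: (le_trans (ler_normD _ _)).
  rewrite -mulrA; apply: sum2_le D0 _ _; [rewrite -e1|rewrite -e2]; [exact: lm f3 g1|exact: lm f1' g3].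
- rewrite (_ : _ - _ = (f' t x - f' s x) * g t x + f' s x * (g t x - g s x) +
      ((f t x - f s x) * g' t x + f s x * (g' t x - g' s x))); last by ring.
  apply: (le_trans (ler_normD _ _)); apply: (le_trans (lerD (ler_normD _ _) (ler_normD _ _))).
  rewrite -mulrA; apply: sum4_le.
  + by rewrite -e1; exact: lm f4 g1.
  + by rewrite -e2; exact: lm f2' g3.
  + by rewrite -e1; exact: lm f3 g2.
  + by rewrite -e2; exact: lm f1' g4.
- rewrite (_ : _ - _ = (f t x - f s x - (t - s) * f' s x) * g s x + f s x * (g t x - g s x - (t - s) * g' s x)
      + (f t x - f s x) * (g t x - g s x)); last by ring.
  apply: (le_trans (ler_normD _ _)); apply: (le_trans (lerD (ler_normD _ _) (lexx _))).
  have := lm _ _ _ _ f5 g1'; have := lm _ _ _ _ f1' g5; have := lm _ _ _ _ f3 g3.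
  rewrite (_ : L * `|t - s| * (M * `|t - s|) = L * M * (t - s) ^+ 2); last first.
    by rewrite -[(t - s) ^+ 2]real_normK ?num_real//; ring.
  rewrite (_ : L * (t - s) ^+ 2 * M = L * M * (t - s) ^+ 2); last by ring.
  rewrite (_ : L * (M * (t - s) ^+ 2) = L * M * (t - s) ^+ 2); last by ring.
  by rewrite -[4 * _ * _]mulrA => h1 h2 h3; apply: le_trans (lerD (lerD h3 h2) h1) _; move: (L * M * _) D1 => w; lra.
Qed.

Lemma unif_deriv_quadratic (p q r : X -> R) (M : R) : (forall x, `|p x| <= M) -> (forall x, `|q x| <= M) ->
  (forall x, `|r x| <= M) ->
  unif_deriv (fun t x => p x + t * q x + t ^+ 2 / 4 * r x) (fun t x => q x + t / 2 * r x).
Proof.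
move=> pM qM rM T; exists (`|M| * (1 + `|T|) ^+ 2) => [|s t x sT tT]; first by rewrite mulr_ge0// sqr_ge0.
have M0 := normr_ge0 M; have T0 := normr_ge0 T.
have {}sT : `|s| <= `|T| by apply: (le_trans sT); exact: ler_norm.
have {}tT : `|t| <= `|T| by apply: (le_trans tT); exact: ler_norm.
have {}pM : `|p x| <= `|M| by apply: (le_trans (pM x)); exact: ler_norm.
have {}qM : `|q x| <= `|M| by apply: (le_trans (qM x)); exact: ler_norm.
have {}rM : `|r x| <= `|M| by apply: (le_trans (rM x)); exact: ler_norm.
have MT : 0 <= `|M| * `|T| by rewrite mulr_ge0.
have MTT : 0 <= `|M| * (`|T| * `|T|) by rewrite !mulr_ge0.
have E : `|M| * (1 + `|T|) ^+ 2 = `|M| + 2 * (`|M| * `|T|) + `|M| * (`|T| * `|T|) by ring.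
have lm (u w P Q : R) : `|u| <= P -> `|w| <= Q -> `|u * w| <= P * Q by move=> hu hw; rewrite normrM ler_pM.
have tt : `|t ^+ 2 / 4| <= `|T| * `|T|.
  rewrite normrM expr2 normrM [X in _ * X]ger0_norm ?invr_ge0//.
  have : `|t| * `|t| <= `|T| * `|T| by rewrite ler_pM.
  by have : 0 <= `|t| * `|t| by []; lra.
have t2 : `|t / 2| <= `|T| by rewrite normrM [X in _ * X]ger0_norm ?invr_ge0//; have := normr_ge0 t; lra.
have d0 := normr_ge0 (t - s).
have MLe1 : `|M| <= `|M| * (1 + `|T|) ^+ 2 by rewrite E; lra.
split.
- apply: (le_trans (ler_normD _ _)); apply: (le_trans (lerD (ler_normD _ _) (lexx _))).
  have := lm _ _ _ _ tT qM; have := lm _ _ _ _ tt rM; rewrite E; rewrite !(mulrC _ `|M|); lra.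
- apply: (le_trans (ler_normD _ _)); have := lm _ _ _ _ t2 rM; rewrite E (mulrC _ `|M|); lra.
- rewrite (_ : _ - _ = (q x + (t + s) / 4 * r x) * (t - s)); last by field.
  rewrite normrM ler_wpM2r//; apply: (le_trans (ler_normD _ _)).
  have ts : `|(t + s) / 4| <= `|T|.
    by rewrite normrM [X in _ * X]ger0_norm ?invr_ge0//; have := ler_normD t s; lra.
  by have := lm _ _ _ _ ts rM; rewrite E (mulrC _ `|M|); lra.
- rewrite (_ : _ - _ = (2^-1 * r x) * (t - s)); last by field.
  rewrite normrM ler_wpM2r// normrM ger0_norm ?invr_ge0//.
  by have := normr_ge0 (r x); lra.
- rewrite (_ : _ - _ = (4^-1 * r x) * (t - s) ^+ 2); last by field.
  rewrite normrM [X in _ * X <= _]ger0_norm ?sqr_ge0// ler_wpM2r ?sqr_ge0// normrM ger0_norm ?invr_ge0//.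
  by have := normr_ge0 (r x); lra.
Qed.

End UniformDerivative.

Section TestAlongCurves.
Variables (R : realType) (X : Type).

Let le_sum5 (d e f g h : R) : 0 <= d -> 0 <= e -> 0 <= f -> 0 <= g -> 0 <= h ->
  [/\ d <= d + e + f + g + h, e <= d + e + f + g + h, f <= d + e + f + g + h, g <= d + e + f + g + h &
    h <= d + e + f + g + h].
Proof. by move=> *; split; lra. Qed.

(** Chain rule along trajectories. The Taylor remainder of [phi] at $(s,y_s)$ is quadratic in
    $|t-s|+|y_t-y_s|\le(1+L)|t-s|$. *)
Lemma unif_deriv_test (phi : R -> R -> R) (y u : R -> X -> R) : test2 phi ->
  (forall T : R, exists2 L : R, 0 <= L & forall s t x, `|s| <= T -> `|t| <= T ->
    [/\ `|u t x| <= L, `|y t x - y s x| <= L * `|t - s|, `|u t x - u s x| <= L * `|t - s| &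
    `|y t x - y s x - (t - s) * u s x| <= L * (t - s) ^+ 2]) ->
  unif_deriv (fun t x => phi t (y t x)) (fun t x => dpt phi t (y t x) + u t x * dpx phi t (y t x)).
Proof.
move=> tp Hy T; have [L L0 HL] := Hy T.
have [M1 M10 B1] := test2_bounded [::] tp; have [M2 M20 B2] := test2_bounded [:: true] tp.
have [M3 M30 B3] := test2_bounded [:: false] tp.
have [K1 K10 C1] := test2_lipschitz [::] tp; have [K2 K20 C2] := test2_lipschitz [:: true] tp.
have [K3 K30 C3] := test2_lipschitz [:: false] tp; have [A A0 HA] := test2_taylor tp.
pose W1 := M2 + L * M3; pose W2 := K1 * (1 + L); pose W3 := K2 * (1 + L) + L * (K3 * (1 + L)) + L * M3.
pose W4 := A * (1 + L) ^+ 2 + L * M3; pose W := M1 + W1 + W2 + W3 + W4.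
have L1 : 0 <= 1 + L by lra.
have p1 : 0 <= L * M3 by rewrite mulr_ge0.
have p2 : 0 <= K1 * (1 + L) by rewrite mulr_ge0.
have p3 : 0 <= K2 * (1 + L) by rewrite mulr_ge0.
have p4 : 0 <= L * (K3 * (1 + L)) by rewrite !mulr_ge0.
have p5 : 0 <= A * (1 + L) ^+ 2 by rewrite mulr_ge0// sqr_ge0.
have [w0 w1 w2 w3 w4] : [/\ M1 <= W, W1 <= W, W2 <= W, W3 <= W & W4 <= W].
  by apply: le_sum5 => //; rewrite ?addr_ge0.
exists W => [|s t x sT tT]; first exact: le_trans w0.
have [u1 y1 u2 y2] := HL s t x sT tT; have [u1' _ _ _] := HL t s x tT sT.
have d0 := normr_ge0 (t - s).
have q0 := sqr_ge0 (t - s).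
have lm (k w P Q : R) : `|k| <= P -> `|w| <= Q -> `|k * w| <= P * Q by move=> hu hw; rewrite normrM ler_pM.
have st : `|t - s| + `|y t x - y s x| <= (1 + L) * `|t - s| by rewrite mulrDl mul1r lerD2l.
have c1 := le_trans (C1 t (y t x) s (y s x)) (ler_wpM2l K10 st).
have c2 := le_trans (C2 t (y t x) s (y s x)) (ler_wpM2l K20 st).
have c3 := le_trans (C3 t (y t x) s (y s x)) (ler_wpM2l K30 st).
have b1 := B1 t (y t x); have b2 := B2 t (y t x); have b3 := B3 t (y t x); have b3' := B3 s (y s x).
rewrite /= in b1 b2 b3 b3' c1 c2 c3.
have mono (k : R) : k <= W -> k * `|t - s| <= W * `|t - s| by move=> ?; rewrite ler_wpM2r.
split.
- exact: le_trans b1 w0.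
- apply: (le_trans (ler_normD _ _)); apply: le_trans w1; apply: lerD b2 _; exact: lm u1 b3.
- by apply: (le_trans c1); rewrite mulrA; apply: mono.
- rewrite (_ : _ - _ = (dpt phi t (y t x) - dpt phi s (y s x)) + u t x * (dpx phi t (y t x) - dpx phi s (y s x))
     + (u t x - u s x) * dpx phi s (y s x)); last by ring.
  apply: (le_trans (ler_normD _ _)); apply: (le_trans (lerD (ler_normD _ _) (lexx _))).
  have h1 := lm _ _ _ _ u1 c3; have h2 := lm _ _ _ _ u2 b3'.
  apply: (@le_trans _ _ ((K2 * (1 + L) + L * (K3 * (1 + L)) + L * M3) * `|t - s|)).
    have -> : (K2 * (1 + L) + L * (K3 * (1 + L)) + L * M3) * `|t - s| =
      K2 * ((1 + L) * `|t - s|) + L * (K3 * ((1 + L) * `|t - s|)) + L * `|t - s| * M3 by ring.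
    by apply: lerD h2; exact: lerD.
  exact: mono w3.
- rewrite (_ : _ - _ = (phi t (y t x) - phi s (y s x) - (t - s) * dpt phi s (y s x) - (y t x - y s x) * dpx phi s (y s x))
     + (y t x - y s x - (t - s) * u s x) * dpx phi s (y s x)); last by ring.
  apply: (le_trans (ler_normD _ _)).
  have h1 := HA t (y s x) s (y t x); have h2 := lm _ _ _ _ y2 b3'.
  have h3 : (`|t - s| + `|y t x - y s x|) ^+ 2 <= ((1 + L) * `|t - s|) ^+ 2.
    by rewrite ler_pXn2r// nnegrE ?addr_ge0// mulr_ge0.
  have {h3} := ler_wpM2l A0 h3; rewrite exprMn real_normK ?num_real// => h3.
  apply: (@le_trans _ _ ((A * (1 + L) ^+ 2 + L * M3) * (t - s) ^+ 2)).
    have -> : (A * (1 + L) ^+ 2 + L * M3) * (t - s) ^+ 2 =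
      A * ((1 + L) ^+ 2 * (t - s) ^+ 2) + L * (t - s) ^+ 2 * M3 by ring.
    by apply: lerD => //; exact: le_trans h1 h3.
  exact: ler_wpM2r q0 _ _ w4.
Qed.

End TestAlongCurves.

(** * Differentiation under the integral sign *)

Section IntegralDerivative.
Variable R : realType.
Notation leb := (@lebesgue_measure R).
Variables (f f' : R -> R -> R) (w : R -> R) (D : set R).
Hypotheses (mD : measurable D) (ff : unif_deriv f f') (mf : forall t, measurable_fun setT (f t))
  (mf' : forall t, measurable_fun setT (f' t)) (mw : measurable_fun setT w) (w0 : forall x, 0 <= w x)
  (iw : leb.-integrable D (EFin \o w)).

Lemma weighted_integrable (h : R -> R) (L : R) : measurable_fun setT h -> (forall x, `|h x| <= L) ->
  leb.-integrable D (EFin \o (fun x => h x * w x)).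
Proof.
move=> mh hL; apply: (@integrable_le _ _ _ leb D _ (fun x => L * w x)) => //.
- by apply: measurable_funTS; exact: measurable_funM.
- by move=> x _; rewrite normrM (ger0_norm (w0 x)) ler_wpM2r.
- exact: RintegrableZ.
Qed.

Lemma weighted_le (h : R -> R) (L : R) : measurable_fun setT h -> (forall x, `|h x| <= L) ->
  `|\int[leb]_(x in D) (h x * w x)| <= L * \int[leb]_(x in D) w x.
Proof.
move=> mh hL; rewrite -RintegralZl//; apply: Rintegral_abs_le => //.
- exact: weighted_integrable mh hL.
- exact: RintegrableZ.
- by move=> x _; rewrite normrM (ger0_norm (w0 x)) ler_wpM2r.
Qed.

Let I t := \int[leb]_(x in D) (f t x * w x).
Let J t := \int[leb]_(x in D) (f' t x * w x).

Let fi t : leb.-integrable D (EFin \o (fun x => f t x * w x)).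
Proof. by have [L L0 HL] := ff `|t|; apply: (@weighted_integrable _ L) => // x; have [] := HL t t x (lexx _) (lexx _). Qed.

Let f'i t : leb.-integrable D (EFin \o (fun x => f' t x * w x)).
Proof. by have [L L0 HL] := ff `|t|; apply: (@weighted_integrable _ L) => // x; have [] := HL t t x (lexx _) (lexx _). Qed.

Lemma integral_rate_continuous : continuous J.
Proof.
move=> t; have [L L0 HL] := ff (`|t| + 1).
pose V := \int[leb]_(x in D) w x; have V0 : 0 <= V by apply: Rintegral_ge0.
apply/cvgrPdist_le => e e0.
have LV : 0 < L * V + 1 by rewrite ltr_wpDl// mulr_ge0.
apply/nbhs_ballP; exists (Num.min 1 (e / (L * V + 1))); first by rewrite /= lt_min ltr01 divr_gt0.
move=> s; rewrite /ball/= lt_min => /andP[st1]; rewrite ltr_pdivlMr// => st2.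
have sT : `|s| <= `|t| + 1 by have := ler_normB t (t - s); rewrite subKr; lra.
have tT : `|t| <= `|t| + 1 by lra.
rewrite /J -RintegralB//.
rewrite (_ : \int[leb]_(x in D) _ = \int[leb]_(x in D) ((f' t x - f' s x) * w x)); last first.
  by apply: Rintegral_eq => x _; ring.
apply: (le_trans (@weighted_le (fun x => f' t x - f' s x) (L * `|t - s|) _ _)).
- exact: measurable_funB.
- by move=> x; have [] := HL s t x sT tT.
- apply: le_trans (ltW st2); rewrite -/V mulrDr mulr1 (_ : L * `|t - s| * V = `|t - s| * (L * V)); last by ring.
  by have := normr_ge0 (t - s); lra.
Qed.

(** On a short interval both the remainder of the integrated function and the variation of its rate
    cost $L(b-a)^2$ times the integral of the weight, and telescoping removes these errors. *)
Lemma integral_deriv t : 0 <= t -> I t - I 0 = \int[leb]_(r in `[0, t]) J r.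
Proof.
move=> t0; have [L L0 HL] := ff t.
have lJ := loc_int_cont integral_rate_continuous.
pose V := \int[leb]_(x in D) w x; have V0 : 0 <= V by apply: Rintegral_ge0.
pose F r := I r - \int[leb]_(q in `[0, r]) J q.
suff : F 0 = F t by rewrite /F set_itv1 Rintegral_set1; lra.
apply: (@telescope_eq _ F id) => // e e0.
have LV : 0 < 2 * (L * V) + 1 by rewrite ltr_wpDl// !mulr_ge0.
exists (e / (2 * (L * V) + 1)) => [|a b a0 ab bt]; first exact: divr_gt0.
rewrite ltr_pdivlMr// => bae.
have ba : 0 <= b - a by lra.
have aT : `|a| <= t by rewrite ger0_norm; lra.
have bT : `|b| <= t by rewrite ger0_norm; lra.
rewrite /F (Rint_cat lJ a0 ab).
rewrite (_ : _ - _ = (I b - I a - (b - a) * J a) - (\int[leb]_(x in `[a, b]) J x - (b - a) * J a)); last by ring.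
apply: (le_trans (ler_normB _ _)).
have H1 : `|I b - I a - (b - a) * J a| <= (L * (b - a) ^+ 2) * V.
  rewrite /I /J -RintegralB// -RintegralZl// -RintegralB//; last 2 first.
  - exact: RintegrableB.
  - exact: RintegrableZ.
  rewrite (_ : \int[leb]_(x in D) _ = \int[leb]_(x in D) ((f b x - f a x - (b - a) * f' a x) * w x)); last first.
    by apply: Rintegral_eq => x _; ring.
  apply: weighted_le; last by move=> x; have [] := HL a b x aT bT.
  by apply: measurable_funB; [exact: measurable_funB|exact: measurable_funM].
have H2 : `|\int[leb]_(x in `[a, b]) J x - (b - a) * J a| <= (L * (b - a) * V) * (b - a).
  rewrite [(b - a) * J a]mulrC -(Rint_itv_cst (J a) ab) -RintegralB//; last 2 first.
  - exact: lJ.2.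
  - exact: integrable_itv_cst.
  rewrite -(Rint_itv_cst _ ab); apply: Rintegral_abs_le => //.
  - by apply: RintegrableB => //; [exact: lJ.2|exact: integrable_itv_cst].
  - exact: integrable_itv_cst.
  move=> r; rewrite /= in_itv/= => /andP[ar rb].
  have rT : `|r| <= t by rewrite ger0_norm; lra.
  rewrite /J -RintegralB//.
  rewrite (_ : \int[leb]_(x in D) _ = \int[leb]_(x in D) ((f' r x - f' a x) * w x)); last first.
    by apply: Rintegral_eq => x _; ring.
  apply: weighted_le; first exact: measurable_funB.
  move=> x; have [_ _ _ + _] := HL a r x aT rT; move=> /le_trans; apply.
  by rewrite ler_wpM2l// ger0_norm; lra.
apply: (le_trans (lerD H1 H2)).
rewrite (_ : _ + _ = (b - a) * (2 * (L * V)) * (b - a)); last by ring.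
by rewrite ler_wpM2r//; move: bae; rewrite mulrDr mulr1; lra.
Qed.

(** [f] vanishes at large times, so its rate integrates to minus the initial value. This is the
    shape of a weak equation, obtained here from an identity along trajectories. *)
Lemma integral_weak (N : R) : (forall t x, N < `|t| -> f t x = 0 /\ f' t x = 0) ->
  (\int[leb]_(r in [set r : R | (0 <= r)%R]) (J r)%:E = - (I 0)%:E)%E.
Proof.
move=> fN.
have z (h : R -> R) : (forall x, h x = 0) -> \int[leb]_(x in D) (h x * w x) = 0.
  move=> h0; rewrite (_ : \int[leb]_(x in D) _ = \int[leb]_(x in D) (0 * w x)); last first.
    by apply: Rintegral_eq => x _; rewrite h0.
  by rewrite RintegralZl// mul0r.
have JN r : N < `|r| -> J r = 0 by move=> Nr; apply: z => x; exact: (fN r x Nr).2.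
have i := test_integrable_half integral_rate_continuous JN.
have mh : (measurable : set (set (measurableTypeR R))) [set r : R | 0 <= r].
  by rewrite -set_itvcy; exact: measurable_itv.
rewrite (@integralE_fin _ _ _ leb)// -EFinN; congr EFin.
pose T := `|N| + 1; have T0 : 0 <= T by rewrite /T; have := normr_ge0 N; lra.
have NT : N < `|T| by rewrite (ger0_norm T0) /T; have := ler_norm N; lra.
have := integral_deriv T0; rewrite {1}/I z ?sub0r => [->|x]; last exact: (fN T x NT).1.
rewrite [LHS]Rintegral_mkcond [RHS]Rintegral_mkcond; congr Rintegral; apply/funext => r.
rewrite !patchE; have [rT|rT] := leP r T.
  by congr (if _ then _ else _); apply/idP/idP; rewrite !inE/= in_itv/= rT andbT.
rewrite [in RHS]memNset; last by rewrite /= in_itv/= => /andP[_]; rewrite leNgt rT.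
case: ifP => // _; apply: JN; apply: (lt_le_trans NT).
by rewrite (ger0_norm T0) (le_trans (ltW rT))// ler_norm.
Qed.

End IntegralDerivative.

(** * Far-field behaviour *)

Section Decay.
Variable R : realType.
Notation leb := (@lebesgue_measure R).
Implicit Types (m : {finite_measure set R -> \bar R}) (x z h M : R) (f g : R -> R).

Lemma integrable_oneDsqrV : leb.-integrable setT (EFin \o (fun x => (oneDsqr x)^-1)).
Proof.
have ge0 x : 0 <= (oneDsqr x)^-1 by rewrite invr_ge0 (le_trans ler01) ?oneDsqr_ge1.
apply/integrableP; split.
  by apply/measurable_EFinP; apply: continuous_measurable_fun; exact: continuous_oneDsqrV.
rewrite (_ : (\int[leb]_x `|_|)%E = (\int[leb]_x ((oneDsqr x)^-1)%:E)%E); last first.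
  by apply: eq_integral => x _ /=; rewrite ger0_norm.
rewrite (@ge0_symfun_integralT R (fun x => (oneDsqr x)^-1))//.
- by rewrite -set_itvcy integral0y_oneDsqr -EFinM ltry.
- exact: continuous_oneDsqrV.
- by move=> x /=; rewrite /oneDsqr sqrrN.
Qed.

(** Chebyshev's inequality with the weight $1+z^2$. *)
Lemma rmeas_moment m (A : set R) M x : measurable A -> m.-integrable setT (EFin \o (fun z => z ^+ 2)) ->
  \int[m]_z (z ^+ 2) <= M -> (forall z, A z -> x ^+ 2 <= z ^+ 2) ->
  rmeas m A <= (mass m + M) * (oneDsqr x)^-1.
Proof.
move=> mA im iM Ax.
have o0 : 0 < oneDsqr x by rewrite (lt_le_trans ltr01) ?oneDsqr_ge1.
have i1 : m.-integrable setT (EFin \o (fun _ : R => 1 : R)).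
  by apply: (@finite_integrable _ _ _ 1) => // z; rewrite normr1.
have iA : m.-integrable setT (EFin \o (\1_A : R -> R)).
  apply: (@finite_integrable _ _ _ 1); first exact: measurable_indic.
  by move=> z; rewrite indicE; case: (_ \in _); rewrite ?normr0 ?normr1.
rewrite ler_pdivlMr// -(Rint_indic m mA) mulrC -RintegralZl//.
apply: (@le_trans _ _ (\int[m]_z (1 + z ^+ 2))); last first.
  by rewrite RintegralD//; apply: lerD => //; rewrite mass_Rint.
apply: le_trans (ler_norm _) _; apply: Rintegral_abs_le => //.
- exact: RintegrableZ.
- exact: RintegrableD.
- move=> z _; rewrite indicE; case: (boolP (z \in A)) => zA.
    by rewrite mulr1 ger0_norm ?(ltW o0)// /oneDsqr lerD2l Ax//; move: zA; rewrite inE.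
  by rewrite mulr0 normr0 addr_ge0 ?sqr_ge0.
Qed.

(** For $|x|\ge1$ the step has reached its limit and the difference is a tail of the measure. For
    $|x|<1$ the trivial bound by the mass suffices, since $1+x^2\le2$; this is the origin of the
    factor 2. *)
Lemma Nl_step_decay (s : R -> R) m M x : (forall x, x <= -1 -> s x = 0) -> (forall x, 1 <= x -> s x = 1) ->
  (forall x, 0 <= s x <= 1) -> m.-integrable setT (EFin \o (fun z => z ^+ 2)) ->
  \int[m]_z (z ^+ 2) <= M -> `|Nl m x - mass m * s x| <= 2 * (mass m + M) * (oneDsqr x)^-1.
Proof.
move=> s0 s1 s01 im iM.
have M0 : 0 <= M by apply: le_trans iM; apply: Rintegral_ge0 => z _; exact: sqr_ge0.
have m0 := mass_ge0 m.
have o0 : 0 < oneDsqr x by rewrite (lt_le_trans ltr01) ?oneDsqr_ge1.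
have mM : 0 <= (mass m + M) * (oneDsqr x)^-1 by apply: mulr_ge0; [exact: addr_ge0|rewrite invr_ge0 ltW].
rewrite -mulrA; have [x1|x1] := leP x (-1).
  rewrite s0// mulr0 subr0 ger0_norm ?Nl_ge0//; apply: (@le_trans _ _ ((mass m + M) * (oneDsqr x)^-1)).
    apply: rmeas_moment => // z /= zx; rewrite -[x ^+ 2]sqrrN -[z ^+ 2]sqrrN.
    by rewrite ler_sqr ?nnegrE; lra.
  by lra.
have [x2|x2] := leP 1 x.
  rewrite s1// mulr1 distrC ger0_norm ?subr_ge0 ?Nl_le_mass//; apply: (@le_trans _ _ ((mass m + M) * (oneDsqr x)^-1)).
    rewrite -rmeas_ge; apply: rmeas_moment => // z /= zx.
    by rewrite ler_sqr ?nnegrE; lra.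
  by lra.
apply: (@le_trans _ _ (mass m)).
  have /andP[h1 h2] := s01 x; have h3 := Nl_ge0 m x; have h4 := Nl_le_mass m x.
  have h5 : 0 <= mass m * s x by rewrite mulr_ge0.
  have h6 : mass m * s x <= mass m by rewrite ler_piMr.
  by rewrite ler_norml; apply/andP; split; lra.
rewrite mulrA ler_pdivlMr//.
have : mass m * oneDsqr x <= mass m * 2.
  apply: ler_wpM2l => //; rewrite /oneDsqr -[X in _ <= X]/(1 + 1) lerD2l.
  by rewrite -[X in X <= _]real_normK ?num_real// expr_le1// ler_norml; lra.
by lra.
Qed.

Lemma tonelli_sections d1 d2 (X : measurableType d1) (Y : measurableType d2)
    (m1 : {sigma_finite_measure set X -> \bar R}) (m2 : {sigma_finite_measure set Y -> \bar R})
    (A : set (X * Y)) : measurable A ->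
  (\int[m1]_x m2 (xsection A x) = \int[m2]_y m1 (ysection A y))%E.
Proof.
move=> mA; have := @indic_fubini_tonelli _ _ _ _ _ m1 m2 A mA.
by rewrite indic_fubini_tonelli_FE// indic_fubini_tonelli_GE.
Qed.

(** Fubini: a given [z] belongs to the windows whose centres fill an interval of length [2 * h]. *)
Lemma Nl_window_integral m h : 0 <= h ->
  (\int[leb]_x (Nl m (x + h) - Nl m (x - h))%:E = (2 * h * mass m)%:E)%E.
Proof.
move=> h0; pose A := [set w : measurableTypeR R * R | w.1 - h <= w.2 < w.1 + h].
have mA : measurable A.
  have m1 : measurable_fun setT (fun w : measurableTypeR R * R => w.1 : R) by exact: measurable_fst.
  have m2 : measurable_fun setT (fun w : measurableTypeR R * R => w.2 : R) by exact: measurable_snd.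
  have mB : measurable_fun setT (fun w : measurableTypeR R * R => w.1 - h <= w.2 < w.1 + h).
    apply: measurable_and; first by apply: measurable_fun_ler => //; exact: measurable_funB.
    by apply: measurable_fun_ltr => //; exact: measurable_funD.
  by have := mB measurableT [set true] I; rewrite setTI.
have := @tonelli_sections _ _ (measurableTypeR R) R leb m A mA.
rewrite (_ : (\int[leb]_x m (xsection A x))%E = (\int[leb]_x (Nl m (x + h) - Nl m (x - h))%:E)%E); last first.
  apply: eq_integral => x _; rewrite -rmeas_itvco ?lerD2l; last by lra.
  rewrite -rmeasE//; congr (m _); apply/seteqP; split => z /=; rewrite /xsection/= inE /A/= in_itv//=.
move=> ->; transitivity (\int[m]_z (2 * h)%:E)%E; last first.
  by rewrite integral_cst// [in RHS]EFinM /mass -rmeasE.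
apply: eq_integral => z _; rewrite (_ : ysection A z = `]z - h, z + h]%classic); last first.
  apply/seteqP; split => x /=; rewrite /ysection/= inE /A/= in_itv/=; lra.
apply: etrans (@lebesgue_measure_itv R (`]z - h, z + h])) _; rewrite /= lte_fin; case: ifP => // hh; first by rewrite -EFinB; congr (_%:E); ring.
by congr (_%:E); move: hh => /negbT; rewrite -leNgt; lra.
Qed.

Lemma Nl_window_integrable m h : 0 <= h ->
  leb.-integrable setT (EFin \o (fun x => Nl m (x + h) - Nl m (x - h))) /\
  \int[leb]_x (Nl m (x + h) - Nl m (x - h)) = 2 * h * mass m.
Proof.
move=> h0; split; last by rewrite /Rintegral Nl_window_integral.
have ms k : measurable_fun setT (fun x => Nl m (x + k)).
  by apply: nondecreasing_measurable => // x y xy; apply: Nl_mono; rewrite lerD2r.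
apply/integrableP; split; first by apply/measurable_EFinP; apply: measurable_funB; [exact: ms|exact: (ms (- h))].
have w0 (x : R) : 0 <= Nl m (x + h) - Nl m (x - h) by rewrite subr_ge0; apply: Nl_mono; lra.
under eq_integral => x _ do rewrite /= ger0_norm//.
by rewrite Nl_window_integral// ltry.
Qed.

Lemma ae_imply2 (P Q S : R -> Prop) : {ae leb, forall x, P x} -> {ae leb, forall x, Q x} ->
  (forall x, P x -> Q x -> S x) -> {ae leb, forall x, S x}.
Proof.
move=> hP hQ H; apply: negligibleS (negligibleU hP hQ) => x /= nS.
by apply: contrapT => /not_orP[/contrapT p /contrapT q]; apply: nS; exact: H.
Qed.

Lemma sqrD_le (p q u v : R) : p ^+ 2 <= u -> q ^+ 2 <= v -> (p + q) ^+ 2 <= 2 * u + 2 * v.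
Proof. by move=> pu qv; have := sqr_ge0 (p - q); rewrite !expr2 in pu qv *; lra. Qed.

Lemma L2D f g : L2 f -> L2 g -> L2 (fun x => f x + g x).
Proof.
move=> [mf f2] [mg g2]; have mfg : measurable_fun setT (fun x => f x + g x) by exact: measurable_funD.
split => //; apply: (@integrable_le _ _ _ leb setT _ (fun x => 2 * (f x ^+ 2 + g x ^+ 2))) => //.
- exact: measurable_funX.
- move=> x _; rewrite ger0_norm ?sqr_ge0//.
  by rewrite mulrDr; exact: sqrD_le.
- by apply: RintegrableZ => //; exact: RintegrableD.
Qed.

End Decay.

(** * The spaces with prescribed far field *)

Section FarFieldSpaces.
Variable R : realType.
Notation leb := (@lebesgue_measure R).
Variables psip psim : R -> R.
Implicit Types (f g w : R -> R) (m : {finite_measure set R -> \bar R}).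

Definition inE2_0 f := exists fb (a b : R), L2 fb /\ Defs.ae_eq f (fun x => fb x + a * psip x + b * psim x).

Lemma inE2_0D f g : inE2_0 f -> inE2_0 g -> inE2_0 (fun x => f x + g x).
Proof.
move=> [f1 [a1 [b1 [L1 E1]]]] [f2 [a2 [b2 [L2' E2]]]].
exists (fun x => f1 x + f2 x), (a1 + a2), (b1 + b2); split; first exact: L2D.
by apply: (ae_imply2 E1 E2) => x -> ->; ring.
Qed.

Lemma inE2_0_of_inE2 f : inE2 psip psim f -> inE2_0 f.
Proof. by move=> [fb [a [b [[h _] E]]]]; exists fb, a, b. Qed.

Lemma inE2_0_of_norm f (c : R) : E20_norm_le psip psim f c -> inE2_0 f.
Proof. by move=> [fb [a [b [h [E _]]]]]; exists fb, a, b. Qed.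

Hypotheses (sp : smooth1 psip) (sm : smooth1 psim).
Hypothesis psip0 : forall x, x <= -1 -> psip x = 0.
Hypothesis psip1 : forall x, 1 <= x -> psip x = 1.
Hypothesis psum : forall x, psip x + psim x = 1.

(** A square integrable derivative upgrades $E_2^0$ to $E_2$. Subtracting the asymptotic profile
    changes the derivative only by [k], which vanishes outside $[-1,1]$ because [psip] and [psim]
    are constant there. *)
Lemma inE2_of_prim w g : prim w g -> leb.-integrable setT (EFin \o (fun x => g x ^+ 2)) ->
  inE2_0 w -> inE2 psip psim w.
Proof.
move=> pw g2 [fb [a [b [[mfb fb2] E]]]].
have psim1 : forall x, x <= -1 -> psim x = 1 by move=> x h; have := psum x; rewrite psip0//; lra.
have psim0 : forall x, 1 <= x -> psim x = 0 by move=> x h; have := psum x; rewrite psip1//; lra.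
have pp := prim_smooth1 sp; have pm := prim_smooth1 sm.
have pf := primD (primD pw (primZ (- a) pp)) (primZ (- b) pm).
pose f := fun x => w x + - a * psip x + - b * psim x.
pose k := fun x => - a * derive1 psip x + - b * derive1 psim x.
have pk : prim (fun x => - a * psip x + - b * psim x) k by exact: (primD (primZ (- a) pp) (primZ (- b) pm)).
have k0 x : ~ `[-1, 1]%classic x -> k x = 0.
  have der1 (h : R -> R) (u : R) : (\forall y \near x, h y = u) -> derive1 h x = 0.
    by move=> hu; rewrite derive1E (@near_eq_derive _ _ _ h (cst u)) ?derive_cst.
  have nlt (y z : R) : y < z -> \forall t \near y, t <= z.
    by move=> yz; near=> t; apply: ltW; near: t; exact: lt_nbhsl.
  have ngt (y z : R) : z < y -> \forall t \near y, z <= t.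
    by move=> yz; near=> t; apply: ltW; near: t; exact: lt_nbhsr.
  rewrite /= in_itv/= => /negP; rewrite negb_and -!ltNge /k => /orP[] h.
    rewrite (der1 psip 0) ?(der1 psim 1) ?mulr0 ?addr0//.
      by apply: (filterS _ (nlt _ _ h)) => y; exact: psim1.
    by apply: (filterS _ (nlt _ _ h)) => y; exact: psip0.
  rewrite (der1 psip 1) ?(der1 psim 0) ?mulr0 ?addr0//.
    by apply: (filterS _ (ngt _ _ h)) => y; exact: psim0.
  by apply: (filterS _ (ngt _ _ h)) => y; exact: psip1.
exists f, a, b; split; last first.
  by apply: aeW => x; rewrite /f; ring.
have cf := prim_continuous pf.
have mf : measurable_fun setT f by exact: (continuous_measurable_fun cf).
have k2 : leb.-integrable setT (EFin \o (fun x => k x ^+ 2)).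
  apply/(@integrable_support _ _ _ leb `[-1, 1]%classic) => //.
    by move=> x /k0 ->; rewrite expr0n.
  have ck : continuous k.
    have dd (h : R -> R) : smooth1 h -> continuous (derive1 h).
      by move=> sh; exact: smooth1_continuous (smooth1_derive1 sh).
    by apply: cont_add; apply: cont_mul; try exact: dd; exact: cst_continuous.
  have ck2 : continuous (fun x => k x ^+ 2) by apply: (cont_mul ck ck).
  by have [_] := loc_int_cont ck2; exact.
split; last first.
  exists (fun x => g x + - a * derive1 psip x + - b * derive1 psim x); split; first exact: prim_weak_deriv.
  have := @L2D R g k (conj pw.1.1 g2) (conj pk.1.1 k2).
  by rewrite /k; under [X in L2 X -> _]funext => x do rewrite addrA.
split => //.
have mf2 : measurable_fun setT (fun x => f x ^+ 2) by exact: measurable_funX.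
have E2 : {ae leb, forall x : R, setT x -> (f x ^+ 2)%:E = (fb x ^+ 2)%:E}.
  by apply: (ae_imply2 E E) => x wE _ _; rewrite /f wE; congr (_%:E); ring.
have [_ h] := integrableP _ _ _ fb2; apply/integrableP; split; first exact/measurable_EFinP.
apply: le_lt_trans h; rewrite le_eqVlt; apply/orP; left; apply/eqP.
apply: ge0_ae_eq_integral => //.
- by apply/measurable_EFinP; exact: measurableT_comp.
- by apply/measurable_EFinP; apply: measurableT_comp => //; exact: measurable_funX.
- by apply: (ae_imply2 E2 E2) => x wE _ _; congr (`|_|)%E; exact: wE.
Unshelve. all: by end_near.
Qed.

End FarFieldSpaces.

(** * The flow of a Lagrangian state *)

Section NullSets.
Variable R : realType.
Notation leb := (@lebesgue_measure R).

Lemma integral_off_null (f h : R -> R) (Z : set R) : measurable_fun setT f -> measurable_fun setT h ->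
  measurable Z -> leb Z = 0%E -> (forall x, ~ Z x -> f x = h x) ->
  (\int[leb]_x (f x)%:E = \int[leb]_x (h x)%:E)%E.
Proof.
move=> mf mh mZ Z0 H; apply: ae_eq_integral => //; try exact/measurable_EFinP.
by exists Z; split => // x /=; apply: contra_notP => nZ _; rewrite H.
Qed.

Lemma prim_compact_support (f g : R -> R) (N : R) : 0 <= N -> prim f g -> (forall x, N < `|x| -> f x = 0) ->
  (forall x, N < `|x| -> g x = 0) -> \int[leb]_x g x = 0.
Proof.
move=> N0 pf f0 g0; have g0' x : N + 1 < `|x| -> g x = 0 by move=> h; apply: g0; lra.
have [_ ->] := loc_int_compact_support pf.1 g0'; rewrite -pf.2; last by lra.
rewrite !f0 ?subrr//; rewrite ?normrN ger0_norm; lra.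
Qed.

End NullSets.

Lemma half_bound (R : realType) (x k c : R) : 0 <= k -> 0 <= c -> `|x| <= c / 2 ->
  `|x| <= k + c /\ `|x / 2| <= k + c.
Proof. by move=> k0 c0; rewrite !ler_norml => /andP[h1 h2]; split; apply/andP; split; lra. Qed.

Section Flow.
Variable R : realType.
Notation leb := (@lebesgue_measure R).
Variables (y0 U0 a b c : R -> R) (K0 KU : R).
Implicit Types (x z p q xi k t r : R).
Hypothesis py : prim y0 a.
Hypothesis pU : prim U0 b.
Hypothesis a0 : forall xi, 0 <= a xi.
Hypothesis c0 : forall xi, 0 <= c xi.
Hypothesis acb : forall xi, a xi * c xi = b xi ^+ 2.
Hypothesis ac1 : forall xi, a xi + c xi = 1.
Hypothesis mc : measurable_fun setT c.
Hypothesis ic : leb.-integrable setT (EFin \o c).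
Hypothesis yK : forall xi, `|y0 xi - xi| <= K0.
Hypothesis UK : forall xi, `|U0 xi| <= KU.
Notation H := (energy_before c).
Variable C : R.
Hypothesis CE : \int[leb]_xi c xi = C.

Let C0 : 0 <= C. Proof. by rewrite -CE; exact: Rintegral_ge0. Qed.
Let lc : loc_int c.
Proof. by split => // u v; apply: (@integrableS _ _ _ leb setT) => //; exact: measurable_itv. Qed.

(** Half the difference between the energies to the left and to the right of the particle; the right
    side of the velocity equation is thus [flow_force xi / 2]. *)
Definition flow_force xi := H xi - C / 2.
Definition flow_y t xi := y0 xi + t * U0 xi + t ^+ 2 / 4 * flow_force xi.
Definition flow_U t xi := U0 xi + t / 2 * flow_force xi.
Definition flow_a t xi := a xi + t * b xi + t ^+ 2 / 4 * c xi.
Definition flow_b t xi := b xi + t / 2 * c xi.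

Lemma flow_force_bound xi : `|flow_force xi| <= C / 2.
Proof. by have /andP[h1 h2] := energy_before_bound c0 mc ic xi; rewrite CE in h2; rewrite ler_norml /flow_force; lra. Qed.

Lemma prim_force : prim flow_force c.
Proof.
split=> // p q pq; rewrite -(energy_beforeB mc ic pq) /flow_force; ring.
Qed.

Lemma prim_flow_y t : prim (flow_y t) (flow_a t).
Proof. exact: primD (primD py (primZ t pU)) (primZ _ prim_force). Qed.

Lemma prim_flow_U t : prim (flow_U t) (flow_b t).
Proof. exact: primD pU (primZ _ prim_force). Qed.

Lemma flow_acb t xi : flow_a t xi * c xi = flow_b t xi ^+ 2.
Proof.
rewrite /flow_a /flow_b (_ : (a xi + t * b xi + t ^+ 2 / 4 * c xi) * c xi =
  a xi * c xi + t * b xi * c xi + t ^+ 2 / 4 * c xi ^+ 2); last by ring.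
by rewrite acb; field.
Qed.

(** Where $c>0$ one has $a_t=b_t^2/c$; where $c=0$, also $b=0$ and $a_t=a$ for all times. Hence
    particles may collide but never cross. *)
Lemma flow_a_ge0 t xi : 0 <= flow_a t xi.
Proof.
have := c0 xi; rewrite le_eqVlt => /predU1P[cx|cx]; last first.
  by rewrite -(pmulr_lge0 _ cx) flow_acb sqr_ge0.
have bx : b xi = 0 by apply/eqP; rewrite -sqrf_eq0 -acb -cx mulr0.
by rewrite /flow_a bx -cx !mulr0 !addr0.
Qed.

Definition flow_K t := K0 + `|t| * KU + t ^+ 2 / 4 * (C / 2).

Lemma flow_y_shift t xi : `|flow_y t xi - y0 xi| <= `|t| * KU + t ^+ 2 / 4 * (C / 2).
Proof.
rewrite (_ : _ - _ = t * U0 xi + t ^+ 2 / 4 * flow_force xi); last by rewrite /flow_y; ring.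
apply: (le_trans (ler_normD _ _)); apply: lerD; rewrite normrM; first by rewrite ler_wpM2l.
by rewrite ger0_norm ?divr_ge0 ?sqr_ge0// ler_wpM2l ?divr_ge0 ?sqr_ge0// flow_force_bound.
Qed.

Lemma flow_yK t xi : `|flow_y t xi - xi| <= flow_K t.
Proof.
have := ler_normD (flow_y t xi - y0 xi) (y0 xi - xi); rewrite addrA subrK.
have := flow_y_shift t xi; have := yK xi; rewrite /flow_K; lra.
Qed.

Definition flow_u t := velocity (flow_y t) (flow_U t).
Definition flow_mu t := energy (prim_flow_y t) c0 mc ic.

Lemma flow_u_lagrangian t xi : flow_u t (flow_y t xi) = flow_U t xi.
Proof.
exact: (velocity_lagrangian (prim_flow_y t) (prim_flow_U t) (flow_a_ge0 t) c0 (flow_acb t) mc ic (flow_yK t)).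
Qed.

Definition flow_g t := slope (flow_y t) (flow_a t) (flow_b t).

Lemma prim_flow_u t : prim (flow_u t) (flow_g t).
Proof.
exact: (prim_velocity (prim_flow_y t) (prim_flow_U t) (flow_a_ge0 t) c0 (flow_acb t) mc ic (flow_yK t)).
Qed.

Lemma flow_u_continuous t : continuous (flow_u t).
Proof. exact: prim_continuous (prim_flow_u t). Qed.

Lemma flow_mass t : mass (flow_mu t) = C.
Proof. by rewrite -CE; exact: energy_mass. Qed.

Lemma flow_distrib t x : Nl (flow_mu t) x = H (label (flow_y t) x).
Proof. exact: (energy_distrib (prim_flow_y t) (flow_a_ge0 t) c0 mc ic (flow_yK t)). Qed.

(** At almost every label with $a_t>0$ the position carries no atom, so [Nl] and [Nr] agree there
    and the Eulerian source is twice the force. At almost every other label $a_t=b_t=0$ and the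
    identities are trivial; for this reason they are stated with the factor $a_t$. *)
Lemma flow_distrib_lagrangian t : exists Z : set R, [/\ measurable Z, leb Z = 0%E & forall xi, ~ Z xi ->
  (flow_g t (flow_y t xi) * flow_a t xi = flow_b t xi) /\
  (Nl (flow_mu t) (flow_y t xi) - rmeas (flow_mu t) [set z | flow_y t xi < z]) * flow_a t xi =
    2 * flow_force xi * flow_a t xi].
Proof.
have [Z1 [mZ1 Z10 H1]] := slope_lagrangian (prim_flow_y t) (flow_a_ge0 t) (flow_acb t) (flow_yK t).
have [Z2 [mZ2 Z20 H2]] := flat_null (prim_flow_y t) (flow_a_ge0 t) (flow_acb t) (flow_yK t).
exists (Z1 `|` Z2); split; [exact: measurableU|exact: lebesgue_null_setU|].
move=> xi /not_orP[n1 n2]; split; first exact: H1.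
case: (H2 xi n2) => [[E [_ nN]]|[-> _]]; last by rewrite !mulr0.
set x := flow_y t xi in nN E *.
have at0 : rmeas (flow_mu t) [set x] = 0.
  rewrite /rmeas (_ : [set x] = [set x] `\` flat_set (flow_y t) (flow_a t)); last first.
    by apply/seteqP; split => z /= [] // ->.
  rewrite (energy_off_flat (prim_flow_y t) (prim_flow_U t) (flow_a_ge0 t) c0 (flow_acb t) mc ic (flow_yK t)) ?integral_set1//.
have NE : Nr (flow_mu t) x = Nl (flow_mu t) x.
  rewrite /Nr (_ : [set z | z <= x] = [set z | z < x] `|` [set x]); last first.
    apply/seteqP; split => z /=; first by rewrite le_eqVlt => /predU1P[->|->]; [right|left].
    by case=> [/ltW//|->].
  rewrite rmeasU ?at0 ?addr0//.
  by apply/seteqP; split => z //= -[zx zE]; move: zx; rewrite zE ltxx.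
rewrite rmeas_gt NE flow_mass flow_distrib E /flow_force; congr (_ * _).
by field.
Qed.

Lemma flow_unif_U : unif_deriv flow_U (fun t xi => flow_force xi / 2).
Proof.
have := @unif_deriv_quadratic R R U0 (fun xi => flow_force xi / 2) (fun _ => 0) (KU + C).
have KU0 : 0 <= KU by apply: le_trans (UK 0).
have h1 xi : `|U0 xi| <= KU + C by apply: le_trans (UK xi) _; rewrite lerDl.
have h2 xi : `|flow_force xi / 2| <= KU + C.
  exact: (half_bound KU0 C0 (flow_force_bound xi)).2.
have h3 (xi : R) : `|0 : R| <= KU + C by rewrite normr0 addr_ge0.
move=> /(_ h1 h2 h3).
rewrite (_ : (fun t xi => U0 xi + t * (flow_force xi / 2) + t ^+ 2 / 4 * 0) = flow_U); last first.
  by apply/funext => t; apply/funext => xi; rewrite /flow_U; field.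
rewrite (_ : (fun t xi => flow_force xi / 2 + t / 2 * 0) = (fun t xi => flow_force xi / 2))//.
by apply/funext => t; apply/funext => xi; rewrite mulr0 addr0.
Qed.

Let b1 xi : `|b xi| <= 1.
Proof.
have h := ac1 xi; have h1 := a0 xi; have h2 := c0 xi.
rewrite -(ler_pXn2r (n := 2))// ?nnegrE// real_normK ?num_real// -acb expr1n.
by rewrite -[X in _ <= X]mulr1 ler_pM//; lra.
Qed.

Lemma flow_unif_a : unif_deriv flow_a flow_b.
Proof.
apply: (@unif_deriv_quadratic R R a b c 1) => [xi|//|xi]; rewrite ger0_norm//.
  by have := ac1 xi; have := c0 xi; lra.
by have := ac1 xi; have := a0 xi; lra.
Qed.

Lemma flow_path T : exists2 L : R, 0 <= L & forall s t xi, `|s| <= T -> `|t| <= T ->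
    [/\ `|flow_U t xi| <= L, `|flow_y t xi - flow_y s xi| <= L * `|t - s|,
    `|flow_U t xi - flow_U s xi| <= L * `|t - s| &
    `|flow_y t xi - flow_y s xi - (t - s) * flow_U s xi| <= L * (t - s) ^+ 2].
Proof.
have KU0 : 0 <= KU by apply: le_trans (UK 0).
(* The initial position is unbounded; the estimate is applied with constant term 0, which changes no
   increment of [flow_y]. *)
have h1 (xi : R) : `|0 : R| <= KU + C by rewrite normr0 addr_ge0.
have h2 xi : `|U0 xi| <= KU + C by apply: le_trans (UK xi) _; rewrite lerDl.
have h3 xi : `|flow_force xi| <= KU + C by exact: (half_bound KU0 C0 (flow_force_bound xi)).1.
have [L L0 HL] := unif_deriv_quadratic h1 h2 h3 T.
exists L => // s t xi sT tT; have [_ e1 e2 e3 e4] := HL s t xi sT tT.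
by split => //; [move: e2|move: e4]; congr (`|_| <= _); rewrite /flow_y /flow_U; ring.
Qed.

Lemma flow_unif_test phi : test2 phi -> unif_deriv (fun t xi => phi t (flow_y t xi))
  (fun t xi => dpt phi t (flow_y t xi) + flow_U t xi * dpx phi t (flow_y t xi)).
Proof. by move=> tp; apply: unif_deriv_test => //; exact: flow_path. Qed.

Let mflow_y t : measurable_fun setT (flow_y t).
Proof. exact: (continuous_measurable_fun (prim_continuous (prim_flow_y t))). Qed.
Let mflow_U t : measurable_fun setT (flow_U t).
Proof. exact: (continuous_measurable_fun (prim_continuous (prim_flow_U t))). Qed.
Let mflow_a t : measurable_fun setT (flow_a t). Proof. exact: (prim_flow_y t).1.1. Qed.
Let mflow_b t : measurable_fun setT (flow_b t). Proof. exact: (prim_flow_U t).1.1. Qed.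
Let mflow_u t : measurable_fun setT (flow_u t).
Proof. exact: (continuous_measurable_fun (@flow_u_continuous t)). Qed.
Let mforce : measurable_fun setT flow_force.
Proof. exact: (continuous_measurable_fun (prim_continuous prim_force)). Qed.

Lemma measurable_dpart phi s t : test2 phi -> measurable_fun setT (dpart s phi t).
Proof.
move=> tp; apply: continuous_measurable_fun; apply: derivable_continuous => x.
by have [_ []] := tp.1 s.
Qed.

Let mdy phi s t : test2 phi -> measurable_fun setT (fun xi => dpart s phi t (flow_y t xi)).
Proof. by move=> tp; exact: (measurableT_comp (measurable_dpart s t tp) (mflow_y t)). Qed.

Lemma flow_energy_integral t (f : R -> R) : measurable_fun setT f ->
  (\int[flow_mu t]_x (f x)%:E = \int[leb]_xi (f (flow_y t xi) * c xi)%:E)%E.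
Proof.
move=> mf; exact: (@is_image_integral _ _ (measurableTypeR R) R R leb (flow_y t) c (mflow_y t) mc c0
  (flow_mu t) f (energyE (prim_flow_y t) c0 mc ic) mf).
Qed.

Lemma flow_lebesgue_integral t (f : R -> R) : measurable_fun setT f ->
  (\int[leb]_x (f x)%:E = \int[leb]_xi (f (flow_y t xi) * flow_a t xi)%:E)%E.
Proof.
move=> mf; exact: (@is_image_integral _ _ (measurableTypeR R) (measurableTypeR R) R leb (flow_y t) (flow_a t)
  (mflow_y t) (mflow_a t) (flow_a_ge0 t) leb f
  (lebesgue_lagrangian (prim_flow_y t) (flow_a_ge0 t) (flow_yK t)) mf).
Qed.

(** The density [c] does not depend on time, so the equation is the time derivative of
    $\int\varphi(t,y_t)\,c\,d\xi$. *)
Theorem flow_transport phi : test2 phi ->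
  (\int[leb]_(t in [set t : R | (0 <= t)%R]) \int[flow_mu t]_(x in setT)
        (dpt phi t x + flow_u t x * dpx phi t x)%:E
      = - \int[flow_mu 0%R]_(x in setT) (phi 0%R x)%:E)%E.
Proof.
move=> tp; have ud := flow_unif_test tp; have [N N0 HN] := test2_support tp.
pose f t xi := phi t (flow_y t xi).
pose f' t xi := dpt phi t (flow_y t xi) + flow_U t xi * dpx phi t (flow_y t xi).
have mf t : measurable_fun setT (f t) by exact: (mdy [::] t tp).
have mf' t : measurable_fun setT (f' t).
  apply: measurable_funD; first exact: (mdy [:: true] t tp).
  by apply: measurable_funM => //; exact: (mdy [:: false] t tp).
have fi (h : R -> R) L : measurable_fun setT h -> (forall xi, `|h xi| <= L) ->
    leb.-integrable setT (EFin \o (fun xi => h xi * c xi)).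
  by move=> mh hL; exact: (weighted_integrable measurableT mc c0 ic mh hL).
rewrite (_ : (\int[leb]_(t in _) _)%E = (\int[leb]_(t in [set t | (0 <= t)%R]) (\int[leb]_xi (f' t xi * c xi))%:E)%E); last first.
  apply: eq_integral => t _; rewrite flow_energy_integral; last first.
    apply: measurable_funD; first exact: (measurable_dpart [:: true] t tp).
    by apply: measurable_funM => //; exact: (measurable_dpart [:: false] t tp).
  have i : leb.-integrable setT (EFin \o (fun xi => f' t xi * c xi)).
    have [L L0 HL] := ud `|t|; apply: (fi _ L) => // xi.
    by have [] := HL t t xi (lexx _) (lexx _).
  apply: etrans _ (@integralE_fin _ _ _ leb _ _ measurableT i).
  by apply: eq_integral => xi _; rewrite flow_u_lagrangian.
rewrite (integral_weak measurableT ud mf mf' mc c0 ic (N := N)); last first.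
  move=> t xi tN; have := HN [:: true] t (flow_y t xi) (or_introl tN).
  have := HN [:: false] t (flow_y t xi) (or_introl tN); have := HN [::] t (flow_y t xi) (or_introl tN).
  by rewrite /= => -> -> ->; rewrite !(mulr0, mul0r, addr0).
congr (- _)%E; rewrite flow_energy_integral; last exact: (measurable_dpart [::] 0 tp).
have i : leb.-integrable setT (EFin \o (fun xi => f 0 xi * c xi)).
  have [L L0 HL] := ud 0; apply: (fi _ L) => // xi.
  by have [] := HL 0 0 xi; rewrite ?normr0.
exact: esym (@integralE_fin _ _ _ leb _ _ measurableT i).
Qed.

(** In Eulerian coordinates this is $\int(\tfrac12u^2\varphi)_x\,dx$. It accounts for the
    coefficient $\tfrac12$ of the flux in the momentum equation, once $\partial_ta_t=b_t$ has been
    used. *)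
Lemma flow_energy_flux phi t : test2 phi ->
  \int[leb]_xi (2^-1 * flow_U t xi ^+ 2 * dpx phi t (flow_y t xi) * flow_a t xi +
     flow_U t xi * phi t (flow_y t xi) * flow_b t xi) = 0.
Proof.
move=> tp; have [N N0 HN] := test2_support tp.
have [pp _] := test2_prim [::] tp.
have pu := prim_flow_u t.
have pW := primM (primZ (2^-1) (primM pu pu)) (pp t).
pose W x := phi t x * (2^-1 * (flow_u t x * flow_g t x + flow_u t x * flow_g t x)) +
  2^-1 * (flow_u t x * flow_u t x) * dpx phi t x.
have z : \int[leb]_x W x = 0.
  apply: (prim_compact_support N0 pW) => x xN.
    by rewrite -/(dpart [::] phi t x) (HN [::]) ?mulr0//; right.
  rewrite -/(dpart [::] phi t x) -/(dpart [:: false] phi t x) (HN [::]) ?(HN [:: false]); try by right.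
  by rewrite mul0r mulr0 addr0.
have mW : measurable_fun setT W by exact: pW.1.1.
rewrite -[RHS]z /Rintegral; congr fine; rewrite (flow_lebesgue_integral t mW).
have [Z [mZ Z0 HZ]] := flow_distrib_lagrangian t.
have m1 := mdy [:: false] t tp; have m0 := mdy [::] t tp.
apply: (integral_off_null _ _ mZ Z0).
- apply: measurable_funD; apply: measurable_funM => //; apply: measurable_funM => //.
  by apply: measurable_funM => //; exact: measurable_funX.
- by apply: measurable_funM => //; exact: (measurableT_comp mW (mflow_y t)).
- move=> xi /HZ[E _]; rewrite /W flow_u_lagrangian -E; by field.
Qed.

(** The time derivative of $\int U_t\,\varphi(t,y_t)\,a_t\,d\xi$ differs from the integrand of the
    equation by exactly the expression that [flow_energy_flux] integrates to 0. *)
Theorem flow_momentum phi : test2 phi ->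
  (\int[leb]_(t in [set t : R | (0 <= t)%R]) \int[leb]_(x in setT)
        (flow_u t x * dpt phi t x + 2^-1 * (flow_u t x) ^+ 2 * dpx phi t x
         + 4^-1 * (fine (flow_mu t [set y | (y < x)%R]) - fine (flow_mu t [set y | (x < y)%R]))
           * phi t x)%:E
      = - \int[leb]_(x in setT) (flow_u 0%R x * phi 0%R x)%:E)%E.
Proof.
move=> tp; have [N N0 HN] := test2_support tp.
have ud := unif_derivM (unif_derivM flow_unif_U (flow_unif_test tp)) flow_unif_a.
have KU0 : 0 <= KU by apply: le_trans (UK 0).
have K00 : 0 <= K0 by apply: le_trans (yK 0).
(* A label moves by at most [flow_K t], so for $|t|\le N$ the test function sees only labels in
   $[-A,A]$. On this interval the weight 1 is integrable, as required for differentiation under the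
   integral. *)
pose A := N + (K0 + N * KU + N ^+ 2 / 4 * (C / 2)).
pose D := `[- A, A]%classic.
have mD : (measurable : set (set (measurableTypeR R))) D by exact: measurable_itv.
have supp s t xi : ~ D xi -> dpart s phi t (flow_y t xi) = 0.
  move=> nD; have [tN|tN] := leP `|t| N; last by rewrite HN//; left.
  rewrite HN//; right; rewrite ltNge; apply/negP => yN; apply: nD.
  rewrite /D /= in_itv/= -ler_norml.
  have h1 : flow_K t <= K0 + N * KU + N ^+ 2 / 4 * (C / 2).
    rewrite /flow_K; apply: lerD; first by rewrite lerD2l ler_wpM2r.
    rewrite ler_wpM2r ?divr_ge0// ler_wpM2r ?invr_ge0// -[t ^+ 2]real_normK ?num_real//.
    by rewrite ler_pXn2r// nnegrE.
  have := flow_yK t xi; have := ler_normB (flow_y t xi) (flow_y t xi - xi); rewrite subKr /A; lra.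
pose f t xi := flow_U t xi * phi t (flow_y t xi) * flow_a t xi.
pose f' t xi := (flow_force xi / 2 * phi t (flow_y t xi) + flow_U t xi *
   (dpt phi t (flow_y t xi) + flow_U t xi * dpx phi t (flow_y t xi))) * flow_a t xi +
   flow_U t xi * phi t (flow_y t xi) * flow_b t xi.
have m0 t := mdy [::] t tp; have m1 t := mdy [:: true] t tp; have m2 t := mdy [:: false] t tp.
rewrite /= in m0 m1 m2.
have mf t : measurable_fun setT (f t) by apply: measurable_funM => //; exact: measurable_funM.
have mf' t : measurable_fun setT (f' t).
  apply: measurable_funD; apply: measurable_funM => //; last exact: measurable_funM.
  apply: measurable_funD; first by apply: measurable_funM => //; exact: measurable_funM.
  by apply: measurable_funM => //; apply: measurable_funD => //; exact: measurable_funM.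
have i1 : leb.-integrable D (EFin \o (cst 1 : R -> R)) by exact: integrable_itv_cst.
have m1' : measurable_fun setT (cst 1 : R -> R) by exact: measurable_cst.
have w0 (xi : R) : 0 <= (cst 1 : R -> R) xi by rewrite /= ler01.
have f'0 t xi : ~ D xi -> f' t xi = 0.
  move=> nD; have := supp [::] t xi nD; have := supp [:: true] t xi nD; have := supp [:: false] t xi nD.
  by rewrite /f' /= => -> -> ->; rewrite !(mulr0, mul0r, addr0).
have f0 t xi : ~ D xi -> f t xi = 0.
  by move=> nD; have := supp [::] t xi nD; rewrite /f /= => ->; rewrite mulr0 mul0r.
have iD (h : R -> R) L : measurable_fun setT h -> (forall xi, `|h xi| <= L) -> (forall xi, ~ D xi -> h xi = 0) ->
    leb.-integrable setT (EFin \o h) /\ \int[leb]_xi h xi = \int[leb]_(xi in D) (h xi * cst 1 xi).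
  move=> mh hL h0; split.
    apply: (proj1 (@integrable_support _ _ _ leb D h mD h0)); have := weighted_integrable mD m1' w0 i1 mh hL.
    by apply: integrable_eq => // xi _; rewrite mulr1.
  by rewrite (@Rintegral_support _ _ _ leb D)//; apply: Rintegral_eq => xi _; rewrite mulr1.
have f'b t : exists L : R, forall xi, `|f' t xi| <= L.
  by have [L L0 HL] := ud `|t|; exists L => xi; have [] := HL t t xi (lexx _) (lexx _).
rewrite (_ : (\int[leb]_(t in _) _)%E = (\int[leb]_(t in [set t | (0 <= t)%R]) (\int[leb]_(xi in D) (f' t xi * cst 1 xi))%:E)%E); last first.
  apply: eq_integral => t _.
  have [L HL] := f'b t; have [if' <-] := iD _ _ (mf' t) HL (f'0 t).
  pose k x := fine (flow_mu t [set y | (y < x)%R]) - fine (flow_mu t [set y | (x < y)%R]).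
  have mk : measurable_fun setT k.
    rewrite (_ : k = fun x => Nl (flow_mu t) x - (mass (flow_mu t) - Nr (flow_mu t) x)); last first.
      by apply/funext => x; rewrite -rmeas_gt.
    apply: measurable_funB; first exact: measurable_Nl.
    by apply: measurable_funB; [exact: measurable_cst|exact: measurable_Nr].
  have n0 := measurable_dpart [::] t tp; have n1 := measurable_dpart [:: true] t tp; have n2 := measurable_dpart [:: false] t tp.
  rewrite /= in n0 n1 n2.
  rewrite (flow_lebesgue_integral t (f := fun x => flow_u t x * dpt phi t x + 2^-1 * flow_u t x ^+ 2 * dpx phi t x + 4^-1 * k x * phi t x)); last first.
    apply: measurable_funD; first apply: measurable_funD; apply: measurable_funM => //; apply: measurable_funM => //.
    exact: measurable_funX.
  pose P xi := (flow_U t xi * dpt phi t (flow_y t xi) + 2^-1 * flow_U t xi ^+ 2 * dpx phi t (flow_y t xi)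
    + flow_force xi / 2 * phi t (flow_y t xi)) * flow_a t xi.
  pose S xi := 2^-1 * flow_U t xi ^+ 2 * dpx phi t (flow_y t xi) * flow_a t xi +
     flow_U t xi * phi t (flow_y t xi) * flow_b t xi.
  have mS : measurable_fun setT S.
    apply: measurable_funD; apply: measurable_funM => //; apply: measurable_funM => //.
    by apply: measurable_funM => //; exact: measurable_funX.
  have Pf' xi : P xi = f' t xi - S xi by rewrite /P /f' /S; field.
  have S0 xi : ~ D xi -> S xi = 0.
    move=> nD; have := supp [::] t xi nD; have := supp [:: false] t xi nD.
    by rewrite /S /= => -> ->; rewrite !(mulr0, mul0r, addr0).
  have Sb : exists L : R, forall xi, `|S xi| <= L.
    have [LU LU0 HU] := flow_unif_U `|t|; have [La La0 Ha] := flow_unif_a `|t|.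
    have [Mp Mp0 Hp] := test2_bounded [::] tp; have [Mx Mx0 Hx] := test2_bounded [:: false] tp.
    exists (2^-1 * (LU * LU) * Mx * La + LU * Mp * La) => xi.
    have [hU _ _ _ _] := HU t t xi (lexx _) (lexx _); have [ha hb _ _ _] := Ha t t xi (lexx _) (lexx _).
    have lm (u w P' Q' : R) : `|u| <= P' -> `|w| <= Q' -> `|u * w| <= P' * Q' by move=> hu hw; rewrite normrM ler_pM.
    apply: (le_trans (ler_normD _ _)); apply: lerD.
      apply: (lm _ _ _ _ _ ha); apply: (lm _ _ _ _ _ (Hx t _)); apply: (lm 2^-1 _ 2^-1 (LU * LU)); last exact: (lm _ _ _ _ hU hU).
      by rewrite ger0_norm ?invr_ge0.
    by apply: (lm _ _ _ _ _ hb); apply: (lm _ _ _ _ hU); exact: Hp.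
  have [LS HLS] := Sb; have [iS _] := iD _ _ mS HLS S0.
  transitivity (\int[leb]_xi (f' t xi - S xi)%:E)%E; last first.
    apply: etrans (@integralE_fin _ _ _ leb setT (fun xi => f' t xi - S xi) measurableT _) _; first exact: RintegrableB.
    by rewrite RintegralB// flow_energy_flux// subr0.
  have [Z [mZ Z0 HZ]] := flow_distrib_lagrangian t.
  apply: (integral_off_null _ _ mZ Z0).
  - apply: measurable_funM => //; apply: measurable_funD; first apply: measurable_funD; apply: measurable_funM => //.
    + by apply: (measurableT_comp (mflow_u t) (mflow_y t)).
    + apply: measurable_funM => //; apply: measurable_funX; exact: (measurableT_comp (mflow_u t) (mflow_y t)).
    + by apply: measurable_funM => //; exact: (measurableT_comp mk (mflow_y t)).
  - exact: measurable_funB.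
  - move=> xi /HZ[_ E]; rewrite -Pf' /P flow_u_lagrangian.
    rewrite mulrDl [RHS]mulrDl; congr (_ + _).
    rewrite (_ : 4^-1 * k (flow_y t xi) * phi t (flow_y t xi) * flow_a t xi =
      4^-1 * phi t (flow_y t xi) * (k (flow_y t xi) * flow_a t xi)); last by ring.
    by rewrite -[k _]/(Nl (flow_mu t) (flow_y t xi) - rmeas (flow_mu t) [set z | flow_y t xi < z]) E; field.
rewrite (integral_weak mD ud mf mf' m1' w0 i1 (N := N)); last first.
  move=> t xi tN; have := HN [:: true] t (flow_y t xi) (or_introl tN).
  have := HN [:: false] t (flow_y t xi) (or_introl tN); have := HN [::] t (flow_y t xi) (or_introl tN).
  by rewrite /= => -> -> ->; rewrite !(mulr0, mul0r, addr0).
congr (- _)%E.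
have n0 := measurable_dpart [::] 0 tp; rewrite /= in n0.
rewrite (flow_lebesgue_integral 0 (f := fun x => flow_u 0 x * phi 0 x)); last exact: measurable_funM.
have [L L0 HL] := ud 0.
have fb xi : `|f 0 xi| <= L by have [] := HL 0 0 xi; rewrite ?normr0.
have [if0 <-] := iD _ _ (mf 0) fb (f0 0).
apply: etrans (esym (@integralE_fin _ _ _ leb _ _ measurableT if0)) _.
by apply: eq_integral => xi _; rewrite flow_u_lagrangian.
Qed.

Implicit Types (T L M h B : R).

Lemma flow_strip t p q : p <= q ->
  (flow_u t q - flow_u t p) ^+ 2 <= (q - p) * (Nl (flow_mu t) q - Nl (flow_mu t) p).
Proof.
exact: (velocity_strip (prim_flow_y t) (prim_flow_U t) (flow_a_ge0 t) c0 (flow_acb t) mc ic (flow_yK t)).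
Qed.

(** Both points lie in the window of half-width [h] around [x]. Unlike the energy between [x] and
    [z], that of the window can be integrated in [x]. *)
Lemma flow_gap t x z h : `|x - z| <= h ->
  (flow_u t z - flow_u t x) ^+ 2 <= h * (Nl (flow_mu t) (x + h) - Nl (flow_mu t) (x - h)).
Proof.
rewrite ler_norml => /andP[h1 h2].
have h0 : 0 <= h by lra.
have K p q : p <= q -> q - p <= h -> x - h <= p -> q <= x + h ->
    (flow_u t q - flow_u t p) ^+ 2 <= h * (Nl (flow_mu t) (x + h) - Nl (flow_mu t) (x - h)).
  move=> pq qph hp qh; apply: le_trans (flow_strip t pq) _.
  have n1 := Nl_mono (flow_mu t) pq; have n2 := Nl_mono (flow_mu t) hp; have n3 := Nl_mono (flow_mu t) qh.
  by apply: ler_pM => //; lra.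
have [xz|zx] := leP x z; first by apply: K => //; lra.
by rewrite -sqrrN opprB; apply: K => //; lra.
Qed.

(* In Lagrangian coordinates the particle found at [x] at time [t] was at [z] at time [s]. *)
Lemma flow_increment t s x L : (forall xi, `|flow_y t xi - flow_y s xi| <= L) ->
  exists2 z, `|x - z| <= L & flow_u t x = flow_u s z + (t - s) / 2 * (Nl (flow_mu t) x - C / 2).
Proof.
move=> HL; set xi := label (flow_y t) x.
have xE : flow_y t xi = x by exact: (label_lagrangian (prim_flow_y t) (flow_a_ge0 t) (flow_yK t)).
exists (flow_y s xi); first by rewrite -[X in X - _]xE.
rewrite flow_u_lagrangian flow_distrib -/xi -/(flow_force xi) {1}/flow_u /velocity -/xi /flow_U.
by field.
Qed.

Lemma flow_y_lipschitz T : exists2 L, 0 <= L & forall (t s : R), 0 <= t <= T -> 0 <= s <= T ->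
  forall xi, `|flow_y t xi - flow_y s xi| <= L * `|t - s|.
Proof.
have [L L0 HL] := flow_path T; exists L => // t s /andP[t0 tT] /andP[s0 sT] xi.
by have [||_ h _ _] := HL s t xi; rewrite ?(ger0_norm s0) ?(ger0_norm t0).
Qed.

(** Following a particle from time [s] to time [t] turns a difference in time into a spatial one at
    distance of order $|t-s|$, plus a term linear in $t-s$. Cauchy--Schwarz on the spatial strip
    gives the exponent $1/2$, and $|t-s|\le\sqrt{Td}$ absorbs the linear term. *)
Lemma flow_holder T : 0 < T -> exists alpha B, 0 < alpha /\ alpha <= 1 /\ 0 <= B /\
  forall t s x y, 0 <= t <= T -> 0 <= s <= T ->
    `|flow_u t x - flow_u s y| <= B * ((`|t - s| + `|x - y|) `^ alpha).
Proof.
move=> T0; have [L L0 HL] := flow_y_lipschitz T.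
exists 2^-1, (Num.sqrt (C * (L + 1)) + C / 4 * Num.sqrt T).
split; first by rewrite invr_gt0.
split; first by rewrite invf_le1// ler1n.
split; first by apply: addr_ge0; [|apply: mulr_ge0; [exact: divr_ge0|]]; exact: sqrtr_ge0.
move=> t s x y tT sT; set d := `|t - s| + `|x - y|.
have d0 : 0 <= d by rewrite addr_ge0.
rewrite powR12_sqrt// mulrDl -mulrA -!sqrtrM ?mulr_ge0 ?addr_ge0 ?(ltW T0)//.
have [z xz ->] := flow_increment x (HL _ _ tT sT).
have e1 : `|flow_u s z - flow_u s y| <= Num.sqrt (C * (L + 1) * d).
  rewrite -sqrtr_sqr ler_psqrt ?nnegrE ?sqr_ge0 ?mulr_ge0 ?addr_ge0//.
  have K p q : p <= q -> (flow_u s q - flow_u s p) ^+ 2 <= (q - p) * C.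
    move=> pq; apply: le_trans (flow_strip s pq) _; apply: ler_wpM2l; first lra.
    by have := Nl_le_mass (flow_mu s) q; have := Nl_ge0 (flow_mu s) p; rewrite flow_mass; lra.
  apply: (@le_trans _ _ (`|z - y| * C)).
    have [zy|yz] := leP z y; first by rewrite -sqrrN opprB distrC ger0_norm ?subr_ge0//; exact: K.
    by rewrite ger0_norm ?subr_ge0 ?(ltW yz)//; apply: K; exact: ltW.
  rewrite mulrC -mulrA; apply: ler_wpM2l => //.
  have : `|z - y| <= `|x - z| + `|x - y|.
    by rewrite (_ : z - y = (z - x) + (x - y)); [rewrite (distrC x z) ler_normD|ring].
  have : 0 <= L * `|x - y| by rewrite mulr_ge0.
  by rewrite /d; have := normr_ge0 (t - s); rewrite mulrDl mulrDr; lra.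
have e2 : `|(t - s) / 2 * (Nl (flow_mu t) x - C / 2)| <= C / 4 * Num.sqrt (T * d).
  rewrite normrM normrM (@ger0_norm _ 2^-1)//.
  have n1 : `|Nl (flow_mu t) x - C / 2| <= C / 2 by rewrite flow_distrib; exact: flow_force_bound.
  have ts : `|t - s| <= Num.sqrt (T * d).
    rewrite -[X in X <= _]sqrtr_sqr ler_psqrt ?nnegrE ?sqr_ge0 ?mulr_ge0 ?(ltW T0)//.
    rewrite -real_normK ?num_real// expr2; apply: ler_pM => //; last by rewrite /d lerDl.
    by move: tT sT => /andP[? ?] /andP[? ?]; rewrite ler_norml; lra.
  apply: (@le_trans _ _ (Num.sqrt (T * d) / 2 * (C / 2))).
    by apply: ler_pM => //; rewrite ler_wpM2r// invr_ge0.
  by rewrite le_eqVlt; apply/orP; left; apply/eqP; field.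
rewrite addrAC; apply: le_trans (ler_normD _ _) _; exact: lerD.
Qed.

(** Up to time [T] every particle moves by at most [D], so $y_t^2\le2y_0^2+2D^2$. *)
Lemma flow_second_moment T : leb.-integrable setT (EFin \o (fun xi => y0 xi ^+ 2 * c xi)) ->
  exists2 M, 0 <= M & forall t, 0 <= t <= T ->
    (flow_mu t).-integrable setT (EFin \o (fun z => z ^+ 2)) /\ \int[flow_mu t]_z (z ^+ 2) <= M.
Proof.
move=> i2; pose D := T * KU + T ^+ 2 / 4 * (C / 2).
have KU0 : 0 <= KU by apply: le_trans (UK 0).
pose f xi := 2 * (y0 xi ^+ 2 * c xi) + 2 * D ^+ 2 * c xi.
have f0 xi : 0 <= f xi by apply: addr_ge0; apply: mulr_ge0 => //; apply: mulr_ge0 => //; exact: sqr_ge0.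
have iF : leb.-integrable setT (EFin \o f).
  by apply: RintegrableD => //; exact: RintegrableZ.
exists (\int[leb]_xi f xi); first by apply: Rintegral_ge0.
move=> t /andP[t0 tT].
have fle xi : `|flow_y t xi ^+ 2 * c xi| <= f xi.
  have h : `|flow_y t xi - y0 xi| <= D.
    apply: le_trans (flow_y_shift t xi) _; rewrite ger0_norm//; apply: lerD; first by rewrite ler_wpM2r.
    by rewrite ler_wpM2r ?divr_ge0// ler_wpM2r ?invr_ge0// ler_sqr ?nnegrE// (le_trans t0 tT).
  rewrite ger0_norm; last exact: (mulr_ge0 (sqr_ge0 _) (c0 xi)).
  rewrite (_ : f xi = (2 * y0 xi ^+ 2 + 2 * D ^+ 2) * c xi); last by rewrite /f; ring.
  rewrite ler_wpM2r//.
  have : (flow_y t xi - y0 xi) ^+ 2 <= D ^+ 2.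
    by rewrite -real_normK ?num_real// ler_sqr ?nnegrE// (le_trans _ h).
  by have := sqr_ge0 (flow_y t xi - 2 * y0 xi); rewrite !expr2; lra.
have mf : measurable_fun setT (fun xi => flow_y t xi ^+ 2 * c xi).
  by apply: measurable_funM => //; apply: measurable_funX; exact: mflow_y.
have ig : leb.-integrable setT (EFin \o (fun xi => flow_y t xi ^+ 2 * c xi)).
  exact: (@integrable_le _ _ _ leb setT _ f).
have msq : measurable_fun setT (fun z : R => z ^+ 2) by exact: measurable_funX.
split.
  exact: ((@is_image_integrable _ _ (measurableTypeR R) R R leb (flow_y t) c (mflow_y t) mc c0
    (flow_mu t) (fun z => z ^+ 2) (energyE (prim_flow_y t) c0 mc ic) msq).2 ig).
rewrite /Rintegral (flow_energy_integral t msq) -/(Rintegral _ _ _).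
apply: le_trans (ler_norm _) _; exact: Rintegral_abs_le.
Qed.

Lemma flow_weakly_continuous (g : R -> R) M : continuous g -> (forall x, `|g x| <= M) ->
  continuous (fun t => fine (\int[flow_mu t]_x (g x)%:E)).
Proof.
move=> cg gM.
have mg : measurable_fun setT g by exact: continuous_measurable_fun.
have mgy t : measurable_fun setT (fun xi => g (flow_y t xi)) by exact: (measurableT_comp mg (mflow_y t)).
rewrite (_ : (fun t => _) = fun t => \int[leb]_xi (g (flow_y t xi) * c xi)); last first.
  by apply/funext => t; rewrite flow_energy_integral.
move=> t.
have iM : leb.-integrable setT (EFin \o (fun xi => M * c xi)) by exact: RintegrableZ.
have le s xi : `|g (flow_y s xi) * c xi| <= M * c xi by rewrite normrM (ger0_norm (c0 xi)) ler_wpM2r.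
have := @continuity_under_integral R _ (measurableTypeR R) leb (fun t xi => g (flow_y t xi) * c xi) setT
  measurableT (t - 1) (t + 1).
apply=> [s _|||s _|].
- apply: (@integrable_le _ _ _ leb setT _ (fun xi => M * c xi)) => //.
  by apply: measurable_funM; [exact: mgy|exact: mc].
- apply: aeW => xi _ s _; apply: cont_mul; last exact: cst_continuous.
  move=> r; apply: continuous_comp; last exact: cg.
  apply: continuousD; last first.
    apply: continuousM; last exact: cst_continuous.
    by apply: continuousM; [exact: exprn_continuous|exact: cst_continuous].
  by apply: continuousD; [exact: cst_continuous|apply: continuousM; [exact: cvg_id|exact: cst_continuous]].
- exact: iM.
- by apply: aeW => xi _; exact: le.
- by rewrite inE/= in_itv/=; apply/andP; split; lra.
Qed.

(** Each particle moves by at most [D], and $(p+D)^\gamma\le2^\gamma(p^\gamma+D^\gamma)$ on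
    comparing $p+D$ with twice the larger of the two terms. *)
Lemma flow_moment t (gamma : R) : 0 <= gamma ->
  (\int[leb]_xi ((1 + `|y0 xi| `^ gamma) * c xi)%:E < +oo)%E ->
  (\int[flow_mu t]_x (1 + `|x| `^ gamma)%:E < +oo)%E.
Proof.
move=> g0 fin.
have mp : measurable_fun setT (fun x : R => 1 + `|x| `^ gamma).
  by apply: measurable_funD => //; exact: (measurableT_comp (@measurable_powR R gamma) (@normr_measurable R setT)).
rewrite (flow_energy_integral t mp).
pose D := `|t| * KU + t ^+ 2 / 4 * (C / 2).
have KU0 : 0 <= KU by apply: le_trans (UK 0).
have D0 : 0 <= D.
  apply: addr_ge0; first exact: mulr_ge0.
  by apply: mulr_ge0; apply: divr_ge0 => //; exact: sqr_ge0.
pose A := 1 + 2 `^ gamma + 2 `^ gamma * D `^ gamma.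
have A0 : 0 <= A by rewrite addr_ge0 ?mulr_ge0 ?powR_ge0// addr_ge0 ?powR_ge0.
have my0 : measurable_fun setT y0 by exact: (continuous_measurable_fun (prim_continuous py)).
apply: (@le_lt_trans _ _ (\int[leb]_xi (A * ((1 + `|y0 xi| `^ gamma) * c xi))%:E)%E).
  apply: ge0_le_integral => //.
  - by move=> xi _; rewrite lee_fin mulr_ge0// addr_ge0 ?powR_ge0.
  - by apply/measurable_EFinP; apply: measurable_funM => //; exact: (measurableT_comp mp (mflow_y t)).
  - apply/measurable_EFinP; apply: measurable_funM => //; apply: measurable_funM => //.
    exact: (measurableT_comp mp my0).
  - move=> xi _; rewrite lee_fin mulrA ler_wpM2r//.
    have h : `|flow_y t xi| <= `|y0 xi| + D.
      have := ler_normD (flow_y t xi - y0 xi) (y0 xi); rewrite subrK => h1.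
      by have := flow_y_shift t xi; rewrite -/D; lra.
    set p := `|y0 xi| `^ gamma; set q := D `^ gamma; set k := 2 `^ gamma.
    have p0 : 0 <= p by exact: powR_ge0.
    have q0 : 0 <= q by exact: powR_ge0.
    have k0 : 0 <= k by exact: powR_ge0.
    have hk : `|flow_y t xi| `^ gamma <= k * p + k * q.
      have [yD|Dy] := leP D `|y0 xi|.
        apply: (@le_trans _ _ (k * p)); last by rewrite lerDl mulr_ge0.
        rewrite /k /p -powRM//; apply: ge0_ler_powR; rewrite ?nnegrE ?mulr_ge0//; lra.
      apply: (@le_trans _ _ (k * q)); last by rewrite lerDr mulr_ge0.
      by rewrite /k /q -powRM//; apply: ge0_ler_powR; rewrite ?nnegrE ?mulr_ge0//; lra.
    rewrite /A -/k -/q.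
    have := mulr_ge0 k0 q0; have := mulr_ge0 (mulr_ge0 k0 q0) p0.
    rewrite !mulrDl !mulrDr !mulr1 !mul1r; lra.
under eq_integral => xi _ do rewrite EFinM.
rewrite ge0_integralZl//.
- by rewrite lte_mul_pinfty.
- apply/measurable_EFinP; apply: measurable_funM => //; exact: (measurableT_comp mp my0).
- by move=> xi _; rewrite lee_fin mulr_ge0// addr_ge0 ?powR_ge0.
Qed.

(** Where $c\ne0$, $a_t=0$ is equivalent to $b_t=b+\tfrac t2c=0$, which for a fixed label has a
    single root in $t$. By Fubini, for almost every time the labels with $a_t=0$ and $c\ne0$ are
    null. *)
Lemma flow_ac : {ae leb, forall t, 0 <= t -> ac_ux2 (flow_u t) (flow_mu t)}.
Proof.
pose B := [set w : measurableTypeR R * measurableTypeR R | (flow_b w.1 w.2 == 0) && (c w.2 != 0)].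
have mB : measurable B.
  have m1 : measurable_fun setT (fun w : measurableTypeR R * measurableTypeR R => flow_b w.1 w.2).
    have m1 : measurable_fun setT (fun w : measurableTypeR R * measurableTypeR R => (w.1 : R)) by exact: measurable_fst.
    have mb2 : measurable_fun setT (fun w : measurableTypeR R * measurableTypeR R => b w.2).
      by apply: (@measurableT_comp _ _ _ _ _ _ b); [exact: pU.1.1|exact: measurable_snd].
    have mc2 : measurable_fun setT (fun w : measurableTypeR R * measurableTypeR R => c w.2).
      by apply: (@measurableT_comp _ _ _ _ _ _ c); [exact: mc|exact: measurable_snd].
    apply: measurable_funD => //; apply: measurable_funM => //; apply: measurable_funM => //.
  have mc2 : measurable_fun setT (fun w : measurableTypeR R * measurableTypeR R => c w.2).
    by apply: (@measurableT_comp _ _ _ _ _ _ c); [exact: mc|exact: measurable_snd].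
  have m2 : measurable_fun setT (fun w : measurableTypeR R * measurableTypeR R => (flow_b w.1 w.2 == 0) && (c w.2 != 0)).
    apply: measurable_and; first exact: measurable_fun_eqr.
    by apply: measurable_neg; exact: measurable_fun_eqr.
  by have := m2 measurableT [set true] I; rewrite setTI.
have := @tonelli_sections R _ _ (measurableTypeR R) (measurableTypeR R) leb leb B mB.
rewrite [X in _ = X -> _](_ : _ = 0%E); last first.
  apply: integral0_eq => xi _.
  have [cz|cn] := eqVneq (c xi) 0.
    rewrite (_ : ysection B xi = set0) ?measure0//.
    by apply/seteqP; split => t //=; rewrite /ysection/= inE /B/= cz eqxx andbF.
  apply/eqP; rewrite eq_le measure_ge0 andbT -(@lebesgue_measure_set1 R (- (2 * b xi) / c xi)).
  apply: le_measure; rewrite ?inE//; first exact: measurable_ysection.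
  move=> t /=; rewrite /ysection/= inE /B/= => /andP[/eqP h _]; rewrite /flow_b in h.
  have : t * c xi = - (2 * b xi) by lra.
  by move=> <-; rewrite mulfK.
move=> I0.
have ms : measurable_fun setT (fun t : R => leb (xsection B t)) by exact: (measurable_fun_xsection _ mB).
have : ae_eq leb setT (fun t : R => leb (xsection B t)) (cst 0%E).
  apply/(@ae_eq_integral_abs _ _ _ leb setT measurableT _ ms); rewrite -[RHS]I0.
  by apply: eq_integral => t _; rewrite gee0_abs.
move=> h; apply: (ae_imply2 h h) => t /(_ I) /= E _ _.
apply: (velocity_ac (prim_flow_y t) (prim_flow_U t) (flow_a_ge0 t) c0 (flow_acb t) mc ic (flow_yK t)).
rewrite -[RHS]E; congr (leb _); apply/seteqP; split => xi /=; rewrite /xsection/= inE /B/=.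
  move=> [az cn]; rewrite cn andbT; have := flow_acb t xi; rewrite az mul0r => /esym/eqP.
  by rewrite sqrf_eq0.
move=> /andP[/eqP bz cn]; split => //; have := flow_acb t xi; rewrite bz expr0n/= => /eqP.
by rewrite mulf_eq0 (negbTE cn) orbF => /eqP.
Qed.

(** * Far field of the flow *)

Section FarField.
Variables psip psim : R -> R.
Hypothesis psip0 : forall x, x <= -1 -> psip x = 0.
Hypothesis psip1 : forall x, 1 <= x -> psip x = 1.
Hypothesis psip01 : forall x, 0 <= psip x <= 1.
Hypothesis psum : forall x, psip x + psim x = 1.
Hypothesis mpsip : measurable_fun setT psip.
Hypothesis iy2 : leb.-integrable setT (EFin \o (fun xi => y0 xi ^+ 2 * c xi)).

Let o0 x : 0 < oneDsqr x. Proof. by rewrite (lt_le_trans ltr01) ?oneDsqr_ge1. Qed.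
Let o1 x : ((oneDsqr x)^-1) ^+ 2 <= (oneDsqr x)^-1.
Proof.
have h : (oneDsqr x)^-1 <= 1 by rewrite invf_le1 ?o0 ?oneDsqr_ge1.
by rewrite expr2 ler_piMl// invr_ge0 ltW.
Qed.

Let mNl (m : {finite_measure set R -> \bar R}) : measurable_fun setT (Nl m) := measurable_Nl m.

Lemma flow_distrib_far t : 0 <= t -> inE1_0 psip (distrib (flow_mu t)).
Proof.
move=> t0; have [M M0 HM] := flow_second_moment t iy2.
have [im iM] : (flow_mu t).-integrable setT (EFin \o (fun z => z ^+ 2)) /\ \int[flow_mu t]_z (z ^+ 2) <= M.
  by apply: HM; rewrite t0 lexx.
exists (fun x => Nl (flow_mu t) x - C * psip x), C; split; last first.
  by apply: aeW => x; rewrite subrK.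
have mf : measurable_fun setT (fun x => Nl (flow_mu t) x - C * psip x).
  by apply: measurable_funB; [exact: mNl|exact: measurable_funM].
split => //; apply: (@integrable_le _ _ _ leb setT _ (fun x => (2 * (C + M)) ^+ 2 * (oneDsqr x)^-1)) => //.
- exact: measurable_funX.
- move=> x _; rewrite ger0_norm ?sqr_ge0//.
  have := @Nl_step_decay R psip (flow_mu t) M x psip0 psip1 psip01 im iM; rewrite flow_mass => h.
  rewrite -real_normK ?num_real//; apply: (@le_trans _ _ ((2 * (C + M) * (oneDsqr x)^-1) ^+ 2)).
    by rewrite ler_sqr ?nnegrE// (le_trans _ h).
  by rewrite exprMn ler_wpM2l ?sqr_ge0.
- by apply: RintegrableZ => //; exact: integrable_oneDsqrV.
Qed.

(** At $\pm\infty$ the difference of velocities tends to $\pm(t-s)C/4$, hence the coefficients [e]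
    and [- e]. The remainder is an increment of [flow_u s] over a distance $L|t-s|$, whose square
    integrates through the windows, plus $(t-s)/2$ times the decaying defect of the distribution
    function. *)
Lemma flow_lipschitz T : 0 < T -> exists L, 0 <= L /\ forall t s, 0 <= t <= T -> 0 <= s <= T ->
  E20_norm_le psip psim (fun x => flow_u t x - flow_u s x) (L * `|t - s|).
Proof.
move=> T0; have [L L0 HL] := flow_y_lipschitz T; have [M M0 HM] := flow_second_moment T iy2.
pose A := 2 * (C + M); pose kappa := \int[leb]_x (oneDsqr x)^-1.
have k0 : 0 <= kappa by apply: Rintegral_ge0 => x _; rewrite invr_ge0 ltW.
(* The terms bound, after division by $(t-s)^2$, the integral of the squared spatial increment, that
   of the squared decaying defect, and $2e^2$ for the two coefficients. *)
pose B := 4 * L ^+ 2 * C + A ^+ 2 / 2 * kappa + C ^+ 2 / 8.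
have B0 : 0 <= B.
  apply: addr_ge0; last by rewrite divr_ge0 ?sqr_ge0.
  by apply: addr_ge0; apply: mulr_ge0 => //; [rewrite mulr_ge0 ?sqr_ge0|rewrite divr_ge0 ?sqr_ge0].
exists (Num.sqrt B); split; first exact: sqrtr_ge0.
move=> t s tT sT; pose e := (t - s) * C / 4; pose h := L * `|t - s|.
have h0 : 0 <= h by exact: mulr_ge0.
pose fb x := flow_u t x - flow_u s x - e * (psip x - psim x).
have psimE x : psim x = 1 - psip x by rewrite -(psum x); ring.
exists fb, e, (- e).
have mpsim : measurable_fun setT psim by rewrite (funext psimE); exact: measurable_funB.
have mfb : measurable_fun setT fb.
  apply: measurable_funB; first by apply: measurable_funB; exact: mflow_u.
  by apply: measurable_funM => //; exact: measurable_funB.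
pose G x := 2 * h * (Nl (flow_mu s) (x + h) - Nl (flow_mu s) (x - h)) +
  (t - s) ^+ 2 / 2 * A ^+ 2 * (oneDsqr x)^-1.
have [iW EW] := Nl_window_integrable (flow_mu s) h0.
have iG : leb.-integrable setT (EFin \o G).
  by apply: RintegrableD => //; apply: RintegrableZ => //; exact: integrable_oneDsqrV.
have EG : \int[leb]_x G x = (t - s) ^+ 2 * (4 * L ^+ 2 * C + A ^+ 2 / 2 * kappa).
  rewrite RintegralD//; last 2 first.
  - exact: RintegrableZ.
  - by apply: RintegrableZ => //; exact: integrable_oneDsqrV.
  rewrite !RintegralZl//; last exact: integrable_oneDsqrV.
  rewrite EW -/kappa flow_mass /h.
  rewrite -[(t - s) ^+ 2]real_normK ?num_real//.
  by move: `|t - s| => d; field.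
have fbG x : `|fb x ^+ 2| <= G x.
  rewrite ger0_norm ?sqr_ge0//.
  have [z xz E] := flow_increment x (HL _ _ tT sT).
  have g1 := flow_gap s xz.
  have [im iM] := HM _ tT.
  have := @Nl_step_decay R psip (flow_mu t) M x psip0 psip1 psip01 im iM; rewrite flow_mass -/A => n1.
  have n2 : (Nl (flow_mu t) x - C * psip x) ^+ 2 <= A ^+ 2 * (oneDsqr x)^-1.
    rewrite -real_normK ?num_real//; apply: (@le_trans _ _ ((A * (oneDsqr x)^-1) ^+ 2)).
      by rewrite ler_sqr ?nnegrE// (le_trans _ n1).
    by rewrite exprMn ler_wpM2l ?sqr_ge0.
  have -> : fb x = (flow_u s z - flow_u s x) + (t - s) / 2 * (Nl (flow_mu t) x - C * psip x).
    by rewrite /fb E /e psimE; field.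
  rewrite /G (_ : (t - s) ^+ 2 / 2 * A ^+ 2 * (oneDsqr x)^-1 =
    2 * (((t - s) / 2) ^+ 2 * (A ^+ 2 * (oneDsqr x)^-1))); last by field; rewrite gt_eqF ?o0.
  rewrite -[2 * h * _]mulrA; apply: sqrD_le; first exact: g1.
  by rewrite exprMn ler_wpM2l ?sqr_ge0.
split.
  split => //; apply: (@integrable_le _ _ _ leb setT _ G) => //; exact: measurable_funX.
split.
  by apply: aeW => x; rewrite /fb psimE; ring.
have nG : L2norm2 fb <= \int[leb]_x G x.
  apply: le_trans (ler_norm _) _; apply: (@Rintegral_abs_le _ _ _ leb setT (fun x => fb x ^+ 2) G) => //.
  by apply: (@integrable_le _ _ _ leb setT _ G) => //; exact: measurable_funX.
rewrite -[`|t - s|]sqrtr_sqr -sqrtrM//.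
rewrite sqrrN; apply: ler_wsqrtr.
rewrite EG in nG; move: nG; rewrite /B /e; move: (L2norm2 fb) (A ^+ 2 / 2 * kappa) (4 * L ^+ 2 * C) => n w v.
move: (t - s) => d; rewrite !expr2; lra.
Qed.

Hypotheses (sp : smooth1 psip) (sm : smooth1 psim).

(** The Lipschitz bound puts the increment from time 0 in $E_2^0$, and square integrability of the
    slope upgrades the sum to $E_2$. *)
Lemma flow_inE2 t : 0 <= t -> inE2 psip psim (flow_u 0) -> inE2 psip psim (flow_u t).
Proof.
move=> t0 h; apply: (inE2_of_prim sp sm psip0 psip1 psum (prim_flow_u t)).
  exact: (slope_square_integrable (prim_flow_y t) (prim_flow_U t) (flow_a_ge0 t) c0 (flow_acb t) mc ic (flow_yK t)).
have [L [L0 HL]] : exists L, 0 <= L /\ forall r s, 0 <= r <= t + 1 -> 0 <= s <= t + 1 ->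
  E20_norm_le psip psim (fun x => flow_u r x - flow_u s x) (L * `|r - s|).
  by apply: flow_lipschitz; rewrite ltr_wpDl.
have tT : 0 <= t <= t + 1 by rewrite t0 lerDl ler01.
have sT : 0 <= (0 : R) <= t + 1 by rewrite lexx addr_ge0 ?ler01.
have h1 := inE2_0_of_norm (HL _ _ tT sT).
have := inE2_0D h1 (inE2_0_of_inE2 h).
by rewrite (_ : (fun x => _) = flow_u t)//; apply/funext => x; rewrite subrK.
Qed.

Lemma flow_inD t : 0 <= t -> inE2 psip psim (flow_u 0) -> inD psip psim (flow_u t) (flow_mu t).
Proof.
move=> t0 h; split; first exact: flow_inE2.
split; first exact: flow_distrib_far.
exact: (velocity_ac_part (prim_flow_y t) (prim_flow_U t) (flow_a_ge0 t) c0 (flow_acb t) mc ic (flow_yK t)).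
Qed.

Theorem flow_weak_cons_sol u0 (m0 : {finite_measure set R -> \bar R}) : Defs.ae_eq (flow_u 0) u0 ->
  meas_eq (flow_mu 0) m0 -> inE2 psip psim (flow_u 0) -> weak_cons_sol psip psim flow_u flow_mu u0 m0.
Proof.
move=> hu hm h; split; first exact: hu.
split; first exact: hm.
split; first by move=> t t0; exact: flow_inE2.
split; first by move=> t t0; have [_] := flow_inD t0 h.
split; first by move=> phi tp; split; [exact: flow_momentum|exact: flow_transport].
split; first by move=> T T0; split; [exact: flow_holder|exact: flow_lipschitz].
split; first exact: flow_ac.
by move=> f cf [M fM]; apply: continuous_subspaceT; exact: (flow_weakly_continuous cf fM).
Qed.

End FarField.

End Flow.

(** * The initial Lagrangian state *)

(* A particle [xi] sits at the point [x] where
   [x + m(]-oo, x[)] reaches [xi], so that [dxi] is transported onto [dx + m]. *)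
Section InitialState.
Variable R : realType.
Notation leb := (@lebesgue_measure R).
Implicit Types (x z p q xi eta : R) (f k : R -> R).
Variables (w g : R -> R) (m : {finite_measure set R -> \bar R}) (N : set R).
Hypothesis pw : prim w g.
Hypothesis mN : measurable N.
Hypothesis N0 : leb N = 0%E.
Hypothesis mE : forall A, measurable A -> m (A `\` N) = (\int[leb]_(x in A) ((g x) ^+ 2)%:E)%E.

(** The generalized inverse of $x\mapsto x+m((-\infty,x))$, in the same form as [quantile]. It is
    flat over the jump of an atom, all of whose labels share one position. *)
Definition init_y xi := sup [set x | x + Nl m x <= xi].
Notation y := init_y.

Lemma init_yP x xi : (x <= y xi) = (x + Nl m x <= xi).
Proof.
have S : has_sup [set x | x + Nl m x <= xi].
  split; first by exists (xi - mass m) => /=; have := Nl_le_mass m (xi - mass m); lra.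
  by exists xi => z /= h; have := Nl_ge0 m z; lra.
apply/idP/idP => [|h]; last exact: (sup_upper_bound S).
move=> xy; apply: (@le_trans _ _ (y xi + Nl m (y xi))); first by have := Nl_mono m xy; lra.
apply/ler_addgt0Pr => e e0.
have [d d0 Hd] := Nl_left_continuous m (y xi) (divr_gt0 e0 (ltr0n R 2)).
have de : 0 < Num.min d (e / 2) by rewrite lt_min d0 divr_gt0.
have [z /= Hz yz] := sup_adherent de S.
have h1 : Num.min d (e / 2) <= d by rewrite ge_min lexx.
have h2 : Num.min d (e / 2) <= e / 2 by rewrite ge_min lexx orbT.
have : Nl m (y xi - d) <= Nl m z by apply: Nl_mono; rewrite /init_y; lra.
by rewrite /init_y in Hd *; lra.
Qed.

Lemma init_y_mono xi eta : xi <= eta -> y xi <= y eta.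
Proof. by move=> h; rewrite init_yP; apply: le_trans h; rewrite -init_yP. Qed.

Lemma init_y_bound xi : `|y xi - xi| <= mass m.
Proof.
have h1 : y xi + Nl m (y xi) <= xi by rewrite -init_yP.
have h2 : xi - mass m <= y xi by rewrite init_yP; have := Nl_le_mass m (xi - mass m); lra.
by have := Nl_ge0 m (y xi); have := mass_ge0 m; rewrite ler_norml; lra.
Qed.

Lemma measurable_init_y : measurable_fun setT y.
Proof. by apply: nondecreasing_measurable => // xi eta; exact: init_y_mono. Qed.
Let my := measurable_init_y.

Let mpre (A : set R) : measurable A -> measurable (y @^-1` A).
Proof. by move=> mA; rewrite -[_ @^-1` _]setTI; exact: my. Qed.

Lemma init_preimage p q : y @^-1` `[p, q[%classic = `[p + Nl m p, q + Nl m q[%classic.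
Proof. by apply/seteqP; split => xi /=; rewrite !in_itv/= init_yP !ltNge init_yP. Qed.

(** Half-open intervals decide the equality of the two measures, and $[p,q[$ pulls back to an
    interval of length $(q-p)+m([p,q[)$. *)
Lemma lebesgue_init_preimage (A : set R) : measurable A -> leb (y @^-1` A) = (leb A + m A)%E.
Proof.
move=> mA.
have i01 (xi : R) : 0 <= (1 : R) by [].
have mo : measurable_fun setT (cst 1 : R -> R) by exact: measurable_cst.
pose m1 : {measure set R -> \bar R} := @image_sigma _ _ (measurableTypeR R) R R leb y (cst 1) my mo i01.
have m1E B : measurable B -> m1 B = leb (y @^-1` B).
  by move=> mB; exact: etrans (@integral_cst _ _ _ leb _ (mpre mB) 1%E) (mul1e _).
pose m2 : {measure set R -> \bar R} := measure_add (@lebR R) m.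
have m2E (B : set R) : m2 B = (@lebR R B + m B)%E by exact: measure_addE.
have E p q : p < q -> leb (y @^-1` `[p, q[%classic) = m2 `[p, q[%classic.
  move=> pq; rewrite init_preimage.
  have h : p + Nl m p < q + Nl m q by apply: ltr_leD => //; exact/Nl_mono/ltW.
  apply: etrans (@lebesgue_measure_itv R (`[p + Nl m p, q + Nl m q[)) _.
  rewrite /= lte_fin h.
  rewrite m2E /lebR lebesgue_measure_itv/= lte_fin pq.
  rewrite (rmeasE m (measurable_itv _)) rmeas_itvco ?(ltW pq)//.
  by rewrite -!EFinB -EFinD; congr (_%:E); ring.
rewrite -m1E//; transitivity (m2 A); last by rewrite m2E.
apply: (@measure_eq_itvco R m1 m2 _ _ A mA) => p q pq.
  by rewrite m1E ?E.
rewrite m1E// E// m2E /lebR lebesgue_measure_itv/= lte_fin pq lte_add_pinfty ?ltry//.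
by rewrite (rmeasE m (measurable_itv _)) ltry.
Qed.

Let mg : measurable_fun setT g. Proof. exact: pw.1.1. Qed.
(** The density of the absolutely continuous part of $dx+m$; [init_off] below discards the labels of
    the singular part. *)
Definition init_weight x := 1 + g x ^+ 2.
Notation G := init_weight.
Let G0 x : 0 < G x. Proof. by rewrite ltr_pwDl ?sqr_ge0. Qed.
Let mG : measurable_fun setT G. Proof. by apply: measurable_funD => //; exact: measurable_funX. Qed.
Definition init_off x : R := \1_(~` N) x.
Notation off := init_off.
Let moff : measurable_fun setT off. Proof. by apply: measurable_indic; exact: measurableC. Qed.
Let offy_ge0 xi : 0 <= off (y xi). Proof. by rewrite /init_off indicE. Qed.
Let moffy : measurable_fun setT (fun xi => off (y xi)).
Proof. exact: (measurableT_comp moff my). Qed.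

Lemma lebesgue_init_off (A : set R) : measurable A ->
  leb (y @^-1` (A `\` N)) = (\int[leb]_(x in A) (G x)%:E)%E.
Proof.
move=> mA; have mAN : measurable (A `\` N) by exact: measurableD.
rewrite lebesgue_init_preimage// mE// (_ : leb (A `\` N) = (\int[leb]_(x in A) (1 : R)%:E)%E).
  rewrite -ge0_integralD//.
  - by move=> x _; rewrite lee_fin sqr_ge0.
  - by apply/measurable_EFinP; apply: measurable_funX; exact: measurable_funTS.
rewrite integral_cst// mul1e.
have mI : measurable (A `&` N) by exact: measurableI.
have I0 : leb (A `&` N) = 0%E.
  by apply/eqP; rewrite eq_le measure_ge0 andbT -[X in (_ <= X)%E]N0 le_measure ?inE.
apply/eqP; rewrite eq_le; apply/andP; split.
  by apply: le_measure; rewrite ?inE// => x [].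
apply: (@le_trans _ _ (leb ((A `\` N) `|` (A `&` N)))).
  apply: le_measure; rewrite ?inE//; first exact: measurableU.
  by move=> x Ax; have [Nx|Nx] := pselect (N x); [right|left].
apply: le_trans (measureU2 leb mAN mI) _.
by rewrite [X in (_ + X)%E](_ : _ = 0%E) ?adde0.
Qed.

(** The measure [nu] is recognized as an image in two ways: of the labels off the singular set under
    [init_y], and of $(1+g^2)dx$ under the identity. *)
Lemma init_integral f : measurable_fun setT f ->
  (\int[leb]_xi (f (y xi) * off (y xi))%:E = \int[leb]_x (f x * G x)%:E)%E.
Proof.
move=> mf; pose nu := @image_sigma _ _ (measurableTypeR R) R R leb y (fun xi => off (y xi)) my moffy offy_ge0.
have G0' x : 0 <= G x by exact: ltW.
have iy : @is_image _ _ (measurableTypeR R) R R leb y (fun xi => off (y xi)) nu by [].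
have ix : @is_image _ _ (measurableTypeR R) R R leb id G nu.
  move=> A mA; rewrite /nu /image_sigma /image_density preimage_id -lebesgue_init_off//.
  rewrite (_ : (\int[_]_(_ in _) _)%E = (\int[leb]_(xi in y @^-1` A) (\1_(y @^-1` (~` N)) xi)%:E)%E) //.
  rewrite integral_indic//; try exact: mpre; last by apply: mpre; exact: measurableC.
  by congr (leb _); rewrite setIC.
have mid : @measurable_fun _ _ (measurableTypeR R) R setT id by exact: measurable_id.
rewrite -(@is_image_integral _ _ (measurableTypeR R) R R leb y _ my moffy offy_ge0 nu f iy mf).
exact: (@is_image_integral _ _ (measurableTypeR R) R R leb id G mid mG G0' nu f ix mf).
Qed.

(** Chain rule for $W\circ y$: the density $k$ of [W] is multiplied by $1/(1+g^2)$, the density of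
    the position, off the singular labels, and by 0 on them. *)
Lemma init_prim f k : measurable_fun setT f -> (forall x, f x * G x = k x) -> loc_int k ->
  (forall x, `|f x| <= 1) -> forall W, prim W k ->
  prim (fun xi => W (y xi)) (fun xi => f (y xi) * off (y xi)).
Proof.
move=> mf fk lk f1 W pW.
have mF : measurable_fun setT (fun xi => f (y xi) * off (y xi)).
  by apply: measurable_funM => //; exact: (measurableT_comp mf my).
have off1 x : `|off x| <= 1 by rewrite /init_off indicE; case: (_ \in _); rewrite ?normr1 ?normr0.
have F1 xi : `|f (y xi) * off (y xi)| <= 1 by rewrite normrM mulr_ile1.
split.
  split => // p q; apply: (@integrable_le _ _ _ leb `[p, q] _ (cst 1)) => //; first exact: measurable_funTS.
  exact: integrable_itv_cst.
move=> p q pq; have xx := init_y_mono pq; rewrite pW.2//.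
pose I := `]y p, y q[%classic : set R.
have mI : measurable I by exact: measurable_itv.
have mIf : measurable_fun setT (fun x => \1_I x * f x).
  by apply: measurable_funM => //; exact: measurable_indic.
have E := init_integral mIf.
(* Off [N], labels in $[p,q]$ and positions strictly between [y p] and [y q] correspond except at
   the two end positions; the labels of these outside [N] form a null set. *)
pose Z := y @^-1` ([set y p; y q] `\` N).
have m2 : measurable [set y p; y q] by exact: measurableU.
have Z0 : leb Z = 0%E.
  apply: etrans (lebesgue_init_off m2) _; apply: (@null_set_integral _ _ _ leb) => //.
    by apply/measurable_EFinP; exact: measurable_funTS.
  by apply: lebesgue_null_setU => //; exact: lebesgue_measure_set1.
have mZ : measurable Z by apply: mpre; exact: measurableD.
have H xi : ~ Z xi -> \1_I (y xi) * f (y xi) * off (y xi) = \1_(`[p, q]%classic) xi * (f (y xi) * off (y xi)).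
  move=> nZ; have [Ny|nN] := pselect (N (y xi)).
    by rewrite (_ : off (y xi) = 0) ?mulr0// /init_off indicE memNset//= => /(_ Ny).
  rewrite (_ : off (y xi) = 1) ?mulr1; last by rewrite /init_off indicE mem_set.
  congr (_ * _); rewrite !indicE; congr (_%:R).
  have np : y xi != y p by apply/eqP => h; apply: nZ; split => //; left.
  have nq : y xi != y q by apply/eqP => h; apply: nZ; split => //; right.
  congr nat_of_bool; apply/idP/idP; rewrite !inE /I /= !in_itv/=.
    move=> /andP[h1 h2]; apply/andP; split.
      by rewrite leNgt; apply/negP => /ltW/init_y_mono; rewrite leNgt h1.
    by rewrite leNgt; apply/negP => /ltW/init_y_mono; rewrite leNgt h2.
  move=> /andP[/init_y_mono h1 /init_y_mono h2].
  by rewrite !lt_neqAle h1 h2 nq eq_sym np.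
have IR (D : set R) (h : R -> R) : measurable D -> \int[leb]_(x in D) h x = \int[leb]_x (\1_D x * h x).
  move=> mD; rewrite (@Rintegral_support _ _ _ leb D)//; last first.
    by move=> x nD; rewrite indicE memNset// mul0r.
  by apply: Rintegral_eq => x Dx; rewrite indicE mem_set// mul1r.
rewrite (IR `[y p, y q]%classic)// (IR `[p, q]%classic)//; transitivity (\int[leb]_x (\1_I x * f x * G x)).
  rewrite /Rintegral; congr fine; apply: (@integral_off_null R _ _ [set y p; y q]) => //.
  - by apply: measurable_funM; [exact: measurable_indic|exact: lk.1].
  - exact: measurable_funM.
  - by apply: lebesgue_null_setU => //; exact: lebesgue_measure_set1.
  move=> x nx; rewrite -mulrA fk; congr (_ * _); rewrite !indicE; congr (_%:R); congr nat_of_bool.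
  have np : y p != x by apply/eqP => h; apply: nx; left.
  have nq : x != y q by apply/eqP => h; apply: nx; right.
  by apply/idP/idP; rewrite !inE /I /= !in_itv/= !lt_neqAle np nq.
rewrite /Rintegral; congr fine; rewrite -E; apply: (@integral_off_null R _ _ Z) => //.
  by apply: measurable_funM => //; exact: (measurableT_comp mIf my).
by apply: measurable_funM => //; exact: measurable_indic.
Qed.

Let G1 x : 1 <= G x. Proof. by rewrite lerDl sqr_ge0. Qed.
Let GV0 x : 0 <= (G x)^-1. Proof. by rewrite invr_ge0 ltW. Qed.
Let GV1 x : (G x)^-1 <= 1. Proof. by rewrite invf_le1. Qed.
Let mGV : measurable_fun setT (fun x => (G x)^-1).
Proof. exact: (measurableT_comp (@measurable_fun_inv R) mG). Qed.
Let off01 x : off x = 0 \/ off x = 1.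
Proof.
have [Nx|nN] := pselect (N x); [left|right]; last by rewrite /init_off indicE mem_set.
by rewrite /init_off indicE memNset//= => /(_ Nx).
Qed.

(** The derivatives of position, velocity and energy with respect to the label. Off [N] they are
    $1/(1+g^2)$, $g/(1+g^2)$ and $g^2/(1+g^2)$; on the singular labels they are 0, 0 and 1, so all
    the energy is concentrated without any length. *)
Definition init_a xi := (G (y xi))^-1 * off (y xi).
Definition init_b xi := g (y xi) / G (y xi) * off (y xi).
Definition init_c xi := 1 - init_a xi.

Lemma init_prim_y : prim y init_a.
Proof.
have c1 : continuous (cst 1 : R -> R) by exact: cst_continuous.
apply: (@init_prim (fun x => (G x)^-1) (fun _ => 1) mGV _ (loc_int_cont c1) _ id) => [x|x|].
- by rewrite mulVf// gt_eqF.
- by rewrite ger0_norm.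
- by split; [exact: (loc_int_cont c1)|move=> p q pq; rewrite Rint_itv_cst// mul1r].
Qed.

Lemma init_prim_w : prim (fun xi => w (y xi)) init_b.
Proof.
apply: (@init_prim (fun x => g x / G x) g _ _ pw.1 _ w pw) => [|x|x].
- exact: measurable_funM.
- by rewrite divfK// gt_eqF.
- rewrite normrM normfV (gtr0_norm (G0 x)) ler_pdivrMr// mul1r /init_weight.
  by have := sqr_ge0 (`|g x| - 1); rewrite -[g x ^+ 2]real_normK ?num_real// sqrrB1; have := normr_ge0 (g x); lra.
Qed.

Lemma init_a_ge0 xi : 0 <= init_a xi. Proof. by rewrite mulr_ge0. Qed.

Lemma init_c_ge0 xi : 0 <= init_c xi.
Proof. by rewrite subr_ge0 /init_a; case: (off01 (y xi)) => ->; rewrite ?mulr0 ?mulr1. Qed.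

Lemma init_ac xi : init_a xi + init_c xi = 1. Proof. by rewrite addrC subrK. Qed.

Lemma init_acb xi : init_a xi * init_c xi = init_b xi ^+ 2.
Proof.
rewrite /init_c /init_a /init_b; case: (off01 (y xi)) => ->; rewrite ?mulr0 ?mulr1 ?mul0r ?expr0n//.
have := gt_eqF (G0 (y xi)); rewrite /init_weight; move: (g (y xi)) => k /negbT h.
by field.
Qed.

Lemma measurable_init_c : measurable_fun setT init_c.
Proof. by apply: measurable_funB => //; exact: init_prim_y.1.1. Qed.

Lemma init_image_lebesgue : @is_image _ _ (measurableTypeR R) (measurableTypeR R) R leb y init_a leb.
Proof. exact: (lebesgue_lagrangian init_prim_y init_a_ge0 init_y_bound). Qed.

(** The labels of an interval have measure its length plus its energy; [init_a] accounts for the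
    length, so [init_c], its complement to 1, accounts for the energy. The length is finite and
    cancels. *)
Lemma init_image : @is_image _ _ (measurableTypeR R) R R leb y init_c m.
Proof.
pose m1 : {measure set R -> \bar R} := @image_sigma _ _ (measurableTypeR R) R R leb y init_c my
  measurable_init_c init_c_ge0.
have fin p q : p < q -> (m `[p, q[%classic < +oo)%E.
  by move=> pq; rewrite (rmeasE m (measurable_itv _)) ltry.
suff H A : measurable A -> m A = m1 A by move=> A mA; exact: H.
apply: (@measure_eq_itvco R m m1) => // p q pq.
have mI : measurable (`[p, q[%classic : set R) by exact: measurable_itv.
have lE : leb `[p, q[%classic = (q - p)%:E.
  by apply: etrans (@lebesgue_measure_itv R (`[p, q[)) _; rewrite /= lte_fin pq.
have := lebesgue_init_preimage mI.
have -> : leb (y @^-1` `[p, q[%classic) = ((leb `[p, q[%classic) + m1 `[p, q[%classic)%E.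
  rewrite {1}(init_image_lebesgue mI) /m1 /image_sigma /image_density -ge0_integralD//.
  - rewrite (_ : (fun xi => _) = cst 1%E).
      by apply/esym; exact: etrans (@integral_cst _ _ _ leb _ (mpre mI) 1%E) (mul1e _).
    by apply/funext => xi; rewrite -EFinD init_ac.
  - exact: mpre.
  - by move=> xi _; rewrite lee_fin init_a_ge0.
  - by apply/measurable_EFinP; apply: measurable_funTS; exact: init_prim_y.1.1.
  - by move=> xi _; rewrite lee_fin init_c_ge0.
  - by apply/measurable_EFinP; apply: measurable_funTS; exact: measurable_init_c.
have cancel (k : R) (v v' : \bar R) : (k%:E + v = k%:E + v')%E -> v = v'.
  by case: v v' => [v||] [v'||]//; rewrite -!EFinD => -[/addrI ->].
by rewrite lE => h; apply/esym; exact: (cancel _ _ _ h).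
Qed.

Lemma init_c_integral : (\int[leb]_xi (init_c xi)%:E = m setT)%E.
Proof. by rewrite (init_image measurableT) /image_density preimage_setT. Qed.

Lemma init_c_integrable : leb.-integrable setT (EFin \o init_c).
Proof.
apply/integrableP; split; first by apply/measurable_EFinP; exact: measurable_init_c.
rewrite (_ : (\int[leb]_x `|_|)%E = m setT); first by rewrite -ge0_fin_numE// fin_num_measure.
by rewrite -init_c_integral; apply: eq_integral => xi _; rewrite /= ger0_norm ?init_c_ge0.
Qed.

Lemma init_mass : \int[leb]_xi init_c xi = mass m.
Proof. by rewrite /Rintegral init_c_integral. Qed.

End InitialState.

Section FiniteEnergyBound.
Variable R : realType.
Notation leb := (@lebesgue_measure R).
Variables (w g psip psim : R -> R).
Hypothesis pw : prim w g.
Hypothesis g2 : leb.-integrable setT (EFin \o (fun x => g x ^+ 2)).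
Hypothesis psip01 : forall x, 0 <= psip x <= 1.
Hypothesis psim01 : forall x, 0 <= psim x <= 1.

Lemma sqr_integral_itv_le (f : R -> R) (p q : R) : leb.-integrable setT (EFin \o (fun x => f x ^+ 2)) ->
  \int[leb]_(x in `[p, q]) (f x ^+ 2) <= \int[leb]_x (f x ^+ 2).
Proof.
move=> i2; have iI : leb.-integrable `[p, q] (EFin \o (fun x => f x ^+ 2)).
  by apply: (@integrableS _ _ _ leb setT) => //; exact: measurable_itv.
have mI : measurable (`[p, q]%classic : set (measurableTypeR R)) by exact: measurable_itv.
rewrite -lee_fin -(@integralE_fin _ _ _ leb _ _ mI iI) -(@integralE_fin _ _ _ leb _ _ measurableT i2).
apply: ge0_subset_integral => //; first by case/integrableP: i2.
by move=> x _; rewrite lee_fin sqr_ge0.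
Qed.

(* On every unit interval an L^2 function takes a value bounded by its norm, and
   [w] moves by at most the square root of its energy across the interval. *)
Lemma bounded_of_inE2 (u : R -> R) : inE2 psip psim u -> Defs.ae_eq u w ->
  exists2 K : R, 0 <= K & forall x, `|w x| <= K.
Proof.
move=> [fb [a [b [[[mfb ifb] _] E]]]] E'.
have wE : Defs.ae_eq w (fun x => fb x + a * psip x + b * psim x).
  by apply: (ae_imply2 E E') => x -> ->.
pose F := \int[leb]_x (fb x ^+ 2); pose E2 := \int[leb]_x (g x ^+ 2).
have F0 : 0 <= F by apply: Rintegral_ge0 => x _; exact: sqr_ge0.
have E20 : 0 <= E2 by apply: Rintegral_ge0 => x _; exact: sqr_ge0.
exists ((F + 1) + 1 + `|a| + `|b| + (E2 + 1)); first by rewrite !addr_ge0.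
move=> x.
have [z [xz zx [wz fz]]] : exists z : R, [/\ x <= z, z <= x + 1 & w z = fb z + a * psip z + b * psim z /\ fb z ^+ 2 <= F + 1].
  apply: contrapT => H.
  have [Z [mZ Z0 HZ]] := wE.
  have i1 : leb.-integrable setT (EFin \o (fun z => fb z ^+ 2)) by [].
  have mI : measurable (`[x, x + 1]%classic : set (measurableTypeR R)) by exact: measurable_itv.
  have iI : leb.-integrable `[x, x + 1]%classic (EFin \o (fun z => fb z ^+ 2)).
    exact: (@integrableS _ _ _ leb setT).
  have h1 : \int[leb]_(z in `[x, x + 1]) (fb z ^+ 2) <= F by exact: sqr_integral_itv_le.
  have iC : leb.-integrable `[x, x + 1]%classic (EFin \o (fun _ : R => F + 1)) by exact: integrable_itv_cst.
  have h2 : F + 1 <= \int[leb]_(z in `[x, x + 1]) (fb z ^+ 2).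
    rewrite (@Rintegral_negligible _ _ _ leb _ Z)//.
    have -> : F + 1 = \int[leb]_(z in `[x, x + 1]) (F + 1) by rewrite Rint_itv_cst ?lerDl//; ring.
    rewrite (@Rintegral_negligible _ _ _ leb `[x, x + 1]%classic Z)//.
    have mD : measurable (`[x, x + 1]%classic `\` Z) by exact: measurableD.
    apply: le_Rintegral => //; try by apply: (@integrableS _ _ _ leb `[x, x + 1]%classic) => // z [].
    move=> z [/= + nZ]; rewrite in_itv/= => /andP[xz zx]; rewrite leNgt; apply/negP => fz.
    apply: H; exists z; split => //; split; last exact: ltW.
    by apply: contrapT => nE; apply: nZ; exact: HZ.
  lra.
have gI : leb.-integrable `[x, z] (EFin \o (fun x => g x ^+ 2)).
  by apply: (@integrableS _ _ _ leb setT) => //; exact: measurable_itv.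
have h : (w z - w x) ^+ 2 <= E2.
  apply: le_trans (prim_cauchy_schwarz pw xz gI) _.
  apply: le_trans (sqr_integral_itv_le x z g2); apply: ler_piMl; last by lra.
  by apply: Rintegral_ge0 => t _; exact: sqr_ge0.
have sq (r k : R) : 0 <= k -> r ^+ 2 <= k -> `|r| <= k + 1.
  move=> k0; rewrite -real_normK ?num_real// => h1.
  by have := sqr_ge0 (`|r| - 1); rewrite sqrrB1; have := normr_ge0 r; lra.
have hz : `|w z| <= (F + 1) + 1 + `|a| + `|b|.
  rewrite wz; apply: le_trans (ler_normD _ _) _; apply: lerD; last first.
    by rewrite normrM ler_piMr//; have /andP[? ?] := psim01 z; rewrite ger0_norm.
  apply: le_trans (ler_normD _ _) _; apply: lerD; last first.
    by rewrite normrM ler_piMr//; have /andP[? ?] := psip01 z; rewrite ger0_norm.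
  by apply: sq => //; rewrite addr_ge0.
rewrite (_ : w x = w z - (w z - w x)); last by ring.
apply: le_trans (ler_normB _ _) _; apply: lerD => //; exact: sq.
Qed.

End FiniteEnergyBound.

(** * Weak conservative solutions *)

Section WeakSolutions.
Variable R : realType.
Notation leb := (@lebesgue_measure R).

Lemma ae_eq_continuous (f h : R -> R) : continuous f -> continuous h -> Defs.ae_eq f h -> forall x, f x = h x.
Proof.
move=> cf ch [Z [mZ Z0 HZ]] x; apply/eqP/negPn/negP => fh.
have e0 : 0 < `|f x - h x| by rewrite normr_gt0 subr_eq0.
have /cvgrPdist_lt/(_ _ e0)/nbhs_ballP[d /= d0 Hd] : {for x, continuous (fun z => f z - h z)}.
  by apply: continuousB; [exact: cf|exact: ch].
pose I := `[x, x + d / 2]%classic : set (measurableTypeR R).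
have sub : I `<=` Z.
  move=> z; rewrite /I/= in_itv/= => /andP[xz zx]; apply: HZ => /= E.
  have := Hd z; rewrite /ball/= E subrr subr0 ltxx => H.
  by have : false by apply: H; rewrite distrC ger0_norm; lra.
have mI : measurable I by exact: measurable_itv.
have : (leb I <= 0)%E by rewrite -Z0; apply: le_measure; rewrite ?inE.
rewrite (_ : leb I = (d / 2)%:E); first by rewrite lee_fin; lra.
apply: etrans (@lebesgue_measure_itv R (`[x, x + d / 2])) _.
by rewrite /= lte_fin ltrDl divr_gt0// -EFinB; congr (_%:E); ring.
Qed.

Variables psip psim : R -> R.

(** Hölder continuity in time is uniform in space, so it carries the bound on [v 0] to every bounded
    time interval; together with its spatial form it gives all of [ucb]. *)
Lemma conservative_of_weak v nu u0 (m0 : {finite_measure set R -> \bar R}) (K : R) :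
  weak_cons_sol psip psim v nu u0 m0 -> (forall x, `|v 0 x| <= K) -> conservative v nu.
Proof.
move=> [_ [_ [_ [vac [weak [reg [_ cont]]]]]]] v0K.
have ucv : ucb v.
  split.
  - move=> t t0 x; have T0 : 0 < t + 1 by rewrite ltr_wpDl.
    have [[al [C [al0 [_ [C0 H]]]]] _] := reg _ T0.
    apply/cvgrPdist_le => e e0; have [d d0 Hd] := powR_small C al0 e0.
    apply/nbhs_ballP; exists d => // z; rewrite /ball/= => xz.
    have tT : 0 <= t <= t + 1 by rewrite t0 lerDl ler01.
    by apply: le_trans (H t t x z tT tT) _; rewrite subrr normr0 add0r; exact: Hd.
  - move=> T; have T0 : 0 < `|T| + 1 by rewrite ltr_wpDl.
    have [[al [C [al0 [_ [C0 H]]]]] _] := reg _ T0.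
    exists (K + C * (`|T| + 1) `^ al) => t z t0 tT.
    have tT' : 0 <= t <= `|T| + 1 by rewrite t0/=; have := ler_norm T; lra.
    have sT : 0 <= (0 : R) <= `|T| + 1 by rewrite lexx ltW.
    rewrite (_ : v t z = v 0 z + (v t z - v 0 z)); last by ring.
    apply: le_trans (ler_normD _ _) _; apply: lerD => //.
    apply: le_trans (H t 0 z z tT' sT) _; rewrite !subrr !subr0 normr0 addr0 ler_wpM2l//.
    by apply: ge0_ler_powR; rewrite ?nnegrE ?(ger0_norm t0) ?(ltW al0) ?(ltW T0)//; case/andP: tT'.
  - move=> t e t0 e0; have T0 : 0 < t + 1 by rewrite ltr_wpDl.
    have [[al [C [al0 [_ [C0 H]]]]] _] := reg _ T0.
    have [d d0 Hd] := powR_small C al0 e0.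
    exists (Num.min d 1); first by rewrite lt_min d0 ltr01.
    move=> s z s0; rewrite lt_min => /andP[sd s1].
    have tT : 0 <= t <= t + 1 by rewrite t0 lerDl ler01.
    have sT : 0 <= s <= t + 1 by rewrite s0/=; have := ler_norm (s - t); lra.
    by apply: le_trans (H s t z z sT tT) _; rewrite subrr normr0 addr0; exact: Hd.
split => //.
- by move=> T T0; have [] := reg T T0.
- by move=> phi tp; have [_] := weak phi tp.
- by move=> phi tp; have [] := weak phi tp.
- by move=> t t0; have [_] := vac t t0.
Qed.

End WeakSolutions.

Lemma sqr_le_powR (R : realType) (gamma x : R) : 2 <= gamma -> x ^+ 2 <= 1 + `|x| `^ gamma.
Proof.
move=> g2; rewrite -real_normK ?num_real//; have [x1|x1] := leP `|x| 1.
  by apply: (@le_trans _ _ 1); [rewrite expr_le1|rewrite lerDl powR_ge0].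
rewrite -powR_mulrn//; apply: (@le_trans _ _ (`|x| `^ gamma)); last by rewrite lerDr.
by apply: ler_powR => //; exact: ltW.
Qed.

Theorem theorem5p10 (R : realType) (psip psim : R -> R)
  (Hsp : smooth1 psip) (Hsm : smooth1 psim)
  (Hsum : forall x, psip x + psim x = 1)
  (Hpb : forall x, 0 <= psip x <= 1) (Hmb : forall x, 0 <= psim x <= 1)
  (Hsuppm : closure [set x | psim x != 0] `<=` [set x | x < 1])
  (Hsuppp : closure [set x | psip x != 0] `<=` [set x | -1 < x])
  (gamma : R) (Hgamma : 2 < gamma)
  (u0 : R -> R) (mu0 : {finite_measure set R -> \bar R})
  (HD : inD psip psim u0 mu0)
  (Hmom : (\int[mu0]_(x in setT) (1 + `|x| `^ gamma)%:E < +oo)%E) :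
  exists (u : R -> R -> R) (mu : R -> {finite_measure set R -> \bar R}),
    weak_cons_sol psip psim u mu u0 mu0 /\
    (forall t, 0 <= t -> inD psip psim (u t) (mu t)) /\
    (forall t, 0 <= t -> (\int[mu t]_(x in setT) (1 + `|x| `^ gamma)%:E < +oo)%E) /\
    (forall (v : R -> R -> R) (nu : R -> {finite_measure set R -> \bar R}),
       weak_cons_sol psip psim v nu u0 mu0 ->
       forall t, 0 <= t -> (forall x, v t x = u t x) /\ meas_eq (nu t) (mu t)).
Proof.
have [s [B sB]] := smooth_step_exists Hsp Hsum Hpb Hsuppm Hsuppp.
have psip0 x : x <= -1 -> psip x = 0.
  move=> x1; apply/eqP/negPn/negP => h.
  by have := Hsuppp x (subset_closure (A := [set x | psip x != 0]) h); rewrite /= ltNge x1.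
have psip1 x : 1 <= x -> psip x = 1.
  move=> x1; have [E|h] := eqVneq (psim x) 0; first by rewrite -(Hsum x) E addr0.
  by have := Hsuppm x (subset_closure (A := [set x | psim x != 0]) h); rewrite /= ltNge x1.
have mpsip : measurable_fun setT psip := continuous_measurable_fun (smooth1_continuous Hsp).
have [u0E [_ [g [N [wd [mN [N0 mE]]]]]]] := HD.
(* [u0] is given only up to a null set; [w] is its absolutely continuous representative, from which
   the Lagrangian velocity is built. *)
have [w pw u0w] := weak_deriv_repr sB wd.
have g2 : (@lebesgue_measure R).-integrable setT (EFin \o (fun x => g x ^+ 2)).
  apply/integrableP; split; first by apply/measurable_EFinP; apply: measurable_funX; exact: pw.1.1.
  rewrite (_ : (\int[_]_x `|_|)%E = (\int[@lebesgue_measure R]_x (g x ^+ 2)%:E)%E); last first.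
    by apply: eq_integral => x _ /=; rewrite ger0_norm ?sqr_ge0.
  by rewrite -mE// -ge0_fin_numE// fin_num_measure//; apply: measurableD.
have [K K0 wK] := bounded_of_inE2 pw g2 Hpb Hmb u0E u0w.
have py := init_prim_y pw mN N0 mE; have pU := init_prim_w pw mN N0 mE.
set y := init_y mu0 in py pU.
set a := init_a g mu0 N in py; set b := init_b g mu0 N in pU; pose c := init_c g mu0 N.
have a0 : forall xi, 0 <= a xi := init_a_ge0 g mu0 N.
have c0 : forall xi, 0 <= c xi := init_c_ge0 g mu0 N.
have acb : forall xi, a xi * c xi = b xi ^+ 2 := init_acb g mu0 N.
have ac1 : forall xi, a xi + c xi = 1 := init_ac g mu0 N.
have mc := measurable_init_c pw mN N0 mE; have ic := init_c_integrable pw mN N0 mE.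
have yK := init_y_bound mu0; have UK xi : `|w (y xi)| <= K by exact: wK.
have CE := init_mass pw mN N0 mE; have im := init_image pw mN N0 mE.
have my : measurable_fun setT y by exact: measurable_init_y.
pose U := fun xi => w (y xi); rewrite -/U in pU.
pose u := flow_u y U c (mass mu0); pose mu := flow_mu py pU c0 mc ic (mass mu0).
have y00 : flow_y y U c (mass mu0) 0 = y by apply/funext => xi; rewrite /flow_y; ring.
have U00 xi : flow_U U c (mass mu0) 0 xi = U xi by rewrite /flow_U; ring.
have u0w' x : u 0 x = w x.
  have <- : y (label y x) = x by exact: (label_lagrangian py a0 yK).
  have := flow_u_lagrangian py pU a0 c0 acb mc ic yK UK CE 0 (label y x).
  by rewrite y00 U00.
have mu00 : meas_eq (mu 0) mu0.
  move=> A mA; rewrite (im _ mA) (energyE _ c0 mc ic mA) /image_density.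
  by rewrite y00.
have hu : Defs.ae_eq (u 0) u0 by apply: (ae_imply2 u0w u0w) => x -> _; exact: u0w'.
have u0E2 : inE2 psip psim (u 0).
  have [fb [d [e [hfb hE]]]] := u0E; exists fb, d, e; split => //.
  by apply: (ae_imply2 hu hE) => x -> ->.
have mp : measurable_fun setT (fun x : R => 1 + `|x| `^ gamma).
  by apply: measurable_funD => //; exact: (measurableT_comp (@measurable_powR R gamma) (@normr_measurable R setT)).
have p0 (x : R) : 0 <= 1 + `|x| `^ gamma by rewrite addr_ge0 ?powR_ge0.
have ymom : (\int[@lebesgue_measure R]_xi ((1 + `|y xi| `^ gamma) * c xi)%:E < +oo)%E.
  have := @is_image_integral _ _ (measurableTypeR R) R R (@lebesgue_measure R) y c my mc c0 mu0 _ im mp.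
  by move=> <-.
(* By $x^2\le1+|x|^\gamma$ the moment hypothesis yields the second moment, here written in labels,
   on which the far-field estimates rest. *)
have iy2 : (@lebesgue_measure R).-integrable setT (EFin \o (fun xi => y xi ^+ 2 * c xi)).
  apply: (@integrable_le _ _ _ (@lebesgue_measure R) setT _ (fun xi => (1 + `|y xi| `^ gamma) * c xi)) => //.
  - by apply: measurable_funM => //; apply: measurable_funX; exact: my.
  - move=> xi _; rewrite ger0_norm; last exact: (mulr_ge0 (sqr_ge0 _) (c0 xi)).
    by rewrite ler_wpM2r//; apply: sqr_le_powR; exact: ltW.
  - apply/integrableP; split.
      by apply/measurable_EFinP; apply: measurable_funM => //; exact: (measurableT_comp mp my).
    apply: le_lt_trans ymom; rewrite le_eqVlt; apply/orP; left; apply/eqP.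
    by apply: eq_integral => xi _; rewrite /= ger0_norm// mulr_ge0.
have sol : weak_cons_sol psip psim u mu u0 mu0.
  exact: (flow_weak_cons_sol a0 acb ac1 yK UK CE psip0 psip1 Hpb Hsum mpsip iy2 Hsp Hsm hu mu00 u0E2).
exists u, mu; split; first exact: sol.
split.
  move=> t t0.
  exact: (flow_inD py pU a0 c0 acb mc ic yK UK CE psip0 psip1 Hpb Hsum mpsip iy2 Hsp Hsm t0 u0E2).
split.
  move=> t t0; apply: (flow_moment py pU c0 mc ic UK CE t _ ymom); lra.
move=> v nu sv t t0.
have cu : conservative u mu by apply: (conservative_of_weak sol (K := K)) => x; rewrite u0w'.
have [vu0 [nu0 [_ [_ [_ [reg _]]]]]] := sv.
(* A competing solution agrees with [u0] at time 0 only almost everywhere, but its Hölder continuity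
   makes [v 0] continuous, so it equals the representative [w] everywhere. *)
have v0w x : v 0 x = w x.
  have [[al [C [al0 [_ [C0 H]]]]] _] := reg _ (@ltr01 R).
  apply: ae_eq_continuous x; last by apply: (ae_imply2 vu0 u0w) => x -> ->.
    move=> x; apply/cvgrPdist_le => e e0; have [d d0 Hd] := powR_small C al0 e0.
    apply/nbhs_ballP; exists d => // z; rewrite /ball/= => xz.
    have tT : 0 <= (0 : R) <= 1 by rewrite lexx ler01.
    by apply: le_trans (H 0 0 x z tT tT) _; rewrite subrr normr0 add0r; exact: Hd.
  exact: prim_continuous pw.
apply: (conservative_unique sB _ cu _ _ t0).
- by apply: (conservative_of_weak sv (K := K)) => x; rewrite v0w.
- by move=> x; rewrite v0w u0w'.
- by move=> A mA; rewrite nu0// mu00.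
Qed.
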